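(* Let $1<p<\infty$ and $|Q|\in L^{p/2}_{\mathrm{loc}}(\Omega)$. Let $A,B$ be functions satisfying the structural conditions with $\gamma,\delta,\psi\in(1,p)$. Fix $y\in\Omega$ and suppose there is a function $r_1:\Omega\to(0,\infty)$ with $r_1\le\min\{R_0,R_1,R_2,1\}$ which satisfies a local uniformity condition in $\tilde B:=B(y,r_1(y))$ with constant $A_*=A_*(y,r_1(y))$. Let $$C_*=\frac{128\,\mathfrak{b}\,\kappa^{10}(\gamma^* )^8}{\tau A_*^3\min\{A_*^2,(8\kappa^5)^{-1}\}},$$ $x_0\in B(y,\frac{\tau}{5\kappa}r_1(y))$ and $r\in(0,\frac{\tau A_*}{5\kappa C_*}r_1(y))$. Assume that $b,e\in L^{\mathcal B}_{\mathrm{loc}}(\Omega)$ with $\mathcal B\ge\max\{p'\sigma',\frac{d_0}{p-1}\}$; $h,g\in L^{\mathcal H}_{\mathrm{loc}}(\Omega)$ with $\mathcal H\ge\frac{d_0}p$, $\mathcal H>\sigma'$; $d,f\in L^{\mathcal D}_{\mathrm{loc}}(\Omega)$ with $\mathcal D\ge\frac{d_0}p$, $\mathcal D>\sigma'$; and $c\in L^{\mathcal C}_{\mathrm{loc}}(\Omega)$ with $\mathcal C\ge d_0$ and $\mathcal C>p\sigma'$. Define $$\epsilon_1=\min\Big\{1,p-\frac{p^2\sigma'}{\mathcal C}\Big\},\quad\epsilon_2=\min\Big\{1,p-\frac{p\sigma'}{\mathcal H}\Big\},\quad\epsilon_3=\min\Big\{1,p-\frac{p\sigma'}{\mathcal D}\Big\},$$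 $$\lambda=\min\Big\{1-\frac{d_0}{(p-1)\mathcal B},\frac1{p-1}\Big(p-\frac{d_0}{\mathcal D}\Big),1-\frac{d_0}{p\mathcal H}\Big\},$$ $$k_1(x_0,r)=\big[(C_*r)^{p-1}\|b+e\|_{\mathcal B,B(x_0,C_*r);\overline{dx}}\big]^{\frac1{p-1}}+\big[(C_*r)^{p}\|c+d+f\|_{\mathcal D,B(x_0,C_*r);\overline{dx}}\big]^{\frac1{p-1}}+\big[(C_*r)^{p}\|g+h\|_{\mathcal H,B(x_0,C_*r);\overline{dx}}\big]^{\frac1p},$$ $$\Lambda_1=C_0^{\frac1{(p-1)\mathcal B}}C_*^{1-\frac{d_0}{(p-1)\mathcal B}}r_1(y)^{1-\lambda}\|b+e\|_{\mathcal B,\tilde B;\overline{dx}}^{\frac1{p-1}}+C_0^{\frac1{(p-1)\mathcal D}}C_*^{\frac{p\mathcal D-d_0}{(p-1)\mathcal D}}r_1(y)^{\frac p{p-1}-\lambda}\|c+d+f\|_{\mathcal D,\tilde B;\overline{dx}}^{\frac1{p-1}}+C_0^{\frac1{p\mathcal H}}C_*^{1-\frac{d_0}{p\mathcal H}}r_1(y)^{1-\lambda}\|g+h\|_{\mathcal H,\tilde B;\overline{dx}}^{\frac1p},$$ $$M_1=1+C_0^{\frac1{\mathcal B}}\big[1+r_1(y)^{p-1}\|b\|_{\mathcal B,\tilde B;\overline{dx}}\big]+C_0^{\frac1{\epsilon_2\mathcal H}}\big[1+r_1(y)^p\|h\|_{\mathcal H,\tilde B;\overline{dx}}\big]^{\frac1{\epsilon_2}}+C_0^{\frac1{\epsilon_3\mathcal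 D}}\big[1+r_1(y)^p\|d\|_{\mathcal D,\tilde B;\overline{dx}}\big]^{\frac1{\epsilon_3}}+C_0^{\frac p{\epsilon_1\mathcal C}}\big[r_1(y)^p\|c\|_{\mathcal C,\tilde B;\overline{dx}}^p\big]^{\frac1{\epsilon_1}}.$$ Then $k_1(x_0,r)\le\Lambda_1r^\lambda$ and, if $(u,\nabla u)\in W^{1,p}_Q(\Omega)$ is a weak solution of $\mathrm{div}(A(x,u,\nabla u))=B(x,u,\nabla u)$ in $\Omega$ such that $u\ge0$ in $B(x_0,C_*r)$, $$\operatorname*{ess\,sup}_{z\in B(x_0,\tau r)}\big(u(z)+k_1(x_0,r)\big)\le C\operatorname*{ess\,inf}_{z\in B(x_0,\tau r)}\big(u(z)+k_1(x_0,r)\big),$$ where $C=C_4(C_5M_1)^{C_6M_1}$ with positive constants: $C_4$ depending only on $p,\sigma,s,\epsilon_1,\epsilon_2,\epsilon_3$; $C_5$ only on $a,p,\sigma,s,\epsilon_1,\epsilon_2,\epsilon_3,C_1,N,C_{s^*}$ and the quasimetric $\rho$; $C_6$ only on $a,p,\sigma,s,\epsilon_1,\epsilon_2,\epsilon_3,C_2,\mathfrak b,\tau,N,C_{s^*},C_0,d_0$ and $\rho$.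
   Context: **Setting.** $\Omega\subset\mathbb{R}^n$ is a bounded domain, $1<p<\infty$, and $Q(x)$ is a measurable, symmetric, nonnegative definite $n\times n$ matrix function on $\Omega$ with $|Q|\in L^{p/2}_{\mathrm{loc}}(\Omega)$. Primes denote dual exponents. $|E|$ is Lebesgue measure, $\fint_E f=\frac1{|E|}\int_E f\,dx$, $\|f\|_{q,E;\overline{dx}}=(\fint_E|f|^q)^{1/q}$. $Lip_0(U)$ is the set of Lipschitz functions with compact support in $U$. **Quasimetric.** $\rho:\Omega\times\Omega\to[0,\infty)$ is symmetric, $\rho(x,y)=0$ iff $x=y$, and $\rho(x,y)\le\kappa[\rho(x,z)+\rho(y,z)]$ for all $x,y,z$, with a constant $\kappa\ge1$. $B(x,r)=\{y\in\Omega:\rho(x,y)<r\}$ and $\gamma^*=\kappa+2\kappa^2$. All balls $B(x,r)$ are open in the Euclidean topology, and for every $x\in\Omega$, $|x-y|\to0$ if $\rho(x,y)\to0$. $R_0:\Omega\to(0,\infty)$ is a function such that the Euclidean closure of $B(x,r)$ is contained in $\Omega$ for $0<r<R_0(x)$ (such a function exists). **Doubling.** $(\Omega,\rho,dx)$ is a local homogeneous space: there are constants $C_0,d_0>0$ and $R_1:\Omega\to(0,\infty)$ such that $|B(x,r)|\le C_0(r/t)^{d_0}|B(y,t)|$ whenever $x,y\in\Omega$, $0<t\le r<R_1(x)$ and $B(y,t)\cap B(x,r)\neq\emptyset$. **Sobolev spaces.** For open $U\subset\Omega$, $W^{1,p}_Q(U)$ is the completion of the locally Lipschitz functions on $U$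 with finite norm $\|u\|_{W^{1,p}_Q(U)}=(\int_U|u|^p+\int_U|\sqrt Q\nabla u|^p)^{1/p}$, identified with the set of pairs $(u,\nabla u)$ ($\nabla u$ denotes the second component, not necessarily determined by $u$) for which there are such functions $u_k$ with $u_k\to u$ in $L^p(U)$ and $\int_U|\sqrt Q(\nabla u_k-\nabla u)|^p\to0$. $(W^{1,p}_Q)_0(U)$ is defined in the same way using Lipschitz functions with compact support in $U$. **Analytic assumptions.** There is $R_2:\Omega\to(0,\infty)$ such that for every ball $B(y,r)$ with $0<r<R_2(y)$ the following hold. (a) Sobolev: with constants $C_1>0$, $\sigma>1$, $\big(\fint_{B(y,r)}|w|^{p\sigma}\big)^{1/(p\sigma)}\le C_1\big[r\big(\fint_{B(y,r)}|\sqrt Q\nabla w|^p\big)^{1/p}+\big(\fint_{B(y,r)}|w|^p\big)^{1/p}\big]$ for all $(w,\nabla w)\in(W^{1,p}_Q)_0(B(y,r))$. (b) Poincaré: with constants $C_2>0$, $\mathfrak{b}\ge1$, $\fint_{B(y,r)}|w-w_{B(y,r)}|\le C_2r\big(\fint_{B(y,\mathfrak{b}r)}|\sqrt Q\nabla w|^p\big)^{1/p}$ for all $(w,\nabla w)\in W^{1,p}_Q(\Omega)$, where $w_{B(y,r)}=\fint_{B(y,r)}w$. (c) Cutoffs: with positive constants $s^*,C_{s^*},\tau,N$, where $p\sigma'<s^*\le\infty$ and $\tau<1$, there are Lipschitz functions $\{\eta_j\}_{j\ge1}$ with $\mathrm{supp}\,\eta_1\subset B(y,r)$, and for all $j$: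 $0\le\eta_j\le1$, $\eta_j=1$ on $B(y,\tau r)$, $\mathrm{supp}\,\eta_{j+1}\subset\{x\in B(y,r):\eta_j(x)=1\}$, and $\big(\fint_{B(y,r)}|\sqrt Q\nabla\eta_j|^{s^*}\big)^{1/s^*}\le C_{s^*}N^j/r$. Set $s=(s^*/p)'=\frac{s^*}{s^*-p}\in[1,\sigma)$. (d) For some $t\in[1,\infty]$ (independent of the ball) there is $C_3=C_3(B(y,r))>0$ with $\big(\int_{B(y,r)}|\sqrt Q\nabla\eta|^{pt}\big)^{1/(pt)}<\infty$ for all $\eta\in\{\eta_j\}$ and $\big(\int_{B(y,r)}|f|^{pt'}\big)^{1/(pt')}\le C_3\|f\|_{W^{1,p}_Q(\Omega)}$ for all $f\in Lip_{\mathrm{loc}}(\Omega)$ (essential suprema if an exponent is infinite). **Local uniformity.** $f:\Omega\to(0,\infty)$ satisfies a local uniformity condition with respect to $\rho$ in $E\subset\Omega$ with constant $A_*\in(0,1)$ if $A_*<f(y)/f(x)<1/A_*$ for all $x\in E$, $y\in B(x,f(x))$. **Structural conditions** (exponents $\gamma,\psi,\delta>1$). There are a constant $a>1$, nonnegative measurable functions $b,c,d,e,f,g,h$ on $\Omega$ and a vector $\tilde A(x,z,\xi)\in\mathbb{R}^n$ such that for a.e. $x\in\Omega$ and all $(z,\xi)\in\mathbb{R}\times\mathbb{R}^n$: $A(x,z,\xi)=\sqrt{Q(x)}\tilde A(x,z,\xi)$; $\xi\cdot A(x,z,\xi)\ge a^{-1}|\sqrt{Q(x)}\xi|^p-h(x)|z|^\gamma-g(x)$;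 $|\tilde A(x,z,\xi)|\le a|\sqrt{Q(x)}\xi|^{p-1}+b(x)|z|^{\gamma-1}+e(x)$; $|B(x,z,\xi)|\le c(x)|\sqrt{Q(x)}\xi|^{\psi-1}+d(x)|z|^{\delta-1}+f(x)$. Standing minimal integrability: $c\in L_{\mathrm{loc}}^{\sigma p/(\sigma p-1-\sigma(\psi-1))}(\Omega)$, $e\in L^{p'}_{\mathrm{loc}}(\Omega)$, $f\in L^{(\sigma p)'}_{\mathrm{loc}}(\Omega)$, $b\in L_{\mathrm{loc}}^{\sigma p/(\sigma(p-1)-\gamma+1)}(\Omega)$, $d\in L_{\mathrm{loc}}^{p\sigma/(p\sigma-\delta)}(\Omega)$. **Weak solution.** $(u,\nabla u)\in W^{1,p}_Q(\Omega)$ is a weak solution of $\mathrm{div}(A(x,u,\nabla u))=B(x,u,\nabla u)$ in $\Omega$ if $\int_\Omega[\nabla\varphi\cdot A(x,u,\nabla u)+\varphi B(x,u,\nabla u)]\,dx=0$ for every nonnegative $\varphi\in Lip_0(\Omega)$. *)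

(* Defs.v *)
From HB Require Import structures.
From mathcomp Require Import all_boot all_order all_algebra.
From mathcomp Require Import all_classical all_reals all_analysis ess_sup_inf.

Set Implicit Arguments.
Unset Strict Implicit.
Unset Printing Implicit Defensive.

Import Order.TTheory GRing.Theory Num.Theory.
Import numFieldNormedType.Exports.

Local Open Scope classical_set_scope.
Local Open Scope ring_scope.

(* Points of the n.+1-dimensional Euclidean space are row vectors; the          *)
(* topology on 'rV[R]_n.+1 comes from the library's sup norm and is the         *)
(* Euclidean one.                                                               *)
Section euclidean.
Context {R : realType} {n : nat}.
Implicit Types (v w : 'rV[R]_n.+1) (A : 'M[R]_n.+1).

Definition dotv v w : R := \sum_i v ord0 i * w ord0 i.

(* `|v| is the sup norm, so the Euclidean length needs its own definition. *)
Definition enorm v : R := Num.sqrt (dotv v v).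

Definition opnorm A : R := sup [set enorm (v *m A) | v in [set v | enorm v = 1]].

Definition psdmx A : Prop := A^T = A /\ forall v, 0 <= dotv v (v *m A).

(* The unique nonnegative definite square root of a nonnegative definite        *)
(* matrix (and 0 when A has none).                                              *)
Definition sqrtmx A : 'M[R]_n.+1 := xget 0 [set S | psdmx S /\ S *m S = A].

End euclidean.

(* Lebesgue measure: the outer measure given by countable covers by half-open   *)
(* boxes, restricted to its Caratheodory measurable sets, so that "measurable"  *)
(* below means Lebesgue measurable.                                             *)
Section lebesgue_measure_Rn.
Context (R : realType) (n : nat).
Local Open Scope ereal_scope.
Implicit Types (A : set 'rV[R]_n.+1) (F : nat -> 'rV[R]_n.+1 * 'rV[R]_n.+1).

Definition box (ab : 'rV[R]_n.+1 * 'rV[R]_n.+1) : set 'rV[R]_n.+1 :=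
  [set x | forall i, (ab.1 ord0 i < x ord0 i <= ab.2 ord0 i)%R].

Definition box_vol (ab : 'rV[R]_n.+1 * 'rV[R]_n.+1) : \bar R :=
  (\prod_i Num.max 0 (ab.2 ord0 i - ab.1 ord0 i))%R%:E.

Definition leb_outer A : \bar R :=
  ereal_inf [set \sum_(k <oo) box_vol (F k) |
             F in [set F | A `<=` \bigcup_k box (F k)]].

Lemma box_vol_ge0 ab : 0 <= box_vol ab.
Proof. by rewrite lee_fin prodr_ge0// => i _; rewrite le_max lexx. Qed.

Lemma leb_outer_ge0 A : 0 <= leb_outer A.
Proof.
apply: le_ereal_inf_tmp => _ [F _ <-].
by apply: nneseries_ge0 => k _ _; exact: box_vol_ge0.
Qed.

Lemma le_leb_outer : {homo leb_outer : A B / A `<=` B >-> A <= B}.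
Proof.
move=> A B AB; apply/ereal_inf_le_tmp => _ [F BF <-].
by exists F => //; exact: subset_trans AB BF.
Qed.

Lemma leb_outer0 : leb_outer set0 = 0.
Proof.
apply/eqP; rewrite eq_le leb_outer_ge0 andbT; apply: ereal_inf_lbound => /=.
exists (fun=> (0, 0)%R) => //; apply: eseries0 => k _ _.
by rewrite /box_vol /= big_ord_recl /= mxE subrr maxxx mul0r.
Qed.

Lemma leb_outer_sigma_subadditive : sigma_subadditive leb_outer.
Proof.
move=> A; have [[i ioo]|] := pselect (exists i, leb_outer (A i) = +oo).
  rewrite (eseries_pinfty _ _ ioo) ?leey// => k _.
  by rewrite -ltNye (lt_le_trans _ (leb_outer_ge0 _)).
rewrite -forallNE => Aoo.
suff add2e (e : {posnum R}) : leb_outer (\bigcup_k A k) <=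
    \sum_(i <oo) leb_outer (A i) + e%:num%:E.
  by apply/lee_addgt0Pr => _/posnumP[].
rewrite (le_trans _ (epsilon_trick _ _ _))//; last first.
  by move=> k; exact: leb_outer_ge0.
pose P k (B : nat -> 'rV[R]_n.+1 * 'rV[R]_n.+1) :=
  A k `<=` \bigcup_j box (B j) /\
  \sum_(j <oo) box_vol (B j) <= leb_outer (A k) + (e%:num / (2 ^ k.+1)%:R)%:E.
have [G PG] : {G : nat -> nat -> _ & forall k, P k (G k)}.
  apply: (@choice _ _ P) => k; rewrite /P /leb_outer.
  set S := (X in ereal_inf X); move infS : (ereal_inf S) => iS.
  case: iS infS => [r Sr|Soo|Soo].
  - have en1 : (0 < e%:num / (2 ^ k.+1)%:R)%R by [].
    have /(lb_ereal_inf_adherent en1) : ereal_inf S \is a fin_num by rewrite Sr.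
    move=> [x [B AB volBx] xS].
    by exists B; split => //; rewrite volBx -Sr; exact/ltW.
  - by have := Aoo k; rewrite /leb_outer Soo.
  - by have := leb_outer_ge0 (A k); rewrite /leb_outer Soo.
have volG_ge0 x : 0 <= (box_vol \o uncurry G) x by exact: box_vol_ge0.
apply: (@le_trans _ _ (\esum_(i in setT) (box_vol \o uncurry G) i)).
  apply: ereal_inf_lbound => /=.
  have /card_esym/ppcard_eqP[f] := card_nat2.
  exists (uncurry G \o f).
    apply: (@subset_trans _ (\bigcup_k \bigcup_j box (G k j))) => [t [i _]|].
      by move=> /(PG i).1 -[j _ ?]; exists i => //; exists j.
    move=> t [i _ [j _ Bijt]]; exists (f^-1%FUN (i, j)) => //=.
    by rewrite invK ?inE.
  rewrite -(esum_pred_image (box_vol \o uncurry G) _ xpredT) ?[fun=> _]set_true//.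
  by rewrite image_eq.
rewrite (_ : esum _ _ = \sum_(i <oo) \sum_(j <oo ) box_vol (G i j)); last first.
  pose J : nat -> set (nat * nat) := fun i => [set (i, j) | j in setT].
  rewrite (_ : setT = \bigcup_k J k); last first.
    by rewrite predeqE => -[a b]; split => // _; exists a => //; exists b.
  rewrite esum_bigcupT /=; last 2 first.
    - apply/trivIsetP => i j _ _ ij.
      rewrite predeqE => -[k m] /=; split => //= -[] [_] _ [<-{k} _].
      by move=> [m' _] [] /esym/eqP; rewrite (negbTE ij).
    - by move=> /= [k m]; exact: box_vol_ge0.
  rewrite -(image_id [set: nat]) -fun_true esum_pred_image//; last first.
    by move=> k _; apply: esum_ge0 => i _; exact: box_vol_ge0.
  apply: eq_eseriesr => /= j _.
  rewrite -(esum_pred_image (box_vol \o uncurry G) (pair j) predT)//=; last 2 first.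
    - by move=> k _; exact: box_vol_ge0.
    - by move=> ? ? _ _; exact: (@can_inj _ _ _ snd).
  by congr esum; rewrite predeqE => -[a b]; split; move=> [i _ <-]; exists i.
apply: lee_lim.
- apply: is_cvg_nneseries => k *.
  by apply: nneseries_ge0 => m _ _; exact: (volG_ge0 (k, m)).
- by apply: is_cvg_nneseries => k *; apply: adde_ge0; rewrite ?leb_outer_ge0.
- by near=> k; apply: lee_sum => i _; exact: (PG i).2.
Unshelve. all: by end_near. Qed.

HB.instance Definition _ := isOuterMeasure.Build R 'rV[R]_n.+1 leb_outer
  leb_outer0 leb_outer_ge0 le_leb_outer leb_outer_sigma_subadditive.

Definition Rn : measurableType _ := caratheodory_type leb_outer.

Definition leb : set Rn -> \bar R := leb_outer.

Let leb0 : leb set0 = 0. Proof. exact: leb_outer0. Qed.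

Let leb_ge0 A : 0 <= leb A. Proof. exact: leb_outer_ge0. Qed.

Let leb_semi_sigma_additive : semi_sigma_additive leb.
Proof. exact: caratheodory_measure_sigma_additive. Qed.

HB.instance Definition _ := isMeasure.Build _ _ _ leb
  leb0 leb_ge0 leb_semi_sigma_additive.

End lebesgue_measure_Rn.
Arguments leb {R n}.

Section function_spaces.
Context {R : realType} {n : nat}.
Local Notation E := 'rV[R]_n.+1.
Implicit Types (U : set E) (u f phi : E -> R) (V : E -> E) (Q : E -> 'M[R]_n.+1)
  (p : R) (q : \bar R).

Definition dual_exp p : R := p / (p - 1).

Definition meas_fun U f := measurable_fun (U : set (Rn R n)) (f : Rn R n -> R).

Definition vol U : R := fine (@leb R n U).

(* The average of f over U, in the extended reals. *)
Definition avg U (f : E -> \bar R) : \bar R :=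
  ((vol U)^-1%:E * \int[leb]_(x in U) f x)%E.

(* The L^q norm of f over U for Lebesgue measure; the library's Lnorm is the    *)
(* essential supremum of |f| when q = +oo.                                      *)
Definition lnorm q U f : \bar R := 'N[@leb R n]_q[(EFin \o f) \_ U]%E.

(* The same norm for dx / |U|. *)
Definition avg_lnorm q U f : \bar R :=
  match q with
  | p%:E => (avg U (fun x => (`|f x| `^ p)%:E) `^ p^-1)%E
  | _ => lnorm q U f
  end.

Definition Lloc q U f : Prop :=
  meas_fun U f /\ forall K, compact K -> K `<=` U -> (lnorm q K f < +oo)%E.

Definition ess_sup_on U (f : E -> \bar R) : \bar R :=
  ess_sup (@leb R n) (patch (fun=> -oo%E) U f).

Definition ess_inf_on U (f : E -> \bar R) : \bar R :=
  ess_inf (@leb R n) (patch (fun=> +oo%E) U f).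

Definition grad f : E -> E := fun x => \row_i 'D_(delta_mx ord0 i) f x.

(* |sqrt(Q) V| as a function of the point; vectors are rows and sqrt(Q) is      *)
(* symmetric, hence the multiplication on the right.                            *)
Definition Qnorm Q V : E -> R := fun x => enorm (V x *m sqrtmx (Q x)).

Definition supp f : set E := closure [set x | f x != 0].

Definition Lip_loc U : set (E -> R) :=
  [set f | forall K, compact K -> K `<=` U -> [lipschitz f x | x in K]].

(* A Lipschitz function with compact support in U, extended by 0. *)
Definition Lip0 U : set (E -> R) :=
  [set f | [/\ lipschitz f, compact (supp f) & supp f `<=` U]].

Definition Wnorm p Q U u V : \bar R :=
  ((\int[leb]_(x in U) (`|u x| `^ p)%:E +
    \int[leb]_(x in U) (Qnorm Q V x `^ p)%:E) `^ p^-1)%E.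

(* The pairs (u, V) that are limits of pairs (u_k, grad u_k) with u_k in D of   *)
(* finite norm. *)
Definition W_closure p Q U (D : set (E -> R)) : set ((E -> R) * (E -> E)) :=
  [set w : (E -> R) * (E -> E) | [/\ meas_fun U w.1,
    forall i, meas_fun U (fun x => w.2 x ord0 i) &
    exists uk : nat -> E -> R,
      [/\ forall k, D (uk k) /\ (Wnorm p Q U (uk k) (grad (uk k)) < +oo)%E,
        lnorm p%:E U (fun x => uk k x - w.1 x) @[k --> \oo] --> 0%E &
        (\int[leb]_(x in U)
          (Qnorm Q (fun x => grad (uk k) x - w.2 x) x `^ p)%:E)%E
          @[k --> \oo] --> 0%E]]].

Definition W1pQ p Q U := W_closure p Q U (Lip_loc U).

Definition W1pQ0 p Q U := W_closure p Q U (Lip0 U).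

End function_spaces.

Section assumptions.
Context {R : realType} {n : nat}.
Local Notation E := 'rV[R]_n.+1.
Implicit Types (Omega : set E) (rho : E -> E -> R) (Q : E -> 'M[R]_n.+1).

Definition quasimetric Omega rho (kappa : R) : Prop :=
  [/\ 1 <= kappa,
    forall x y, Omega x -> Omega y ->
      [/\ 0 <= rho x y, rho x y = rho y x & rho x y = 0 <-> x = y] &
    forall x y z, Omega x -> Omega y -> Omega z ->
      rho x y <= kappa * (rho x z + rho y z)].

Definition qball Omega rho (x : E) (r : R) : set E :=
  [set y | Omega y /\ rho x y < r].

Definition local_homogeneous Omega rho (C0 d0 : R) (R1 : E -> R) : Prop :=
  forall x y r t, Omega x -> Omega y -> 0 < t -> t <= r -> r < R1 x ->
    qball Omega rho y t `&` qball Omega rho x r !=set0 ->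
    (leb (qball Omega rho x r) <=
      (C0 * (r / t) `^ d0)%:E * leb (qball Omega rho y t))%E.

Definition sobolev_ineq Omega rho p Q (R2 : E -> R) (C1 sigma : R) : Prop :=
  forall y r, Omega y -> 0 < r -> r < R2 y ->
  let B := qball Omega rho y r in
  forall w, W1pQ0 p Q B w ->
    (avg_lnorm (p * sigma)%:E B w.1 <=
      C1%:E * (r%:E * avg_lnorm p%:E B (Qnorm Q w.2) + avg_lnorm p%:E B w.1))%E.

Definition poincare_ineq Omega rho p Q (R2 : E -> R) (C2 bb : R) : Prop :=
  forall y r, Omega y -> 0 < r -> r < R2 y ->
  let B := qball Omega rho y r in
  forall w, W1pQ p Q Omega w ->
    let wB := fine (avg B (EFin \o w.1)) in
    (avg B (fun x => `|w.1 x - wB|%:E) <=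
      (C2 * r)%:E * avg_lnorm p%:E (qball Omega rho y (bb * r)) (Qnorm Q w.2))%E.

Definition cutoffs Omega rho p Q (R2 : E -> R) (sstar : \bar R)
    (Cs tau N : R) (t : \bar R) : Prop :=
  forall y r, Omega y -> 0 < r -> r < R2 y ->
  let B := qball Omega rho y r in
  exists eta : nat -> E -> R,
  [/\ supp (eta 1%N) `<=` B,
    forall j, (1 <= j)%N ->
      [/\ lipschitz (eta j),
        forall x, 0 <= eta j x <= 1,
        forall x, qball Omega rho y (tau * r) x -> eta j x = 1,
        supp (eta j.+1) `<=` [set x | B x /\ eta j x = 1] &
        (avg_lnorm sstar B (Qnorm Q (grad (eta j))) <= (Cs * N ^+ j / r)%:E)%E],
    forall j, (1 <= j)%N ->
      (lnorm (p%:E * t) B (Qnorm Q (grad (eta j))) < +oo)%E &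
    exists C3 : R, 0 < C3 /\ forall f, Lip_loc Omega f ->
      (lnorm (p%:E * hoelder_conjugate t) B f <=
        C3%:E * Wnorm p Q Omega f (grad f))%E].

Definition locally_uniform Omega rho (f : E -> R) (D : set E) (A : R) : Prop :=
  forall x y, D x -> qball Omega rho x (f x) y -> A < f y / f x < A^-1.

Definition structural Omega p Q (gamma psi delta a : R) (b c d e f g h : E -> R)
    (A : E -> R -> E -> E) (B : E -> R -> E -> R) : Prop :=
  let nonneg_meas k := meas_fun Omega k /\ forall x, Omega x -> 0 <= k x in
  [/\ nonneg_meas b, nonneg_meas c, nonneg_meas d & nonneg_meas e] /\
  [/\ nonneg_meas f, nonneg_meas g & nonneg_meas h] /\
  exists At : E -> R -> E -> E,
    {ae @leb R n, forall x, Omega x -> forall (z : R) (xi : E),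
      let Qxi := enorm (xi *m sqrtmx (Q x)) in
      [/\ A x z xi = At x z xi *m sqrtmx (Q x),
        dotv xi (A x z xi) >= a^-1 * Qxi `^ p - h x * `|z| `^ gamma - g x,
        enorm (At x z xi) <= a * Qxi `^ (p - 1) + b x * `|z| `^ (gamma - 1) + e x &
        `|B x z xi| <= c x * Qxi `^ (psi - 1) + d x * `|z| `^ (delta - 1) + f x]}.

(* Integrability of the integrand is part of the meaning of the integral being  *)
(* 0 (the library's integral is total).                                         *)
Definition weak_solution Omega p Q (A : E -> R -> E -> E) (B : E -> R -> E -> R)
    (u : E -> R) (Du : E -> E) : Prop :=
  W1pQ p Q Omega (u, Du) /\
  forall phi, Lip0 Omega phi -> (forall x, 0 <= phi x) ->
    let F x := (dotv (grad phi x) (A x (u x) (Du x)) + phi x * B x (u x) (Du x))%:E in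
    leb.-integrable (Omega : set (Rn R n)) F /\ (\int[leb]_(x in Omega) F x = 0)%E.

End assumptions.

(* Main.v *)
(* De Giorgi-Nash-Moser by Moser's iteration. For k > k1 put U = u + k. The      *)
(* coefficients b, ..., h, after division by powers of k, have scaled norms      *)
(* controlled by M1 on all balls inside B(x0, C* r). Testing the equation with   *)
(* eta^p U^(1-p) and using the Poincare inequality bounds the mean oscillation   *)
(* of log U by a multiple of M1; a John-Nirenberg argument then bounds the       *)
(* product of the means of U^q and U^-q for |q| of order 1/M1. Testing with      *)
(* eta^p U^(pm-p+1), the Sobolev inequality and absorption give a reverse        *)
(* Hoelder inequality from exponent p m s to p m sigma, whose iteration along    *)
(* m = m0 chi^j and m = - m0 chi^j, chi = sigma / s, bounds ess sup U and        *)
(* ess inf U by these means. The claim follows as k decreases to k1.             *)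
(* Since Q may degenerate, grad u is not determined by u; every test function    *)
(* is built from locally Lipschitz approximants of (u, grad u), for which        *)
(* Rademacher's theorem provides the chain rule almost everywhere.               *)
Require Import Defs.
From HB Require Import structures.
From mathcomp Require Import all_boot all_order all_algebra.
From mathcomp Require Import all_classical all_reals all_analysis ess_sup_inf.
From mathcomp Require Import measurable_realfun lra ring.
From mathcomp Require Import sesquilinear.
From mathcomp Require complex spectral.

Set Implicit Arguments.
Unset Strict Implicit.
Unset Printing Implicit Defensive.

Import Order.TTheory GRing.Theory Num.Theory.
Import numFieldNormedType.Exports.

Local Open Scope classical_set_scope.
Local Open Scope ring_scope.

(** * Lebesgue measure *)

(** The proof is Moser's iteration with every constant tracked, so that the final one has the form
    (C5 M1)^(C6 M1).

    Fix k > k1 and let U be u + k, continued to negative values of u by a C^1 function that stays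
    above k / 2 ([pos_shift]). Since U >= k, a lower-order term such as b u^(gamma-1) + e is at most
    (b + (b + e) k^(1-p)) U^(p-1), and likewise for the other coefficients ([pointwise_energy]). The
    equation thus behaves as if homogeneous of degree p - 1, with coefficients [coef_b], c,
    [coef_d], [coef_h]. The definitions of k1 and M1, together with doubling, give these
    coefficients the correctly scaled norms on every ball inside B(x0, Cstar r), with one number M
    proportional to M1 ([avg_rescale]).

    Testing with eta^p U theta(U)^p, where theta(U) truncates U^(m-1), bounds the energy of eta
    theta(U) grad u by lower-order terms. Hoelder's inequality interpolates these between L^p and
    L^(p sigma), the Sobolev inequality controls the L^(p sigma) norm by the energy again, and
    [absorption] solves the resulting inequality with a constant linear in M. Away from the
    resonance m = (p - 1) / p this yields the reverse Hoelder inequality [moser_step]. For m = 0 it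
    yields [log_energy], a bound for the gradient of log U whose constant does not contain the
    Sobolev constant.

    By [log_energy] and the Poincare inequality, the mean oscillation of log U is at most a multiple
    of M on every small ball. [john_nirenberg] converts this into geometric decay of level sets, and
    [avg_power_bound] into bounds 7 e^(q l) for the means of U^q, valid for |q| up to a multiple of
    1 / M1 of either sign and with the same l. Starting [moser_iteration] at m0 and at -m0, with m0
    of order 1 / M1, bounds U^m0 and U^(-m0) almost everywhere; l cancels in the quotient and leaves
    a power W^(2 / m0) of the Moser constant W ([harnack_ball]). This power is how M1 enters the
    exponent. [nonresonant_exponent] keeps all m0 chi^j away from the resonance. The Sobolev
    constant C1 occurs only in W, hence only in the base C5. Letting k decrease to k1 gives the
    inequality ([ess_sup_le_ess_inf]); the bound for k1 itself is doubling once more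
    ([rescaled_norm_le]).

    Because Q may degenerate, a gradient is a second component attached to a function and not
    determined by it. Every product or composition is therefore realized as a limit of Lipschitz
    functions, to which Rademacher's theorem applies; [test_ineq] passes from such Lipschitz test
    functions to the nonlinear ones. *)

Section lebesgue_basics.
Context {R : realType} {n : nat}.
Local Notation E := 'rV[R]_n.+1.
Implicit Types (A U : set (Rn R n)).

(** The hyperplane cuts each box of a cover into two boxes whose volumes add up exactly, so a cover
    of X splits into covers of its two parts with the same total. Measurability of coordinates, and
    then of open sets, rests on this. *)
Lemma leb_outer_halfspace (i : 'I_n.+1) (c : R) :
  caratheodory_measurable (@leb_outer R n) [set x : E | x ord0 i <= c].
Proof.
apply: (@le_caratheodory_measurable R E (@leb_outer R n)) => X /=.
apply: le_ereal_inf_tmp => _ [F XF <-].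
pose up (f : R -> R) (v : E) : E := \row_j (if j == i then f (v ord0 j) else v ord0 j).
pose F1 k := ((F k).1, up (Order.min^~ c) (F k).2).
pose F2 k := (up (Order.max^~ c) (F k).1, (F k).2).
have F12 k : (box_vol (F k) = box_vol (F1 k) + box_vol (F2 k))%E.
  suff key : \prod_j Num.max 0 ((F k).2 ord0 j - (F k).1 ord0 j) =
      \prod_j Num.max 0 ((F1 k).2 ord0 j - (F1 k).1 ord0 j) +
      \prod_j Num.max 0 ((F2 k).2 ord0 j - (F2 k).1 ord0 j).
    by rewrite /box_vol key EFinD.
  have D1 (H : 'I_n.+1 -> R) : \prod_j H j = H i * \prod_(j | j != i) H j.
    by rewrite (bigD1 i).
  rewrite !D1 /= !mxE eqxx.
  have -> : \prod_(j < n.+1 | j != i) Num.max 0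
      (up (Num.min^~ c) (F k).2 ord0 j - (F k).1 ord0 j) =
      \prod_(j < n.+1 | j != i) Num.max 0 ((F k).2 ord0 j - (F k).1 ord0 j).
    by apply: eq_bigr => j /negbTE ji; rewrite !mxE ji.
  have -> : \prod_(j < n.+1 | j != i) Num.max 0
      ((F k).2 ord0 j - up (Num.max^~ c) (F k).1 ord0 j) =
      \prod_(j < n.+1 | j != i) Num.max 0 ((F k).2 ord0 j - (F k).1 ord0 j).
    by apply: eq_bigr => j /negbTE ji; rewrite !mxE ji.
  rewrite -mulrDl; congr (_ * _).
  move: ((F k).1 ord0 i) ((F k).2 ord0 i) => a b.
  rewrite /Num.max /Num.min.
  by repeat case: ifPn => //; rewrite -?leNgt => *; lra.
have -> : (\sum_(k <oo) box_vol (F k) =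
    \sum_(k <oo) box_vol (F1 k) + \sum_(k <oo) box_vol (F2 k))%E.
  rewrite -nneseriesD//; last 2 first.
  - by move=> *; exact: box_vol_ge0.
  - by move=> *; exact: box_vol_ge0.
  by apply: eq_eseriesr => k _; exact: F12.
apply: leeD; apply: ereal_inf_lbound => /=.
- exists F1 => // x [/XF [k _ Fx] xc]; exists k => // j /=.
  rewrite mxE; have /andP[-> /= xj] := Fx j.
  by case: ifPn => // /eqP ji; rewrite le_min xj ji.
- exists F2 => // x [/XF [k _ Fx] /= /negP xc]; exists k => // j /=.
  rewrite mxE; have /andP[ax ->] := Fx j; rewrite andbT.
  by case: ifPn => // /eqP ji; rewrite gt_max ax ji ltNge.
Qed.

Lemma measurable_coord (i : 'I_n.+1) :
  measurable_fun [set: Rn R n] (fun x : Rn R n => (x : E) ord0 i).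
Proof.
apply: (measurability _ (RGenInftyO.measurableE R)) => //.
move=> _ [_ [a ->] <-]; rewrite setTI.
have -> : (fun x : Rn R n => (x : E) ord0 i) @^-1` `]-oo, a[%classic =
   ~` \bigcap_(k in [set: nat]) [set x : E | ~ (x ord0 i <= a - k.+1%:R^-1)].
  apply/seteqP; split=> [x/= xa H|x/= H].
    have xa' : 0 < a - x ord0 i by rewrite subr_gt0; move: xa; rewrite in_itv.
    have := near_infty_natSinv_lt (PosNum xa') => -[N _ /(_ N (leqnn N)) /= N1].
    by apply: (H N) => //=; rewrite lerBrDr -lerBrDl ltW.
  rewrite in_itv/= ltNge; apply/negP => ax; apply: H => k _ /= xk.
  by have := le_trans ax xk; rewrite lerBrDr gerDl leNgt invr_gt0 ltr0Sn.
apply: measurableC; apply: bigcap_measurable => // k _.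
apply: (@measurableC _ (Rn R n) [set x : E | x ord0 i <= a - k.+1%:R^-1]).
exact: leb_outer_halfspace.
Qed.

Lemma bigcup_countType_measurable d (T : measurableType d) (I : countType)
    (D : set I) (F : I -> set T) :
  (forall i, D i -> measurable (F i)) -> measurable (\bigcup_(i in D) F i).
Proof.
move=> mF.
rewrite (_ : \bigcup_(i in D) F i = \bigcup_k
   \bigcup_(i in D `&` [set i | pickle i = k]) F i); last first.
  apply/seteqP; split=> [x [i Di Fi]|x [k _ [i [Di _] Fi]]]; last by exists i.
  by exists (pickle i) => //; exists i.
apply: bigcupT_measurable => k.
have [[i [Di ik]]|H] := pselect (exists i, D i /\ pickle i = k).
  rewrite (_ : \bigcup_(i in _) _ = F i); first exact: mF.
  apply/seteqP; split=> [x [j [Dj jk] Fj]|x Fi]; last by exists i.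
  by rewrite (_ : i = j)//; apply: (pcan_inj pickleK); rewrite ik jk.
rewrite (_ : \bigcup_(i in _) _ = set0)//.
by apply/seteqP; split=> // x [j Hj]; exfalso; apply: H; exists j.
Qed.

Lemma coord_le_norm (x : E) i : `|x ord0 i| <= `|x|.
Proof.
rewrite [leRHS]mx_normrE.
exact: (le_bigmax _ (fun ij : 'I_1 * 'I_n.+1 => `|x ij.1 ij.2|) (ord0, i)).
Qed.

Lemma norm_ltP (x : E) (e : R) : 0 < e ->
  `|x| < e <-> (forall i, `|x ord0 i| < e).
Proof.
move=> e0; split=> [H i|H]; first exact: le_lt_trans (coord_le_norm x i) H.
rewrite [ltLHS]mx_normrE; apply/bigmax_ltP; split=> // -[i j] _ /=.
by rewrite (ord1 i).
Qed.

Lemma ball_rV (x : E) e (y : E) : 0 < e ->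
  ball x e y <-> (forall i, `|x ord0 i - y ord0 i| < e).
Proof.
move=> e0; rewrite mx_norm_ball /ball_/= norm_ltP//.
by split=> H i; have := H i; rewrite !mxE.
Qed.

Lemma measurable_ballRn (x : E) (e : R) : 0 < e ->
  measurable (ball x e : set (Rn R n)).
Proof.
move=> e0.
have -> : (ball x e : set (Rn R n)) = \bigcap_(i in [set: 'I_n.+1])
    ((fun y : Rn R n => (y : E) ord0 i) @^-1` (ball (x ord0 i) e)).
  apply/seteqP; split=> [y /(ball_rV _ _ e0) H i _|y H]; first exact: H.
  by apply/ball_rV => // i; exact: (H i).
apply: fin_bigcap_measurable; first exact: finite_finset.
move=> i _; rewrite -[X in measurable X]setTI; apply: measurable_coord => //.
exact: measurable_ball.
Qed.

Definition ratv (q : 'rV[rat]_n.+1) : E := \row_i ratr (q ord0 i).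

Lemma dense_ratv (x : E) (e : R) : 0 < e -> exists q, ball x e (ratv q).
Proof.
move=> e0.
have H i : exists q : rat, `|x ord0 i - ratr q| < e.
  have [y [xy [q _ qy]]] := @dense_rat R (ball (x ord0 i) e)
     (ex_intro _ _ (ballxx _ e0)) (ball_open _ _).
  by exists q; rewrite qy.
have [f fP] := choice H.
by exists (\row_i f i); apply/ball_rV => // i; rewrite !mxE.
Qed.

(** Second countability: rational centres and radii 1/(k+1) suffice. Measurability of open sets is
    thereby reduced to that of sup-norm balls, which are products of intervals. *)
Lemma open_ratv_cover (U : set E) : open U ->
  U = \bigcup_(qk in [set qk : 'rV[rat]_n.+1 * nat |
        ball (ratv qk.1) qk.2.+1%:R^-1 `<=` U]) ball (ratv qk.1) qk.2.+1%:R^-1.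
Proof.
move=> oU; apply/seteqP; split=> [x Ux|x [qk H] xb]; last exact: H.
have [e /= e0 eU] : exists2 e : R, 0 < e & ball x e `<=` U.
  by have /nbhs_ballP[e/= e0 ?] := open_nbhs_nbhs (conj oU Ux); exists e.
have e20 : 0 < e / 2 by rewrite divr_gt0.
have := near_infty_natSinv_lt (PosNum e20) => -[N _ /(_ N (leqnn N)) /= N1].
have N0 : 0 < N.+1%:R^-1 :> R by rewrite invr_gt0.
have [q xq] := dense_ratv x N0.
exists (q, N) => //=; last exact: ball_sym.
move=> y qy; apply: eU.
have := ball_triangle xq qy; apply: le_ball.
rewrite [leRHS]splitr; apply: lerD; exact: ltW.
Qed.

Lemma open_measurable_Rn (U : set E) : open U -> measurable (U : set (Rn R n)).
Proof.
move=> /open_ratv_cover ->.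
by apply: bigcup_countType_measurable => -[q k] _; apply: measurable_ballRn;
  rewrite invr_gt0.
Qed.

Lemma closed_measurable_Rn (U : set E) : closed U -> measurable (U : set (Rn R n)).
Proof.
move=> cU; rewrite -[X in measurable X](setCK U); apply: measurableC.
by apply: open_measurable_Rn; exact: closed_openC.
Qed.

Lemma leb_lty (A : set E) : bounded_set A -> (@leb R n A < +oo)%E.
Proof.
move=> [M [_ /(_ (`|M| + 1))]] HM.
have {}HM x : A x -> `|x| <= `|M| + 1.
  by apply: HM; rewrite (le_lt_trans (ler_norm M))// ltrDl.
pose K : E := const_mx (`|M| + 2).
(* One large box; all the others are degenerate and have volume 0. *)
pose F (k : nat) : E * E := if k is 0 then (- K, K) else (0, 0).
apply: (@le_lt_trans _ _ (\sum_(k <oo) box_vol (F k))%E).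
  apply: ereal_inf_lbound; exists F => // x Ax; exists 0 => // i /=.
  have := HM _ Ax; have := coord_le_norm x i; rewrite !mxE.
  by rewrite ler_norml => /andP[]; move: `|x| => y *; apply/andP; split; lra.
rewrite (nneseries_split 0 1)//; last by move=> *; exact: box_vol_ge0.
rewrite eseries0 ?adde0; first by rewrite big_nat1 ltry.
move=> [|k]// _ _; rewrite /box_vol /= big_ord_recl /= mxE subrr maxxx mul0r//.
Qed.

(** Completeness of the Caratheodory measure. It makes almost everywhere limits measurable as they
    stand. *)
Lemma leb_negligible_measurable A : (@leb R n).-negligible A -> measurable A.
Proof. exact: (@measure_is_complete_caratheodory R E (@leb_outer R n)). Qed.

End lebesgue_basics.

(** * Square roots of nonnegative definite matrices *)

Section linear_algebra.
Context {R : realType} {n : nat}.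
Implicit Types (v w : 'rV[R]_n.+1) (A : 'M[R]_n.+1).

Lemma dotvC v w : dotv v w = dotv w v.
Proof. by apply: eq_bigr => i _; rewrite mulrC. Qed.

Lemma dotvDl v1 v2 w : dotv (v1 + v2) w = dotv v1 w + dotv v2 w.
Proof. by rewrite -big_split; apply: eq_bigr => i _ /=; rewrite mxE mulrDl. Qed.

Lemma dotvZl a v w : dotv (a *: v) w = a * dotv v w.
Proof. by rewrite mulr_sumr; apply: eq_bigr => i _ /=; rewrite mxE mulrA. Qed.

Lemma dotvDr v w1 w2 : dotv v (w1 + w2) = dotv v w1 + dotv v w2.
Proof. by rewrite dotvC dotvDl !(dotvC v). Qed.

Lemma dotvZr a v w : dotv v (a *: w) = a * dotv v w.
Proof. by rewrite dotvC dotvZl (dotvC v). Qed.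

Lemma dotvv_ge0 v : 0 <= dotv v v.
Proof. by apply: sumr_ge0 => i _; rewrite -expr2 sqr_ge0. Qed.

Lemma enorm_ge0 v : 0 <= enorm v.
Proof. exact: sqrtr_ge0. Qed.

Lemma norm_enorm v : `|enorm v| = enorm v. Proof. exact: ger0_norm (enorm_ge0 v). Qed.

Lemma enorm_sqr v : enorm v ^+ 2 = dotv v v.
Proof. by rewrite sqr_sqrtr// dotvv_ge0. Qed.

Lemma enorm0 : enorm (0 : 'rV[R]_n.+1) = 0.
Proof.
by rewrite /enorm /dotv big1 ?sqrtr0// => i _; rewrite mxE mul0r.
Qed.

Lemma enormZ a v : enorm (a *: v) = `|a| * enorm v.
Proof.
by rewrite /enorm dotvZl dotvZr mulrA -expr2 sqrtrM ?sqr_ge0// sqrtr_sqr.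
Qed.

(** The quadratic t -> |v + t w|^2 is nonnegative, in particular at its minimizer. If w has length 0
    it is affine in t and would become negative unless its slope vanishes. *)
Lemma dotv_enorm v w : `|dotv v w| <= enorm v * enorm w.
Proof.
rewrite -(@ler_pXn2r _ 2)// ?nnegrE ?mulr_ge0 ?enorm_ge0// exprMn !enorm_sqr.
rewrite -normrX ger0_norm ?sqr_ge0//.
have H t : 0 <= dotv v v + t * (2 * dotv v w) + t ^+ 2 * dotv w w.
  have := dotvv_ge0 (v + t *: w).
  by rewrite dotvDl !dotvDr !dotvZl !dotvZr (dotvC w v); congr (_ <= _); ring.
have := dotvv_ge0 w; rewrite le_eqVlt => /orP[/eqP w0|w0].
  rewrite -w0 mulr0; move: H; rewrite -w0; move: (dotv v v) (dotv v w) => a c H.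
  have [->|c0] := eqVneq c 0; first by rewrite expr0n.
  have := H (- (a + 1) / (2 * c)); rewrite mulr0 addr0.
  rewrite (_ : _ / _ * _ = - (a + 1)); last by field.
  lra.
have := H (- dotv v w / dotv w w).
move: w0; move: (dotv v v) (dotv v w) (dotv w w) => a c d d0.
rewrite (_ : a + _ + _ = (a * d - c ^+ 2) / d); last first.
  by field; rewrite gt_eqF.
by rewrite pmulr_lge0 ?invr_gt0// subr_ge0.
Qed.

Lemma enormD v w : enorm (v + w) <= enorm v + enorm w.
Proof.
rewrite -(@ler_pXn2r _ 2)// ?nnegrE ?addr_ge0 ?enorm_ge0// enorm_sqr.
rewrite dotvDl !dotvDr sqrrD !enorm_sqr (dotvC w v) addrA lerD2r -addrA lerD2l.
by rewrite -mulr2n ler_pMn2r// (le_trans (ler_norm _))// dotv_enorm.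
Qed.

End linear_algebra.

Lemma poly_interpolation (F : fieldType) (g : F -> F) (s : seq F) :
  exists q : {poly F}, forall x, x \in s -> q.[x] = g x.
Proof.
elim: s => [|y s [q qP]]; first by exists 0.
have [ys|ys] := boolP (y \in s).
  by exists q => x; rewrite inE => /predU1P[->|]; exact: qP.
pose r := \prod_(z <- s) ('X - z%:P).
have ry : r.[y] != 0.
  rewrite horner_prod prodf_seq_neq0; apply/allP => z zs /=.
  by rewrite hornerXsubC subr_eq0; apply: contraNneq ys => ->.
exists (q + ((g y - q.[y]) / r.[y]) *: r) => x.
rewrite inE hornerD hornerZ => /predU1P[->|xs].
  by rewrite divfK// addrC subrK.
have /eqP -> : r.[x] == 0 by rewrite -/(root _ _) root_prod_XsubC.
by rewrite mulr0 addr0 qP.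
Qed.

Lemma trmx_horner_mx (F : comNzRingType) m (A : 'M[F]_m.+1) (q : {poly F}) :
  A^T = A -> (horner_mx A q)^T = horner_mx A q.
Proof.
move=> As; elim/poly_ind: q => [|q c IH]; first by rewrite rmorph0 trmx0.
rewrite rmorphD rmorphM /= horner_mx_X horner_mx_C linearD /= tr_scalar_mx.
congr (_ + _); rewrite trmx_mul IH As.
have := mulrC 'X q => /(congr1 (horner_mx A)); rewrite !rmorphM /= horner_mx_X => <-.
by rewrite -mulmxE.
Qed.

Section psd_sqrt.
Import spectral complex.
Context {R : realType} {n : nat}.
Implicit Types (v w : 'rV[R]_n.+1) (A : 'M[R]_n.+1).

Lemma dotv_mx v w : dotv v w = (v *m w^T) ord0 ord0.
Proof. by rewrite mxE; apply: eq_bigr => i _; rewrite mxE. Qed.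

Lemma dotv_mulmx v w A : dotv v (w *m A) = dotv (v *m A^T) w.
Proof. by rewrite !dotv_mx trmx_mul mulmxA. Qed.

Lemma psdmx_eigenvalue_ge0 A d : psdmx A -> eigenvalue A d -> 0 <= d.
Proof.
move=> [_ Apsd] /eigenvalueP[v vA v0].
have := Apsd v; rewrite vA dotvZr.
have vv : 0 < dotv v v.
  rewrite lt_neqAle dotvv_ge0 andbT eq_sym; apply: contra_neq v0 => vv0.
  apply/rowP => i; rewrite mxE; apply/eqP; rewrite -sqrf_eq0 expr2.
  move/eqP: vv0; rewrite psumr_eq0; last by move=> j _; rewrite -expr2 sqr_ge0.
  by move=> /allP/(_ i); rewrite mem_index_enum => /(_ isT).
by rewrite pmulr_lge0.
Qed.

(* The square root is a polynomial in [A], interpolating the fourth root on    *)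
(* the spectrum and then squared, so that reality, symmetry and positivity are *)
(* automatic.                                                                  *)
Lemma psdmx_sqrt_exists_closed (C : numClosedFieldType) (f : {rmorphism R -> C}) A :
  (forall x, f x \is Num.real) -> (forall z, z \is Num.real -> exists x, z = f x) ->
  psdmx A -> exists S, psdmx S /\ S *m S = A.
Proof.
move=> freal realf Apsd; have [Asym _] := Apsd.
pose AC := map_mx f A.
have ACh : AC \is hermsymmx.
  apply: realsym_hermsym; last by apply/mxOverP => i j; rewrite mxE.
  by apply/is_hermitianmxP; rewrite /= expr0 scale1r map_mx_id// /AC map_trmx Asym.
have spreal := hermitian_spectral_diag_real ACh.
have /hermitian_normalmx/orthomx_spectralP Aeq := ACh.
set P := spectralmx AC in Aeq; set sp := spectral_diag AC in Aeq spreal.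
have Punit : P \in unitmx by exact: spectral_unit.
have /choice[d dP] : forall i, exists d : R, sp ord0 i = f d.
  by move=> i; apply: realf; exact: (mxOverP spreal).
have d0 i : 0 <= d i.
  apply: psdmx_eigenvalue_ge0 Apsd _.
  rewrite eigenvalue_root_char -(fmorph_root f) map_char_poly -/AC.
  rewrite -eigenvalue_root_char; apply/eigenvalueP; exists (row i P).
    have : P *m AC = diag_mx sp *m P by rewrite {1}Aeq !mulmxA mulmxV// mul1mx.
    move=> /(congr1 (row i)); rewrite !row_mul row_diag_mx -scalemxAl -rowE => ->.
    by rewrite dP.
  have [B] : exists B, P *m B = 1%:M by exists (invmx P); rewrite mulmxV.
  apply: contra_eqN => /eqP Pi0; apply/negP => /eqP /(congr1 (row i)).
  rewrite row_mul Pi0 mul0mx => /rowP/(_ i); rewrite !mxE eqxx => /esym/eqP.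
  by rewrite oner_eq0.
have [q qP] := poly_interpolation (fun x => Num.sqrt (Num.sqrt x))
   [seq d i | i : 'I_n.+1].
have {}qP i : q.[d i] ^+ 4 = d i.
  rewrite qP ?map_f ?mem_enum// (exprM _ 2 2) !sqr_sqrtr// sqrtr_ge0.
pose T := horner_mx A q.
have TS : T^T = T by exact: trmx_horner_mx.
exists (T *m T); split.
  split; first by rewrite trmx_mul TS.
  by move=> v; rewrite mulmxA dotv_mulmx TS dotvv_ge0.
(* Since q(d i)^4 = d i on the spectrum, the diagonalization over the closed field identifies q^4
   evaluated at A with A. *)
have -> : T *m T *m (T *m T) = horner_mx A (q ^+ 4).
  by rewrite rmorphXn /= -/T !mulmxE -!expr2 -exprM.
apply: (map_mx_inj (f := f)).
rewrite map_horner_mx -/AC {1}Aeq.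
rewrite horner_mx_uconjC// horner_mx_diag [in RHS]Aeq.
congr (_ *m diag_mx _ *m _); apply/rowP => i.
by rewrite mxE dP horner_map horner_exp qP.
Qed.

Lemma psdmx_sqrt A : psdmx A -> psdmx (sqrtmx A) /\ sqrtmx A *m sqrtmx A = A.
Proof.
move=> Apsd.
have [|z|S PS] := @psdmx_sqrt_exists_closed (complex.complex R)
  (complex.real_complex R) A _ _ Apsd.
- by move=> x; rewrite complex.complex_real.
- by move=> /complex.complex_realP.
rewrite /sqrtmx; exact: (@xgetPex _ 0 [set S | psdmx S /\ S *m S = A] (ex_intro _ S PS)).
Qed.

Lemma sqrtmx_sym A : (sqrtmx A)^T = sqrtmx A.
Proof.
rewrite /sqrtmx; case: xgetP => [S _ [[]]//|_]; exact: trmx0.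
Qed.

(** Expresses the weighted length through A itself, so that [Qnorm] is measurable as soon as the
    entries of Q are. *)
Lemma enorm_sqrtmx A v : psdmx A -> enorm (v *m sqrtmx A) = Num.sqrt (dotv v (v *m A)).
Proof.
move=> /psdmx_sqrt[_ AA]; rewrite /enorm -[in RHS]AA; congr Num.sqrt.
by rewrite mulmxA [RHS]dotv_mulmx sqrtmx_sym.
Qed.

End psd_sqrt.

(** * Lebesgue measurable functions *)

Section measurability.
Context {R : realType} {n : nat}.
Local Notation E := 'rV[R]_n.+1.
Implicit Types (U : set E) (f g : E -> R) (V : E -> E).

Lemma meas_sub U U' f : measurable (U : set (Rn R n)) -> U' `<=` U ->
  meas_fun U f -> meas_fun U' f.
Proof. by move=> mU sU; apply: measurable_funS. Qed.

Lemma meas_cst U (c : R) : meas_fun U (fun=> c).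
Proof. exact: measurable_cst. Qed.

Lemma measD U f g : meas_fun U f -> meas_fun U g -> meas_fun U (fun x => f x + g x).
Proof. exact: measurable_funD. Qed.

Lemma measN U f : meas_fun U f -> meas_fun U (fun x => - f x).
Proof. exact: measurable_funN. Qed.

Lemma measB U f g : meas_fun U f -> meas_fun U g -> meas_fun U (fun x => f x - g x).
Proof. exact: measurable_funB. Qed.

Lemma measM U f g : meas_fun U f -> meas_fun U g -> meas_fun U (fun x => f x * g x).
Proof. exact: measurable_funM. Qed.

Lemma meas_compM U f (g : R -> R) : measurable_fun setT g -> meas_fun U f ->
  meas_fun U (fun x => g (f x)).
Proof. by move=> mg mf; apply: (measurableT_comp mg). Qed.

Lemma meas_comp U f (g : R -> R) : continuous g -> meas_fun U f ->
  meas_fun U (fun x => g (f x)).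
Proof. by move=> cg; apply: meas_compM; exact: continuous_measurable_fun. Qed.

Lemma meas_norm U f : meas_fun U f -> meas_fun U (fun x => `|f x|).
Proof. by apply: meas_compM; exact: normr_measurable. Qed.

Lemma meas_powR U f p : meas_fun U f -> meas_fun U (fun x => f x `^ p).
Proof. by apply: (@meas_compM _ _ (fun z => z `^ p)); exact: measurable_powR. Qed.

Lemma meas_sqrt U f : meas_fun U f -> meas_fun U (fun x => Num.sqrt (f x)).
Proof. by apply: meas_comp; exact: sqrt_continuous. Qed.

Lemma meas_sum (I : Type) (s : seq I) U (f : I -> E -> R) :
  (forall i, meas_fun U (f i)) -> meas_fun U (fun x => \sum_(i <- s) f i x).
Proof. by move=> mf; apply: measurable_sum. Qed.

Lemma meas_EFin U f : meas_fun U f ->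
  measurable_fun (U : set (Rn R n)) (fun x : Rn R n => (f x)%:E).
Proof. by move=> mf; apply/measurable_EFinP. Qed.

Lemma EFin_ge0 U f : (forall x, U x -> 0 <= f x) -> forall x : Rn R n, U x -> (0 <= (f x)%:E)%E.
Proof. by move=> f0 x /f0; rewrite lee_fin. Qed.

Lemma meas_ext U f g : (forall x, U x -> f x = g x) -> meas_fun U f -> meas_fun U g.
Proof.
by move=> fg; apply: eq_measurable_fun => x; rewrite inE; exact: fg.
Qed.

Definition measV U V := forall i, meas_fun U (fun x => V x ord0 i).

Lemma meas_dotv U V W : measV U V -> measV U W ->
  meas_fun U (fun x => dotv (V x) (W x)).
Proof. by move=> mV mW; apply: meas_sum => i; exact: measM. Qed.

Lemma meas_Qnorm U (Q : E -> 'M[R]_n.+1) V :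
  (forall x, U x -> psdmx (Q x)) -> (forall i j, meas_fun U (fun x => Q x i j)) ->
  measV U V -> meas_fun U (Qnorm Q V).
Proof.
move=> Qpsd mQ mV; apply: (@meas_ext _ (fun x => Num.sqrt (dotv (V x) (V x *m Q x)))).
  by move=> x Ux; rewrite /Qnorm enorm_sqrtmx//; exact: Qpsd.
apply/meas_sqrt/meas_dotv => // i.
apply: (@meas_ext _ (fun x => \sum_j V x ord0 j * Q x j i)).
  by move=> x _; rewrite mxE.
by apply: meas_sum => j; exact: measM.
Qed.

End measurability.

(** Recursion on the head symbol of the function body. Leaves that no hypothesis closes are left as
    goals. *)
Ltac meas := lazymatch goal with
  | |- meas_fun ?U (fun _ => ?c) => exact (@meas_cst _ _ U c)
  | |- meas_fun ?U (fun x => (@?f x + @?g x)%R) => refine (@measD _ _ U f g _ _); meas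
  | |- meas_fun ?U (fun x => (@?f x * @?g x)%R) => refine (@measM _ _ U f g _ _); meas
  | |- meas_fun ?U (fun x => (- @?f x)%R) => refine (@measN _ _ U f _); meas
  | |- meas_fun ?U (fun x => `| @?f x |%R) => refine (@meas_norm _ _ U f _); meas
  | |- meas_fun ?U (fun x => (@?f x `^ _)%R) => refine (@meas_powR _ _ U f _ _); meas
  | |- meas_fun ?U _ => first [match goal with H : ?T |- ?G => constr_eq T G; exact H end |
      match goal with H : meas_fun U ?h |- meas_fun _ (fun x => ?g x) => constr_eq g h; exact H end |
      match goal with H : forall _, meas_fun U _ |- _ => solve [simple apply H] end | idtac]
  end.

(** * Averages and a four-factor Hoelder inequality *)

Section averages.
Context {R : realType} {n : nat}.
Local Notation E := 'rV[R]_n.+1.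
Context {U : set E}.
Hypothesis mU : measurable (U : set (Rn R n)).
Hypothesis U_gt0 : (0 < @leb R n U)%E.
Hypothesis U_lty : (@leb R n U < +oo)%E.
Implicit Types (f g : E -> R).
Local Notation avgR f := (avg U (fun x => (f x)%:E)).

Lemma vol_gt0 : 0 < vol U.
Proof. by rewrite /vol -lte_fin fineK ?ge0_fin_numE// ltW. Qed.

Lemma volE : ((vol U)%:E = @leb R n U)%E.
Proof. by rewrite /vol fineK// ge0_fin_numE// ltW. Qed.

Lemma avg_ge0 (f : E -> \bar R) : (forall x, U x -> 0 <= f x)%E -> (0 <= avg U f)%E.
Proof.
move=> f0; rewrite mule_ge0//; last exact: integral_ge0.
by rewrite lee_fin invr_ge0 ltW// vol_gt0.
Qed.

Lemma le_avg_ae f g : meas_fun U f -> meas_fun U g ->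
  (forall x, U x -> 0 <= f x) -> (forall x, U x -> 0 <= g x) ->
  {ae @leb R n, forall x, U x -> f x <= g x} -> (avgR f <= avgR g)%E.
Proof.
move=> mf mg f0 g0 fg; apply: lee_wpmul2l.
  by rewrite lee_fin invr_ge0 ltW// vol_gt0.
exact: (ae_ge0_le_integral mU (EFin_ge0 f0) (meas_EFin mf) (EFin_ge0 g0) (meas_EFin mg) fg).
Qed.

Lemma le_avg f g : meas_fun U f -> meas_fun U g ->
  (forall x, U x -> 0 <= f x <= g x) -> (avgR f <= avgR g)%E.
Proof.
move=> mf mg fg; apply: le_avg_ae => //.
- by move=> x /fg/andP[].
- by move=> x /fg/andP[]; exact: le_trans.
- by apply: aeW => x /fg/andP[].
Qed.

Lemma avgD f g : meas_fun U f -> meas_fun U g ->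
  (forall x, U x -> 0 <= f x) -> (forall x, U x -> 0 <= g x) ->
  (avgR (fun x => f x + g x) = avgR f + avgR g)%E.
Proof.
move=> mf mg f0 g0; rewrite /avg.
under eq_integral do rewrite EFinD.
rewrite (ge0_integralD _ mU (EFin_ge0 f0) (meas_EFin mf) (EFin_ge0 g0) (meas_EFin mg)).
rewrite ge0_muleDr//; apply: integral_ge0 => x Ux; rewrite lee_fin.
  exact: f0.
exact: g0.
Qed.

Lemma avgZ (c : R) f : 0 <= c -> meas_fun U f -> (forall x, U x -> 0 <= f x) ->
  (avgR (fun x => c * f x)%R = c%:E * avgR f)%E.
Proof.
move=> c0 mf f0; rewrite /avg.
under eq_integral do rewrite EFinM.
by rewrite (ge0_integralZl _ mU (meas_EFin mf) (EFin_ge0 f0)) ?lee_fin// muleCA.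
Qed.

Lemma avg_cst (c : R) : avgR (fun=> c) = c%:E.
Proof.
rewrite /avg integral_cst//; transitivity ((vol U)^-1%:E * (c%:E * (vol U)%:E))%E.
  by rewrite volE.
rewrite -!EFinM mulrCA mulVf ?mulr1//.
by rewrite gt_eqF// vol_gt0.
Qed.

Lemma eq_avg (f g : E -> R) : (forall x, U x -> f x = g x) -> avgR f = avgR g.
Proof.
by move=> fg; congr (_ * _)%E; apply: eq_integral => x; rewrite inE => /fg ->.
Qed.

(** Weighted arithmetic-geometric mean inequality in which the slack 1 - (a + b + c + d) is the
    weight of a fifth number 1. After division by the product [s] it is a sum of inequalities ln y
    <= y - 1. *)
Lemma weighted_AMGM4 (x y z t a b c d : R) : 0 <= x -> 0 <= y -> 0 <= z -> 0 <= t ->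
  0 <= a -> 0 <= b -> 0 <= c -> 0 <= d -> a + b + c + d <= 1 ->
  x `^ a * y `^ b * z `^ c * t `^ d <=
  a * x + b * y + c * z + d * t + (1 - (a + b + c + d)).
Proof.
move=> x0 y0 z0 t0 a0 b0 c0 d0 abcd.
have rhs0 : 0 <= a * x + b * y + c * z + d * t + (1 - (a + b + c + d)).
  by rewrite addr_ge0 ?subr_ge0// !addr_ge0 ?mulr_ge0.
set s := x `^ a * _ * _ * _.
have := powR_ge0 x a; have := powR_ge0 y b; have := powR_ge0 z c.
have := powR_ge0 t d => td zc yb xa.
have : 0 <= s by rewrite /s !mulr_ge0.
rewrite le_eqVlt => /orP[/eqP <-//|s0].
have ln_bound u w : 0 <= u -> 0 <= w -> 0 < u `^ w ->
    w * ln u <= w * (u / s) - w * 1 + w * ln s.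
  move=> u0 w0; have [->|w1] := eqVneq w 0; first by rewrite !mul0r subr0 addr0.
  move=> uw; have u1 : 0 < u by apply: gt0_powR uw => //; rewrite lt_neqAle eq_sym w1.
  rewrite -mulrBr -mulrDr ler_wpM2l// -lerBlDr -ln_div ?posrE//.
  have := @le_ln1Dx R (u / s - 1); rewrite [1 + _]addrC subrK; apply.
  by rewrite ltrBrDr addNr divr_gt0.
have key : ln s = a * ln x + b * ln y + c * ln z + d * ln t.
  rewrite /s; have [sx sy sz st] : [/\ 0 < x `^ a, 0 < y `^ b, 0 < z `^ c & 0 < t `^ d].
    move: s0; rewrite /s => s0.
    by split; rewrite lt_neqAle ?xa ?yb ?zc ?td andbT eq_sym; apply: contraTneq s0 => ->;
      rewrite ?(mul0r, mulr0) ltxx.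
  by rewrite !lnM ?posrE ?mulr_gt0// !ln_powR.
have [sx sy sz st] : [/\ 0 < x `^ a, 0 < y `^ b, 0 < z `^ c & 0 < t `^ d].
  move: s0; rewrite /s => s0.
  by split; rewrite lt_neqAle ?xa ?yb ?zc ?td andbT eq_sym; apply: contraTneq s0 => ->;
    rewrite ?(mul0r, mulr0) ltxx.
have hx := ln_bound _ _ x0 a0 sx; have hy := ln_bound _ _ y0 b0 sy.
have hz := ln_bound _ _ z0 c0 sz; have ht := ln_bound _ _ t0 d0 st.
have h1 : - ln s <= 1 / s - 1.
  have := @le_ln1Dx R (1 / s - 1); rewrite [1 + _]addrC subrK ln_div ?posrE// ln1 sub0r.
  by apply; rewrite ltrBrDr addNr divr_gt0.
have h1' : (1 - (a + b + c + d)) * - ln s <= (1 - (a + b + c + d)) * (1 / s - 1).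
  by rewrite ler_wpM2l// subr_ge0.
have : 1 <= (a * x + b * y + c * z + d * t + (1 - (a + b + c + d))) / s.
  rewrite !mulrDl; move: key hx hy hz ht h1'; rewrite !mulrA !mul1r.
  rewrite -!mulNr mulr1.
  move: (a * x / s) (b * y / s) (c * z / s) (d * t / s) (ln s) => ax by_ cz dt ls.
  move: (a * ln x) (b * ln y) (c * ln z) (d * ln t) => ? ? ? ?.
  lra.
by rewrite ler_pdivlMr// mul1r.
Qed.

Lemma powR_cvg_right (A a : R) : 0 <= A -> 0 <= a ->
  (A + e) `^ a @[e --> 0^'+] --> A `^ a.
Proof.
move=> A0; rewrite le_eqVlt => /predU1P[<-|a0].
  by under eq_fun do rewrite powRr0; rewrite powRr0; exact: cvg_cst.
move: A0; rewrite le_eqVlt => /predU1P[<-|A0].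
  under eq_fun do rewrite add0r; rewrite powR0 ?gt_eqF//; exact: powR_cvg0.
apply: (@cvg_comp _ _ _ (fun e => A + e) (fun x => x `^ a) _ (nbhs A)).
  rewrite -[X in _ `=>` nbhs X]addr0; apply: cvgD; first exact: cvg_cst.
  exact: cvg_within.
suff : {for A, continuous (fun x => x `^ a)} by [].
apply/differentiable_continuous/derivable1_diffP.
by apply: derivable_powR; rewrite in_itv/= A0.
Qed.

(** The weighted arithmetic-geometric mean inequality is applied pointwise to the functions divided
    by their bounds and then averaged. The total mass is 1, hence exponents with sum below 1 are
    allowed. The bounds are first increased by e > 0, so that the division makes sense when one of
    them is 0, and then e tends to 0. *)
Lemma avg_holder4 (f g h k : E -> R) (A B C D a b c d : R) :
  meas_fun U f -> meas_fun U g -> meas_fun U h -> meas_fun U k ->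
  (forall x, U x -> [/\ 0 <= f x, 0 <= g x, 0 <= h x & 0 <= k x]) ->
  0 <= A -> 0 <= B -> 0 <= C -> 0 <= D ->
  0 <= a -> 0 <= b -> 0 <= c -> 0 <= d -> a + b + c + d <= 1 ->
  (avgR f <= A%:E)%E -> (avgR g <= B%:E)%E -> (avgR h <= C%:E)%E -> (avgR k <= D%:E)%E ->
  (avgR (fun x => f x `^ a * g x `^ b * h x `^ c * k x `^ d)%R <=
   (A `^ a * B `^ b * C `^ c * D `^ d)%:E)%E.
Proof.
move=> mf mg mh mk f0 A0 B0 C0 D0 a0 b0 c0 d0 abcd fA gB hC kD.
set L := avg U _.
have step e : 0 < e ->
    (L <= ((A + e) `^ a * (B + e) `^ b * (C + e) `^ c * (D + e) `^ d)%:E)%E.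
  move=> e0.
  have [Ae Be Ce De] : [/\ 0 < A + e, 0 < B + e, 0 < C + e & 0 < D + e].
    by split; rewrite ltr_wpDl.
  set P := (_ `^ a * _ * _ * _)%R.
  have P0 : 0 <= P by rewrite /P !mulr_ge0 ?powR_ge0.
  apply: (@le_trans _ _ (avgR (fun x => P * (a / (A + e) * f x + b / (B + e) * g x +
     c / (C + e) * h x + d / (D + e) * k x + (1 - (a + b + c + d))))))%E.
    apply: le_avg.
      by meas.
      by meas.
    move=> x Ux; have [fx gx hx kx] := f0 x Ux.
    rewrite !mulr_ge0 ?powR_ge0//=.
    have := @weighted_AMGM4 (f x / (A + e)) (g x / (B + e)) (h x / (C + e))
      (k x / (D + e)) a b c d.
    rewrite !divr_ge0// ?(ltW Ae, ltW Be, ltW Ce, ltW De)//.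
    move=> /(_ isT isT isT isT a0 b0 c0 d0 abcd).
    have E4 (w u v : R) : w / v * u = w * (u / v) by rewrite mulrAC mulrA.
    rewrite !E4 => /(ler_wpM2l P0); apply: le_trans.
    rewrite le_eqVlt; apply/orP; left; apply/eqP.
    rewrite !powRM ?invr_ge0 ?(ltW Ae, ltW Be, ltW Ce, ltW De)//.
    have eV (v w : R) : 0 < v -> v^-1 `^ w = (v `^ w)^-1.
      by move=> v0; rewrite -powR_inv1 ?ltW// -powRrM mulN1r powRN.
    rewrite !eV// /P.
    have := powR_gt0 a Ae; have := powR_gt0 b Be; have := powR_gt0 c Ce.
    have := powR_gt0 d De.
    move: (_ `^ d) ((_ + _) `^ c) ((_ + _) `^ b) ((_ + _) `^ a) => p1 p2 p3 p4.
    by move=> p10 p20 p30 p40; field; rewrite !gt_eqF.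
  have d0' (u v : R) : 0 <= u -> 0 < v -> 0 <= u / v by move=> *; rewrite divr_ge0// ltW.
  have [f0' g0 h0 k0] : [/\ (forall x, U x -> 0 <= f x), (forall x, U x -> 0 <= g x),
     (forall x, U x -> 0 <= h x) & forall x, U x -> 0 <= k x].
    by split=> x /f0[].
  have r0 : 0 <= 1 - (a + b + c + d) by rewrite subr_ge0.
  rewrite avgZ//; first last.
  - by move=> x Ux; have [fx gx hx kx] := f0 x Ux; do ?apply: addr_ge0 => //;
    rewrite mulr_ge0 ?d0'.
  - by meas.
  rewrite -[leRHS]mule1.
  apply: lee_wpmul2l; first by rewrite lee_fin.
  do 4 (rewrite avgD; [|by meas|by meas|
    by move=> x Ux; have [fx gx hx kx] := f0 x Ux; do ?apply: addr_ge0 => //;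
       rewrite mulr_ge0 ?d0'|
    by move=> x Ux; have [fx gx hx kx] := f0 x Ux => //; rewrite mulr_ge0 ?d0']).
  rewrite avg_cst !avgZ ?d0'//.
  have H (u v : R) (Y : \bar R) : 0 <= u -> 0 <= v -> (Y <= v%:E)%E ->
     ((u / (v + e))%:E * Y <= u%:E)%E.
    move=> u0 v0 Yv; apply: (@le_trans _ _ ((u / (v + e))%:E * v%:E)%E).
      by apply: lee_wpmul2l => //; rewrite lee_fin divr_ge0// addr_ge0// ltW.
    rewrite -EFinM lee_fin -mulrA ler_piMr// mulrC ler_pdivrMr ?ltr_wpDl// mul1r.
    by rewrite lerDl ltW.
  apply: (@le_trans _ _ (a%:E + b%:E + c%:E + d%:E + (1 - (a + b + c + d))%:E)%E).
    by rewrite !leeD// H.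
  by rewrite -!EFinD lee_fin addrCA subrr addr0.
have LA : L \is a fin_num.
  rewrite ge0_fin_numE; last first.
    by apply: avg_ge0 => x Ux; rewrite lee_fin !mulr_ge0 ?powR_ge0.
  by apply: le_lt_trans (step 1 ltr01) _; rewrite ltry.
rewrite -(fineK LA) lee_fin.
have cv : (A + e) `^ a * (B + e) `^ b * (C + e) `^ c * (D + e) `^ d @[e --> 0^'+]
    --> A `^ a * B `^ b * C `^ c * D `^ d.
  apply: cvgM; last exact: powR_cvg_right.
  apply: cvgM; last exact: powR_cvg_right.
  by apply: cvgM; exact: powR_cvg_right.
apply: (cvgr_to_ge cv); near=> e.
by rewrite -lee_fin fineK// step.
Unshelve. all: by end_near. Qed.

End averages.

(** * Almost everywhere statements *)

Section almost_everywhere.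
Context {R : realType} {n : nat}.
Local Notation E := 'rV[R]_n.+1.
Implicit Types (P Q S : E -> Prop).

Lemma ae_imp P Q : (forall x, P x -> Q x) ->
  {ae @leb R n, forall x, P x} -> {ae @leb R n, forall x, Q x}.
Proof.
by move=> PQ; apply: (@filterS _ _ (ae_filter_ringOfSetsType (@leb R n))) => x; exact: PQ.
Qed.

Lemma ae_imp2 P Q S : (forall x, P x -> Q x -> S x) ->
  {ae @leb R n, forall x, P x} -> {ae @leb R n, forall x, Q x} ->
  {ae @leb R n, forall x, S x}.
Proof.
by move=> PQ; apply: (@filterS2 _ _ (ae_filter_ringOfSetsType (@leb R n))) => x; exact: PQ.
Qed.

Lemma ae_all (P : nat -> E -> Prop) : (forall k, {ae @leb R n, forall x, P k x}) ->
  {ae @leb R n, forall x, forall k, P k x}.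
Proof. exact: ae_foralln. Qed.

Lemma ae_fin (I : finType) (P : I -> E -> Prop) :
  (forall i, {ae @leb R n, forall x, P i x}) ->
  {ae @leb R n, forall x, forall i, P i x}.
Proof.
move=> H.
have := @ae_all (fun k x => forall i : I, k = enum_rank i -> P i x).
move=> /(_ _)/(ae_imp _); apply; first by move=> x + i => /(_ _ i erefl).
move=> k; have [[i ki]|nk] := pselect (exists i : I, k = enum_rank i); last first.
  by apply: aeW => x i ki; exfalso; apply: nk; exists i.
apply: ae_imp (H i) => x Pi j; rewrite ki => /val_inj/enum_rank_inj <-//.
Qed.

End almost_everywhere.

(** * Rademacher's theorem *)

Section lipschitz_line.
Context {R : realType}.
Variables (f : R -> R) (L : R).
Hypothesis L0 : 0 < L.
Hypothesis lipf : forall x y, `|f x - f y| <= L * `|x - y|.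

Let g x := f x + L * x.

Let lip_continuous (c : R) : continuous (fun x => f x + c * x).
Proof.
move=> x; apply: continuousD; last first.
  by apply: continuousM; [exact: cvg_cst|exact: cvg_id].
apply/cvgrPdist_lt => e e0; near=> y.
apply: le_lt_trans (lipf x y) _; rewrite mulrC -ltr_pdivlMr//.
by near: y; apply: cvgr_dist_lt; [exact: cvg_id|rewrite divr_gt0].
Unshelve. all: by end_near. Qed.

Let g_nd : {homo g : x y / x <= y}.
Proof.
move=> x y xy; rewrite /g.
have := lipf x y; rewrite ler_norml distrC ger0_norm ?subr_ge0// => /andP[_].
lra.
Qed.

Let g_rc : right_continuous g.
Proof. by apply: right_continuousW; exact: lip_continuous. Qed.

HB.instance Definition _ := isCumulative.Build R _ R g g_nd g_rc.

Let nu : {measure set (measurableTypeR R) -> \bar R} := lebesgue_stieltjes_measure g.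

(** On an interval, f x + L x increases by at most 2 L times the length, and both measures are
    infima over the same interval covers. *)
Let nu_le A : (nu A <= (2 * L)%:E * lebesgue_measure A)%E.
Proof.
have L20 : 0 < 2 * L by rewrite mulr_gt0.
rewrite -lee_pdivrMl//.
apply: le_ereal_inf_tmp => _ [F FA <-].
rewrite lee_pdivrMl// -nneseriesZl//.
apply: (@le_trans _ _ (\sum_(k <oo) wlength g (F k))%E).
  by apply: ereal_inf_lbound; exists F.
apply: lee_nneseries => [k _ _|k _]; first exact: wlength_ge0.
have [mF _] := FA; have := mF k => /ocitvP[->|[[a b]/= ab ->]].
  apply: (@le_trans _ _ 0%E); first by rewrite wlength0.
  by apply: mule_ge0; [rewrite lee_fin ltW|exact: wlength_ge0].
have -> : wlength g `]a, b]%classic = (g b - g a)%:E.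
  by apply: wlength_itv_bnd; exact: ltW.
have -> : wlength idfun `]a, b]%classic = (b - a)%:E.
  by apply: (@wlength_itv_bnd _ idfun); exact: ltW.
rewrite -EFinM lee_fin /g.
have ba : `|b - a| = b - a by rewrite ger0_norm// subr_ge0 ltW.
have := lipf b a; rewrite ba ler_norml => /andP[_].
lra.
Qed.

(* The Stieltjes measure of the nondecreasing function [f x + L x] is absolutely *)
(* continuous; its density is integrated by the fundamental theorem.             *)
Lemma lipschitz_ae_derivable : {ae lebesgue_measure, forall x, derivable f x 1}.
Proof.
suff H (N : nat) : {ae lebesgue_measure, forall x,
    `]- N%:R, N%:R[%classic x -> derivable f x 1}.
  have := ae_foralln H; apply: filterS => x Hx; have /archi_boundP := normr_ge0 x.
  set M := Num.bound _ => xM; apply: (Hx M).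
  by rewrite /= in_itv/=; move: xM; rewrite ltr_norml.
pose D : set (measurableTypeR R) := `]- N%:R, N%:R]%classic.
have mD : measurable D by exact: measurable_itv.
have muD : (lebesgue_measure D < +oo)%E.
  by rewrite /D lebesgue_measure_itv/=; case: ifP => _; rewrite -?EFinB ltry.
have nuD : (nu D < +oo)%E.
  apply: (le_lt_trans (nu_le D)); rewrite lte_mul_pinfty// ?lee_fin//.
  by rewrite mulr_ge0// ltW.
(* Restriction to a bounded interval makes the Stieltjes measure finite, as the Radon-Nikodym
   theorem is applied to a finite measure; absolute continuity is [nu_le]. *)
pose nuN : {finite_measure set _ -> \bar R} := mfrestr mD nuD.
have nuNmu : nuN `<< lebesgue_measure.
  apply/null_content_dominatesP => A mA muA.
  rewrite /nuN /mfrestr /mrestr; apply/eqP; rewrite eq_le measure_ge0 andbT.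
  apply: (@le_trans _ _ (nu A)).
    by apply: le_measure; rewrite ?inE//; exact: measurableI.
  by apply: le_trans (nu_le A) _; rewrite [lebesgue_measure A]muA mule0.
have [h [h0 hfin hint hE]] := radon_nikodym_sigma_finite nuNmu.
pose k := fine \o h.
have hk : h = EFin \o k by apply/funext => x; rewrite /= fineK.
rewrite hk in hint hE.
have intk y : lebesgue_measure.-integrable
    [set` Interval (BRight (- N%:R)) (BRight y)] (EFin \o k).
  by apply: integrableS hint => //; exact: measurable_itv.
have lock : locally_integrable [set: R] k 
  by apply: open_integrable_locally; [exact: openT|exact: hint].
have /= := FTC1 intk lock.
apply: filterS; first exact: (ae_filter_ringOfSetsType lebesgue_measure).
move=> x + xN; move: xN; rewrite /= in_itv/= => /andP[Nx xN].
rewrite /= lte_fin => /(_ Nx)[+ _].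
set F := (fun _ => Rintegral _ _ _) => dF.
have FE y : - N%:R < y < N%:R -> F y = g y - g (- N%:R).
  move=> /andP[Ny yN]; rewrite /F /Rintegral.
  rewrite -hE; last exact: measurable_itv.
  rewrite [nuN _](_ : _ = nu (`]- N%:R, y]%classic `&` D))// setIidl; last first.
    move=> z; rewrite /D /= !in_itv/= => /andP[Nz zy].
  by rewrite Nz/= (le_trans zy)// ltW.
  have oc : ocitv `]- N%:R, y]%classic by exact: is_ocitv.
  rewrite [nu _](_ : _ = (wlength g)^*%mu `]- N%:R, y]%classic)//.
  by rewrite measurable_mu_extE//= wlength_itv_bnd// ltW.
have dg : derivable g x 1.
  have -> : g = (fun y => (g y - g (- N%:R)) + g (- N%:R)).
    by apply/funext => y; rewrite subrK.
  apply: derivableD; last exact: derivable_cst.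
  apply: (near_eq_derivable _ dF).
  have xin : x \in `]- N%:R, N%:R[ by rewrite in_itv/= Nx.
  have := near_in_itvoo xin; apply: filterS => y.
  by rewrite in_itv/= => /FE ->.
have -> : f = (fun y => g y - L * y) by apply/funext => y; rewrite /g addrK.
apply: (derivableB dg); apply: (@derivableM _ _ (cst L) id); first exact: derivable_cst.
exact: derivable_id.
Qed.

End lipschitz_line.

(** * Translation invariance and sigma-finiteness *)

Section translation.
Context {R : realType} {n : nat}.
Local Notation E := 'rV[R]_n.+1.

Lemma leb_shift (v : E) (A : set E) : @leb R n [set x | A (x + v)] = @leb R n A.
Proof.
have le (w : E) (B : set E) : (@leb R n [set x | B (x + w)%R] <= @leb R n B)%E.
  apply: le_ereal_inf_tmp => _ [F BF <-].
  pose F' k := ((F k).1 - w, (F k).2 - w).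
  rewrite (_ : (\sum_(k <oo) box_vol (F k) = \sum_(k <oo) box_vol (F' k))%E); last first.
    apply: eq_eseriesr => k _; congr EFin; apply: eq_bigr => i _.
    have -> : (F' k).2 ord0 i - (F' k).1 ord0 i = (F k).2 ord0 i - (F k).1 ord0 i => //.
    by rewrite /F' /= !mxE; ring.
  apply: ereal_inf_lbound; exists F' => // x /= /BF[k _ Fk]; exists k => // i /=.
  by have := Fk i; rewrite !mxE lerBrDr ltrBlDr.
apply/eqP; rewrite eq_le le/=.
have := le (- v) [set x | A (x + v)].
rewrite (_ : [set x | [set x0 | A (x0 + v)%R] (x - v)%R] = A)//.
by apply/seteqP; split=> x /=; rewrite subrK.
Qed.

Lemma leb_sigma_finite : sigma_finite setT (@leb R n).
Proof.
exists (fun k => ball (0 : E) k.+1%:R).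
  apply/esym; rewrite -subTset => x _; exists (Num.bound `|x|) => //.
  rewrite mx_norm_ball /ball_/= sub0r normrN.
  by rewrite (lt_le_trans (archi_boundP _))// ler_nat.
move=> k; split; first exact: measurable_ballRn.
apply: leb_lty; exists k.+1%:R; split=> // M kM x.
rewrite mx_norm_ball /ball_/= sub0r normrN => xk.
by rewrite ltW// (lt_trans xk).
Qed.

HB.instance Definition _ :=
  @Measure_isSigmaFinite.Build _ _ _ (@leb R n) leb_sigma_finite.

End translation.

(** * Partial derivatives of Lipschitz functions *)

Section directional.
Context {R : realType} {n : nat}.
Local Notation E := 'rV[R]_n.+1.
Variables (f : E -> R) (L : R) (i : 'I_n.+1).
Hypothesis L0 : 0 < L.
Hypothesis lipf : forall x y, `|f x - f y| <= L * `|x - y|.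

Local Notation e := (delta_mx ord0 i : E).

Let quo (h : R) (x : E) : R := h^-1 * (f (h *: e + x) - f x).

Let small (m : nat) (q : rat) := (q != 0) && (`|ratr q : R| < m.+1%:R^-1).

(* The Cauchy criterion for the difference quotients along rational increments *)
(* exhibits the set of non-differentiability as a Borel set.                   *)
Let good := \bigcap_(k in [set: nat]) \bigcup_(m in [set: nat])
  \bigcap_(p in [set p : rat * rat | small m p.1 && small m p.2])
  ~` [set x | k.+1%:R^-1 < `|quo (ratr p.1) x - quo (ratr p.2) x|].

Lemma lip_cts : continuous f.
Proof.
move=> x; have FF : ProperFilter (nbhs (x : E)) by exact: nbhs_pfilter.
apply/cvgrPdist_lt => eps eps0.
suff : nbhs (x : E) [set y | `|f x - f y| < eps] by [].
apply/nbhs_ballP; exists (eps / L); first exact: divr_gt0.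
move=> y; rewrite mx_norm_ball /ball_/= => xy.
by apply: le_lt_trans (lipf x y) _; rewrite mulrC -ltr_pdivlMr.
Qed.

Lemma norm_delta : `|e| = 1.
Proof.
rewrite [LHS]mx_normrE; apply/eqP; rewrite eq_le; apply/andP; split.
  apply/bigmax_leP; split=> // -[j k] _ /=.
  by rewrite mxE normr_nat lern1 leq_b1.
apply: le_trans (le_bigmax _ _ (ord0, i)).
by rewrite /= mxE !eqxx normr1.
Qed.

Let quo_cts h : continuous (quo h).
Proof.
move=> x; have FF : ProperFilter (nbhs (x : E)) by exact: nbhs_pfilter.
rewrite /quo; apply: cvgM; first exact: cvg_cst.
apply: cvgB; last exact: lip_cts.
apply: (@continuous_comp E E R (fun y => h *: e + y) f); last exact: lip_cts.
by apply: cvgD; [exact: cvg_cst|exact: cvg_id].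
Qed.

(** The set is a countable combination of open sets, so it is enough that [phi] pulls open sets back
    to measurable ones. This covers both the identity and the map (t, x) -> x + t e out of the
    product sigma-algebra, which Tonelli's theorem requires. *)
Lemma measurable_good d (T : measurableType d) (phi : T -> E) :
  (forall U : set E, open U -> measurable (phi @^-1` U)) ->
  measurable (phi @^-1` good).
Proof.
move=> mphi.
rewrite (_ : phi @^-1` good = \bigcap_(k in [set: nat]) \bigcup_(m in [set: nat])
  ~` \bigcup_(p in [set p : rat * rat | small m p.1 && small m p.2])
  (phi @^-1` [set x | k.+1%:R^-1 < `|quo (ratr p.1) x - quo (ratr p.2) x|])); last first.
  apply/seteqP; split=> x H k _; have [m _ mP] := H k I; exists m => //.
    by move=> [p pm xp]; exact: (mP p pm xp).
  by move=> p pm xp; apply: mP; exists p.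
apply: bigcapT_measurable => k; apply: bigcupT_measurable => m.
apply: measurableC; apply: bigcup_countType_measurable => p _.
apply: mphi.
have c : continuous (fun x => `|quo (ratr p.1) x - quo (ratr p.2) x|).
  move=> x; have FF : ProperFilter (nbhs (x : E)) by exact: nbhs_pfilter.
  apply: cvg_norm; apply: cvgB; exact: quo_cts.
rewrite (_ : [set x | _] = (fun x => `|quo (ratr p.1) x - quo (ratr p.2) x|) @^-1`
   `]k.+1%:R^-1, +oo[%classic); last first.
  by apply/seteqP; split=> x /=; rewrite in_itv/= andbT.
by move/continuousP : c; apply; exact: interval_open.
Qed.

Lemma quoE x : (fun h => h^-1 *: ((f \o shift x) (h *: e) - f x)) = quo ^~ x.
Proof. by []. Qed.

Lemma derivable_good x : derivable f x e -> good x.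
Proof.
rewrite /derivable quoE => /cvg_ex[l /cvgrPdist_lt H] k _.
have k0 : 0 < k.+1%:R^-1 / 2 :> R by rewrite divr_gt0.
have /nbhs_ballP[d /= d0 dP] := H _ k0.
have := near_infty_natSinv_lt (PosNum d0) => -[m _ /(_ m (leqnn m)) /= md].
exists m => // p /andP[/andP[p10 p1m] /andP[p20 p2m]]; apply/negP; rewrite -leNgt.
have b q : q != 0 -> `|ratr q : R| < m.+1%:R^-1 -> `|l - quo (ratr q) x| < k.+1%:R^-1 / 2.
  move=> q0 qm; apply: dP; last by rewrite fmorph_eq0.
  by rewrite /ball/= sub0r normrN (lt_trans qm).
have := b _ p10 p1m; have := b _ p20 p2m.
rewrite [`|l - quo (ratr p.1) x|]distrC => h1 h2.
have := ler_distD l (quo (ratr p.1) x) (quo (ratr p.2) x).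
move/le_trans; apply.
by rewrite [leRHS]splitr lerD// ltW.
Qed.

(** Difference quotients depend continuously on the increment away from 0, so the Cauchy condition
    along rational increments extends to all increments. *)
Lemma good_derivable x : good x -> derivable f x e.
Proof.
move=> gx; rewrite /derivable quoE.
apply/cauchy_cvgP; apply: cauchy_exP => eps eps0.
have := near_infty_natSinv_lt (PosNum eps0) => -[k _ /(_ k (leqnn k)) /= keps].
have [m _ mP] := gx k I.
have m0 : 0 < m.+1%:R^-1 :> R by rewrite invr_gt0.
have ratin (h d : R) : 0 < d -> exists q : rat, `|h - ratr q| < d.
  move=> d0; have [y [hy [q _ qy]]] := @dense_rat R (ball h d)
     (ex_intro _ _ (ballxx _ d0)) (ball_open _ _).
  by exists q; rewrite qy.
have m20 : 0 < m.+1%:R^-1 / 2 :> R by rewrite divr_gt0.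
have [q0 q0P] := ratin (m.+1%:R^-1 / 2) (m.+1%:R^-1 / 2) m20.
have sq0 : small m q0.
  move: q0P; rewrite ltr_norml => /andP[q01 q02].
  have [q0p q0m] : (0 < ratr q0 :> R) /\ (ratr q0 < m.+1%:R^-1 :> R).
    by move: q01 q02; move: (ratr q0 : R) (m.+1%:R^-1 : R) => u w *; split; lra.
  rewrite /small gtr0_norm// q0m andbT.
  by rewrite -(fmorph_eq0 (@ratr R)) gt_eqF.
exists (quo (ratr q0) x).
apply/nbhs_ballP; exists m.+1%:R^-1 => //= h; rewrite /ball/= sub0r normrN => hm h0.
apply: le_lt_trans keps; rewrite leNgt; apply/negP => H.
have cq : {for h, continuous (quo ^~ x)}.
  apply: cvgM; first by apply: inv_continuous.
  apply: cvgB; last exact: cvg_cst.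
  apply: (@continuous_comp R E R (fun z => z *: e + x) f h); last exact: lip_cts.
  apply: cvgD; last exact: cvg_cst.
  exact: scalel_continuous.
have cd : {for h, continuous (fun z => `|quo (ratr q0) x - quo z x|)}.
  apply: (@continuous_comp _ _ _ _ (@Num.norm _ R)); last exact: norm_continuous.
  by apply: cvgB => //; exact: cvg_cst.
have : \forall z \near h, [/\ z != 0, `|z| < m.+1%:R^-1 &
    k.+1%:R^-1 < `|quo (ratr q0) x - quo z x|].
  have n1 : \forall z \near h, (0 : R) < `|z|.
    apply: (@cvgr_gt R R (nbhs h) _ (fun z : R => `|z|) `|h|).
      exact: norm_continuous.
    by rewrite normr_gt0.
  have n2 : \forall z \near h, `|z : R| < m.+1%:R^-1.
    by apply: (@cvgr_lt R R (nbhs h) _ (fun z : R => `|z|) `|h|) => //; exact: norm_continuous.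
  have n3 : \forall z \near h, k.+1%:R^-1 < `|quo (ratr q0) x - quo z x|.
    by apply: (@cvgr_gt R R (nbhs h) _ _ _ cd).
  by move: n1 n2 n3; apply: filterS3 => z; rewrite normr_gt0.
move=> /nbhs_ballP[d /= d0 dP].
have [q qd] := ratin h d d0.
have [z0 zm zk] := dP _ qd.
apply: (mP (q0, q)) => //=; rewrite sq0/= /small zm andbT.
by rewrite -(fmorph_eq0 (@ratr R)).
Qed.

Let Phi (tx : measurableTypeR R * Rn R n) : E := (tx.2 : E) + (tx.1 : R) *: e.

Lemma measurable_line_open (U : set E) : open U -> measurable (Phi @^-1` U).
Proof.
move=> /open_ratv_cover ->; rewrite preimage_bigcup.
apply: bigcup_countType_measurable => -[q k] _.
have r0 : 0 < k.+1%:R^-1 :> R by rewrite invr_gt0.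
rewrite (_ : _ @^-1` _ = \bigcap_(j in [set: 'I_n.+1])
    ((fun tx => (tx.2 : E) ord0 j + (tx.1 : R) * e ord0 j) @^-1`
       ball (ratv q ord0 j : R) k.+1%:R^-1)); last first.
  apply/seteqP; split=> tx.
    by move=> /(ball_rV _ _ r0) H j _; have := H j; rewrite /Phi !mxE.
  by move=> H; apply/ball_rV => // j; have := H j I; rewrite /Phi !mxE.
apply: fin_bigcap_measurable; first exact: finite_finset.
move=> j _; rewrite -[X in measurable X]setTI.
apply: (_ : measurable_fun setT _) => //; last exact: measurable_ball.
apply: measurable_funD.
  exact: (measurableT_comp (measurable_coord j) measurable_snd).
apply: measurable_funM; last exact: measurable_cst.
exact: measurable_fst.
Qed.

(* Tonelli for the set of pairs [(t, x)] such that [x + t e] is bad: each slice   *)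
(* in [t] is null by the theorem on the line, and each slice in [x] is a          *)
(* translate of the bad set.                                                     *)
Lemma lipschitz_ae_partial : {ae @leb R n, forall x, derivable f x e}.
Proof.
have mgood : measurable (good : set (Rn R n)).
  by apply: (@measurable_good _ (Rn R n) id) => U; exact: open_measurable_Rn.
suff leb0 : @leb R n (~` good) = 0%E.
  exists (~` good); split=> //; first exact: measurableC.
  by move=> x /= nx gx; apply: nx; exact: good_derivable.
pose S : set (measurableTypeR R * Rn R n) := (`[0, 1]%classic `*` setT) `\` Phi @^-1` good.
have mS : measurable S.
  apply: measurableD.
    by apply: measurableX => //; exact: measurable_itv.
  by apply: measurable_good => U; exact: measurable_line_open.
have := @indic_fubini_tonelli _ _ _ _ _ (@lebesgue_measure R) (@leb R n) S mS.
rewrite indic_fubini_tonelli_FE//.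
rewrite indic_fubini_tonelli_GE//.
have -> : (\int[leb]_x (lebesgue_measure \o ysection S) x = 0)%E.
  apply: integral0_eq => x _ /=.
  have lipphi s t : `|f (x + s *: e) - f (x + t *: e)| <= L * `|s - t|.
    apply: le_trans (lipf _ _) _; rewrite opprD addrACA subrr add0r -scalerBl.
    by rewrite normrZ norm_delta mulr1.
  have [N [mN N0 HN]] := lipschitz_ae_derivable L0 lipphi.
  apply/eqP; rewrite eq_le measure_ge0 andbT -N0.
  apply: le_measure; rewrite ?inE//; first exact: measurable_ysection.
  move=> t /=; rewrite /ysection /= inE => -[[_ _] ng]; apply: HN => /= dt.
  apply: ng; apply: derivable_good; move: dt; rewrite /derivable.
  rewrite (_ : (fun h => _) = (fun h => h^-1 *: ((f \o shift (Phi (t, x))) (h *: e) -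
    f (Phi (t, x)))))//.
  apply/funext => h /=; congr (_ *: (f _ - _)).
  by rewrite /Phi /= [h%:A]mulr1 scalerDl addrCA.
move=> intS0.
have : (\int[lebesgue_measure]_(x in `[0%R, 1%R]) (cst (@leb R n (~` good)) x) = 0)%E.
  rewrite -[RHS]intS0 integral_mkcond; apply: eq_integral => t _.
  rewrite patchE; case: ifPn => t01 /=.
    rewrite -(leb_shift (t *: e)); congr (leb _); apply/seteqP; split=> x /=.
      by rewrite /xsection /= inE => ng; split=> //; split=> //; rewrite inE in t01.
    by rewrite /xsection /= inE => -[].
  rewrite (_ : xsection S t = set0) ?measure0//.
  apply/seteqP; split=> // x; rewrite /xsection /= inE => -[[t01' _] _].
  by move: t01; rewrite notin_setE.
rewrite integral_cst//.
have m01 : lebesgue_measure (`[0, 1]%classic : set R) = 1%E.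
  by rewrite lebesgue_measure_itv/= lte_fin ltr01 oppr0 adde0.
move=> H; rewrite -[LHS]mule1 -[RHS]H; congr (_ * _)%E.
by rewrite -m01.
Qed.

End directional.

(** * Rademacher's theorem for locally Lipschitz functions *)

Section loc_lipschitz.
Context {R : realType} {n : nat}.
Local Notation E := 'rV[R]_n.+1.
Local Notation e i := (delta_mx ord0 i : E).

Lemma lipschitz_onP (f : E -> R) (K : set E) : [lipschitz f x | x in K] ->
  exists2 L : R, 0 < L & forall x y, K x -> K y -> `|f x - f y| <= L * `|x - y|.
Proof.
case=> M [Mreal HM].
have L0 : 0 < Num.max M 0 + 1 by rewrite ltr_pwDr// le_max lexx orbT.
exists (Num.max M 0 + 1) => // x y Kx Ky.
have M1 : M < Num.max M 0 + 1.
  by rewrite (@le_lt_trans _ _ (Num.max M 0)) ?le_max ?lexx// ltrDl.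
exact: (HM _ M1 (x, y) (conj Kx Ky)).
Qed.

Lemma lipschitz_onW (f : E -> R) (K : set E) (L : R) :
  (forall x y, K x -> K y -> `|f x - f y| <= L * `|x - y|) ->
  [lipschitz f x | x in K].
Proof.
move=> H; exists L; split; first exact: num_real.
move=> M LM [x y] [Kx Ky] /=; apply: le_trans (H x y Kx Ky) _.
by rewrite ler_wpM2r// ltW.
Qed.

(** Projection onto a cube. It is 1-Lipschitz for the sup norm, so composing with it turns a
    function that is Lipschitz on a compact cube into a globally Lipschitz one with the same values
    inside. *)
Definition clamp (c : E) (r : R) (x : E) : E :=
  \row_i Num.max (c ord0 i - r) (Num.min (c ord0 i + r) (x ord0 i)).

Lemma clamp_lip c r x y : `|clamp c r x - clamp c r y| <= `|x - y|.
Proof.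
rewrite [leLHS]mx_normrE; apply/bigmax_leP; split=> // -[j k] _ /=.
rewrite (ord1 j) !mxE; apply: le_trans (coord_le_norm _ k); rewrite !mxE.
move: (c ord0 k) (x ord0 k) (y ord0 k) => a s t.
rewrite /Num.max /Num.min; case: (lerP s t) => st; rewrite ?[`|s - t|]ler0_norm ?[`|s - t|]gtr0_norm ?subr_le0 ?subr_gt0//.
  by rewrite ler_norml; repeat case: ifPn; rewrite -?leNgt => *; lra.
by rewrite ler_norml; repeat case: ifPn; rewrite -?leNgt => *; lra.
Qed.

Lemma clamp_id c r x : ball c r x -> clamp c r x = x.
Proof.
move=> cx; have r0 : 0 < r.
  by rewrite (le_lt_trans _ (_ : `|c - x| < r))//; move: cx; rewrite mx_norm_ball.
apply/rowP => i; rewrite mxE.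
have := (ball_rV c x r0).1 cx i; rewrite ltr_norml => /andP[h1 h2].
by rewrite min_r ?max_r//; lra.
Qed.

Lemma clamp_in (c : E) (r : R) (x : E) : 0 <= r -> forall i, `[c ord0 i - r, c ord0 i + r]%classic (clamp c r x ord0 i).
Proof.
move=> r0 i; rewrite mxE /= in_itv/= le_max lexx/= ge_max; apply/andP; split.
  by lra.
by rewrite ge_min lexx.
Qed.

(** U is covered by the halves of countably many rational balls contained in it, and on each half
    ball f coincides with the globally Lipschitz function f composed with [clamp]. *)
Lemma Lip_loc_ae_derivable (U : set E) (f : E -> R) : open U -> Lip_loc U f ->
  {ae @leb R n, forall x, U x -> forall i, derivable f x (e i)}.
Proof.
move=> oU lf.
have step (qk : 'rV[rat]_n.+1 * nat) i : ball (ratv qk.1) qk.2.+1%:R^-1 `<=` U ->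
  {ae @leb R n, forall x, ball (ratv qk.1 : E) (qk.2.+1%:R^-1 / 2) x -> derivable f x (e i)}.
  set c := ratv _; set r := _^-1 => cU.
  have r0 : 0 < r by rewrite invr_gt0.
  have r20 : 0 < r / 2 by rewrite divr_gt0.
  pose K := [set y : E | forall i, `[c ord0 i - r / 2, c ord0 i + r / 2]%classic (y ord0 i)].
  have cK : compact K.
    apply: (@rV_compact R n.+1 (fun j => `[c ord0 j - r / 2, c ord0 j + r / 2]%classic)).
    by move=> j; exact: segment_compact.
  have KU : K `<=` U.
    move=> y Ky; apply: cU; apply/ball_rV => // j.
    have := Ky j; rewrite /= in_itv/= => /andP[h1 h2].
    by rewrite ltr_norml; apply/andP; split; lra.
  have [L L0 LK] := lipschitz_onP (lf _ cK KU).
  have lipg x y : `|f (clamp c (r / 2) x) - f (clamp c (r / 2) y)| <= L * `|x - y|.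
    apply: le_trans (LK _ _ _ _) _; [exact: clamp_in (ltW _)..|].
    by rewrite ler_wpM2l ?clamp_lip// ltW.
  have := lipschitz_ae_partial i L0 lipg.
  apply: ae_imp => x dx cx.
  apply: (near_eq_derivable _ dx).
  have : nbhs (x : E) (ball c (r / 2)).
    by apply: open_nbhs_nbhs; split=> //; exact: ball_open.
  by apply: filterS => y cy; rewrite clamp_id.
have cov := open_ratv_cover oU.
have step2 (m : nat) : {ae @leb R n, forall x, (exists qk : 'rV[rat]_n.+1 * nat,
   [/\ pickle qk = m, ball (ratv qk.1) qk.2.+1%:R^-1 `<=` U &
     ball (ratv qk.1 : E) (qk.2.+1%:R^-1 / 2) x]) -> forall i, derivable f x (e i)}.
  have [[qk [qm qU]]|H] := pselect (exists qk : 'rV[rat]_n.+1 * nat,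
      pickle qk = m /\ ball (ratv qk.1 : E) qk.2.+1%:R^-1 `<=` U); last first.
    by apply: aeW => x [qk [a b _]]; exfalso; apply: H; exists qk.
  have : forall i, {ae @leb R n, forall x, ball (ratv qk.1 : E) (qk.2.+1%:R^-1 / 2) x ->
     derivable f x (e i)} by move=> i; exact: step.
  move=> /ae_fin; apply: ae_imp => x Hx [qk' [qm' qU' bx]] i.
  by apply: Hx; rewrite (_ : qk = qk')//; apply: (pcan_inj pickleK); rewrite qm qm'.
have := ae_all step2; apply: ae_imp => x Hx Ux.
have [d /= d0 dU] : exists2 d : R, 0 < d & ball x d `<=` U.
  by have /nbhs_ballP[d/= d0 ?] := open_nbhs_nbhs (conj oU Ux); exists d.
have d20 : 0 < d / 2 by rewrite divr_gt0.
have := near_infty_natSinv_lt (PosNum d20) => -[N _ /(_ N (leqnn N)) /= N1].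
have N0 : 0 < N.+1%:R^-1 / 2 :> R by rewrite divr_gt0.
have [q xq] := dense_ratv x N0.
apply: (Hx (pickle (q, N))); exists (q, N); split=> //=; last exact: ball_sym.
move=> y qy; apply: dU.
have := ball_triangle xq qy; apply: le_ball.
by move: N1 N0; move: (N.+1%:R^-1 : R) => u *; lra.
Qed.

End loc_lipschitz.

(** * Degenerate Sobolev spaces *)

Section integrals.
Context {R : realType} {n : nat}.
Local Notation E := 'rV[R]_n.+1.
Implicit Types (U : set E) (f g : E -> R) (fk : nat -> E -> R).

Definition intU U f := (\int[@leb R n]_(x in (U : set (Rn R n))) (f x)%:E)%E.

Lemma intU_ge0 U f : (forall x, U x -> 0 <= f x) -> (0 <= intU U f)%E.
Proof. by move=> f0; apply: integral_ge0 => x Ux; rewrite lee_fin f0. Qed.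

Lemma le_intU_ae U f g : measurable (U : set (Rn R n)) -> meas_fun U f -> meas_fun U g ->
  (forall x, U x -> 0 <= f x) -> (forall x, U x -> 0 <= g x) ->
  {ae @leb R n, forall x, U x -> f x <= g x} -> (intU U f <= intU U g)%E.
Proof.
move=> mU mf mg f0 g0 fg.
exact: (ae_ge0_le_integral mU (EFin_ge0 f0) (meas_EFin mf) (EFin_ge0 g0) (meas_EFin mg) fg).
Qed.

Lemma le_intU U f g : measurable (U : set (Rn R n)) -> meas_fun U f -> meas_fun U g ->
  (forall x, U x -> 0 <= f x <= g x) -> (intU U f <= intU U g)%E.
Proof.
move=> mU mf mg fg; apply: le_intU_ae => //.
- by move=> x /fg/andP[].
- by move=> x /fg/andP[]; exact: le_trans.
- by apply: aeW => x /fg/andP[].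
Qed.

Lemma intUD U f g : measurable (U : set (Rn R n)) -> meas_fun U f -> meas_fun U g ->
  (forall x, U x -> 0 <= f x) -> (forall x, U x -> 0 <= g x) ->
  intU U (fun x => f x + g x) = (intU U f + intU U g)%E.
Proof.
move=> mU mf mg f0 g0; rewrite /intU.
exact: (ge0_integralD _ mU (EFin_ge0 f0) (meas_EFin mf) (EFin_ge0 g0) (meas_EFin mg)).
Qed.

Lemma intUZ U (c : R) f : measurable (U : set (Rn R n)) -> 0 <= c -> meas_fun U f ->
  (forall x, U x -> 0 <= f x) -> intU U (fun x => c * f x) = (c%:E * intU U f)%E.
Proof.
move=> mU c0 mf f0; rewrite /intU.
have c0' : (0 <= c%:E)%E by rewrite lee_fin.
exact: (ge0_integralZl _ mU (meas_EFin mf) (EFin_ge0 f0) c0').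
Qed.

Lemma eq_intU U f g : (forall x, U x -> f x = g x) -> intU U f = intU U g.
Proof. by move=> fg; apply: eq_integral => x; rewrite inE => /fg ->. Qed.

Lemma le_intU_set U V f : measurable (U : set (Rn R n)) -> measurable (V : set (Rn R n)) ->
  U `<=` V -> meas_fun V f -> (forall x, V x -> 0 <= f x) -> (intU U f <= intU V f)%E.
Proof.
by move=> mU mV UV mf f0; exact: (ge0_subset_integral _ mU mV (meas_EFin mf) (EFin_ge0 f0) UV).
Qed.

(** Off the exceptional set this is a pointwise limit; the rest of any preimage is part of a null
    set and measurable by completeness. *)
Lemma meas_cvg_ae U fk f : measurable (U : set (Rn R n)) -> (forall k, meas_fun U (fk k)) ->
  {ae @leb R n, forall x, U x -> fk k x @[k --> \oo] --> f x} -> meas_fun U f.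
Proof.
move=> mU mfk cvf.
pose N := ~` [set x | U x -> fk k x @[k --> \oo] --> f x].
have mN (A : set (Rn R n)) : measurable (A `&` N).
  apply: leb_negligible_measurable; apply: negligibleS cvf; exact: subIsetr.
have mUN : measurable (U `\` N : set (Rn R n)).
  have -> : (U `\` N : set (Rn R n)) = U `\` (U `&` N).
    by apply/seteqP; split=> x /=; tauto.
  by apply: measurableD => //; exact: mN.
have mfD : measurable_fun (U `\` N : set (Rn R n)) (f : Rn R n -> R).
  apply: (@measurable_fun_cvg _ (Rn R n) R _ fk f).
    by move=> k; apply: measurable_funS (mfk k) => //; exact: subDsetl.
  by move=> x [Ux /contrapT]; exact.
move=> _ B mB.
have -> : U `&` f @^-1` B =
    ((U `\` N) `&` f @^-1` B) `|` ((U `&` f @^-1` B) `&` N).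
  apply/seteqP; split => x /=; last by case=> [[[]]|[]].
  by move=> [Ux Bx]; have [Nx|Nx] := pselect (N x); [right|left].
by apply: measurableU; [exact: mfD|exact: mN].
Qed.

(** Fatou's lemma in the form in which bounds are passed to limits below: real-valued functions,
    convergence almost everywhere, and a bound that need only hold eventually. *)
Lemma intU_fatou U fk f (M : \bar R) : measurable (U : set (Rn R n)) ->
  (forall k, meas_fun U (fk k)) -> (forall k x, U x -> 0 <= fk k x) ->
  (forall x, U x -> 0 <= f x) ->
  {ae @leb R n, forall x, U x -> fk k x @[k --> \oo] --> f x} ->
  (\forall k \near \oo, (intU U (fk k) <= M)%E) -> (intU U f <= M)%E.
Proof.
move=> mU mfk fk0 f0 cvf [K _ HK].
have mf := meas_cvg_ae mU mfk cvf.
have [N [mN N0 HN]] := cvf.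
have mUN : measurable (U `\` N : set (Rn R n)) by exact: measurableD.
have f0E x : U x -> (0 <= (f x)%:E)%E by move=> Ux; rewrite lee_fin f0.
rewrite /intU (ge0_negligible_integral mN mU (meas_EFin mf) f0E N0).
pose gk k x := (fk (k + K)%N x)%:E.
have mgk k : measurable_fun (U `\` N : set (Rn R n)) (gk k : Rn R n -> \bar R).
  by apply: measurable_funS (meas_EFin (mfk _)) => //; exact: subDsetl.
have cvg x : (U `\` N) x -> gk k x @[k --> \oo] --> (f x)%:E.
  move=> [Ux Nx]; apply: cvg_EFin; first exact: nearW.
  rewrite (_ : _ \o _ = (fun k => fk (k + K)%N x))//.
  apply: (@cvg_comp _ _ _ (addn^~ K) (fun k => fk k x) \oo \oo _ (cvg_addnr K)).
  by move: Nx => /(contra_not (HN x))/contrapT; exact.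
rewrite (_ : integral _ _ _ = (\int[@leb R n]_(x in (U `\` N : set (Rn R n)))
    limn_einf (gk ^~ x))%E); last first.
  by apply: eq_integral => x; rewrite inE => /cvg/cvg_limn_einf_sup[-> _].
have gk0 k x : (U `\` N) x -> (0 <= gk k x)%E by move=> [Ux _]; rewrite lee_fin fk0.
apply: le_trans (@fatou _ (Rn R n) R (@leb R n) _ mUN gk mgk gk0) _.
rewrite limn_einf_lim; apply: lime_le; first exact: is_cvg_einfs.
apply: nearW => k; apply: (@le_trans _ _ (\int[@leb R n]_(x in U `\` N) gk k x)%E).
  by apply: ereal_inf_lbound; exists k => /=.
apply: le_trans (HK (k + K)%N _) => /=; last by rewrite leq_addl.
apply: ge0_subset_integral => //; first exact: meas_EFin.
by move=> x Ux; rewrite lee_fin fk0.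
Qed.

Lemma intU_dct0 U fk g : measurable (U : set (Rn R n)) ->
  (forall k, meas_fun U (fk k)) -> meas_fun U g ->
  (forall k x, U x -> 0 <= fk k x) -> (forall x, U x -> 0 <= g x) ->
  (intU U g < +oo)%E ->
  {ae @leb R n, forall x, U x -> fk k x @[k --> \oo] --> 0} ->
  {ae @leb R n, forall x, U x -> forall k, fk k x <= g x} ->
  intU U (fk k) @[k --> \oo] --> 0%E.
Proof.
move=> mU mfk mg fk0 g0 ig cvf fg.
have mfkE k : measurable_fun (U : set (Rn R n)) (fun x : Rn R n => (fk k x)%:E).
  exact: meas_EFin.
have := @dominated_convergence _ (Rn R n) R (@leb R n) U mU
  (fun k x => (fk k x)%:E) (cst 0%E) (fun x => (g x)%:E) mfkE (measurable_cst _).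
case.
- apply: ae_imp cvf => x H Ux; apply: cvg_EFin; first exact: nearW.
  exact: H.
- apply/integrableP; split; first exact: meas_EFin.
  rewrite (_ : integral _ _ _ = intU U g)//.
  by apply: eq_integral => x; rewrite inE => Ux; rewrite gee0_abs// lee_fin g0.
- apply: ae_imp fg => x H k Ux; rewrite abse_EFin lee_fin ger0_norm ?fk0//.
  exact: H.
by move=> _ _; rewrite integral0.
Qed.

(** The series of the functions has finite integral by monotone convergence, hence converges almost
    everywhere, and its terms tend to 0. *)
Lemma intU_fast_ae U fk : measurable (U : set (Rn R n)) ->
  (forall k, meas_fun U (fk k)) -> (forall k x, U x -> 0 <= fk k x) ->
  (forall k, (intU U (fk k) <= (2^-1 ^+ k)%:E)%E) ->
  {ae @leb R n, forall x, U x -> fk k x @[k --> \oo] --> 0}.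
Proof.
move=> mU mfk fk0 H.
pose s (x : Rn R n) := (\sum_(k <oo) (fk k x)%:E)%E.
have fkE0 k x : U x -> (0 <= (fk k x)%:E)%E by move=> Ux; rewrite lee_fin fk0.
have mfkE k : measurable_fun (U : set (Rn R n)) (fun x : Rn R n => (fk k x)%:E).
  exact: meas_EFin.
have ms : measurable_fun (U : set (Rn R n)) s.
  by apply: ge0_emeasurable_sum => // k x Ux _; exact: fkE0.
have s0 x : U x -> (0 <= s x)%E by move=> Ux; apply: nneseries_ge0 => k _ _; exact: fkE0.
have is_ : (@leb R n).-integrable (U : set (Rn R n)) s.
  apply/integrableP; split=> //.
  rewrite (_ : integral _ _ _ = (\int[@leb R n]_(x in (U : set (Rn R n))) s x)%E); last first.
    by apply: eq_integral => x; rewrite inE => Ux; rewrite gee0_abs// s0.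
  rewrite (@integral_nneseries _ (Rn R n) R (@leb R n) U mU (fun k x => (fk k x)%:E))//.
  apply: (@le_lt_trans _ _ 2%:E); last by rewrite ltry.
  apply: le_trans (@epsilon_trick0 R 2 xpredT _) => //.
  apply: lee_nneseries => [k _ _|k _].
    by apply: integral_ge0 => x Ux; exact: fkE0.
  apply: le_trans (H k) _; rewrite lee_fin natrX exprS invfM mulrA mulfV//.
  by rewrite mul1r exprVn.
have := integrable_ae mU is_; apply: ae_imp => x H' Ux; have sfin := H' Ux.
apply: cvg_series_cvg_0; apply: nondecreasing_is_cvgn.
  apply/nondecreasing_seqP => k; rewrite !seriesEnat/= big_nat_recr//= lerDl; exact: fk0.
exists (fine (s x)) => _ [k _ <-]; rewrite -lee_fin fineK// seriesEnat/= -sumEFin.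
by apply: nneseries_lim_ge => i _ _; exact: fkE0.
Qed.

Lemma lnormE (U : set E) (f : E -> R) (p : R) : 0 < p -> measurable (U : set (Rn R n)) ->
  lnorm p%:E U f = (intU U (fun x => `|f x| `^ p)%R `^ p^-1)%E.
Proof.
move=> p0 mU; rewrite /lnorm unlock; congr (_ `^ _)%E.
rewrite /intU [RHS]integral_mkcond; apply: eq_integral => x _.
rewrite !patchE; case: ifPn => // _.
by rewrite abse0 poweR0r// gt_eqF.
Qed.

Lemma lnorm_y (U : set E) (f : E -> R) : (0 < @leb R n setT)%E ->
  (lnorm +oo%E U f < +oo)%E ->
  exists M : R, 0 <= M /\ {ae @leb R n, forall x, U x -> `|f x| <= M}.
Proof.
move=> T0; rewrite /lnorm unlock T0 => H.
set s := ess_sup _ _ in H.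
have sf : {ae @leb R n, forall x, U x -> (`|f x|%:E <= s)%E}.
  have := @ess_sup_ge _ (Rn R n) R (@leb R n) (abse \o ((EFin \o f) \_ U)).
  by apply: ae_imp => x /= + Ux; rewrite patchE mem_set.
exists (Num.max 0 (fine s)); split; first by rewrite le_max lexx.
apply: ae_imp sf => x + Ux => /(_ Ux); case: s H => [s| |]//= _.
by rewrite lee_fin => /le_trans; apply; rewrite le_max lexx orbT.
Qed.

Lemma poweR_root_le (a : \bar R) (c p : R) : 0 < p -> 0 <= c -> (0 <= a)%E ->
  (a `^ p^-1 <= c%:E)%E <-> (a <= (c `^ p)%:E)%E.
Proof.
move=> p0 c0 a0; case: a a0 => [a| |]//; last first.
  by rewrite poweRyr ?invr_eq0 ?gt_eqF// !leye_eq.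
rewrite lee_fin poweR_EFin !lee_fin => a0; split=> H.
  have := ge0_ler_powR (ltW p0) _ _ H; rewrite -powRrM mulVf ?gt_eqF// powRr1//.
  by apply; rewrite nnegrE ?powR_ge0.
have := ge0_ler_powR (_ : 0 <= p^-1) _ _ H; rewrite -powRrM mulfV ?gt_eqF// powRr1//.
by apply; rewrite ?nnegrE ?powR_ge0 ?invr_ge0// ltW.
Qed.

End integrals.

(** * Gradients of locally Lipschitz functions: measurability and calculus rules *)

Section lip_measurability.
Context {R : realType} {n : nat}.
Local Notation E := 'rV[R]_n.+1.
Local Notation e i := (delta_mx ord0 i : E).

Lemma measurable_shift (v : E) (A : set E) : measurable (A : set (Rn R n)) ->
  measurable ([set x | A (x + v)] : set (Rn R n)).
Proof.
move=> mA.
have {}mA : caratheodory_measurable (@leb_outer R n) A by exact: mA.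
suff : caratheodory_measurable (@leb_outer R n) [set x | A (x + v)] by [].
move=> X; rewrite -[LHS](leb_shift (- v)).
apply: (etrans (mA [set x | X (x - v)])).
by congr (_ + _)%E; rewrite -[LHS](leb_shift v); congr (leb_outer _);
  apply/seteqP; split=> x /=; rewrite addrK.
Qed.

Lemma meas_shift (f : E -> R) (v : E) : meas_fun setT f ->
  meas_fun setT (fun x => f (x + v)).
Proof.
move=> mf _ B mB; rewrite setTI.
rewrite (_ : _ @^-1` B = [set x | (f @^-1` B) (x + v)])//.
by apply: measurable_shift; rewrite -[X in measurable X]setTI; exact: mf.
Qed.

Lemma Lip_loc_near (U : set E) (f : E -> R) x : open U -> Lip_loc U f -> U x ->
  exists r L : R, [/\ 0 < r, 0 < L, ball x r `<=` U &
    forall y z, ball x r y -> ball x r z -> `|f y - f z| <= L * `|y - z|].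
Proof.
move=> oU lf Ux.
have [r /= r0 rU] : exists2 r : R, 0 < r & ball x r `<=` U.
  by have /nbhs_ballP[d/= d0 ?] := open_nbhs_nbhs (conj oU Ux); exists d.
have r20 : 0 < r / 2 by rewrite divr_gt0.
pose K := [set y : E | forall i, `[x ord0 i - r / 2, x ord0 i + r / 2]%classic (y ord0 i)].
have cK : compact K.
  apply: (@rV_compact R n.+1 (fun j => `[x ord0 j - r / 2, x ord0 j + r / 2]%classic)).
  by move=> j; exact: segment_compact.
have KU : K `<=` U.
  move=> y Ky; apply: rU; apply/ball_rV => // j.
  have := Ky j; rewrite /= in_itv/= => /andP[h1 h2].
  by rewrite ltr_norml; apply/andP; split; lra.
have bK : ball x (r / 2) `<=` K.
  move=> y /(ball_rV _ _ r20) H i /=; rewrite in_itv/=.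
  by have := H i; rewrite ltr_norml => /andP[h1 h2]; apply/andP; split; lra.
have [L L0 LK] := lipschitz_onP (lf _ cK KU).
exists (r / 2), L; split=> //.
- by move=> y /bK /KU.
- by move=> y z /bK Ky /bK Kz; exact: LK.
Qed.

Lemma Lip_loc_continuous (U : set E) (f : E -> R) x : open U -> Lip_loc U f -> U x ->
  {for x, continuous f}.
Proof.
move=> oU lf Ux; have [r [L [r0 L0 rU H]]] := Lip_loc_near oU lf Ux.
have FF : ProperFilter (nbhs (x : E)) by exact: nbhs_pfilter.
apply/cvgrPdist_lt => eps eps0.
suff : nbhs (x : E) [set y | `|f x - f y| < eps] by [].
apply/nbhs_ballP; exists (Num.min r (eps / L)).
  by rewrite /= lt_min r0 divr_gt0.
move=> y xy; have xr : ball x r y by apply: le_ball xy; rewrite ge_min lexx.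
have xe : ball x (eps / L) y by apply: le_ball xy; rewrite ge_min lexx orbT.
apply: (le_lt_trans (H x y (ballxx _ r0) xr)).
by move: xe; rewrite mx_norm_ball /ball_/= ltr_pdivlMr// mulrC.
Qed.

Lemma meas_Lip_loc (U : set E) (f : E -> R) : open U -> Lip_loc U f -> meas_fun U f.
Proof.
move=> oU lf; apply: (measurability _ (RGenOpens.measurableE R)) => //.
move=> _ [_ [a [b ->]] <-]; apply: open_measurable_Rn.
rewrite openE => x [Ux fx].
have cf := Lip_loc_continuous oU lf Ux.
have : nbhs x (U `&` f @^-1` `]a, b[%classic).
  apply: filterI; first exact: open_nbhs_nbhs.
  by apply: cf; apply: open_nbhs_nbhs; split => //; exact: interval_open.
by [].
Qed.

(** A partial derivative is an almost everywhere limit of difference quotients with increments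
    1/(k+1). Extending f by 0 outside U makes the quotients globally defined and does not change
    them near a point of U once k is large. *)
Lemma meas_grad (U : set E) (f : E -> R) : open U -> Lip_loc U f -> measV U (grad f).
Proof.
move=> oU lf i; have mU := open_measurable_Rn oU.
pose g : E -> R := f \_ U.
have mg : meas_fun setT g by apply/(measurable_restrictT _ mU)/meas_Lip_loc.
pose h (k : nat) x := k.+1%:R * (g (x + k.+1%:R^-1 *: e i) - g x).
apply: (@meas_cvg_ae _ _ U h) => //.
  move=> k; apply: meas_sub (_ : meas_fun setT _) => //.
  by rewrite /h; meas; exact: meas_shift.
apply: ae_imp (Lip_loc_ae_derivable oU lf) => x + Ux => /(_ Ux i) dx.
rewrite mxE.
have ->: 'D_(e i) f x = lim (h^-1 *: ((f \o shift x) (h *: e i) - f x) @[h --> 0^']) by [].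
have cvH := dx; rewrite /derivable in cvH.
have cvk : (k.+1%:R^-1 : R) @[k --> \oo] --> 0^'.
  move=> A nA; have : nbhs (0 : R) (fun z => z != 0 -> A z) by exact: nA.
  move=> /(@cvg_harmonic R) [m _ Hm]; exists m => // k mk.
  by apply: (Hm k mk); rewrite invr_eq0 pnatr_eq0.
have := cvg_comp _ _ cvk cvH.
apply: cvg_trans; apply: near_eq_cvg.
have [r /= r0 rU] : exists2 r : R, 0 < r & ball x r `<=` U.
  by have /nbhs_ballP[d/= d0 ?] := open_nbhs_nbhs (conj oU Ux); exists d.
have := near_infty_natSinv_lt (PosNum r0); apply: filterS => k /= kr.
rewrite /h /= invrK /g !patchE !mem_set//; first by rewrite [k.+1%:R^-1 *: e i + x]addrC.
apply: rU; rewrite mx_norm_ball /ball_/= opprD addNKr normrN normrZ norm_delta mulr1.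
by rewrite ger0_norm// invr_ge0.
Qed.

Lemma line_derivative (f : E -> R) (x v : E) : derivable f x v ->
  is_derive (0 : R) (1 : R) (fun h => f (h *: v + x)) ('D_v f x).
Proof.
move=> dx.
have EQ : (fun h : R => h^-1 *: (((fun h => f (h *: v + x)) \o shift 0) (h *: (1 : R)) - f (0 *: v + x)))
   = (fun h => h^-1 *: ((f \o shift x) (h *: v) - f x)).
  by apply/funext => h /=; rewrite scale0r add0r addr0 [h%:A]mulr1.
by split; rewrite /derivable /derive EQ.
Qed.

Lemma line_derivative_inv (f : E -> R) (x v : E) d :
  is_derive (0 : R) (1 : R) (fun h => f (h *: v + x)) d -> derivable f x v /\ 'D_v f x = d.
Proof.
move=> [].
have EQ : (fun h : R => h^-1 *: (((fun h => f (h *: v + x)) \o shift 0) (h *: (1 : R)) - f (0 *: v + x)))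
   = (fun h => h^-1 *: ((f \o shift x) (h *: v) - f x)).
  by apply/funext => h /=; rewrite scale0r add0r addr0 [h%:A]mulr1.
by rewrite /derivable /derive EQ.
Qed.

Lemma derive_comp_real (f : E -> R) (F : R -> R) (x v : E) d : derivable f x v ->
  is_derive (f x) (1 : R) F d ->
  derivable (F \o f) x v /\ 'D_v (F \o f) x = d * 'D_v f x.
Proof.
move=> /line_derivative dx dF; apply: line_derivative_inv.
apply: (@is_derive1_comp _ F (fun h => f (h *: v + x)) 0).
by rewrite /= scale0r add0r.
Qed.

Lemma grad_comp (f : E -> R) (F : R -> R) (x : E) d : (forall i, derivable f x (e i)) ->
  is_derive (f x) (1 : R) F d -> grad (F \o f) x = d *: grad f x.
Proof.
move=> dx dF; apply/rowP => i; rewrite !mxE.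
by have [_ ->] := derive_comp_real (dx i) dF.
Qed.

Lemma grad_mul (f g : E -> R) (x : E) : (forall i, derivable f x (e i)) ->
  (forall i, derivable g x (e i)) ->
  grad (fun y => f y * g y) x = f x *: grad g x + g x *: grad f x.
Proof.
move=> df dg; apply/rowP => i; rewrite !mxE.
exact: (deriveM (df i) (dg i)).
Qed.

Lemma grad_sub (f g : E -> R) (x : E) : (forall i, derivable f x (e i)) ->
  (forall i, derivable g x (e i)) -> grad (fun y => f y - g y) x = grad f x - grad g x.
Proof.
move=> df dg; apply/rowP => i; rewrite !mxE.
exact: (deriveB (df i) (dg i)).
Qed.

Lemma grad_locally0 (f : E -> R) (U : set E) x : open U -> U x ->
  (forall y, U y -> f y = 0) -> grad f x = 0.
Proof.
move=> oU Ux f0; apply/rowP => i; rewrite !mxE.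
rewrite -(@derive_cst R E R (0 : R) x (e i)); apply: near_eq_derive.
by have := open_nbhs_nbhs (conj oU Ux); apply: filterS => y /f0 ->.
Qed.

(** The point z = 0 is included, where p > 1 makes the derivative vanish: cutoff functions are
    raised to powers and do take the value 0. *)
Lemma is_derive_norm_powR (p z : R) : 1 < p -> 0 <= z ->
  is_derive z (1 : R) (fun w => `|w| `^ p) (p * z `^ (p - 1)).
Proof.
move=> p1; rewrite le_eqVlt => /predU1P[<-|z0].
  rewrite powR0 ?subr_eq0 ?gt_eqF// mulr0.
  have cv : (h^-1 *: (((fun w : R => `|w| `^ p) \o shift 0) (h *: (1 : R)) - `|0 : R| `^ p))
      @[h --> 0^'] --> (0 : R).
    apply/cvgrPdist_lt => eps eps0; near=> h.
    rewrite /= addr0 [h%:A]mulr1 normr0 powR0 ?gt_eqF ?(lt_trans ltr01)// subr0 sub0r normrN.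
    have h0 : h != 0 by near: h; exact: nbhs_dnbhs_neq.
    rewrite normrM normfV [`|_ `^ _|]ger0_norm ?powR_ge0//.
    rewrite -(mulr_powRB1 (normr_ge0 h)) ?(lt_trans ltr01)// mulrA mulVf ?normr_eq0// mul1r.
    have : `|h| < eps `^ (p - 1)^-1 by near: h; apply: dnbhs0_lt; rewrite powR_gt0.
    move=> /(@gt0_ltr_powR _ (p - 1)); rewrite -powRrM mulVf ?subr_eq0 ?gt_eqF//.
    by rewrite powRr1 ?(ltW eps0)// subr_gt0 => ->//; rewrite nnegrE ?powR_ge0.
  split; first by apply/cvg_ex; exists 0.
  exact: cvg_lim cv.
have := @is_derive1_powR R p z z0.
move=> [dz vz]; split.
  by apply: (near_eq_derivable _ dz); near=> w; rewrite ger0_norm// ltW//; near: w; exact: lt_nbhsr.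
rewrite -vz; apply: near_eq_derive; near=> w.
by rewrite ger0_norm// ltW//; near: w; exact: lt_nbhsr.
Unshelve. all: by end_near. Qed.

End lip_measurability.

(** * Convergence in L^p *)

Section Lp_integrals.
Context {R : realType} {n : nat}.
Local Notation E := 'rV[R]_n.+1.
Implicit Types (U : set E) (f g h : E -> R) (p : R).

(** The p-th power of the L^p norm. Without the root the triangle inequality costs a factor 2^p,
    which is harmless for finiteness and for convergence to 0. *)
Definition Lpi U p f : \bar R := intU U (fun x => `|f x| `^ p).

Lemma Lpi_ge0 U p f : (0 <= Lpi U p f)%E.
Proof. by apply: intU_ge0 => x _; exact: powR_ge0. Qed.

Lemma powR_leD (a b p : R) : 0 <= p -> 0 <= a -> 0 <= b ->
  (a + b) `^ p <= 2 `^ p * (a `^ p + b `^ p).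
Proof.
move=> p0 a0 b0; wlog ab : a b a0 b0 / a <= b.
  move=> H; have [|/ltW] := leP a b; first exact: H.
  by move=> /(H _ _ b0 a0); rewrite addrC [b `^ p + _]addrC.
apply: (@le_trans _ _ ((2 * b) `^ p)).
  by apply: ge0_ler_powR => //; rewrite ?nnegrE ?addr_ge0 ?mulr_ge0//; lra.
by rewrite powRM// ler_wpM2l ?powR_ge0// lerDr powR_ge0.
Qed.

Lemma le_Lpi U p f g : 0 <= p -> measurable (U : set (Rn R n)) -> meas_fun U f -> meas_fun U g ->
  {ae @leb R n, forall x, U x -> `|f x| <= `|g x|} -> (Lpi U p f <= Lpi U p g)%E.
Proof.
move=> p0 mU mf mg fg; apply: le_intU_ae => //.
- by meas.
- by meas.
apply: ae_imp fg => x H Ux; apply: ge0_ler_powR => //; rewrite ?nnegrE//.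
exact: H.
Qed.

Lemma LpiZ U p (c : R) f : measurable (U : set (Rn R n)) -> meas_fun U f ->
  Lpi U p (fun x => c * f x) = ((`|c| `^ p)%:E * Lpi U p f)%E.
Proof.
move=> mU mf; rewrite /Lpi -intUZ ?powR_ge0//; last by meas.
by apply: eq_intU => x _; rewrite normrM powRM.
Qed.

Lemma Lpi_leD U p f g h : 0 <= p -> measurable (U : set (Rn R n)) ->
  meas_fun U f -> meas_fun U g -> meas_fun U h ->
  {ae @leb R n, forall x, U x -> `|h x| <= `|f x| + `|g x|} ->
  (Lpi U p h <= (2 `^ p)%:E * (Lpi U p f + Lpi U p g))%E.
Proof.
move=> p0 mU mf mg mh hfg.
rewrite /Lpi -intUD//; try by meas.
rewrite -intUZ ?powR_ge0//; try by meas.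
  have R0 x : 0 <= 2 `^ p * (`|f x| `^ p + `|g x| `^ p).
    by rewrite mulr_ge0 ?addr_ge0 ?powR_ge0.
  have L0 x : 0 <= `|h x| `^ p by exact: powR_ge0.
  have LR : {ae @leb R n, forall x, U x ->
      `|h x| `^ p <= 2 `^ p * (`|f x| `^ p + `|g x| `^ p)}.
    apply: ae_imp hfg => x H Ux; apply: le_trans (powR_leD p0 _ _) => //.
    by apply: ge0_ler_powR; rewrite ?nnegrE ?addr_ge0// H.
  by apply: le_intU_ae => //; meas.
Qed.

Lemma Lpi_ltyD U p f g h : 0 <= p -> measurable (U : set (Rn R n)) ->
  meas_fun U f -> meas_fun U g -> meas_fun U h ->
  {ae @leb R n, forall x, U x -> `|h x| <= `|f x| + `|g x|} ->
  (Lpi U p f < +oo)%E -> (Lpi U p g < +oo)%E -> (Lpi U p h < +oo)%E.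
Proof.
move=> p0 mU mf mg mh hfg ff gg.
apply: le_lt_trans (Lpi_leD p0 mU mf mg mh hfg) _.
have := lte_add_pinfty ff gg; move: (_ + _)%E => a ya.
by rewrite lte_mul_pinfty// lee_fin powR_ge0.
Qed.

(** Convergence to 0 of nonnegative extended reals, expressed by eventual upper bounds so that
    comparison, sums and roots are immediate even when early terms are infinite. *)
Definition ev0 (a : nat -> \bar R) :=
  forall e : R, 0 < e -> exists K, forall k, (K <= k)%N -> (a k <= e%:E)%E.

Lemma ev0P (a : nat -> \bar R) : (forall k, (0 <= a k)%E) ->
  ev0 a <-> a k @[k --> \oo] --> 0%E.
Proof.
move=> a0; split.
  move=> H; apply/fine_cvgP; split.
    have [K HK] := H 1 ltr01; exists K => // k /= /HK ak.
    by rewrite ge0_fin_numE// (le_lt_trans ak)// ltry.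
  apply/cvgrPdist_le => e e0; have [K HK] := H e e0; exists K => // k /= /HK ak.
  rewrite sub0r normrN ger0_norm ?fine_ge0// -lee_fin fineK//.
  by rewrite ge0_fin_numE// (le_lt_trans ak)// ltry.
move=> /fine_cvgP[[K1 _ F1] /cvgrPdist_le H] e e0.
have [K2 _ HK2] := H e e0.
exists (maxn K1 K2) => k; rewrite geq_max => /andP[k1 k2].
have := HK2 k k2; rewrite /= sub0r normrN ger0_norm ?fine_ge0// -lee_fin fineK//.
exact: F1.
Qed.

Lemma ev0_le (a b : nat -> \bar R) : (forall k, (a k <= b k)%E) -> ev0 b -> ev0 a.
Proof.
move=> ab H e /H[K HK]; exists K => k /HK; exact: le_trans.
Qed.

Lemma ev0D (a b : nat -> \bar R) : ev0 a -> ev0 b -> ev0 (fun k => a k + b k)%E.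
Proof.
move=> ca cb e e0; have e20 : 0 < e / 2 by rewrite divr_gt0.
have [K HK] := ca _ e20; have [L HL] := cb _ e20.
exists (maxn K L) => k; rewrite geq_max => /andP[/HK h1 /HL h2].
by rewrite [e]splitr EFinD leeD.
Qed.

Lemma ev0Z (c : R) (a : nat -> \bar R) : 0 <= c -> ev0 a -> ev0 (fun k => c%:E * a k)%E.
Proof.
move=> c0 ca e e0; have c1 : 0 < c + 1 by rewrite ltr_wpDl.
have [K HK] := ca (e / (c + 1)) (divr_gt0 e0 c1); exists K => k /HK h.
apply: (@le_trans _ _ (c%:E * (e / (c + 1))%:E)%E); first by rewrite lee_wpmul2l.
have cc : c / (c + 1) <= 1 by rewrite ler_pdivrMr// mul1r lerDl.
by rewrite -EFinM lee_fin mulrCA ler_piMr// ltW.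
Qed.

Lemma ev0_poweR (q : R) (a : nat -> \bar R) : 0 < q -> (forall k, (0 <= a k)%E) ->
  ev0 a -> ev0 (fun k => a k `^ q)%E.
Proof.
move=> q0 a0 ca e e0; have [K HK] := ca (e `^ q^-1) (powR_gt0 _ e0).
exists K => k /HK h; rewrite -[q]invrK; apply/poweR_root_le; rewrite ?invr_gt0//.
exact: ltW.
Qed.

Lemma ev0_poweR_inv (q : R) (a : nat -> \bar R) : 0 < q -> (forall k, (0 <= a k)%E) ->
  ev0 (fun k => a k `^ q^-1)%E -> ev0 a.
Proof.
move=> q0 a0 ca e e0; have [K HK] := ca (e `^ q^-1) (powR_gt0 _ e0).
exists K => k /HK h; have := (poweR_root_le q0 (powR_ge0 e q^-1) (a0 k)).1 h.
by rewrite -powRrM mulVf ?gt_eqF// powRr1// ltW.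
Qed.

Definition Lp0 U p (fk : nat -> E -> R) := ev0 (fun k => Lpi U p (fk k)).

Lemma Lp0D U p fk gk hk : 0 <= p -> measurable (U : set (Rn R n)) ->
  (forall k, meas_fun U (fk k)) -> (forall k, meas_fun U (gk k)) ->
  (forall k, meas_fun U (hk k)) ->
  (forall k, {ae @leb R n, forall x, U x -> `|hk k x| <= `|fk k x| + `|gk k x|}) ->
  Lp0 U p fk -> Lp0 U p gk -> Lp0 U p hk.
Proof.
move=> p0 mU mf mg mh H cf cg.
have cfg := ev0Z (powR_ge0 2 p) (ev0D cf cg).
by apply: ev0_le cfg => k; exact: Lpi_leD.
Qed.

Lemma Lp0_le U p fk hk (c : R) : 0 <= p -> measurable (U : set (Rn R n)) ->
  (forall k, meas_fun U (fk k)) -> (forall k, meas_fun U (hk k)) ->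
  (forall k, {ae @leb R n, forall x, U x -> `|hk k x| <= c * `|fk k x|}) ->
  Lp0 U p fk -> Lp0 U p hk.
Proof.
move=> p0 mU mf mh H cf.
have cfg := ev0Z (powR_ge0 `|c| p) cf.
apply: ev0_le cfg => k; rewrite -(LpiZ _ _ mU (mf k)).
apply: (le_Lpi p0 mU (mh k) (@measM _ _ _ (fun=> c) _ (@meas_cst _ _ _ _) (mf k))).
apply: ae_imp (H k) => x + Ux => /(_ Ux)/le_trans; apply.
by rewrite normrM ler_wpM2r// ler_norm.
Qed.

Lemma Lp0_sub U V p fk : measurable (U : set (Rn R n)) -> measurable (V : set (Rn R n)) ->
  V `<=` U -> (forall k, meas_fun U (fk k)) -> Lp0 U p fk -> Lp0 V p fk.
Proof.
move=> mU mV VU mf; apply: ev0_le => k.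
by apply: le_intU_set => //; meas.
Qed.

Lemma lnorm_Lpi U p f : 0 < p -> measurable (U : set (Rn R n)) ->
  lnorm p%:E U f = (Lpi U p f `^ p^-1)%E.
Proof. exact: lnormE. Qed.

Lemma ev0_shift (a : nat -> \bar R) (s : nat -> nat) : (forall k, (k <= s k)%N) ->
  ev0 a -> ev0 (fun k => a (s k)).
Proof.
by move=> ks H e /H[K HK]; exists K => k kK; apply: HK; exact: leq_trans (ks k).
Qed.

End Lp_integrals.

(** * Approximation in the degenerate Sobolev space *)

Section sobolev_approximation.
Context {R : realType} {n : nat}.
Local Notation E := 'rV[R]_n.+1.
Local Notation e i := (delta_mx ord0 i : E).
Implicit Types (U : set E) (f g : E -> R).

Lemma Lip_locB U f g : Lip_loc U f -> Lip_loc U g -> Lip_loc U (fun x => f x - g x).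
Proof.
move=> lf lg K cK KU.
have [L L0 HL] := lipschitz_onP (lf K cK KU); have [M M0 HM] := lipschitz_onP (lg K cK KU).
apply: (@lipschitz_onW _ _ _ _ (L + M)) => x y Kx Ky.
rewrite (_ : f x - g x - (f y - g y) = f x - f y - (g x - g y)); last by ring.
by rewrite mulrDl (le_trans (ler_normB _ _))// lerD ?HL ?HM.
Qed.

Lemma lipschitz_Lip_loc U f : lipschitz f -> Lip_loc U f.
Proof.
move=> lf K _ _; have [L L0 H] := lipschitz_onP lf.
by apply: (@lipschitz_onW _ _ _ _ L) => x y _ _; exact: H.
Qed.

Lemma lip_bounded f (K : set E) : [lipschitz f x | x in K] -> bounded_set K ->
  exists2 M : R, 0 <= M & forall x, K x -> `|f x| <= M.
Proof.
move=> /lipschitz_onP[L L0 HL] [N [_ HN]].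
have [[x0 Kx0]|K0] := pselect (exists x, K x); last first.
  by exists 0 => // x Kx; exfalso; apply: K0; exists x.
have N1 : N < `|N| + 1 by rewrite (le_lt_trans (ler_norm _))// ltrDl.
exists (`|f x0| + L * (2 * (`|N| + 1))).
  by rewrite addr_ge0// mulr_ge0 ?(ltW L0)// mulr_ge0// addr_ge0.
move=> x Kx; rewrite -[f x](subrK (f x0)) addrC (le_trans (ler_normD _ _))// lerD2l.
apply: le_trans (HL x x0 Kx Kx0) _; rewrite ler_pM2l// mulr2n mulrDl mul1r.
by rewrite (le_trans (ler_normB _ _))// lerD ?HN.
Qed.

(** g is controlled on the support of eta only. Between a point x of the support and a point y
    outside it, eta(y) = 0, so the difference of the products is (eta(x) - eta(y)) g(x) with g(x)
    bounded. *)
Lemma lipschitz_cutoff_mul (eta g : E -> R) : lipschitz eta -> (forall x, 0 <= eta x <= 1) ->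
  compact (supp eta) -> [lipschitz g x | x in supp eta] ->
  lipschitz (fun x => eta x * g x).
Proof.
move=> le eta01 cs lg; have [M M0 HM] := lip_bounded lg (compact_bounded cs).
have [L L0 HL] := lipschitz_onP lg; have [N N0 HN] := lipschitz_onP le.
have S0 x : ~ supp eta x -> eta x = 0.
  by move=> sx; apply/eqP/negPn/negP => ex; apply: sx; exact: subset_closure.
have one x y : supp eta x -> eta y = 0 -> `|eta x * g x - eta y * g y| <= N * M * `|x - y|.
  move=> sx ey; rewrite ey mul0r subr0 normrM -[eta x]subr0 -ey mulrAC.
  by apply: ler_pM => //; [exact: HN|exact: HM].
apply: (@lipschitz_onW _ _ _ _ (L + N * M)) => x y _ _.
have NM : 0 <= N * M by rewrite mulr_ge0// ltW.
have [sx|sx] := pselect (supp eta x); have [sy|sy] := pselect (supp eta y).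
- rewrite (_ : _ - _ = eta x * (g x - g y) + (eta x - eta y) * g y); last by ring.
  rewrite (le_trans (ler_normD _ _))// !normrM mulrDl lerD//.
    have /andP[e0 e1] := eta01 x; rewrite (ger0_norm e0) -[leRHS]mul1r.
    by apply: ler_pM => //; exact: HL.
  by rewrite mulrAC; apply: ler_pM => //; [exact: HN|exact: HM].
- apply: le_trans (one _ _ sx (S0 _ sy)) _; rewrite ler_wpM2r//; lra.
- rewrite distrC [`|x - y|]distrC; apply: le_trans (one _ _ sy (S0 _ sx)) _.
  by rewrite ler_wpM2r//; lra.
- by rewrite !S0// !mul0r subrr normr0 mulr_ge0// addr_ge0// ltW.
Qed.

Lemma supp_mul_sub (eta g : E -> R) : supp (fun x => eta x * g x) `<=` supp eta.
Proof.
by apply: closureS => x /=; apply: contraNneq => ->; rewrite mul0r.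
Qed.

Lemma cvg_norm_powR (p : R) (a : nat -> R) (b : R) : 0 < p ->
  a k @[k --> \oo] --> b -> `|a k| `^ p @[k --> \oo] --> `|b| `^ p.
Proof.
move=> p0 /cvg_norm; move: (normr_ge0 b); rewrite le_eqVlt => /predU1P[b0|b0].
  rewrite -b0 powR0 ?gt_eqF// => /cvgrPdist_lt ca; apply/cvgrPdist_lt => eps e0.
  have [K _ HK] := ca _ (powR_gt0 p^-1 e0); exists K => // k /HK /=.
  rewrite !sub0r !normrN normr_id => h.
  rewrite ger0_norm ?powR_ge0//.
  have := gt0_ltr_powR p0 _ _ h; rewrite -powRrM mulVf ?gt_eqF// powRr1 ?(ltW e0)//.
  by apply; rewrite nnegrE// powR_ge0.
move=> ca; apply: (@cvg_comp _ _ _ (fun k => `|a k|) (fun x => x `^ p) _ (nbhs `|b|) _ ca).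
suff : {for `|b|, continuous (fun x => x `^ p)} by [].
apply/differentiable_continuous/derivable1_diffP.
by apply: derivable_powR; rewrite in_itv/= b0.
Qed.

Lemma cvg_of_norm_powR (p : R) (a : nat -> R) (b : R) : 0 < p ->
  `|a k - b| `^ p @[k --> \oo] --> 0 -> a k @[k --> \oo] --> b.
Proof.
move=> p0 /cvgrPdist_lt ca; apply/cvgrPdist_lt => eps e0.
have [K _ HK] := ca _ (powR_gt0 p e0); exists K => // k /HK /=.
rewrite sub0r normrN ger0_norm ?powR_ge0// distrC.
by apply: contraTT; rewrite -!leNgt => h; apply: ge0_ler_powR; rewrite ?nnegrE// ltW.
Qed.

Variables (Omega : set E) (p : R) (Q : E -> 'M[R]_n.+1).
Hypotheses (oO : open Omega) (p1 : 1 < p) (Qpsd : forall x, Omega x -> psdmx (Q x)).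
Hypothesis mQ : forall i j, meas_fun Omega (fun x => Q x i j).

Local Notation qn x v := (enorm (v *m sqrtmx (Q x))).

Lemma qnD x v w : qn x (v + w) <= qn x v + qn x w.
Proof. by rewrite mulmxDl enormD. Qed.

Lemma qnZ x a v : qn x (a *: v) = `|a| * qn x v.
Proof. by rewrite -scalemxAl enormZ. Qed.

Lemma qnN x v : qn x (- v) = qn x v.
Proof. by rewrite -scaleN1r qnZ normrN1 mul1r. Qed.

Let p0 : 0 < p. Proof. exact: lt_trans p1. Qed.
Let p0' : 0 <= p. Proof. exact: ltW. Qed.
Let mO : measurable (Omega : set (Rn R n)). Proof. exact: open_measurable_Rn. Qed.

Lemma meas_qn U V : measurable (U : set (Rn R n)) -> U `<=` Omega -> measV U V ->
  meas_fun U (fun x => qn x (V x)).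
Proof.
move=> mU UO mV; apply: meas_Qnorm => //.
  by move=> x /UO; exact: Qpsd.
by move=> i j; apply: meas_sub (mQ i j).
Qed.

(** Almost everywhere convergence is added to the norm convergence, so that nonlinear functions of
    the approximants converge as well. *)
Definition approximates (v : nat -> E -> R) (u : E -> R) (Du : E -> E) :=
  [/\ forall k, Lip_loc Omega (v k),
    forall k, (Lpi Omega p (v k) < +oo)%E /\ (Lpi Omega p (Qnorm Q (grad (v k))) < +oo)%E,
    Lp0 Omega p (fun k x => v k x - u x),
    Lp0 Omega p (fun k x => qn x (grad (v k) x - Du x)) &
    {ae @leb R n, forall x, Omega x -> v k x @[k --> \oo] --> u x}].

Lemma Wnorm_lty U f V : (Wnorm p Q U f V < +oo)%E <->
  (Lpi U p f < +oo)%E /\ (Lpi U p (Qnorm Q V) < +oo)%E.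
Proof.
have -> : Wnorm p Q U f V = ((Lpi U p f + Lpi U p (Qnorm Q V)) `^ p^-1)%E.
  have <- : intU U (fun x => Qnorm Q V x `^ p) = Lpi U p (Qnorm Q V).
    by apply: eq_intU => x _; rewrite ger0_norm// enorm_ge0.
  by [].
have := Lpi_ge0 U p f; have := Lpi_ge0 U p (Qnorm Q V).
case: (Lpi U p f) => [a| |]//; case: (Lpi U p (Qnorm Q V)) => [b| |]// b0 a0.
- by split=> // _; rewrite !ltry.
- by rewrite addey// poweRyr ?invr_eq0 ?gt_eqF// ltxx; split=> // -[].
- by rewrite addye// poweRyr ?invr_eq0 ?gt_eqF// ltxx; split=> // -[].
- by rewrite addye// poweRyr ?invr_eq0 ?gt_eqF// ltxx; split=> // -[].
Qed.

Lemma W_closureP U D (u : E -> R) (Du : E -> E) : measurable (U : set (Rn R n)) ->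
  W_closure p Q U D (u, Du) <->
  [/\ meas_fun U u, measV U Du & exists v : nat -> E -> R,
    [/\ forall k, D (v k),
      forall k, (Lpi U p (v k) < +oo)%E /\ (Lpi U p (Qnorm Q (grad (v k))) < +oo)%E,
      Lp0 U p (fun k x => v k x - u x) &
      Lp0 U p (fun k x => qn x (grad (v k) x - Du x))]].
Proof.
move=> mU.
have EQ (v : nat -> E -> R) : (fun k => Lpi U p (fun x => qn x (grad (v k) x - Du x))) =
   (fun k => \int[leb]_(x in (U : set (Rn R n)))
      (Qnorm Q (fun x => grad (v k) x - Du x) x `^ p)%:E)%E.
  by apply/funext => k; apply: eq_integral => x _; rewrite ger0_norm ?enorm_ge0.
split=> [[/= mu mDu [v [Dv H1 H2]]]|[mu mDu [v [Dv H0 H1 H2]]]]; split=> //; exists v; split=> //.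
- by move=> k; have [] := Dv k.
- by move=> k; apply/Wnorm_lty; have [] := Dv k.
- apply: (ev0_poweR_inv p0); first by move=> k; exact: Lpi_ge0.
  apply/ev0P; first by move=> k; exact: poweR_ge0.
  by move: H1; under eq_fun do rewrite lnorm_Lpi//.
- by apply/ev0P; [move=> k; exact: Lpi_ge0|rewrite EQ].
- by move=> k; split=> //; apply/Wnorm_lty; exact: H0.
- under eq_fun do rewrite lnorm_Lpi//.
  apply/ev0P; first by move=> k; exact: poweR_ge0.
  have pV : 0 < p^-1 by rewrite invr_gt0.
  exact: (ev0_poweR pV (fun k => Lpi_ge0 _ _ _) H1).
- by rewrite -EQ; apply/ev0P => //; move=> k; exact: Lpi_ge0.
Qed.

Lemma W1pQ_approx u Du : W1pQ p Q Omega (u, Du) ->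
  [/\ meas_fun Omega u, measV Omega Du & exists v, approximates v u Du].
Proof.
move=> /(W_closureP _ _ _ mO)[mu mDu [v [Dv H0 H1 H2]]]; split=> //.
have ek k : 0 < (2^-1 : R) ^+ k by rewrite exprn_gt0.
(* A subsequence whose errors are at most 2^-k; by [intU_fast_ae] it converges almost everywhere. *)
pose s k := maxn k (projT1 (cid (H1 _ (ek k)))).
have ks k : (k <= s k)%N by rewrite leq_maxl.
exists (fun k => v (s k)); split.
- by move=> k; exact: Dv.
- by move=> k; exact: H0.
- exact: (@ev0_shift _ _ s ks H1).
- exact: (@ev0_shift _ _ s ks H2).
have mv k : meas_fun Omega (v k) by apply: meas_Lip_loc.
have := @intU_fast_ae R n Omega (fun k x => `|v (s k) x - u x| `^ p) mO.
move=> /(_ _ _ _)/(ae_imp _); apply; first 1 last.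
- by move=> k; meas.
- by move=> k x _; exact: powR_ge0.
- by move=> k; rewrite /s; case: cid => K /= HK; apply: HK; rewrite leq_maxr.
- by move=> x + Ox => /(_ Ox); exact: cvg_of_norm_powR.
Qed.

Lemma approximates_lty v u Du : meas_fun Omega u -> measV Omega Du ->
  approximates v u Du -> (Lpi Omega p u < +oo)%E /\ (Lpi Omega p (Qnorm Q Du) < +oo)%E.
Proof.
move=> mu mDu [Lv fv cu cDu _].
have [K HK] := cu 1 ltr01; have [L HL] := cDu 1 ltr01.
have mv k : meas_fun Omega (v k) by apply: meas_Lip_loc.
have mg k : measV Omega (grad (v k)) by exact: meas_grad.
have mgD k : measV Omega (fun x => grad (v k) x - Du x).
  by move=> i; apply: meas_ext (measB (mg k i) (mDu i)) => x _; rewrite !mxE.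
split.
  apply: (@Lpi_ltyD _ _ _ _ (v K) (fun x => v K x - u x)) => //; first by meas.
  - apply: aeW => x _; rewrite -[X in `|X| <= _](subrK (v K x)) addrC distrC.
    by rewrite (le_trans (ler_normD _ _))// distrC.
  - by have [] := fv K.
  - by apply: le_lt_trans (HK K _) _ => //; rewrite ltry.
apply: (@Lpi_ltyD _ _ _ _ (Qnorm Q (grad (v L))) (fun x => qn x (grad (v L) x - Du x))) => //.
- exact: meas_qn.
- exact: meas_qn.
- exact: meas_qn.
- apply: aeW => x _; rewrite !ger0_norm ?enorm_ge0// -(qnN _ (_ - Du x)).
  by apply: le_trans (qnD _ _ _); rewrite opprB addrC subrK.
- by have [] := fv L.
- by apply: le_lt_trans (HL L _) _ => //; rewrite ltry.
Qed.

End sobolev_approximation.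

(** * Products of a cutoff with a function of u *)

Section cutoff_products.
Local Opaque enorm sqrtmx mulmx grad meas_fun.
Context {R : realType} {n : nat}.
Local Notation E := 'rV[R]_n.+1.
Local Notation e i := (delta_mx ord0 i : E).
Variables (Omega : set E) (p : R) (Q : E -> 'M[R]_n.+1).
Hypotheses (oO : open Omega) (p1 : 1 < p) (Qpsd : forall x, Omega x -> psdmx (Q x)).
Hypothesis mQ : forall i j, meas_fun Omega (fun x => Q x i j).
Local Notation qn x v := (enorm (v *m sqrtmx (Q x))).

Let p0 : 0 < p. Proof. exact: lt_trans p1. Qed.
Let p0' : 0 <= p. Proof. exact: ltW. Qed.
Let mO : measurable (Omega : set (Rn R n)). Proof. exact: open_measurable_Rn. Qed.

Variable B : set E.
Hypotheses (oB : open B) (BO : B `<=` Omega).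
Let mB : measurable (B : set (Rn R n)). Proof. exact: open_measurable_Rn. Qed.

(** The last clause is the form in which condition (d) on the cutoffs is used: multiplication by
    |sqrt(Q) grad eta| is bounded from the Sobolev space to L^p(B), so products of a cutoff with an
    unbounded function still have an admissible gradient. *)
Definition good_cutoff (eta : E -> R) :=
  [/\ lipschitz eta, forall x, 0 <= eta x <= 1, compact (supp eta) /\ supp eta `<=` B,
    (Lpi B p (Qnorm Q (grad eta)) < +oo)%E &
    exists2 X : R, 0 <= X & forall f, Lip_loc Omega f ->
      (Lpi B p (fun x => f x * Qnorm Q (grad eta) x)%R <=
        X%:E * (Lpi Omega p f + Lpi Omega p (Qnorm Q (grad f))))%E].

Section with_cutoff.
Variable eta : E -> R.
Hypothesis geta : good_cutoff eta.

Let mgeta : measV B (grad eta).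
Proof.
by case: geta => le _ _ _ _; apply: meas_grad => //; exact: lipschitz_Lip_loc.
Qed.

Let mqeta : meas_fun B (fun x => qn x (grad eta x)).
Proof. by apply: (meas_qn oO) => //. Qed.

Let meta : meas_fun B eta.
Proof.
by case: geta => le _ _ _ _; apply: meas_Lip_loc => //; exact: lipschitz_Lip_loc.
Qed.

Variables (u : E -> R) (Du : E -> E) (v : nat -> E -> R).
Hypotheses (mu : meas_fun Omega u) (mDu : measV Omega Du).
Hypothesis appv : approximates Omega p Q v u Du.

Let mv k : meas_fun Omega (v k).
Proof. by case: appv => Lv _ _ _ _; exact: meas_Lip_loc. Qed.

Let mgv k : measV Omega (grad (v k)).
Proof. by case: appv => Lv _ _ _ _; exact: meas_grad. Qed.

Let mBv k : meas_fun B (v k). Proof. by apply: meas_sub (mv k). Qed.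
Let mBu : meas_fun B u. Proof. by apply: meas_sub mu. Qed.

Lemma measVB U V W : measV (U : set E) V -> measV U W -> measV U (fun x => V x - W x : E).
Proof.
by move=> mV mW i; apply: meas_ext (measB (mV i) (mW i)) => x _; rewrite !mxE.
Qed.

Lemma measVD U V W : measV (U : set E) V -> measV U W -> measV U (fun x => V x + W x : E).
Proof.
by move=> mV mW i; apply: meas_ext (measD (mV i) (mW i)) => x _; rewrite !mxE.
Qed.

Lemma measVZ U (c : E -> R) V : meas_fun U c -> measV (U : set E) V ->
  measV U (fun x => c x *: V x : E).
Proof.
by move=> mc mV i; apply: meas_ext (measM mc (mV i)) => x _; rewrite !mxE.
Qed.

Lemma measV_sub U U' V : measurable (U : set (Rn R n)) -> U' `<=` U ->
  measV U V -> measV U' V.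
Proof. by move=> mU UU mV i; apply: meas_sub (mV i). Qed.

(* The approximants form a Cauchy sequence for the weighted norm, so the bound *)
(* for locally Lipschitz functions passes to the limit by Fatou's lemma.       *)
Lemma Lp0_mul_grad_cutoff : Lp0 B p (fun k x => (v k x - u x) * qn x (grad eta x)).
Proof.
have [le eta01 _ _ [X X0 HX]] := geta; have [Lv fv cu cDu av] := appv => eps e0.
pose d := eps / (4 * 2 `^ p * (X + 1)).
have X1 : 0 < X + 1 by rewrite ltr_wpDl.
have p2 : 0 < (2 : R) `^ p by rewrite powR_gt0.
have d0 : 0 < d by rewrite divr_gt0// !mulr_gt0.
have [K HK] := cu _ d0; have [L HL] := cDu _ d0.
have mgD k : measV Omega (fun x => grad (v k) x - Du x) by exact: measVB.
have H k j : (maxn K L <= k)%N -> (maxn K L <= j)%N ->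
    (Lpi B p (fun x => (v k x - v j x) * qn x (grad eta x))%R <= eps%:E)%E.
  rewrite !geq_max => /andP[Kk Lk] /andP[Kj Lj].
  apply: le_trans (HX _ (Lip_locB (Lv k) (Lv j))) _.
  have E1 : (Lpi Omega p (fun x => (v k x - v j x)%R) <= (2 `^ p * (2 * d))%:E)%E.
    apply: (@le_trans _ _ ((2 `^ p)%:E * (Lpi Omega p (fun x => v k x - u x)%R +
        Lpi Omega p (fun x => v j x - u x)%R))%E).
      have m1 k' : meas_fun Omega (fun x => v k' x - u x) by apply: measB.
      apply: (Lpi_leD p0' mO (m1 k) (m1 j)); first exact: measB.
      apply: aeW => x _; rewrite (_ : v k x - v j x = v k x - u x - (v j x - u x)).
        exact: ler_normB.
      by ring.
    rewrite EFinM lee_pmul2l// (_ : 2 * d = d + d)%R; last by ring.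
    by rewrite EFinD leeD// ?HK ?HL.
  have E2 : (Lpi Omega p (Qnorm Q (grad (fun x => v k x - v j x)%R)) <= (2 `^ p * (2 * d))%:E)%E.
    apply: (@le_trans _ _ ((2 `^ p)%:E * (Lpi Omega p (fun x => qn x (grad (v k) x - Du x)) +
        Lpi Omega p (fun x => qn x (grad (v j) x - Du x))))%E).
      have m1 k' := meas_qn oO Qpsd mQ mO (@subset_refl _ Omega) (mgD k').
      apply: (Lpi_leD p0' mO (m1 k) (m1 j)).
        by apply: (meas_qn oO Qpsd mQ mO (@subset_refl _ Omega)); apply: meas_grad oO (Lip_locB (Lv k) (Lv j)).
      apply: ae_imp2 (Lip_loc_ae_derivable oO (Lv k)) (Lip_loc_ae_derivable oO (Lv j)).
      move=> x dk dj Ox; rewrite /Qnorm (grad_sub (dk Ox) (dj Ox)).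
      rewrite [X in X <= _]norm_enorm [X in _ <= X + _]norm_enorm [X in _ <= _ + X]norm_enorm.
      rewrite -(qnN Q x (grad (v j) x - Du x)); apply: le_trans (qnD _ _ _ _).
      by rewrite opprB addrA subrK.
    rewrite EFinM lee_pmul2l// (_ : 2 * d = d + d)%R; last by ring.
    by rewrite EFinD leeD// ?HK ?HL.
  apply: (@le_trans _ _ (X%:E * ((2 `^ p * (2 * d))%:E + (2 `^ p * (2 * d))%:E))%E).
    apply: lee_wpmul2l; first by rewrite lee_fin.
    exact: (leeD E1 E2).
  rewrite -EFinD -EFinM lee_fin.
  rewrite (_ : X * _ = X * (4 * 2 `^ p * d)); last by ring.
  have -> : eps = (X + 1) * (4 * 2 `^ p * d).
    by rewrite /d; field; rewrite !gt_eqF.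
  apply: ler_wpM2r; last by rewrite lerDl.
  by apply: mulr_ge0; [apply: mulr_ge0; [by []|exact: powR_ge0]|exact: ltW].
exists (maxn K L) => k kKL.
have mfj j : meas_fun B (fun x => `|(v k x - v j x) * qn x (grad eta x)| `^ p) by meas.
apply: (@intU_fatou R n B _ (fun x => `|(v k x - u x) * qn x (grad eta x)| `^ p) eps%:E mB mfj).
- by move=> j x _; exact: powR_ge0.
- by move=> x _; exact: powR_ge0.
- apply: ae_imp av => x cx Bx; apply: cvg_norm_powR => //.
  apply: cvgMr_tmp; apply: cvgB; [exact: cvg_cst|exact: cx (BO Bx)].
- by exists (maxn K L) => // j /= jKL; exact: H.
Qed.

Variables (F F' : R -> R) (K : R).
Hypotheses (dF : forall z : R, is_derive z (1 : R) F (F' z)) (cF' : continuous F').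
Hypothesis bF' : forall z, `|F' z| <= K.

Let K0 : 0 <= K. Proof. exact: le_trans (bF' 0). Qed.

Lemma bounded_derive_lip a b : `|F a - F b| <= K * `|a - b|.
Proof.
have cF : continuous F.
  by move=> z; apply/differentiable_continuous/derivable1_diffP; have [] := dF z.
wlog ab : a b / b <= a.
  move=> H; have [/H//|/ltW/H] := leP b a.
  by rewrite distrC [`|b - a|]distrC.
have [|c _ ->] := @MVT_segment R F F' b a ab (fun z _ => dF z).
  exact: continuous_subspaceT.
by rewrite normrM ler_wpM2r.
Qed.

Let cF : continuous F.
Proof.
by move=> z; apply/differentiable_continuous/derivable1_diffP; have [] := dF z.
Qed.

Let mFv k : meas_fun Omega (fun x => F (v k x)). Proof. exact: meas_comp. Qed.
Let mF'v k : meas_fun Omega (fun x => F' (v k x)). Proof. exact: meas_comp. Qed.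
Let mFu : meas_fun Omega (fun x => F (u x)). Proof. exact: meas_comp. Qed.
Let mF'u : meas_fun Omega (fun x => F' (u x)). Proof. exact: meas_comp. Qed.

(** Dominated convergence: F' is continuous and bounded by K, the approximants converge almost
    everywhere, and 2 K |sqrt(Q) Du| is a majorant in L^p. *)
Lemma Lp0_derive_comp : Lp0 Omega p (fun k x => (F' (v k x) - F' (u x)) * qn x (Du x)).
Proof.
have [_ fv _ _ av] := appv; have [_ fDu] := approximates_lty oO p1 Qpsd mQ mu mDu appv.
have mq : meas_fun Omega (fun x => qn x (Du x)) by exact: (meas_qn oO).
apply/ev0P; first by move=> k; exact: Lpi_ge0.
have mk k : meas_fun Omega (fun x => `|(F' (v k x) - F' (u x)) * qn x (Du x)| `^ p) by meas.
have mg : meas_fun Omega (fun x => `|2 * K * qn x (Du x)| `^ p) by meas.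
apply: (intU_dct0 mO mk mg (fun _ _ _ => powR_ge0 _ _) (fun _ _ => powR_ge0 _ _)).
- rewrite -/(Lpi Omega p (fun x => 2 * K * qn x (Du x))) LpiZ//.
  by move: fDu; rewrite /Qnorm; move: (Lpi Omega p _) => a ya; rewrite lte_mul_pinfty// lee_fin powR_ge0.
- apply: ae_imp av => x cx Ox; rewrite -[X in _ --> X](powR0 (lt0r_neq0 p0)) -[X in _ --> X `^ _](normr0 R).
  apply: cvg_norm_powR => //; rewrite -[X in _ --> X](mul0r (qn x (Du x))).
  apply: cvgMr_tmp; rewrite -(subrr (F' (u x))); apply: cvgB; last exact: cvg_cst.
  by apply: (@cvg_comp _ _ _ (fun k => v k x) F' _ (nbhs (u x))); [exact: cx|exact: cF'].
- apply: aeW => x _ k; apply: ge0_ler_powR; rewrite ?nnegrE//.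
  rewrite !normrM ler_wpM2r// (le_trans (ler_normB _ _))//.
  rewrite [`|2|]ger0_norm// [`|K|]ger0_norm// mulr2n mulrDl mul1r.
  by rewrite lerD.
Qed.

Let w x := eta x * F (u x).
Let W x : E := F (u x) *: grad eta x + (eta x * F' (u x)) *: Du x.
Let wk k x := eta x * F (v k x).

Lemma grad_cutoff_comp k : {ae @leb R n, forall x, B x -> grad (wk k) x =
  F (v k x) *: grad eta x + (eta x * F' (v k x)) *: grad (v k) x}.
Proof.
have [le _ _ _ _] := geta; have [Lv _ _ _ _] := appv.
have le' : Lip_loc B eta by exact: lipschitz_Lip_loc.
apply: ae_imp2 (Lip_loc_ae_derivable oB le') (Lip_loc_ae_derivable oO (Lv k)).
move=> x de dv Bx; have Ox := BO Bx.
rewrite /wk (@grad_mul _ _ eta (fun x => F (v k x))); last 2 first.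
- exact: de.
- by move=> i; have [] := derive_comp_real (dv Ox i) (dF (v k x)).
rewrite (grad_comp (dv Ox) (dF (v k x))) addrC scalerA.
by congr (_ + _); rewrite scalerA.
Qed.

Lemma Lip0_cutoff_comp k : Lip0 B (wk k).
Proof.
have [le e01 [cs sB] _ _] := geta; have [Lv _ _ _ _] := appv; split.
- apply: lipschitz_cutoff_mul => //.
  have [L L0 HL] := lipschitz_onP (Lv k _ cs (subset_trans sB BO)).
  apply: (@lipschitz_onW _ _ _ _ (K * L)) => x y sx sy.
  by apply: le_trans (bounded_derive_lip _ _) _; rewrite -mulrA ler_wpM2l// HL.
- apply: (subclosed_compact _ cs); last exact: supp_mul_sub.
  exact: closed_closure.
- exact: subset_trans (@supp_mul_sub _ _ _ _) sB.
Qed.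

Let mw : meas_fun B w.
Proof. by apply: measM => //; apply: meas_sub mFu. Qed.

Let mW : measV B W.
Proof.
apply: measVD; apply: measVZ.
- by apply: meas_sub mFu.
- exact: mgeta.
- by apply: measM => //; apply: meas_sub mF'u.
- exact: measV_sub mDu.
Qed.

Let mwk k : meas_fun B (wk k).
Proof. by apply: measM => //; apply: meas_sub (mFv k). Qed.

Let mgwk k : measV B (grad (wk k)).
Proof.
by apply: meas_grad => //; apply: lipschitz_Lip_loc; case: (Lip0_cutoff_comp k).
Qed.

Let mqD k : meas_fun B (fun x => qn x (grad (v k) x - Du x)).
Proof. exact: (meas_qn oO Qpsd mQ mB BO (measVB (measV_sub mO BO (mgv k)) (measV_sub mO BO mDu))). Qed.

Lemma Lp0_cutoff_comp : Lp0 B p (fun k x => wk k x - w x).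
Proof.
have [le e01 _ _ _] := geta; have [_ _ cu _ _] := appv.
have mD k : meas_fun Omega (fun x => v k x - u x) by apply: measB.
apply: (@Lp0_le _ _ _ _ (fun k x => v k x - u x) _ K) => //.
- by move=> k; apply: meas_sub (mD k).
- by move=> k; apply: measB.
- move=> k; apply: aeW => x _; rewrite /wk /w -mulrBr normrM.
  have /andP[h0 h1] := e01 x; rewrite (ger0_norm h0) -[leRHS]mul1r.
  by apply: ler_pM => //; exact: bounded_derive_lip.
- by apply: (Lp0_sub mO mB BO) => //; exact: cu.
Qed.

(** The error is the sum of (F(v) - F(u)) grad eta, eta F'(v) (grad v - Du) and eta (F'(v) - F'(u))
    Du. These tend to 0 by [Lp0_mul_grad_cutoff], by the choice of v, and by [Lp0_derive_comp]. *)
Lemma Lp0_grad_cutoff_comp : Lp0 B p (fun k x => qn x (grad (wk k) x - W x)).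
Proof.
have [le e01 _ _ _] := geta; have [_ _ cu cDu _] := appv.
have mq : meas_fun Omega (fun x => qn x (Du x)) by exact: (meas_qn oO).
have mBq : meas_fun B (fun x => qn x (Du x)) by apply: meas_sub mq.
have mO1 k : meas_fun Omega (fun x => qn x (grad (v k) x - Du x)).
  by apply: (meas_qn oO) => //; exact: measVB.
have mO2 k : meas_fun Omega (fun x => (F' (v k x) - F' (u x)) * qn x (Du x)) by meas.
have mB2 k : meas_fun B (fun x => (F' (v k x) - F' (u x)) * qn x (Du x)).
  by apply: meas_sub (mO2 k).
have mB3 k : meas_fun B (fun x => (v k x - u x) * qn x (grad eta x)).
  by apply: measM => //; apply: measB; [apply: meas_sub (mv k)|apply: meas_sub mu].
pose a k x := K * `|(v k x - u x) * qn x (grad eta x)| + K * qn x (grad (v k) x - Du x).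
have ma k : meas_fun B (a k) by rewrite /a; meas.
have mh k : meas_fun B (fun x => qn x (grad (wk k) x - W x)).
  exact: (meas_qn oO Qpsd mQ mB BO (measVB (mgwk k) mW)).
have ma1 k : meas_fun B (fun x => K * `|(v k x - u x) * qn x (grad eta x)|) by meas.
have ma2 k : meas_fun B (fun x => K * qn x (grad (v k) x - Du x)) by meas.
apply: (Lp0D p0' mB ma mB2 mh).
- move=> k; apply: ae_imp (grad_cutoff_comp k) => x /[apply] ->.
  rewrite [X in X <= _]ger0_norm ?enorm_ge0//.
  rewrite (_ : _ - W x = (F (v k x) - F (u x)) *: grad eta x +
     ((eta x * F' (v k x)) *: (grad (v k) x - Du x) +
      (eta x * (F' (v k x) - F' (u x))) *: Du x)); last first.
    by rewrite /W; apply/rowP => i; rewrite !mxE; ring.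
  apply: le_trans (qnD _ _ _ _) _; rewrite /a !normrM.
  rewrite [X in _ <= X + _]ger0_norm; last first.
    by rewrite addr_ge0// mulr_ge0// ?enorm_ge0// mulr_ge0// enorm_ge0.
  rewrite -addrA !norm_enorm; apply: lerD.
    by rewrite qnZ mulrA ler_wpM2r ?enorm_ge0// bounded_derive_lip.
  have /andP[h0 h1] := e01 x; apply: le_trans (qnD _ _ _ _) _.
  rewrite !qnZ !normrM (ger0_norm h0); apply: lerD; apply: ler_wpM2r; rewrite ?enorm_ge0//.
    by rewrite -[leRHS]mul1r; apply: ler_pM.
  by rewrite ler_piMl.
- apply: (Lp0D p0' mB ma1 ma2 ma).
  + by move=> k; apply: aeW => x _; exact: ler_normD.
  + apply: (@Lp0_le _ _ _ _ _ _ K p0' mB mB3 ma1 _ Lp0_mul_grad_cutoff).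
    by move=> k; apply: aeW => x _; rewrite normrM normr_id [`|K|]ger0_norm.
  + apply: (@Lp0_le _ _ _ _ _ _ K p0' mB mqD ma2 _ (Lp0_sub mO mB BO mO1 cDu)).
    by move=> k; apply: aeW => x _; rewrite normrM [`|K|]ger0_norm.
- exact: (Lp0_sub mO mB BO mO2 Lp0_derive_comp).
Qed.

Lemma Lpi_cutoff_comp_lty k : (@leb R n B < +oo)%E ->
  (Lpi B p (wk k) < +oo)%E /\ (Lpi B p (Qnorm Q (grad (wk k))) < +oo)%E.
Proof.
move=> lB; have [le e01 [cs sB] fe _] := geta; have [Lv fv _ _ _] := appv.
have [M M0 HM] : exists2 M : R, 0 <= M & forall x, supp eta x -> `|F (v k x)| <= M.
  apply: lip_bounded (compact_bounded cs).
  have [L L0 HL] := lipschitz_onP (Lv k _ cs (subset_trans sB BO)).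
  apply: (@lipschitz_onW _ _ _ _ (K * L)) => x y sx sy.
  by apply: le_trans (bounded_derive_lip _ _) _; rewrite -mulrA ler_wpM2l// HL.
have S0 x : ~ supp eta x -> eta x = 0.
  by move=> sx; apply/eqP/negPn/negP => ex; apply: sx; exact: subset_closure.
have oS : open (~` supp eta) by rewrite openC; exact: closed_closure.
split.
  apply: (@le_lt_trans _ _ (Lpi B p (fun=> M))).
    apply: le_Lpi => //; first exact: meas_cst.
    apply: aeW => x _; rewrite (ger0_norm M0).
    have [sx|/S0 ex] := pselect (supp eta x); last by rewrite /wk ex mul0r normr0.
    have /andP[h0 h1] := e01 x; rewrite normrM (ger0_norm h0) -[leRHS]mul1r.
    by apply: ler_pM => //; exact: HM.
  by rewrite /Lpi /intU integral_cst// lte_mul_pinfty// lee_fin powR_ge0.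
have mqv : meas_fun B (fun x => qn x (grad (v k) x)).
  exact: (meas_qn oO Qpsd mQ mB BO (measV_sub mO BO (mgv k))).
have m1 : meas_fun B (fun x => M * qn x (grad eta x)) by meas.
have m2 : meas_fun B (fun x => K * qn x (grad (v k) x)) by meas.
have m3 : meas_fun B (Qnorm Q (grad (wk k))) by exact: (meas_qn oO Qpsd mQ mB BO (mgwk k)).
apply: (Lpi_ltyD p0' mB m1 m2 m3).
- apply: ae_imp (grad_cutoff_comp k) => x H Bx; rewrite /Qnorm.
  rewrite [X in X <= _]norm_enorm [X in _ <= X + _]normrM [X in _ <= _ + X]normrM.
  rewrite [X in _ <= _ * X + _]norm_enorm [X in _ <= _ + _ * X]norm_enorm.
  rewrite (ger0_norm M0) (ger0_norm K0).
  have [sx|sx] := pselect (supp eta x); last first.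
    rewrite (@grad_locally0 _ _ (wk k) (~` supp eta) x oS sx).
      by rewrite mul0mx enorm0 addr_ge0// mulr_ge0// enorm_ge0.
    by move=> y /S0; rewrite /wk => ->; rewrite mul0r.
  rewrite H//; apply: le_trans (qnD _ _ _ _) _; rewrite !qnZ; apply: lerD.
    by rewrite ler_wpM2r ?enorm_ge0// HM.
  rewrite ler_wpM2r ?enorm_ge0// normrM; have /andP[h0 h1] := e01 x.
  by rewrite (ger0_norm h0) -[leRHS]mul1r; apply: ler_pM.
- rewrite LpiZ//; move: fe; rewrite /Qnorm; move: (Lpi _ _ _) => b yb.
  by rewrite lte_mul_pinfty// lee_fin powR_ge0.
- have : (Lpi B p (Qnorm Q (grad (v k))) < +oo)%E.
    have [_] := fv k; apply: le_lt_trans; apply: le_intU_set => //.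
    have mqO : meas_fun Omega (Qnorm Q (grad (v k))) by apply: (meas_qn oO).
    by meas.
  rewrite LpiZ//; rewrite /Qnorm; move: (Lpi _ _ _) => b yb.
  by rewrite lte_mul_pinfty// lee_fin powR_ge0.
Qed.

(** Product and chain rule in the degenerate space. The second component [W] is given by the
    expected formula and is justified by the explicit Lipschitz approximants [wk]. *)
Lemma W1pQ0_cutoff_comp : (@leb R n B < +oo)%E -> W1pQ0 p Q B (w, W).
Proof.
move=> lB; apply/W_closureP => //; split=> //; exists wk; split.
- by move=> k; exact: Lip0_cutoff_comp.
- by move=> k; exact: Lpi_cutoff_comp_lty.
- exact: Lp0_cutoff_comp.
- exact: Lp0_grad_cutoff_comp.
Qed.

End with_cutoff.
End cutoff_products.

(** * Hoelder estimates for cutoffs and powers of cutoffs *)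

Section holder_cutoffs.
Context {R : realType} {n : nat}.
Local Notation E := 'rV[R]_n.+1.
Local Notation e i := (delta_mx ord0 i : E).
Implicit Types (f g : E -> R).
Local Opaque enorm sqrtmx mulmx grad meas_fun.

Lemma powR_le1_of (a r : R) : 0 <= r -> 0 <= a <= 1 -> a `^ r <= 1.
Proof.
move=> r0 /andP[a0 a1]; have := ge0_ler_powR r0 _ _ a1.
by rewrite powR1; apply; rewrite nnegrE.
Qed.

Lemma poweR_inv_lty (a : \bar R) (q : R) : 0 < q -> (a `^ q^-1 < +oo)%E -> (a < +oo)%E.
Proof.
move=> q0; case: a => [a| |]//; first by move=> _; rewrite ltry.
by rewrite poweRyr ?invr_eq0 ?gt_eqF.
Qed.

Section finite_measure.
Variable U : set E.
Hypotheses (mU : measurable (U : set (Rn R n))) (U_gt0 : (0 < @leb R n U)%E).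
Hypothesis U_lty : (@leb R n U < +oo)%E.

Lemma avg_Lpi q f : avg U (fun x => (`|f x| `^ q)%:E) = ((vol U)^-1%:E * Lpi U q f)%E.
Proof. by []. Qed.

Lemma Lpi_avg q f : Lpi U q f = ((vol U)%:E * avg U (fun x => (`|f x| `^ q)%:E))%E.
Proof.
rewrite avg_Lpi muleA -EFinM mulfV ?mul1e//.
by rewrite gt_eqF// vol_gt0.
Qed.

(* Hoelder's inequality for integrals, in a form that allows exponents with *)
(* 1/q + 1/q' < 1; the volume factor is irrelevant for its uses.            *)
Lemma holder_avg (q q' : R) f g (A B : R) : 0 < q -> 0 < q' -> q^-1 + q'^-1 <= 1 ->
  meas_fun U f -> meas_fun U g -> 0 <= A -> 0 <= B ->
  (avg U (fun x => (`|f x| `^ q)%:E) <= A%:E)%E ->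
  (avg U (fun x => (`|g x| `^ q')%:E) <= B%:E)%E ->
  (avg U (fun x => `|f x * g x|%:E) <= (A `^ q^-1 * B `^ q'^-1)%:E)%E.
Proof.
move=> q0 q'0 qq mf mg A0 B0 fA gB.
have m1 : meas_fun U (fun x => `|f x| `^ q) by meas.
have m2 : meas_fun U (fun x => `|g x| `^ q') by meas.
have := avg_holder4 mU U_gt0 U_lty m1 m2 (@meas_cst R n U 1) (@meas_cst R n U 1).
move=> /(_ A B 1 1 q^-1 q'^-1 0 0 _ A0 B0 ler01 ler01).
rewrite !powRr0 !mulr1; move=> H.
apply: le_trans (H _ _ _ _ _ _ fA gB _ _); rewrite ?invr_ge0 ?(ltW q0) ?(ltW q'0)//.
- rewrite le_eqVlt; apply/orP; left; apply/eqP; apply: eq_avg => x _.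
  by rewrite !mulr1 -!powRrM !mulfV ?gt_eqF// !powRr1// normrM.
- by rewrite !addr0.
- by rewrite avg_cst.
- by rewrite avg_cst.
Qed.

Lemma holder_ev0 (q q' : R) (fk : nat -> E -> R) g : 0 < q -> 0 < q' -> q^-1 + q'^-1 <= 1 ->
  (forall k, meas_fun U (fk k)) -> meas_fun U g ->
  Lp0 U q fk -> (Lpi U q' g < +oo)%E -> ev0 (fun k => intU U (fun x => `|fk k x * g x|)).
Proof.
move=> q0 q'0 qq mf mg cf fg eps e0.
have V0 := vol_gt0 U_gt0 U_lty.
have Vi0 : 0 < (vol U)^-1 by rewrite invr_gt0.
pose B := fine (avg U (fun x => (`|g x| `^ q')%:E)).
have gfin : avg U (fun x => (`|g x| `^ q')%:E) \is a fin_num.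
  rewrite ge0_fin_numE; last by rewrite avg_Lpi mule_ge0 ?Lpi_ge0// lee_fin ltW.
  by rewrite avg_Lpi lte_mul_pinfty// lee_fin ltW.
have B0 : 0 <= B.
  by apply: fine_ge0; rewrite avg_Lpi mule_ge0 ?Lpi_ge0// lee_fin ltW.
pose C := B `^ q'^-1 + 1; have C0 : 0 < C by rewrite ltr_wpDl// powR_ge0.
pose A := (eps / (vol U * C)) `^ q.
have A0 : 0 < A by rewrite powR_gt0// divr_gt0// mulr_gt0.
have [K HK] := cf (vol U * A) (mulr_gt0 V0 A0); exists K => k /HK h.
have fA : (avg U (fun x => (`|fk k x| `^ q)%:E) <= A%:E)%E.
  rewrite avg_Lpi; apply: (@le_trans _ _ ((vol U)^-1%:E * (vol U * A)%:E)%E).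
    by rewrite lee_wpmul2l// lee_fin ltW.
  by rewrite -EFinM mulKf// gt_eqF.
have gB : (avg U (fun x => (`|g x| `^ q')%:E) <= B%:E)%E by rewrite fineK.
have := holder_avg q0 q'0 qq (mf k) mg (ltW A0) B0 fA gB.
rewrite /avg -/(intU U (fun x => `|fk k x * g x|)) => H.
rewrite -[X in (X <= _)%E]mul1e -(mulfV (lt0r_neq0 V0)) EFinM -muleA.
apply: (@le_trans _ _ ((vol U)%:E * (A `^ q^-1 * B `^ q'^-1)%:E)%E).
  by rewrite lee_wpmul2l// lee_fin ltW.
rewrite -EFinM lee_fin /A -powRrM mulfV ?gt_eqF// powRr1; last first.
  by rewrite divr_ge0 ?ltW// mulr_gt0.
apply: (@le_trans _ _ (vol U * (eps / (vol U * C) * C))).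
  by rewrite !ler_pM2l ?divr_gt0 ?mulr_gt0// lerDl.
by rewrite le_eqVlt; apply/orP; left; apply/eqP; field; rewrite !gt_eqF.
Qed.

End finite_measure.

Variables (Omega : set E) (p : R) (Q : E -> 'M[R]_n.+1).
Hypotheses (oO : open Omega) (p1 : 1 < p) (Qpsd : forall x, Omega x -> psdmx (Q x)).
Hypothesis mQ : forall i j, meas_fun Omega (fun x => Q x i j).
Variable B : set E.
Hypotheses (oB : open B) (BO : B `<=` Omega).
Hypotheses (B_gt0 : (0 < @leb R n B)%E) (B_lty : (@leb R n B < +oo)%E).
Let p0 : 0 < p. Proof. exact: lt_trans p1. Qed.
Let p0' : 0 <= p. Proof. exact: ltW. Qed.
Let mO : measurable (Omega : set (Rn R n)). Proof. exact: open_measurable_Rn. Qed.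
Let mB : measurable (B : set (Rn R n)). Proof. exact: open_measurable_Rn. Qed.

(* The integrability condition on a cutoff function and the embedding of the    *)
(* Sobolev space into L^(p t') combine by Hoelder's inequality.                  *)
Lemma cutoff_mul_bound (eta : E -> R) (t : \bar R) (C3 : R) : lipschitz eta ->
  (1 <= t)%E -> (lnorm (p%:E * t) B (Qnorm Q (grad eta)) < +oo)%E -> 0 < C3 ->
  (forall f, Lip_loc Omega f -> (lnorm (p%:E * hoelder_conjugate t) B f <=
     C3%:E * Wnorm p Q Omega f (grad f))%E) ->
  exists2 X : R, 0 <= X & forall f, Lip_loc Omega f ->
      (Lpi B p (fun x => f x * Qnorm Q (grad eta) x)%R <=
        X%:E * (Lpi Omega p f + Lpi Omega p (Qnorm Q (grad f))))%E.
Proof.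
move=> le t1 fq C30 Hf.
have mge : measV B (grad eta) by apply: meas_grad oB (lipschitz_Lip_loc le).
have mq : meas_fun B (Qnorm Q (grad eta)) by exact: (meas_qn oO Qpsd mQ mB BO mge).
have T0 : (0 < @leb R n setT)%E.
  by apply: lt_le_trans B_gt0 _; apply: le_leb_outer.
have WE f : Wnorm p Q Omega f (grad f) =
    ((Lpi Omega p f + Lpi Omega p (Qnorm Q (grad f))) `^ p^-1)%E.
  rewrite /Wnorm.
  have <- : intU Omega (fun x => Qnorm Q (grad f) x `^ p) = Lpi Omega p (Qnorm Q (grad f)).
    by apply: eq_intU => x _; rewrite ger0_norm// enorm_ge0.
  by [].
(* Only functions whose Sobolev norm is finite, with p-th power S, need an estimate. Taking Y + 1 as
   the constant keeps it positive, so the bound is +oo in the remaining case. *)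
suff [Y Y0 HY] : exists2 Y : R, 0 <= Y & forall f (S : R), Lip_loc Omega f -> 0 <= S ->
    (lnorm (p%:E * hoelder_conjugate t) B f <= (C3 * S `^ p^-1)%:E)%E ->
    (Lpi B p (fun x => f x * Qnorm Q (grad eta) x)%R <= (Y * S)%:E)%E.
  exists (Y + 1); first by rewrite addr_ge0.
  move=> f lf; have := Hf f lf; rewrite WE.
  have : (0 <= Lpi Omega p f + Lpi Omega p (Qnorm Q (grad f)))%E.
    by rewrite adde_ge0// Lpi_ge0.
  move: (_ + _)%E => [S S0| |//]; last by rewrite gt0_muley ?leey// lte_fin ltr_wpDl.
  rewrite poweR_EFin -EFinM => H; apply: le_trans (HY f S lf S0 H) _.
  by rewrite -EFinM lee_fin ler_wpM2r// lerDl.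
(* For t = 1 an essential bound on f is paired with the L^p norm of the gradient, for t = +oo the
   roles are exchanged, and in between Hoelder's inequality with exponents t' and t is applied to
   p-th powers. *)
case: t t1 fq Hf => [t| |//].
- rewrite lee_fin le_eqVlt => /predU1P[<-|t1] fq _.
    rewrite hoelder_conjugate1 gt0_muley ?lte_fin//.
    have fq' : (Lpi B p (Qnorm Q (grad eta)) < +oo)%E.
      move: fq; rewrite -EFinM mulr1 lnorm_Lpi//.
      exact: poweR_inv_lty.
    have F0 : (0 <= Lpi B p (Qnorm Q (grad eta)))%E by exact: Lpi_ge0.
    exists (C3 `^ p * fine (Lpi B p (Qnorm Q (grad eta)))).
      by rewrite mulr_ge0 ?powR_ge0// fine_ge0.
    move=> f S lf S0 H.
    have mf : meas_fun B f by apply: meas_sub mO BO (meas_Lip_loc oO lf).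
    have Hae : {ae @leb R n, forall x, B x -> `|f x| <= C3 * S `^ p^-1}.
      move: H; rewrite /lnorm unlock T0; set s := ess_sup _ _ => H.
      have := @ess_sup_ge _ (Rn R n) R (@leb R n) (abse \o ((EFin \o f) \_ B)).
      by apply: ae_imp => x /= + Bx; rewrite patchE mem_set// => /le_trans/(_ H).
    apply: (@le_trans _ _ (Lpi B p (fun x => (C3 * S `^ p^-1) * Qnorm Q (grad eta) x)%R)).
      apply: le_Lpi => //; [by meas|by meas|].
      apply: ae_imp Hae => x h Bx; rewrite !normrM ler_wpM2r//.
      by rewrite -normrM; apply: le_trans (h Bx) (ler_norm _).
    rewrite LpiZ// ger0_norm; last by rewrite mulr_ge0 ?powR_ge0// ltW.
    rewrite powRM ?powR_ge0 ?(ltW C30)// -powRrM mulVf ?gt_eqF// powRr1//.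
    rewrite -{1}(fineK (_ : Lpi B p (Qnorm Q (grad eta)) \is a fin_num)); last by rewrite ge0_fin_numE.
    by rewrite -EFinM lee_fin mulrAC.
  have t0 : 0 < t by exact: lt_trans t1.
  have tm : 0 < t - 1 by rewrite subr_gt0.
  have hcE : hoelder_conjugate t%:E = (t / (t - 1))%:E.
    rewrite /hoelder_conjugate /= eqe gt_eqF// -EFinB inver gt_eqF//.
  rewrite hcE -!EFinM; set t' := t / (t - 1).
  have t'0 : 0 < t' by rewrite divr_gt0.
  have tt : t'^-1 + t^-1 <= 1.
    by rewrite /t' invf_div le_eqVlt; apply/orP; left; apply/eqP; field; rewrite gt_eqF.
  have fq' : (Lpi B (p * t) (Qnorm Q (grad eta)) < +oo)%E.
    move: fq; rewrite -EFinM lnorm_Lpi ?mulr_gt0//.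
    by apply: poweR_inv_lty; rewrite mulr_gt0.
  have F0 : (0 <= Lpi B (p * t) (Qnorm Q (grad eta)))%E by exact: Lpi_ge0.
  have V0 := vol_gt0 B_gt0 B_lty.
  have Vi0 : 0 <= (vol B)^-1 by rewrite invr_ge0 ltW.
  set G := fine (Lpi B (p * t) (Qnorm Q (grad eta))).
  have GE : Lpi B (p * t) (Qnorm Q (grad eta)) = G%:E by rewrite fineK// ge0_fin_numE.
  have G0 : 0 <= G by rewrite fine_ge0.
  exists (vol B * ((vol B)^-1 `^ t'^-1 * C3 `^ p * ((vol B)^-1 * G) `^ t^-1)).
    by rewrite !mulr_ge0 ?powR_ge0// ltW.
  move=> f S lf S0 H.
  have mf : meas_fun B f by apply: meas_sub mO BO (meas_Lip_loc oO lf).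
  have CS0 : 0 <= C3 * S `^ p^-1 by rewrite mulr_ge0 ?powR_ge0// ltW.
  have fE : (Lpi B (p * t') f <= ((C3 * S `^ p^-1) `^ (p * t'))%:E)%E.
    have pt : 0 < p * t' by rewrite mulr_gt0.
    by move: H; rewrite lnorm_Lpi// => /(poweR_root_le pt CS0 (Lpi_ge0 _ _ _)).
  have m1 : meas_fun B (fun x => `|f x| `^ p) by meas.
  have m2 : meas_fun B (fun x => `|Qnorm Q (grad eta) x| `^ p) by meas.
  have pp (w : R) x : `| `|w| `^ p | `^ x = `|w| `^ (p * x).
    by rewrite ger0_norm ?powR_ge0// -powRrM.
  have E1 : (avg B (fun x => (`| `|f x| `^ p | `^ t')%:E) <=
      ((vol B)^-1 * (C3 * S `^ p^-1) `^ (p * t'))%:E)%E.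
    under [X in avg B X]eq_fun do rewrite pp.
    by rewrite avg_Lpi EFinM lee_wpmul2l.
  have E2 : (avg B (fun x => (`| `|Qnorm Q (grad eta) x| `^ p | `^ t)%:E) <= ((vol B)^-1 * G)%:E)%E.
    under [X in avg B X]eq_fun do rewrite pp.
    by rewrite avg_Lpi EFinM -GE.
  have A10 : 0 <= (vol B)^-1 * (C3 * S `^ p^-1) `^ (p * t') by rewrite mulr_ge0 ?powR_ge0.
  have A20 : 0 <= (vol B)^-1 * G by rewrite mulr_ge0.
  have := holder_avg mB B_gt0 B_lty t'0 t0 tt m1 m2 A10 A20 E1 E2.
  rewrite /avg -/(intU B (fun x => `| `|f x| `^ p * `|Qnorm Q (grad eta) x| `^ p |)) => H'.
  have -> : Lpi B p (fun x => f x * Qnorm Q (grad eta) x)%R =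
      intU B (fun x => `| `|f x| `^ p * `|Qnorm Q (grad eta) x| `^ p |).
    by apply: eq_intU => x _; rewrite normrM powRM// [RHS]normrM !(ger0_norm (powR_ge0 _ _)).
  rewrite -[X in (X <= _)%E]mul1e -(mulfV (lt0r_neq0 V0)) EFinM -muleA.
  apply: (le_trans (lee_wpmul2l _ H')); first by rewrite lee_fin ltW.
  have PW X : 0 <= X ->
      ((vol B)^-1 * X `^ (p * t')) `^ t'^-1 = (vol B)^-1 `^ t'^-1 * X `^ p.
    by move=> X0; rewrite powRM ?powR_ge0// -powRrM mulfK ?gt_eqF.
  rewrite -EFinM lee_fin -mulrA ler_pM2l// PW// powRM ?powR_ge0 ?(ltW C30)//.
  rewrite -[(S `^ _) `^ p]powRrM mulVf ?gt_eqF// powRr1//.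
  by rewrite le_eqVlt; apply/orP; left; apply/eqP; ring.
move=> _ fq _; rewrite hoelder_conjugatey mule1.
move: fq; rewrite gt0_muley ?lte_fin// => /(lnorm_y T0)[M [M0 HM]].
exists (M `^ p * C3 `^ p); first by rewrite mulr_ge0 ?powR_ge0.
move=> f S lf S0 H.
have mf : meas_fun B f by apply: meas_sub mO BO (meas_Lip_loc oO lf).
have CS0 : 0 <= C3 * S `^ p^-1 by rewrite mulr_ge0 ?powR_ge0// ltW.
have fE : (Lpi B p f <= ((C3 * S `^ p^-1) `^ p)%:E)%E.
  by move: H; rewrite lnorm_Lpi// => /(poweR_root_le p0 CS0 (Lpi_ge0 _ _ _)).
apply: (@le_trans _ _ (Lpi B p (fun x => M * f x)%R)).
  apply: le_Lpi => //; [by meas|by meas|].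
  apply: ae_imp HM => x h Bx; rewrite !normrM mulrC ler_wpM2r//.
  by apply: le_trans (h Bx) (ler_norm _).
rewrite LpiZ// ger0_norm// -mulrA EFinM lee_wpmul2l ?lee_fin ?powR_ge0//.
apply: le_trans fE _; rewrite lee_fin powRM ?powR_ge0 ?(ltW C30)//.
by rewrite -powRrM mulVf ?gt_eqF// powRr1.
Qed.

Lemma powR_lip (q a b : R) : 1 < q -> 0 <= a <= 1 -> 0 <= b <= 1 ->
  `|a `^ q - b `^ q| <= q * `|a - b|.
Proof.
move=> q1; wlog ab : a b / b <= a.
  move=> H ha hb; have [/H|/ltW/H] := leP b a; first exact.
  by rewrite distrC [`|b - a|]distrC; exact.
move=> /andP[a0 a1] /andP[b0 b1].
have q0 : 0 < q by exact: lt_trans q1.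
have H : {within `[b, a], continuous (fun w : R => `|w| `^ q)}.
  apply: derivable_within_continuous => z; rewrite in_itv/= => /andP[bz _].
  by have [] := is_derive_norm_powR q1 (le_trans b0 bz).
have [|c] := @MVT_segment R (fun w => `|w| `^ q) (fun z => q * z `^ (q - 1)) b a ab _ H.
  move=> z; rewrite in_itv/= => /andP[bz _].
  exact: is_derive_norm_powR q1 (le_trans b0 (ltW bz)).
rewrite in_itv/= => /andP[bc ca]; rewrite (ger0_norm a0) (ger0_norm b0) => ->.
have c0 : 0 <= c by exact: le_trans bc.
rewrite normrM ler_wpM2r// [`|q * _|]ger0_norm; last by rewrite mulr_ge0 ?powR_ge0// ltW.
rewrite -[leRHS]mulr1 ler_pM2l// ?powR_le1_of// ?subr_ge0 ?(ltW q1)//.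
by rewrite c0 (le_trans ca).
Qed.

Lemma grad_cutoff_pow (eta : E -> R) (q : R) : lipschitz eta -> (forall x, 0 <= eta x <= 1) ->
  1 < q -> {ae @leb R n, forall x, B x ->
    grad (fun y => eta y `^ q) x = (q * eta x `^ (q - 1)) *: grad eta x}.
Proof.
move=> le e01 q1; apply: ae_imp (Lip_loc_ae_derivable oB (lipschitz_Lip_loc le)) => x de Bx.
have e0 y : 0 <= eta y by have /andP[] := e01 y.
have -> : (fun y => eta y `^ q) = (fun w => `|w| `^ q) \o eta.
  by apply/funext => y /=; rewrite ger0_norm.
exact: grad_comp (de Bx) (is_derive_norm_powR q1 (e0 x)).
Qed.

(** The gradient of eta^q is q eta^(q-1) grad eta, pointwise at most q times that of eta, so every
    clause is inherited. The test functions contain eta^p. *)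
Lemma good_cutoff_pow (eta : E -> R) (q : R) : 1 < q -> good_cutoff Omega p Q B eta ->
  good_cutoff Omega p Q B (fun x => eta x `^ q).
Proof.
move=> q1 [le e01 [cs sB] fe [X X0 HX]]; have q0 : 0 < q by exact: lt_trans q1.
have sE : supp (fun x => eta x `^ q) `<=` supp eta.
  by apply: closureS => x /=; apply: contraNneq => ->; rewrite powR0// gt_eqF.
have mge : measV B (grad eta) by apply: meas_grad oB (lipschitz_Lip_loc le).
have lq : lipschitz (fun x => eta x `^ q).
  have [L L0 HL] := lipschitz_onP le.
  apply: (@lipschitz_onW _ _ _ _ (q * L)) => x y _ _.
  by apply: le_trans (powR_lip q1 (e01 x) (e01 y)) _; rewrite -mulrA ler_pM2l// HL.
have mgq : measV B (grad (fun x => eta x `^ q)) by apply: meas_grad oB (lipschitz_Lip_loc lq).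
have mq : meas_fun B (Qnorm Q (grad eta)) by exact: (meas_qn oO Qpsd mQ mB BO mge).
have mq' : meas_fun B (Qnorm Q (grad (fun x => eta x `^ q))).
  exact: (meas_qn oO Qpsd mQ mB BO mgq).
have Hq : {ae @leb R n, forall x, B x ->
    `|Qnorm Q (grad (fun x => eta x `^ q)) x| <= `|q * Qnorm Q (grad eta) x|}.
  apply: ae_imp (grad_cutoff_pow le e01 q1) => x + Bx => /(_ Bx); rewrite /Qnorm => ->.
  have /andP[e0 e1] := e01 x.
  have h : `|eta x `^ (q - 1)| <= 1.
    by rewrite ger0_norm ?powR_ge0// powR_le1_of ?e01// subr_ge0 ltW.
  by rewrite qnZ !normrM !normr_id ler_wpM2r// ler_piMr.
split; first exact: lq.
- move=> x; have /andP[e0 e1] := e01 x; rewrite powR_ge0/= powR_le1_of ?e01//.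
  exact: ltW.
- split; last exact: subset_trans sE sB.
  by apply: (subclosed_compact _ cs) => //; exact: closed_closure.
- apply: (@le_lt_trans _ _ (Lpi B p (fun x => q * Qnorm Q (grad eta) x)%R)).
    by apply: le_Lpi p0' mB mq' _ Hq; meas.
  rewrite LpiZ//; move: fe; move: (Lpi B p _) => z yz.
  by rewrite lte_mul_pinfty// lee_fin powR_ge0.
- exists (`|q| `^ p * X); first by rewrite mulr_ge0 ?powR_ge0.
  move=> f lf; have mf : meas_fun B f by apply: meas_sub mO BO (meas_Lip_loc oO lf).
  apply: (@le_trans _ _ (Lpi B p (fun x => q * (f x * Qnorm Q (grad eta) x))%R)).
    have ma : meas_fun B (fun x => f x * Qnorm Q (grad (fun x => eta x `^ q)) x) by exact: measM.
    have mc : meas_fun B (fun x => f x * Qnorm Q (grad eta) x) by exact: measM.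
    have mb : meas_fun B (fun x => q * (f x * Qnorm Q (grad eta) x)) by meas.
    apply: (le_Lpi p0' mB ma mb).
    apply: ae_imp Hq => x + Bx => /(_ Bx) h.
    by rewrite mulrCA !(normrM (f x)) ler_wpM2l.
  have mc : meas_fun B (fun x => f x * Qnorm Q (grad eta) x) by exact: measM.
  rewrite (LpiZ _ _ mB mc).
  rewrite EFinM -muleA lee_wpmul2l ?lee_fin ?powR_ge0//; exact: HX.
Qed.

End holder_cutoffs.

(** * Nonlinear test functions in the weak equation *)

Section test_functions.
Context {R : realType} {n : nat}.
Local Notation E := 'rV[R]_n.+1.
Local Notation e i := (delta_mx ord0 i : E).
Local Opaque enorm sqrtmx mulmx grad meas_fun.
Variables (Omega : set E) (p : R) (Q : E -> 'M[R]_n.+1).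
Hypotheses (oO : open Omega) (p1 : 1 < p) (Qpsd : forall x, Omega x -> psdmx (Q x)).
Hypothesis mQ : forall i j, meas_fun Omega (fun x => Q x i j).
Local Notation qn x v := (enorm (v *m sqrtmx (Q x))).
Let p0 : 0 < p. Proof. exact: lt_trans p1. Qed.
Let p0' : 0 <= p. Proof. exact: ltW. Qed.
Let mO : measurable (Omega : set (Rn R n)). Proof. exact: open_measurable_Rn. Qed.
Variable B : set E.
Hypotheses (oB : open B) (BO : B `<=` Omega).
Hypotheses (B_gt0 : (0 < @leb R n B)%E) (B_lty : (@leb R n B < +oo)%E).
Let mB : measurable (B : set (Rn R n)). Proof. exact: open_measurable_Rn. Qed.
Variables (zeta : E -> R).
Hypothesis gz : good_cutoff Omega p Q B zeta.
Variables (u : E -> R) (Du : E -> E) (v : nat -> E -> R).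
Hypotheses (mu : meas_fun Omega u) (mDu : measV Omega Du).
Hypothesis appv : approximates Omega p Q v u Du.
Variables (F F' : R -> R) (K : R).
Hypotheses (dF : forall z : R, is_derive z (1 : R) F (F' z)) (cF' : continuous F').
Hypothesis bF' : forall z, `|F' z| <= K.

Let w x := zeta x * F (u x).
Let W x : E := F (u x) *: grad zeta x + (zeta x * F' (u x)) *: Du x.
Let wk k x := zeta x * F (v k x).

Let L0wk k : Lip0 B (wk k). Proof. exact: (Lip0_cutoff_comp BO gz appv dF bF' k). Qed.
Let lwk k : lipschitz (wk k). Proof. by have [] := L0wk k. Qed.
Let mwk k : meas_fun B (wk k).
Proof. exact: meas_Lip_loc oB (lipschitz_Lip_loc (lwk k)). Qed.
Let mgwk k : measV B (grad (wk k)).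
Proof. exact: meas_grad oB (lipschitz_Lip_loc (lwk k)). Qed.

Let mwW : meas_fun B w /\ measV B W.
Proof.
have := W1pQ0_cutoff_comp oO p1 Qpsd mQ oB BO gz mu mDu appv dF cF' bF' B_lty.
by move=> /(W_closureP Q p1 _ _ _ mB)[].
Qed.

Let mgD k : measV B (fun x => grad (wk k) x - W x).
Proof. exact: measVB (mgwk k) mwW.2. Qed.

Let mqD k : meas_fun B (fun x => qn x (grad (wk k) x - W x)).
Proof. exact: (meas_qn oO Qpsd mQ mB BO (mgD k)). Qed.

Let mD k : meas_fun B (fun x => wk k x - w x).
Proof. exact: measB (mwk k) mwW.1. Qed.

Let cw : Lp0 B p (fun k x => wk k x - w x).
Proof. exact: (Lp0_cutoff_comp oO p1 oB BO gz mu appv dF bF'). Qed.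

Let cW : Lp0 B p (fun k x => qn x (grad (wk k) x - W x)).
Proof. exact: (Lp0_grad_cutoff_comp oO p1 Qpsd mQ oB BO gz mu mDu appv dF cF' bF'). Qed.

(** Makes the Sobolev inequality applicable to the approximation error itself, which improves its
    convergence from L^p to L^(p sigma). The approximants are [wk k - wk j] with j tending to
    infinity. *)
Lemma W1pQ0_cutoff_error k :
  W1pQ0 p Q B (fun x => wk k x - w x, fun x => grad (wk k) x - W x).
Proof.
have [lz z01 [cs sB] _ _] := gz.
have dwk j : {ae @leb R n, forall x, B x -> forall i, derivable (wk j) x (e i)}.
  exact: Lip_loc_ae_derivable oB (lipschitz_Lip_loc (lwk j)).
have lD j : lipschitz (fun x => wk k x - wk j x).
  have [L _ HL] := lipschitz_onP (lwk k); have [M _ HM] := lipschitz_onP (lwk j).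
  apply: (@lipschitz_onW _ _ _ _ (L + M)) => x y _ _.
  rewrite (_ : wk k x - wk j x - _ = wk k x - wk k y - (wk j x - wk j y)); last by ring.
  by rewrite mulrDl (le_trans (ler_normB _ _))// lerD ?HL ?HM.
have mgD' j : measV B (grad (fun x => wk k x - wk j x)).
  exact: meas_grad oB (lipschitz_Lip_loc (lD j)).
have mq (V : E -> E) : measV B V -> meas_fun B (fun x => qn x (V x)).
  exact: (meas_qn oO Qpsd mQ mB BO).
have sE j : (fun x => wk k x - wk j x) = (fun x => zeta x * (F (v k x) - F (v j x))).
  by apply/funext => x; rewrite /wk mulrBr.
apply/(W_closureP Q p1 _ _ _ mB); split; [exact: mD|exact: mgD|].
exists (fun j x => wk k x - wk j x); split.
- move=> j; split; first exact: lD.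
    apply: (subclosed_compact _ cs); first exact: closed_closure.
    by rewrite sE; exact: supp_mul_sub.
  by rewrite sE; exact: subset_trans (@supp_mul_sub _ _ _ _) sB.
- have fwk k' := Lpi_cutoff_comp_lty oO p1 Qpsd mQ oB BO gz appv dF bF' k' B_lty.
  move=> j; split.
    have [fk _] := fwk k; have [fj _] := fwk j.
    have mkj : meas_fun B (fun x => wk k x - wk j x) by exact: measB.
    apply: (Lpi_ltyD p0' mB (mwk k) (mwk j) mkj _ fk fj).
    by apply: aeW => x _; exact: ler_normB.
  have [_ fk] := fwk k; have [_ fj] := fwk j.
  apply: (Lpi_ltyD p0' mB (mq _ (mgwk k)) (mq _ (mgwk j)) (mq _ (mgD' j)) _ fk fj).
  apply: ae_imp2 (dwk k) (dwk j) => x dk dj Bx.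
  rewrite (grad_sub (dk Bx) (dj Bx)).
  rewrite [X in X <= _]norm_enorm [X in _ <= X + _]norm_enorm [X in _ <= _ + X]norm_enorm.
  by rewrite -(qnN Q x (grad (wk j) x)); exact: qnD.
- have mZ j : meas_fun B (fun x => wk k x - wk j x - (wk k x - w x)).
    by apply: measB (mD k); exact: measB.
  apply: (@Lp0_le _ _ _ _ _ _ 1 p0' mB mD mZ _ cw) => j; apply: aeW => x _.
  rewrite mul1r (_ : _ - (wk k x - w x) = - (wk j x - w x)) ?normrN//.
  by ring.
- have mZ j : meas_fun B (fun x => qn x (grad (fun x => wk k x - wk j x) x - (grad (wk k) x - W x))).
    by apply: mq; exact: measVB (mgD' j) (mgD k).
  apply: (@Lp0_le _ _ _ _ _ _ 1 p0' mB mqD mZ _ cW) => j.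
  apply: ae_imp2 (dwk k) (dwk j) => x dk dj Bx.
  rewrite mul1r (grad_sub (dk Bx) (dj Bx)).
  rewrite (_ : _ - (grad (wk k) x - W x) = - (grad (wk j) x - W x)) ?qnN//.
  by apply/rowP => i; rewrite !mxE; ring.
Qed.

Variables (sigma C1 r : R).
Hypotheses (s1 : 1 < sigma) (C10 : 0 <= C1) (r0 : 0 <= r).
Hypothesis Hsob : forall w, W1pQ0 p Q B w -> (avg_lnorm (p * sigma)%:E B w.1 <=
      C1%:E * (r%:E * avg_lnorm p%:E B (Qnorm Q w.2) + avg_lnorm p%:E B w.1))%E.

Let V0 : 0 < vol B. Proof. exact: vol_gt0. Qed.
Let Vi0 : 0 <= (vol B)^-1. Proof. by rewrite invr_ge0 ltW. Qed.

Lemma Lp0_sigma_cutoff_comp : Lp0 B (p * sigma) (fun k x => wk k x - w x).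
Proof.
have ps0 : 0 < p * sigma by rewrite mulr_gt0// (lt_trans ltr01).
have pV0 : 0 < p^-1 by rewrite invr_gt0.
have sc0 q f : (0 <= (vol B)^-1%:E * Lpi B q f)%E by rewrite mule_ge0 ?Lpi_ge0// lee_fin.
have H1 : ev0 (fun k => (vol B)^-1%:E * Lpi B (p * sigma) (fun x => wk k x - w x)%R)%E.
  apply: (ev0_poweR_inv ps0); first by move=> k; exact: sc0.
  have a1 := ev0_poweR pV0 (fun k => sc0 p _) (ev0Z Vi0 cW).
  have a2 := ev0_poweR pV0 (fun k => sc0 p _) (ev0Z Vi0 cw).
  apply: ev0_le (ev0Z C10 (ev0D (ev0Z r0 a1) a2)) => k.
  exact: (Hsob (W1pQ0_cutoff_error k)).
apply: ev0_le (ev0Z (ltW V0) H1) => k.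
by rewrite muleA -EFinM mulfV ?gt_eqF// mul1e.
Qed.

Variables (A : E -> R -> E -> E) (Bf : E -> R -> E -> R).
Hypothesis F0 : forall z, 0 <= F z.
Hypothesis Hsol : forall phi, Lip0 Omega phi -> (forall x, 0 <= phi x) ->
  let F x := (dotv (grad phi x) (A x (u x) (Du x)) + phi x * Bf x (u x) (Du x))%:E in
  leb.-integrable (Omega : set (Rn R n)) F /\ (\int[leb]_(x in Omega) F x = 0)%E.
Variables (Abar Bbar : E -> R).
Hypotheses (mA : meas_fun B Abar) (mBb : meas_fun B Bbar).
Hypotheses (fA : (Lpi B (dual_exp p) Abar < +oo)%E)
  (fB : (Lpi B (dual_exp (p * sigma)) Bbar < +oo)%E).
Hypothesis HAB : {ae @leb R n, forall x, B x -> supp zeta x ->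
  (exists2 At : E, A x (u x) (Du x) = At *m sqrtmx (Q x) & enorm At <= Abar x) /\
  `|Bf x (u x) (Du x)| <= Bbar x}.

Lemma dual_expV (q : R) : 1 < q -> 0 < dual_exp q /\ q^-1 + (dual_exp q)^-1 <= 1.
Proof.
move=> q1; have q0 : 0 < q by exact: lt_trans q1.
have q10 : 0 < q - 1 by rewrite subr_gt0.
split; first by rewrite divr_gt0.
by rewrite /dual_exp invf_div le_eqVlt; apply/orP; left; apply/eqP; field; rewrite gt_eqF.
Qed.

Lemma dotv_sqrtmx x V At : `|dotv V (At *m sqrtmx (Q x))| <= qn x V * enorm At.
Proof. by rewrite dotv_mulmx sqrtmx_sym dotv_enorm. Qed.

Lemma intU_real_parts (f : E -> R) : leb.-integrable (B : set (Rn R n)) (EFin \o f) ->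
  (\int[@leb R n]_(x in (B : set (Rn R n))) (f x)%:E = 0)%E ->
  [/\ meas_fun B f, intU B (fun x => Num.max (f x) 0) = intU B (fun x => Num.max (- f x) 0) &
    (intU B (fun x => Num.max (f x) 0)%R < +oo)%E].
Proof.
move=> iF F0'; have mf : meas_fun B f by apply/measurable_EFinP; exact: measurable_int iF.
have E1 : (\int[@leb R n]_(x in (B : set (Rn R n))) ((EFin \o f)^\+ x))%E =
     intU B (fun x => Num.max (f x) 0).
  by apply: eq_integral => x _; rewrite funeposE /= EFin_max.
have E2 : (\int[@leb R n]_(x in (B : set (Rn R n))) ((EFin \o f)^\- x))%E =
     intU B (fun x => Num.max (- f x) 0).
  by apply: eq_integral => x _; rewrite funenegE /= EFin_max.
have h1 : (intU B (fun x => Num.max (f x) 0%R) < +oo)%E.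
  by rewrite -E1; exact: integral_funepos_lt_pinfty.
have h2 : (intU B (fun x => Num.max (- f x) 0)%R < +oo)%E.
  by rewrite -E2; exact: integral_funeneg_lt_pinfty.
have h3 : (intU B (fun x => Num.max (f x) 0%R) - intU B (fun x => Num.max (- f x) 0)%R = 0)%E.
  by rewrite -E1 -E2 -integralE.
have : (0 <= intU B (fun x => Num.max (f x) 0%R))%E.
  by apply: intU_ge0 => x _; rewrite le_max lexx orbT.
have : (0 <= intU B (fun x => Num.max (- f x) 0)%R)%E.
  by apply: intU_ge0 => x _; rewrite le_max lexx orbT.
move: h1 h2 h3; move: (intU B _) (intU B _) => [a| |]// [b| |]// _ _ + _ _.
by rewrite -EFinB => -[] /eqP; rewrite subr_eq0 => /eqP ->; split=> //; rewrite ltry.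
Qed.

(** The equation is tested with the Lipschitz functions [wk k]. The integrand belonging to the limit
    (w, W) enters only through a pointwise comparison of Low with Up and is never integrated.
    Replacing it by that of [wk k] costs |sqrt(Q)(grad wk - W)| Abar + |wk - w| Bbar, whose integral
    tends to 0 by Hoelder's inequality, in L^p against its dual and in L^(p sigma) against its dual.
    The factor s allows the equation to be used with either sign. *)
Lemma test_ineq (Low Up : E -> R) (s : R) : `|s| <= 1 ->
  meas_fun B Low -> meas_fun B Up ->
  (forall x, B x -> 0 <= Low x) -> (forall x, B x -> 0 <= Up x) ->
  {ae @leb R n, forall x, B x -> Low x <= Up x +
     s * (dotv (W x) (A x (u x) (Du x)) + w x * Bf x (u x) (Du x))} ->
  (intU B Low <= intU B Up)%E.
Proof.
move=> s1' mL mU L0 U0 HLU.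
have [lz z01 [cs sB] _ _] := gz.
have [d0 dp] := dual_expV p1.
have ps1 : 1 < p * sigma.
  by rewrite -[ltLHS]mulr1 ltr_pM// ?(ltW ltr01).
have ps0 : 0 < p * sigma by exact: lt_trans ps1.
have [ds0 dsp] := dual_expV ps1.
have cA := holder_ev0 mB B_gt0 B_lty p0 d0 dp mqD mA cW fA.
have cB := holder_ev0 mB B_gt0 B_lty ps0 ds0 dsp mD mBb Lp0_sigma_cutoff_comp fB.
pose Fk k x := dotv (grad (wk k) x) (A x (u x) (Du x)) + wk k x * Bf x (u x) (Du x).
pose Ek k x := `|qn x (grad (wk k) x - W x) * Abar x| + `|(wk k x - w x) * Bbar x|.
have Ek0 k x : B x -> 0 <= Ek k x by move=> _; exact: addr_ge0.
have mA1 k : meas_fun B (fun x => `|qn x (grad (wk k) x - W x) * Abar x|).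
  exact/meas_norm/measM.
have mB1 k : meas_fun B (fun x => `|(wk k x - w x) * Bbar x|).
  exact/meas_norm/measM.
have mEk k : meas_fun B (Ek k) by exact: measD.
have S0 x : ~ supp zeta x -> zeta x = 0.
  by move=> sx; apply/eqP/negPn/negP => ex; apply: sx; exact: subset_closure.
have oS : open (~` supp zeta) by rewrite openC; exact: closed_closure.
have gwk0 k x : ~ supp zeta x -> grad (wk k) x = 0.
  move=> sx; apply: (@grad_locally0 _ _ (wk k) (~` supp zeta) x oS sx).
  by move=> y /S0; rewrite /wk => ->; rewrite mul0r.
have gz0 x : ~ supp zeta x -> grad zeta x = 0.
  move=> sx; apply: (@grad_locally0 _ _ zeta (~` supp zeta) x oS sx).
  by move=> y /S0.
have FkE k : {ae @leb R n, forall x, B x ->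
    `|dotv (W x) (A x (u x) (Du x)) + w x * Bf x (u x) (Du x) - Fk k x| <= Ek k x}.
  apply: ae_imp HAB => x H Bx; have [sx|sx] := pselect (supp zeta x).
    have [[At AE Ale] Ble] := H Bx sx.
    rewrite -normrN opprB /Fk.
    rewrite (_ : _ - _ = dotv (grad (wk k) x - W x) (A x (u x) (Du x)) +
        (wk k x - w x) * Bf x (u x) (Du x)); last first.
      have -> : grad (wk k) x - W x = grad (wk k) x + (-1) *: W x by rewrite scaleN1r.
      by rewrite dotvDl dotvZl; ring.
    apply: le_trans (ler_normD _ _) _; apply: lerD.
      rewrite AE; apply: le_trans (dotv_sqrtmx _ _ _) _.
      rewrite normrM norm_enorm ler_wpM2l ?enorm_ge0//.
      by apply: le_trans Ale (ler_norm _).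
    by rewrite !normrM ler_wpM2l//; apply: le_trans Ble (ler_norm _).
  have W0 : W x = 0 by rewrite /W gz0// S0// mul0r scale0r scaler0 addr0.
  rewrite /Fk W0 gwk0// /w /wk S0// !mul0r !addr0 subrr normr0.
  exact: Ek0.
have [->|Uy] := eqVneq (intU B Up) +oo%E; first by rewrite leey.
have Ufin : intU B Up \is a fin_num.
  by rewrite ge0_fin_numE ?intU_ge0// ltey.
apply/lee_addgt0Pr => eps e0; have e20 : 0 < eps / 2 by rewrite divr_gt0.
have [K1 HK1] := cA _ e20; have [K2 HK2] := cB _ e20.
pose k := maxn K1 K2.
have Ele : (intU B (Ek k) <= eps%:E)%E.
  rewrite intUD//; apply: (@le_trans _ _ ((eps / 2)%:E + (eps / 2)%:E)%E).
    by apply: leeD; [apply: HK1; rewrite leq_maxl|apply: HK2; rewrite leq_maxr].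
  by rewrite -EFinD -splitr.
have wk0 x : 0 <= wk k x by rewrite mulr_ge0//; have /andP[] := z01 x.
have L0O : Lip0 Omega (wk k).
  by have [h1 h2 h3] := L0wk k; split=> //; exact: subset_trans h3 BO.
have [iF F0'] := Hsol L0O wk0.
have iFB : leb.-integrable (B : set (Rn R n)) (EFin \o Fk k) by apply: integrableS iF.
have F0B : (\int[@leb R n]_(x in (B : set (Rn R n))) (Fk k x)%:E = 0)%E.
  rewrite -F0' -{1}(setIidr BO) integral_mkcondr; apply: eq_integral => x _.
  rewrite patchE; case: ifPn => //; rewrite notin_setE => nBx.
  have sx : ~ supp zeta x by move=> /sB.
  by rewrite gwk0// /wk S0// !mul0r addr0 -[0 : E](scale0r 0) dotvZl mul0r.
have iFs : leb.-integrable (B : set (Rn R n)) (EFin \o (fun x => s * Fk k x)).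
  rewrite (_ : EFin \o _ = (fun x => s%:E * (Fk k x)%:E)%E)//.
  exact: (integrableZl mB _ iFB).
have F0s : (\int[@leb R n]_(x in (B : set (Rn R n))) (s * Fk k x)%:E = 0)%E.
  rewrite (_ : (fun x => (s * Fk k x)%:E) = (fun x => s%:E * (Fk k x)%:E)%E)//.
  by rewrite (integralZl mB iFB) F0B mule0.
have [mFs EFs Flt] := intU_real_parts iFs F0s.
have mFn : meas_fun B (fun x => - (s * Fk k x)) by exact: measN.
(* As s Fk has integral 0, its positive and negative parts have equal finite integrals and cancel
   from the integrated inequality Low + N <= Up + Ek + P, all of whose terms are nonnegative. *)
pose P x := Num.max (s * Fk k x) 0; pose N x := Num.max (- (s * Fk k x)) 0.
have mP : meas_fun B P by apply: measurable_maxr => //; exact: meas_cst.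
have mN : meas_fun B N by apply: measurable_maxr => //; exact: meas_cst.
have P0 x : B x -> 0 <= P x by move=> _; rewrite le_max lexx orbT.
have N0 x : B x -> 0 <= N x by move=> _; rewrite le_max lexx orbT.
have mLN : meas_fun B (fun x => Low x + N x) by exact: measD.
have mUE : meas_fun B (fun x => Up x + Ek k x) by exact: measD.
have mUEP : meas_fun B (fun x => Up x + Ek k x + P x) by exact: measD.
have main : (intU B (fun x => Low x + N x)%R <= intU B (fun x => Up x + Ek k x + P x)%R)%E.
  apply: (le_intU_ae mB mLN mUEP).
  - by move=> x Bx; rewrite addr_ge0// ?L0 ?N0.
  - by move=> x Bx; rewrite !addr_ge0// ?U0 ?P0 ?Ek0.
  apply: ae_imp2 HLU (FkE k) => x h1 h2 Bx; have := h1 Bx; have := h2 Bx.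
  have PN : P x - N x = s * Fk k x.
    rewrite /P /N; case: (leP 0 (s * Fk k x)) => h.
      by rewrite max_r ?oppr_le0// subr0.
    by rewrite max_l ?oppr_ge0 ?(ltW h)// sub0r opprK.
  set T := dotv (W x) _ + _ => le1 le2.
  have le3 : s * (T - Fk k x) <= Ek k x.
    apply: le_trans (ler_norm _) _; rewrite normrM; apply: le_trans _ le1.
    by rewrite ler_piMl.
  move: le2 le3 PN; rewrite mulrBr.
  by move: (s * T) (s * Fk k x) (P x) (N x) (Ek k x) (Low x) (Up x) => ? ? ? ? ? ? ?; lra.
move: main; rewrite (intUD mB mL mN)// (intUD mB mUE mP)//; last first.
  by move=> x Bx; rewrite addr_ge0// ?U0 ?Ek0.
rewrite (intUD mB mU (mEk k))//; last by move=> x Bx; exact: Ek0.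
rewrite /N -EFs -/P.
have Pfin : intU B P \is a fin_num by rewrite ge0_fin_numE// intU_ge0.
rewrite leeD2rE// => /le_trans; apply.
by rewrite leeD2l.
Qed.

End test_functions.

(** * Composition without a cutoff *)

Section composition.
Context {R : realType} {n : nat}.
Local Notation E := 'rV[R]_n.+1.
Local Notation e i := (delta_mx ord0 i : E).
Local Opaque enorm sqrtmx mulmx grad meas_fun.
Variables (Omega : set E) (p : R) (Q : E -> 'M[R]_n.+1).
Hypotheses (oO : open Omega) (p1 : 1 < p) (Qpsd : forall x, Omega x -> psdmx (Q x)).
Hypothesis mQ : forall i j, meas_fun Omega (fun x => Q x i j).
Hypothesis O_lty : (@leb R n Omega < +oo)%E.
Local Notation qn x v := (enorm (v *m sqrtmx (Q x))).
Let p0 : 0 < p. Proof. exact: lt_trans p1. Qed.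
Let p0' : 0 <= p. Proof. exact: ltW. Qed.
Let mO : measurable (Omega : set (Rn R n)). Proof. exact: open_measurable_Rn. Qed.
Variables (u : E -> R) (Du : E -> E) (v : nat -> E -> R).
Hypotheses (mu : meas_fun Omega u) (mDu : measV Omega Du).
Hypothesis appv : approximates Omega p Q v u Du.
Variables (F F' : R -> R) (K : R).
Hypotheses (dF : forall z : R, is_derive z (1 : R) F (F' z)) (cF' : continuous F').
Hypothesis bF' : forall z, `|F' z| <= K.

Let K0 : 0 <= K. Proof. exact: le_trans (bF' 0). Qed.

Let cF : continuous F.
Proof.
by move=> z; apply/differentiable_continuous/derivable1_diffP; have [] := dF z.
Qed.

Let mv k : meas_fun Omega (v k).
Proof. by case: appv => Lv _ _ _ _; exact: meas_Lip_loc. Qed.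

Lemma Lip_loc_comp k : Lip_loc Omega (fun x => F (v k x)).
Proof.
have [Lv _ _ _ _] := appv => C cC CO; have [L L0 HL] := lipschitz_onP (Lv k C cC CO).
apply: (@lipschitz_onW _ _ _ _ (K * L)) => x y Cx Cy.
by apply: le_trans (bounded_derive_lip dF bF' _ _) _; rewrite -mulrA ler_wpM2l// HL.
Qed.

Lemma grad_comp_approx k : {ae @leb R n, forall x, Omega x ->
  grad (fun x => F (v k x)) x = F' (v k x) *: grad (v k) x}.
Proof.
have [Lv _ _ _ _] := appv; apply: ae_imp (Lip_loc_ae_derivable oO (Lv k)) => x dv Ox.
exact: grad_comp (dv Ox) (dF (v k x)).
Qed.

Lemma Lp0_comp : Lp0 Omega p (fun k x => F (v k x) - F (u x)).
Proof.
have [_ _ cu _ _] := appv.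
have m1 k : meas_fun Omega (fun x => v k x - u x) by exact: measB.
have m2 k : meas_fun Omega (fun x => F (v k x) - F (u x)) by apply: measB; exact: meas_comp.
apply: (@Lp0_le _ _ _ _ _ _ K p0' mO m1 m2 _ cu) => k; apply: aeW => x _.
exact: bounded_derive_lip dF bF' _ _.
Qed.

(** The Poincare inequality is stated for functions on all of Omega, so log U must be admissible
    there without a cutoff. Finite measure of Omega puts the constant F(0) in L^p. *)
Lemma W1pQ_comp : W1pQ p Q Omega (fun x => F (u x), fun x => F' (u x) *: Du x : E).
Proof.
have [Lv fv _ cDu _] := appv.
have mgv k : measV Omega (grad (v k)) by exact: meas_grad oO (Lv k).
have mgF k : measV Omega (grad (fun x => F (v k x))) by exact: meas_grad oO (Lip_loc_comp k).
have mF'u : meas_fun Omega (fun x => F' (u x)) by exact: meas_comp.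
have mFu : meas_fun Omega (fun x => F (u x)) by exact: meas_comp.
have mF'Du : measV Omega (fun x => F' (u x) *: Du x : E) by exact: measVZ mF'u mDu.
have mq (V : E -> E) : measV Omega V -> meas_fun Omega (fun x => qn x (V x)).
  exact: (meas_qn oO Qpsd mQ mO (@subset_refl _ Omega)).
have mqD k := mq _ (measVB (mgv k) mDu).
have mqF k := mq _ (measVB (mgF k) mF'Du).
have mF'v k : meas_fun Omega (fun x => F' (v k x)) by exact: meas_comp.
have mFv k : meas_fun Omega (fun x => F (v k x)) by exact: meas_comp.
apply/(W_closureP Q p1 _ _ _ mO); split=> [//|//|].
exists (fun k x => F (v k x)); split.
- exact: Lip_loc_comp.
- move=> k; have [f1 f2] := fv k; split.
    have m1 : meas_fun Omega (fun x => K * v k x) by meas.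
    apply: (Lpi_ltyD p0' mO (@meas_cst _ _ _ (F 0)) m1 (mFv k)).
    + apply: aeW => x _; rewrite -[F (v k x)](subrK (F 0)) addrC.
      apply: le_trans (ler_normD _ _) _; rewrite lerD2l normrM (ger0_norm K0).
      by apply: le_trans (bounded_derive_lip dF bF' _ _) _; rewrite subr0.
    + by rewrite /Lpi /intU integral_cst// lte_mul_pinfty// lee_fin powR_ge0.
    + rewrite LpiZ//; move: f1; move: (Lpi _ _ _) => b yb.
      by rewrite lte_mul_pinfty// lee_fin powR_ge0.
  have m1 : meas_fun Omega (fun x => K * Qnorm Q (grad (v k)) x).
    exact: (@measM _ _ _ (fun=> K) _ (@meas_cst _ _ _ K) (mq _ (mgv k))).
  apply: (@le_lt_trans _ _ (Lpi Omega p (fun x => K * Qnorm Q (grad (v k)) x)%R)).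
    apply: (le_Lpi p0' mO (mq _ (mgF k)) m1).
    apply: ae_imp (grad_comp_approx k) => x /[apply] ->.
    by rewrite qnZ !normrM normr_id ler_wpM2r// (ger0_norm K0).
  rewrite (LpiZ _ _ mO (mq _ (mgv k))); move: f2; rewrite /Qnorm; move: (Lpi _ _ _) => b yb.
  by rewrite lte_mul_pinfty// lee_fin powR_ge0.
- exact: Lp0_comp.
have cF'D := Lp0_derive_comp oO p1 Qpsd mQ mu mDu appv cF' bF'.
have m2 k : meas_fun Omega (fun x => (F' (v k x) - F' (u x)) * qn x (Du x)).
  by apply: measM (mq _ mDu); exact: measB.
have m3 k : meas_fun Omega (fun x => K * qn x (grad (v k) x - Du x)).
  exact: (@measM _ _ _ (fun=> K) _ (@meas_cst _ _ _ K) (mqD k)).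
apply: (Lp0D p0' mO m3 m2 mqF _ _ cF'D).
  move=> k; apply: ae_imp (grad_comp_approx k) => x /[apply] ->.
  rewrite [X in X <= _]ger0_norm ?enorm_ge0//.
  rewrite (_ : _ - _ = F' (v k x) *: (grad (v k) x - Du x) + (F' (v k x) - F' (u x)) *: Du x).
    apply: le_trans (qnD _ _ _ _) _; rewrite !qnZ !normrM !norm_enorm.
    by rewrite lerD2r ler_wpM2r ?enorm_ge0// (ger0_norm K0).
  by apply/rowP => i; rewrite !mxE; ring.
apply: (@Lp0_le _ _ _ _ _ _ K p0' mO mqD m3 _ cDu) => k; apply: aeW => x _.
by rewrite normrM (ger0_norm K0).
Qed.

End composition.

(** * Energy estimates *)

Section truncations.
Context {R : realType}.
Implicit Types (z k l m p : R).

Lemma is_derive_glue (f f1 f2 : R -> R) (c d : R) : f c = f1 c -> f c = f2 c ->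
  (forall z, f z = f1 z \/ f z = f2 z) ->
  is_derive c (1 : R) f1 d -> is_derive c (1 : R) f2 d -> is_derive c (1 : R) f d.
Proof.
move=> fc1 fc2 H [d1 e1] [d2 e2].
have cv : (h^-1 *: ((f \o shift c) (h *: (1 : R)) - f c)) @[h --> 0^'] --> d.
  have c1 : (h^-1 *: ((f1 \o shift c) (h *: (1 : R)) - f1 c)) @[h --> 0^'] --> d.
    by rewrite -e1; exact: d1.
  have c2 : (h^-1 *: ((f2 \o shift c) (h *: (1 : R)) - f2 c)) @[h --> 0^'] --> d.
    by rewrite -e2; exact: d2.
  apply/cvgrPdist_lt => eps e0.
  move/cvgrPdist_lt : c1 => /(_ _ e0) c1; move/cvgrPdist_lt : c2 => /(_ _ e0) c2.
  near=> h.
  have [hE|hE] := H (h *: (1 : R) + c).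
    by rewrite /= hE fc1; near: h; exact: c1.
  by rewrite /= hE fc2; near: h; exact: c2.
split; first by apply/cvg_ex; exists d.
exact: cvg_lim cv.
Unshelve. all: by end_near. Qed.

Lemma is_derive_eq_near (f g : R -> R) (c d : R) : {near c, f =1 g} ->
  is_derive c (1 : R) f d -> is_derive c (1 : R) g d.
Proof.
move=> fg [df ef]; split; first exact: near_eq_derivable df.
by rewrite -ef; apply/esym/near_eq_derive.
Qed.

(* [u] is nonnegative in one ball only, and its approximants are not: this is a  *)
(* C^1 replacement of [z + k] that stays above [k / 2] for negative [z].         *)
Definition pos_shift k z := Num.max z 0 + k / 2 + (k / 2) ^+ 2 / (k / 2 - Num.min z 0).

Definition pos_shift' k z := (k / 2 / (k / 2 - Num.min z 0)) ^+ 2.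

Lemma powR_pos1 (q z : R) : 0 < z -> z `^ q = z * z `^ (q - 1).
Proof.
move=> z0; rewrite -{2}(powRr1 (ltW z0)) -powRD; first by rewrite addrC subrK.
by rewrite (gt_eqF z0) implybT.
Qed.

Lemma powR_invM (q z : R) : 0 <= z -> z^-1 `^ q = (z `^ q)^-1.
Proof. by move=> z0; rewrite -powR_inv1// -powRrM mulN1r powRN. Qed.

Section pos_shift.
Variable k : R.
Hypothesis k0 : 0 < k.
Let k20 : 0 < k / 2. Proof. by rewrite divr_gt0. Qed.

Let den_gt0 z : 0 < k / 2 - Num.min z 0.
Proof. by rewrite subr_gt0 (le_lt_trans _ k20)// ge_min lexx orbT. Qed.

Lemma pos_shiftE z : 0 <= z -> pos_shift k z = z + k.
Proof.
move=> z0; rewrite /pos_shift max_l// min_r// subr0 expr2 mulfK ?gt_eqF//.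
by rewrite -addrA -splitr.
Qed.

Lemma pos_shift_ge z : k / 2 <= pos_shift k z.
Proof.
rewrite /pos_shift addrAC lerDr addr_ge0 ?le_max ?lexx ?orbT//.
by rewrite divr_ge0 ?sqr_ge0// ltW.
Qed.

Lemma pos_shift_gt0 z : 0 < pos_shift k z.
Proof. exact: lt_le_trans (pos_shift_ge z). Qed.

Lemma pos_shift'E z : 0 <= z -> pos_shift' k z = 1.
Proof. by move=> z0; rewrite /pos_shift' min_r// subr0 divff ?expr1n// gt_eqF. Qed.

Lemma pos_shift'_bound z : 0 < pos_shift' k z <= 1.
Proof.
have d0 := den_gt0 z; rewrite exprn_gt0 ?divr_gt0//= expr_le1// ?divr_ge0 ?(ltW d0) ?(ltW k20) ?(ltW k0)//.
by rewrite ler_pdivrMr// mul1r lerBrDr gerDl ge_min lexx orbT.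
Qed.

Lemma continuous_pos_shift' : continuous (pos_shift' k).
Proof.
move=> z; have d0 := den_gt0 z; rewrite /pos_shift'.
apply: cvgM; (apply: cvgM; first exact: cvg_cst); (apply: cvgV; first by rewrite gt_eqF);
  apply: cvgB; first [exact: cvg_cst | apply: continuous_min; first [exact: cvg_id|exact: cvg_cst]].
Qed.

Lemma is_derive_pos_shift z : is_derive z (1 : R) (pos_shift k) (pos_shift' k z).
Proof.
pose f1 z := z + k; pose f2 z := k / 2 + (k / 2) ^+ 2 * (k / 2 - z)^-1.
have d1 (w : R) : is_derive w (1 : R) f1 1.
  have -> : f1 = (fun z => id z + cst k z) by [].
  by apply: is_derive_eq; rewrite addr0.
have d2 (w : R) : w <= 0 -> is_derive w (1 : R) f2 ((k / 2 / (k / 2 - w)) ^+ 2).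
  move=> w0; have dw : 0 < k / 2 - w by rewrite subr_gt0 (le_lt_trans w0).
  have h : is_derive w (1 : R) (fun z => k / 2 - z) (- 1).
    have -> : (fun z => k / 2 - z) = (fun z => cst (k / 2) z - id z) by [].
    by apply: is_derive_eq; rewrite sub0r.
  have h2 := @is_deriveV R (fun z => k / 2 - z) w (- 1) 1 (lt0r_neq0 dw) h.
  have h3 := @is_deriveZ R R R (fun z => (k / 2 - z)^-1) ((k / 2) ^+ 2) w 1 _ h2.
  have h4 := @is_deriveD R R R (cst (k / 2)) (fun z => (k / 2) ^+ 2 *: (k / 2 - z)^-1) w 1 0 _ (is_derive_cst _ _ _) h3.
  apply: (@is_derive_eq _ _ _ _ _ _ _ _ h4); rewrite /GRing.scale/= add0r.
  by rewrite mulrN1 opprK [RHS]expr_div_n.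
have E1 (w : R) : 0 <= w -> pos_shift k w = f1 w by exact: pos_shiftE.
have E2 (w : R) : w <= 0 -> pos_shift k w = f2 w.
  by move=> w0; rewrite /pos_shift max_r// min_l// add0r.
have [z0|z0|->] := ltgtP z 0.
- have -> : pos_shift' k z = (k / 2 / (k / 2 - z)) ^+ 2 by rewrite /pos_shift' min_l// ltW.
  apply: is_derive_eq_near (d2 z (ltW z0)).
  by near=> w; rewrite E2// ltW//; near: w; exact: lt_nbhsl.
- rewrite pos_shift'E ?ltW//; apply: is_derive_eq_near (d1 z).
  by near=> w; rewrite E1// ltW//; near: w; exact: lt_nbhsr.
- rewrite pos_shift'E//; apply: (@is_derive_glue _ f1 f2).
  + exact: E1.
  + exact: E2.
  + by move=> w; have [/E1|/ltW/E2] := leP 0 w; [left|right].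
  + by have := d2 0 (lexx 0); rewrite subr0 divff ?expr1n// gt_eqF.
Unshelve. all: by end_near. Qed.

Variables (H H' : R -> R).
Hypothesis dH : forall z, 0 < z -> is_derive z (1 : R) H (H' z).
Hypothesis cH' : forall z, 0 < z -> {for z, continuous H'}.

Lemma is_derive_comp_pos_shift z :
  is_derive z (1 : R) (fun z => H (pos_shift k z)) (H' (pos_shift k z) * pos_shift' k z).
Proof.
have := @is_derive1_comp R H (pos_shift k) z _ _ (dH (pos_shift_gt0 z)) (is_derive_pos_shift z).
exact.
Qed.

Lemma continuous_comp_pos_shift : continuous (fun z => H' (pos_shift k z) * pos_shift' k z).
Proof.
move=> z; apply: cvgM; last exact: continuous_pos_shift'.
apply: (@cvg_comp _ _ _ (pos_shift k) H' _ (nbhs (pos_shift k z))).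
  by apply/differentiable_continuous/derivable1_diffP; have [] := is_derive_pos_shift z.
exact: cH' (pos_shift_gt0 z).
Qed.

Lemma bound_comp_pos_shift (K : R) : (forall z, k / 2 <= z -> `|H' z| <= K) ->
  forall z, `|H' (pos_shift k z) * pos_shift' k z| <= K.
Proof.
move=> HK z; have /andP[h0 h1] := pos_shift'_bound z.
rewrite normrM (ger0_norm (ltW h0)) (le_trans _ (HK _ (pos_shift_ge z)))//.
by rewrite ler_piMr.
Qed.

End pos_shift.

Section theta.
Variables (m l p : R).
Hypotheses (l0 : 0 <= l) (p1 : 1 < p).

(** z theta(z) is z^m if l = 0, and for m > 1, l > 0 a truncation of z^m that grows linearly.
    [theta_mu] and [theta_beta] are the factors in (z theta)' = theta theta_mu and (z theta^p)' =
    theta^p theta_beta. The test function z theta^p corresponds to z^(pm-p+1). *)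
Definition theta z := z `^ (m - 1) * (1 + l * z) `^ (1 - m).
Definition theta_mu z := 1 + (m - 1) / (1 + l * z).
Definition theta_beta z := 1 + p * (m - 1) / (1 + l * z).

Let lz_gt0 z : 0 < z -> 0 < 1 + l * z.
Proof. by move=> z0; rewrite ltr_pwDl// mulr_ge0// ltW. Qed.

Lemma theta_gt0 z : 0 < z -> 0 < theta z.
Proof. by move=> z0; rewrite mulr_gt0// powR_gt0// lz_gt0. Qed.

Lemma continuous_powR_pos (q z : R) : 0 < z -> {for z, continuous (fun x => x `^ q)}.
Proof.
move=> z0; apply/differentiable_continuous/derivable1_diffP.
by apply: derivable_powR; rewrite in_itv/= z0.
Qed.

Lemma continuous_lz z : {for z, continuous (fun x => 1 + l * x)}.
Proof.
apply: cvgD; first exact: cvg_cst.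
by apply: cvgM; [exact: cvg_cst|exact: cvg_id].
Qed.

Lemma continuous_theta z : 0 < z -> {for z, continuous theta}.
Proof.
move=> z0; apply: cvgM; first exact: continuous_powR_pos.
apply: (@cvg_comp _ _ _ (fun x => 1 + l * x) (fun x => x `^ (1 - m)) _ (nbhs (1 + l * z))).
  exact: continuous_lz.
exact: continuous_powR_pos (lz_gt0 z0).
Qed.

Lemma continuous_theta_frac (q z : R) : 0 < z -> {for z, continuous (fun x => 1 + q / (1 + l * x))}.
Proof.
move=> z0; apply: cvgD; first exact: cvg_cst.
apply: cvgM; first exact: cvg_cst.
by apply: cvgV; [rewrite gt_eqF// lz_gt0|exact: continuous_lz].
Qed.

Lemma is_derive_theta z : 0 < z ->
  is_derive z (1 : R) theta (theta z * ((m - 1) / (z * (1 + l * z)))).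
Proof.
move=> z0; have lz := lz_gt0 z0.
have h : is_derive z (1 : R) (fun z => 1 + l * z) l.
  have -> : (fun z => 1 + l * z) = (fun z => cst 1 z + l *: id z) by [].
  by apply: is_derive_eq; rewrite add0r [l%:A]mulr1.
have h1 := is_derive1_powR (m - 1) z0.
have h2 := @is_derive1_comp R (fun x => x `^ (1 - m)) (fun z => 1 + l * z) z _ _
   (is_derive1_powR (1 - m) lz) h.
have h3 := @is_deriveM R R (fun x => x `^ (m - 1)) (fun z => (1 + l * z) `^ (1 - m)) z 1 _ _ h1 h2.
apply: (@is_derive_eq _ _ _ _ _ _ _ _ h3).
rewrite /GRing.scale/= /theta.
rewrite (powR_pos1 (m - 1) z0) (powR_pos1 (1 - m) lz).
by move: (_ `^ (m - 1 - 1)) (_ `^ (1 - m - 1)) => x y; field; rewrite !gt_eqF.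
Qed.

Lemma is_derive_theta_mul z : 0 < z ->
  is_derive z (1 : R) (fun z => z * theta z) (theta z * theta_mu z).
Proof.
move=> z0; have lz := lz_gt0 z0.
have h := @is_deriveM R R id theta z 1 _ _ (is_derive_id z (1 : R)) (is_derive_theta z0).
apply: (@is_derive_eq _ _ _ _ _ _ _ _ h).
rewrite /GRing.scale/= /theta_mu.
by move: (theta z) => x; field; rewrite !gt_eqF.
Qed.

Lemma is_derive_theta_powR z : 0 < z ->
  is_derive z (1 : R) (fun z => z * theta z `^ p) (theta z `^ p * theta_beta z).
Proof.
move=> z0; have lz := lz_gt0 z0; have t0 := theta_gt0 z0.
have h1 := @is_derive1_comp R (fun x => x `^ p) theta z _ _ (is_derive1_powR p t0)
  (is_derive_theta z0).
have h := @is_deriveM R R id (fun z => theta z `^ p) z 1 _ _ (is_derive_id z (1 : R)) h1.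
apply: (@is_derive_eq _ _ _ _ _ _ _ _ h).
rewrite /GRing.scale/= /theta_beta (powR_pos1 p t0).
by move: (theta z) (_ `^ _) => x y; field; rewrite !gt_eqF.
Qed.

Lemma continuous_theta_mul' z : 0 < z -> {for z, continuous (fun z => theta z * theta_mu z)}.
Proof.
move=> z0; apply: cvgM; first exact: continuous_theta.
exact: continuous_theta_frac.
Qed.

Lemma continuous_theta_powR' z : 0 < z ->
  {for z, continuous (fun z => theta z `^ p * theta_beta z)}.
Proof.
move=> z0; apply: cvgM; last exact: continuous_theta_frac.
apply: (@cvg_comp _ _ _ theta (fun x => x `^ p) _ (nbhs (theta z))).
  exact: continuous_theta.
exact: continuous_powR_pos (theta_gt0 z0).
Qed.

Lemma frac_le1 (q z : R) : 0 < z -> `|q / (1 + l * z)| <= `|q|.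
Proof.
move=> z0; have lz := lz_gt0 z0; rewrite normrM normfV (ger0_norm (ltW lz)).
by rewrite ler_pdivrMr// ler_peMr// lerDl mulr_ge0// ltW.
Qed.

Lemma theta_mu_bound z : 0 < z -> `|theta_mu z| <= 1 + `|m - 1|.
Proof.
move=> z0; rewrite /theta_mu (le_trans (ler_normD _ _))// normr1 lerD2l.
exact: frac_le1.
Qed.

Lemma theta_beta_bound z : 0 < z -> `|theta_beta z| <= 1 + p * `|m - 1|.
Proof.
move=> z0; rewrite /theta_beta (le_trans (ler_normD _ _))// normr1 lerD2l.
apply: le_trans (frac_le1 _ z0) _; rewrite normrM [`|p|]ger0_norm//.
by rewrite ltW// (lt_trans ltr01).
Qed.

Hypothesis lm : m <= 1 /\ l = 0 \/ 1 < m /\ 0 < l.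

(** Coercivity of the test function after a fixed choice of sign: for m > 1 [theta_beta] is at least
    1, for m <= 1 it is the constant 1 + p(m - 1). The lower bound degenerates only at the resonance
    m = (p - 1) / p. *)
Lemma theta_beta_sg z : 0 < z ->
  Num.min 1 `|1 + p * (m - 1)| <= Num.sg (1 + p * (m - 1)) * theta_beta z.
Proof.
move=> z0; have lz := lz_gt0 z0; rewrite /theta_beta.
case: lm => [[m1 ->]|[m1 l0']].
  by rewrite mul0r addr0 divr1 -normrEsg ge_min lexx orbT.
have pm : 0 < p * (m - 1) by rewrite mulr_gt0 ?subr_gt0// (lt_trans ltr01).
rewrite gtr0_sg ?ltr_pwDl ?(ltW pm)// mul1r ge_min lerDl divr_ge0 ?(ltW pm) ?(ltW lz)//.
Qed.

Lemma theta_bounded k : 0 < k -> exists2 T : R, 0 <= T & forall z, k <= z -> theta z <= T.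
Proof.
move=> k0; case: lm => [[m1 lE]|[m1 l0']].
  exists (k `^ (m - 1)); first exact: powR_ge0.
  move=> z kz; have z0 : 0 < z by exact: lt_le_trans kz.
  rewrite /theta lE mul0r addr0 powR1 mulr1 -[m - 1]opprB !powRN.
  rewrite lef_pV2 ?posrE ?powR_gt0//; apply: ge0_ler_powR; rewrite ?nnegrE ?subr_ge0//; exact: ltW.
exists (l^-1 `^ (m - 1)); first exact: powR_ge0.
move=> z kz; have z0 : 0 < z by exact: lt_le_trans kz.
have lz := lz_gt0 z0.
rewrite /theta -[1 - m]opprB powRN -powR_invM ?(ltW lz)//.
rewrite -powRM ?invr_ge0 ?(ltW z0) ?(ltW lz)//.
apply: ge0_ler_powR; rewrite ?nnegrE ?subr_ge0 ?divr_ge0 ?invr_ge0 ?(ltW m1) ?(ltW z0) ?(ltW lz)//.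
by rewrite ler_pdivrMr// mulrDr mulr1 mulrA mulVf ?gt_eqF// mul1r lerDr invr_ge0.
Qed.

Lemma theta_le z : 0 < z -> theta z <= z `^ (m - 1).
Proof.
move=> z0; have lz := lz_gt0 z0; rewrite /theta ler_piMr ?powR_ge0//.
case: lm => [[m1 ->]|[m1 l0']]; first by rewrite mul0r addr0 powR1.
rewrite -[1 - m]opprB powRN invf_le1 ?powR_gt0// -[leLHS](powRr0 (1 + l * z)).
by apply: ler_powR; rewrite ?subr_ge0 ?(ltW m1)// lerDl mulr_ge0// ltW.
Qed.

End theta.
End truncations.

(** * Absorption and the pointwise energy inequality *)

Section real_inequalities.
Context {R : realType}.
Implicit Types (p a x y z k : R).

Lemma powR_le_1D (x al be : R) : 0 <= x -> 0 <= al -> al <= be -> x `^ al <= 1 + x `^ be.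
Proof.
move=> x0 al0 albe; have [x1|x1] := leP x 1.
  by rewrite (le_trans (powR_le1_of al0 _)) ?x0// lerDl powR_ge0.
by apply: (le_trans (ler_powR (ltW x1) albe)); rewrite lerDr.
Qed.

Lemma powR_mono (q x y : R) : 0 <= q -> 0 <= x -> x <= y -> x `^ q <= y `^ q.
Proof.
move=> q0 x0 xy; apply: ge0_ler_powR; rewrite ?nnegrE//.
exact: le_trans xy.
Qed.

Lemma powR_anti (q r x : R) : 0 < x -> x <= 1 -> r <= q -> x `^ q <= x `^ r.
Proof.
move=> x0 x1 rq; rewrite -(subrK r q) powRD; last by rewrite (gt_eqF x0) implybT.
by rewrite ler_piMl ?powR_ge0// powR_le1_of ?subr_ge0// (ltW x0).
Qed.

Lemma powRDp (q r x : R) : 0 < x -> x `^ (q + r) = x `^ q * x `^ r.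
Proof. by move=> x0; rewrite powRD// (gt_eqF x0) implybT. Qed.

Section absorption.
Variables (p a lam1 lam2 D M N e th1 th2 th3 : R).
Let e1 := Num.min 1 (p * (1 - th1)).
Let e2 := Num.min 1 (p * (1 - th2)).
Let e3 := Num.min 1 (p * (1 - th3)).
Definition absorption_exp := Num.min (Num.min (e1 / p) e2) e3.
Definition absorption_cst :=
  (a * (2 * p * a + 2 + lam2) * D `^ p / lam1) `^ absorption_exp^-1.
Hypotheses (p1 : 1 < p) (a1 : 1 <= a) (lam10 : 0 < lam1) (lam11 : lam1 <= 1) (lam21 : 1 <= lam2).
Hypotheses (D1 : 1 <= D) (M1 : 1 <= M) (N0 : 0 < N).
Hypotheses (th10 : 0 <= th1) (th11 : th1 < 1) (th20 : 0 <= th2) (th21 : th2 < 1).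
Hypotheses (th30 : 0 <= th3) (th31 : th3 < 1).

Let p0 : 0 < p. Proof. exact: lt_trans p1. Qed.
Let eps := absorption_exp.
Let e10 : 0 < e1. Proof. by rewrite lt_min ltr01 mulr_gt0// subr_gt0. Qed.
Let e20 : 0 < e2. Proof. by rewrite lt_min ltr01 mulr_gt0// subr_gt0. Qed.
Let e30 : 0 < e3. Proof. by rewrite lt_min ltr01 mulr_gt0// subr_gt0. Qed.
Let eps0 : 0 < eps.
Proof. by rewrite /eps /absorption_exp lt_min e30 andbT lt_min e20 andbT divr_gt0. Qed.
Let epse3 : eps <= e3. Proof. by rewrite ge_min; apply/orP; right. Qed.
Let epse2 : eps <= e2.
Proof. by rewrite ge_min; apply/orP; left; rewrite ge_min; apply/orP; right. Qed.
Let epse1 : eps <= e1 / p.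
Proof. by rewrite ge_min; apply/orP; left; rewrite ge_min; apply/orP; left. Qed.
Let eps1 : eps <= 1.
Proof. by rewrite /eps /absorption_exp !ge_min lexx /= orbT. Qed.
Let K := a * (2 * p * a + 2 + lam2) * D `^ p / lam1.

Let K1 : 1 <= K.
Proof.
rewrite /K ler_pdivlMr// mul1r (le_trans lam11)//.
have Dp : 1 <= D `^ p by rewrite -[leLHS](powRr0 D) ler_powR// ltW.
rewrite -[leLHS]mul1r ler_pM//.
rewrite -[leLHS]mul1r ler_pM//.
have : 0 <= p * a by rewrite mulr_ge0 ?(ltW p0)// (le_trans ler01).
rewrite -mulrA; move: (p * a) => pa; move: lam21; lra.
Qed.

Lemma absorption_cst_ge1 : 1 <= absorption_cst.
Proof.
rewrite -[leLHS](powRr0 K); apply: (ler_powR K1).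
by rewrite invr_ge0 ltW.
Qed.

Hypothesis e_ge0 : 0 <= e.
Let T := Num.max e N.
Hypothesis H : lam1 / a * e `^ p <= p * a * N * e `^ (p - 1) +
  p * N * M * (D * T) `^ (p - 1) +
  M `^ (e1 / p) * N `^ (1 - th1) * (D * T) `^ th1 * e `^ (p - 1) +
  M `^ e3 * N `^ (p * (1 - th3)) * (D * T) `^ (p * th3) +
  lam2 * (M `^ e2 * N `^ (p * (1 - th2)) * (D * T) `^ (p * th2)).

(** If e > N, put t = N / e and X = M t. Unless X > 1, where the claim is immediate, division of the
    hypothesis by e^p leaves terms that are all at most multiples of D^p X^eps with eps =
    [absorption_exp], because in each of them the power of M is at most that of t and at least eps.
    Hence 1 <= K X^eps, that is, e <= K^(1/eps) M N. The result is linear in M since the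
    coefficients are measured by the powers M^(e1/p), M^e2, M^e3, which is why M1 contains the roots
    1/epsilon_i. *)
Lemma absorption : T <= absorption_cst * M * N.
Proof.
have c1 := absorption_cst_ge1.
have MN : N <= M * N by rewrite ler_peMl// ltW.
have MN0 : 0 < M * N by exact: lt_le_trans MN.
have fin : N <= absorption_cst * M * N.
  by rewrite -mulrA (le_trans MN)// ler_peMl// ltW.
rewrite /T; have [//|Ne] := leP e N.
have e0 : 0 < e by exact: lt_trans Ne.
have TE : T = e by rewrite /T max_l// ltW.
pose t := N / e; have t0 : 0 < t by rewrite divr_gt0.
have t1 : t <= 1 by rewrite ler_pdivrMr// mul1r ltW.
have NE : N = t * e by rewrite divfK// gt_eqF.
pose X := M * t; have M0 : 0 < M by exact: lt_le_trans M1.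
have X0 : 0 < X by rewrite mulr_gt0.
suff KX : 1 <= K * X `^ eps.
  have : 1 <= absorption_cst * X.
    have eV : 0 <= eps^-1 by rewrite invr_ge0 ltW.
    have := powR_mono eV ler01 KX.
    rewrite powR1 (powRM _ (le_trans ler01 K1) (powR_ge0 _ _)).
    by rewrite -powRrM mulfV ?gt_eqF// powRr1 ?(ltW X0).
  move=> /(ler_wpM2l (ltW e0)); rewrite mulr1 => /le_trans; apply.
  by rewrite /X {1}NE le_eqVlt; apply/orP; left; apply/eqP; ring.
have Dp1 : 1 <= D `^ p by rewrite -[leLHS](powRr0 D) ler_powR// ltW.
have D0 : 0 < D by exact: lt_le_trans D1.
have DX q x : q <= p -> 0 <= x -> x <= X `^ eps -> D `^ q * x <= D `^ p * X `^ eps.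
  by move=> qp x0 xX; apply: ler_pM => //; [exact: powR_ge0|exact: ler_powR].
have [X1|X1] := leP 1 X.
  rewrite -[leLHS]mul1r ler_pM// -[leLHS](powRr0 X) ler_powR//; exact: ltW.
have XX q : eps <= q -> X `^ q <= X `^ eps by move=> h; apply: powR_anti => //; exact: ltW.
have XX1 : X <= X `^ eps by rewrite -[leLHS](powRr1 (ltW X0)) XX.
have tX : t <= X by rewrite /X ler_peMl// ltW.
have Mt q r : eps <= q -> q <= r -> M `^ q * t `^ r <= X `^ eps.
  move=> h1 h2; apply: le_trans (XX q h1); rewrite /X (powRM q (ltW M0) (ltW t0)).
  by rewrite ler_wpM2l ?powR_ge0// powR_anti.
have ep q r s : q + r + s = p -> e `^ q * e `^ r * e `^ s = e `^ p by move=> <-; rewrite !powRDp.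
have E1 : p * a * N * e `^ (p - 1) = p * a * t * e `^ p.
  by rewrite NE (powR_pos1 p e0); ring.
have E2 : p * N * M * (D * T) `^ (p - 1) = p * (D `^ (p - 1) * X) * e `^ p.
  by rewrite TE powRM ?ltW// NE (powR_pos1 p e0) /X; ring.
have E3 : M `^ (e1 / p) * N `^ (1 - th1) * (D * T) `^ th1 * e `^ (p - 1) =
    (D `^ th1 * (M `^ (e1 / p) * t `^ (1 - th1))) * e `^ p.
  rewrite TE powRM ?ltW// NE powRM ?ltW// -(ep (1 - th1) th1 (p - 1)); last by ring.
  by move: (e `^ (1 - th1)) (e `^ th1) (e `^ (p - 1)) => ? ? ?; ring.
have E4 th ee : M `^ ee * N `^ (p * (1 - th)) * (D * T) `^ (p * th) =
    (D `^ (p * th) * (M `^ ee * t `^ (p * (1 - th)))) * e `^ p.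
  rewrite TE powRM ?ltW// NE powRM ?ltW// -(ep (p * (1 - th)) (p * th) 0); last by ring.
  by rewrite powRr0; move: (e `^ _) (e `^ (p * th)) => ? ?; ring.
have epp : 0 < e `^ p by rewrite powR_gt0.
have : lam1 / a <= p * a * t + p * (D `^ (p - 1) * X) +
    D `^ th1 * (M `^ (e1 / p) * t `^ (1 - th1)) +
    D `^ (p * th3) * (M `^ e3 * t `^ (p * (1 - th3))) +
    lam2 * (D `^ (p * th2) * (M `^ e2 * t `^ (p * (1 - th2)))).
  rewrite -(ler_pM2r epp); move: H; rewrite E1 E2 E3 !E4 => /le_trans; apply.
  by rewrite le_eqVlt; apply/orP; left; apply/eqP; ring.
have B1 : t <= D `^ p * X `^ eps.
  by apply: (le_trans tX); apply: (le_trans XX1); rewrite ler_peMl ?powR_ge0.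
have B2 : D `^ (p - 1) * X <= D `^ p * X `^ eps.
  by apply: DX => //; [rewrite gerBl|exact: ltW].
have pthle th : 0 <= th -> th < 1 -> p * th <= p by move=> ? /ltW ?; rewrite ler_piMr// ltW.
have B3 : D `^ th1 * (M `^ (e1 / p) * t `^ (1 - th1)) <= D `^ p * X `^ eps.
  apply: DX; [by rewrite (le_trans (ltW th11))// ltW|by rewrite mulr_ge0 ?powR_ge0|].
  apply: (Mt _ _ epse1).
  by rewrite ler_pdivrMr// mulrC /e1 ge_min lexx orbT.
have B4 : D `^ (p * th3) * (M `^ e3 * t `^ (p * (1 - th3))) <= D `^ p * X `^ eps.
  apply: DX; [exact: pthle|by rewrite mulr_ge0 ?powR_ge0|].
  apply: (Mt _ _ epse3).
  by rewrite /e3 ge_min lexx orbT.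
have B5 : D `^ (p * th2) * (M `^ e2 * t `^ (p * (1 - th2))) <= D `^ p * X `^ eps.
  apply: DX; [exact: pthle|by rewrite mulr_ge0 ?powR_ge0|].
  apply: (Mt _ _ epse2).
  by rewrite /e2 ge_min lexx orbT.
set Y := D `^ p * X `^ eps in B1 B2 B3 B4 B5.
move: B1 B2 B3 B4 B5; set y2 := _ * X; set y3 := D `^ th1 * _; set y4 := D `^ (p * th3) * _;
  set y5 := D `^ (p * th2) * _ => B1 B2 B3 B4 B5 HH.
have a0 : 0 < a by exact: lt_le_trans a1.
have Y0 : 0 <= Y by rewrite mulr_ge0 ?powR_ge0.
have pa0 : 0 <= p * a by rewrite mulr_ge0// ltW.
have ppa : p <= p * a by rewrite ler_peMr// ltW.
have HY : lam1 / a <= (2 * p * a + 2 + lam2) * Y.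
  apply: (le_trans HH).
  have h1 := ler_wpM2l pa0 B1.
  have h2 : p * y2 <= p * a * Y by apply: ler_pM => //; rewrite ?(ltW p0)// mulr_ge0 ?powR_ge0// ltW.
  have h5 : lam2 * y5 <= lam2 * Y by rewrite ler_wpM2l// (le_trans ler01).
  have -> : (2 * p * a + 2 + lam2) * Y = 2 * (p * a * Y) + 2 * Y + lam2 * Y by ring.
  move: h1 h2 h5 B3 B4; move: (p * a * t) (p * y2) (p * a * Y) (lam2 * y5) (lam2 * Y) => ? ? ? ? ?.
  lra.
have -> : K * X `^ eps = (a / lam1) * ((2 * p * a + 2 + lam2) * Y).
  by rewrite /K /Y; ring.
have al0 : 0 < a / lam1 by rewrite divr_gt0.
have := ler_wpM2l (ltW al0) HY; rewrite {1}(_ : a / lam1 * (lam1 / a) = 1)//.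
by field; rewrite !gt_eqF.
Qed.

End absorption.

Section pointwise_energy.
Variables (p a gamma psi delta lam1 lam2 k : R).
Hypotheses (p1 : 1 < p) (a1 : 0 < a) (k0 : 0 < k) (gamma1 : 1 < gamma) (gammap : gamma < p).
Hypotheses (psi1 : 1 < psi) (psip : psi < p) (delta1 : 1 < delta) (deltap : delta < p).
Variables (b c d e f g h : R).
Hypotheses (b0 : 0 <= b) (c0 : 0 <= c) (d0 : 0 <= d) (e0 : 0 <= e) (f0 : 0 <= f)
  (g0 : 0 <= g) (h0 : 0 <= h).
Variables (eta qeta u Y th beta s At X1 X2 Bv : R).
Let z := u + k.
Hypotheses (eta0 : 0 <= eta) (qeta0 : 0 <= qeta) (u0 : 0 <= u) (Y0 : 0 <= Y) (th0 : 0 <= th).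
Hypotheses (s1 : `|s| <= 1) (lam20 : 0 <= lam2) (sb1 : lam1 <= s * beta) (sb2 : `|beta| <= lam2) (lam10 : 0 <= lam1).
Hypotheses (At0 : 0 <= At) (HAt : At <= a * Y `^ (p - 1) + b * u `^ (gamma - 1) + e).
Hypotheses (HX1 : `|X1| <= qeta * At) (HX2 : a^-1 * Y `^ p - h * u `^ gamma - g <= X2).
Hypothesis HB : `|Bv| <= c * Y `^ (psi - 1) + d * u `^ (delta - 1) + f.

(** Because z >= k, one has 1 <= z^(p-1) k^(1-p), so free terms and powers with exponents below p
    are dominated by the top power of z, at the price of the augmented coefficients. X1, X2 and Bv
    stand for grad eta . A, grad u . A and the right-hand side, and s is the sign that makes the
    term with X2 coercive. *)
Lemma pointwise_energy :
  lam1 / a * (eta * (th * Y)) `^ p <=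
  p * (z * th * qeta) * (a * (eta * (th * Y)) `^ (p - 1) +
     (b + (b + e) * k `^ (1 - p)) * (eta * (z * th)) `^ (p - 1)) +
  eta * (z * th) * (c * (eta * (th * Y)) `^ (p - 1) +
     (d + (c + d + f) * k `^ (1 - p)) * (eta * (z * th)) `^ (p - 1)) +
  lam2 * ((h + (g + h) * k `^ (- p)) * (eta * (z * th)) `^ p) +
  s * (z * th `^ p * (p * eta `^ (p - 1)) * X1 + eta `^ p * (th `^ p * beta) * X2 +
       eta `^ p * (z * th `^ p) * Bv).
Proof.
have p0 : 0 < p by exact: lt_trans p1.
have p10 : 0 <= p - 1 by rewrite subr_ge0 ltW.
have kz : k <= z by rewrite /z lerDr.
have z0 : 0 < z by exact: lt_le_trans kz.
have uz : u <= z by rewrite /z lerDl ltW.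
pose zp := z `^ (p - 1).
have zp0 : 0 <= zp by exact: powR_ge0.
have kzp : 1 <= zp * k `^ (1 - p).
  rewrite -[1 - p]opprB powRN ler_pdivlMr ?powR_gt0// mul1r; apply: powR_mono => //; exact: ltW.
have uzp : u `^ (p - 1) <= zp by apply: powR_mono.
have k1p : 0 <= k `^ (1 - p) by exact: powR_ge0.
have u1 al : 1 < al -> al < p -> u `^ (al - 1) <= zp * k `^ (1 - p) + zp.
  move=> al1 alp; apply: le_trans (powR_le_1D u0 _ _) _; last exact: lerD kzp uzp.
    by rewrite subr_ge0 ltW.
  by rewrite lerD2r ltW.
have HA : At <= a * Y `^ (p - 1) + (b + (b + e) * k `^ (1 - p)) * zp.
  apply: (le_trans HAt); have h1 := ler_wpM2l b0 (u1 _ gamma1 gammap).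
  have h2 : e <= e * (zp * k `^ (1 - p)) by rewrite ler_peMr.
  rewrite -addrA lerD2l; move: h1 h2; move: (u `^ _) (k `^ _) => x y h1 h2.
  have -> : (b + (b + e) * y) * zp = b * (zp * y + zp) + e * (zp * y) by ring.
  exact: lerD.
have HBv : `|Bv| <= c * Y `^ (p - 1) + (d + (c + d + f) * k `^ (1 - p)) * zp.
  apply: (le_trans HB); have h1 := ler_wpM2l d0 (u1 _ delta1 deltap).
  have h2 : f <= f * (zp * k `^ (1 - p)) by rewrite ler_peMr.
  have h3 : c * Y `^ (psi - 1) <= c * (zp * k `^ (1 - p) + Y `^ (p - 1)).
    have q1 : 0 <= psi - 1 by rewrite subr_ge0 ltW.
    have q2 : psi - 1 <= p - 1 by rewrite lerD2r ltW.
    rewrite ler_wpM2l//; apply: le_trans (powR_le_1D Y0 q1 q2) _.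
    by rewrite lerD2r.
  move: h1 h2 h3; move: (u `^ _) (k `^ _) (Y `^ (psi - 1)) (Y `^ (p - 1)) => x y v w h1 h2 h3.
  have -> : c * w + (d + (c + d + f) * y) * zp =
     c * (zp * y + w) + d * (zp * y + zp) + f * (zp * y) by ring.
  by rewrite !lerD.
have HH : h * u `^ gamma + g <= (h + (g + h) * k `^ (- p)) * z `^ p.
  have h1 : u `^ gamma <= z `^ p * k `^ (- p) + z `^ p.
    apply: le_trans (powR_le_1D u0 _ (ltW gammap)) _; first by rewrite ltW// (lt_trans ltr01).
    apply: lerD; last by apply: powR_mono => //; exact: ltW.
    rewrite powRN ler_pdivlMr ?powR_gt0// mul1r; apply: powR_mono => //; exact: ltW.
  have h2 : g <= g * (z `^ p * k `^ (- p)).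
    rewrite ler_peMr// powRN ler_pdivlMr ?powR_gt0// mul1r; apply: powR_mono => //; exact: ltW.
  have := lerD (ler_wpM2l h0 h1) h2; move=> /le_trans; apply.
  by rewrite le_eqVlt; apply/orP; left; apply/eqP; ring.
pose T1 := eta `^ (p - 1); pose tp := th `^ (p - 1).
have T10 : 0 <= T1 by exact: powR_ge0.
have tp0 : 0 <= tp by exact: powR_ge0.
have etap : eta `^ p = eta * T1 by rewrite mulr_powRB1.
have thp : th `^ p = th * tp by rewrite mulr_powRB1.
have Ey : (eta * (th * Y)) `^ (p - 1) = T1 * (tp * Y `^ (p - 1)) by rewrite !powRM ?mulr_ge0.
have Ew : (eta * (z * th)) `^ (p - 1) = T1 * (zp * tp) by rewrite !powRM ?mulr_ge0 ?(ltW z0).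
have Eyp : (eta * (th * Y)) `^ p = eta `^ p * (th `^ p * Y `^ p) by rewrite !powRM ?mulr_ge0.
have Ewp : (eta * (z * th)) `^ p = eta `^ p * (z `^ p * th `^ p).
  by rewrite !powRM ?mulr_ge0 ?(ltW z0).
rewrite Ey Ew Eyp Ewp.
have sX (x y : R) : `|x| <= y -> - y <= s * x.
  move=> xy; have := ler_norm (- (s * x)); rewrite normrN normrM.
  have := ler_piMl (normr_ge0 x) s1; move: xy.
  by move: `|x| (`|s| * `|x|) (s * x) => ? ? ?; lra.
have G0 : 0 <= z * th `^ p * (p * T1).
  by rewrite !mulr_ge0 ?powR_ge0 ?(ltW z0) ?(ltW p0).
have i1 : - (z * th `^ p * (p * T1) * (qeta * (a * Y `^ (p - 1) +
    (b + (b + e) * k `^ (1 - p)) * zp))) <= s * (z * th `^ p * (p * T1) * X1).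
  apply: sX; rewrite normrM (ger0_norm G0) ler_wpM2l//.
  by apply: (le_trans HX1); rewrite ler_wpM2l.
have i3 : - (eta `^ p * (z * th `^ p) * (c * Y `^ (p - 1) +
    (d + (c + d + f) * k `^ (1 - p)) * zp)) <= s * (eta `^ p * (z * th `^ p) * Bv).
  have G1 : 0 <= eta `^ p * (z * th `^ p) by rewrite !mulr_ge0 ?powR_ge0 ?(ltW z0).
  by apply: sX; rewrite normrM (ger0_norm G1) ler_wpM2l.
have i2 : eta `^ p * th `^ p * (lam1 / a * Y `^ p - lam2 * ((h + (g + h) * k `^ (- p)) * z `^ p))
    <= s * (eta `^ p * (th `^ p * beta) * X2).
  rewrite (_ : s * _ = eta `^ p * th `^ p * (s * beta * X2)); last by ring.
  rewrite ler_wpM2l ?mulr_ge0 ?powR_ge0//.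
  have sb0 : 0 <= s * beta by exact: le_trans sb1.
  have sbl : s * beta <= lam2.
    apply: le_trans (ler_norm _) _; rewrite normrM (le_trans _ sb2)//.
    by rewrite ler_piMl.
  apply: le_trans (ler_wpM2l sb0 HX2).
  have yp0 : 0 <= a^-1 * Y `^ p by rewrite mulr_ge0 ?powR_ge0// invr_ge0 ltW.
  have hg0 : 0 <= h * u `^ gamma + g by rewrite addr_ge0// mulr_ge0// powR_ge0.
  have j1 := ler_wpM2r yp0 sb1.
  have j2 : s * beta * (h * u `^ gamma + g) <= lam2 * ((h + (g + h) * k `^ (- p)) * z `^ p).
    by apply: ler_pM.
  have -> : s * beta * (a^-1 * Y `^ p - h * u `^ gamma - g) =
     s * beta * (a^-1 * Y `^ p) - s * beta * (h * u `^ gamma + g) by ring.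
  have -> : lam1 / a * Y `^ p = lam1 * (a^-1 * Y `^ p) by rewrite mulrA.
  exact: lerB.
rewrite !mulrDr.
set V1 := s * _ in i1 *; set V3 := s * (_ * Bv) in i3 *; set V2 := s * (_ * X2) in i2 *.
move: i1 i2 i3; rewrite etap thp.
move: (Y `^ (p - 1)) (Y `^ p) (k `^ (1 - p)) (k `^ (- p)) (z `^ p) V1 V2 V3 => y1 yp kp kpp zpp V1 V2 V3.
move=> i1 i2 i3.
have := lerD (lerD i1 i2) i3; clear -k0; move=> hh.
rewrite -subr_ge0; rewrite -subr_ge0 in hh; apply: le_trans hh _.
rewrite le_eqVlt; apply/orP; left; apply/eqP; ring.
Qed.

End pointwise_energy.
End real_inequalities.

(** * Averaged energy inequality and absorption *)

Section averaged_absorption.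
Context {R : realType} {n : nat}.
Local Notation E := 'rV[R]_n.+1.
Local Opaque meas_fun.
Variable B : set E.
Hypotheses (mB : measurable (B : set (Rn R n))) (B_gt0 : (0 < @leb R n B)%E).
Hypothesis B_lty : (@leb R n B < +oo)%E.
Local Notation avgR f := (avg B (fun x => (f x)%:E)).
Variables (p sigma : R).
Hypotheses (p1 : 1 < p) (s1 : 1 < sigma).
Let sg' := dual_exp sigma.
Let p0 : 0 < p. Proof. exact: lt_trans p1. Qed.
Let sg0 : 0 < sigma. Proof. exact: lt_trans s1. Qed.
Let sm0 : 0 < sigma - 1. Proof. by rewrite subr_gt0. Qed.
Let sg'0 : 0 < sg'. Proof. by rewrite divr_gt0. Qed.
Let pm0 : 0 < p - 1. Proof. by rewrite subr_gt0. Qed.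
Variables (w Y V : E -> R) (N S e r : R).
Hypotheses (mw : meas_fun B w) (mY : meas_fun B Y) (mV : meas_fun B V).
Hypotheses (w0 : forall x, B x -> 0 <= w x) (Y0 : forall x, B x -> 0 <= Y x)
  (V0 : forall x, B x -> 0 <= V x).
Hypotheses (N0 : 0 <= N) (S0 : 0 <= S) (e0 : 0 <= e) (r0 : 0 < r).
Hypotheses (Hw : (avgR (fun x => w x `^ p)%R <= (N `^ p)%:E)%E)
  (HS : (avgR (fun x => w x `^ (p * sigma))%R <= (S `^ (p * sigma))%:E)%E)
  (HY : avgR (fun x => Y x `^ p)%R = ((e / r) `^ p)%:E)
  (HV : (avgR (fun x => V x `^ p)%R <= ((N / r) `^ p)%:E)%E).

Let powRK (x q s : R) : 0 <= x -> q != 0 -> (x `^ q) `^ (s / q) = x `^ s.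
Proof. by move=> x0 q0; rewrite -powRrM mulrCA mulfV// mulr1. Qed.

Let powRK1 (x q : R) : 0 <= x -> q != 0 -> (x `^ q) `^ q^-1 = x.
Proof. by move=> x0 q0; rewrite -[q^-1]mul1r powRK// powRr1. Qed.

Let pn0 : p != 0. Proof. by rewrite gt_eqF. Qed.
Let psn0 : p * sigma != 0. Proof. by rewrite gt_eqF// mulr_gt0. Qed.

Let avg1 : (avgR (fun=> 1)%R <= 1%:E)%E.
Proof. by rewrite avg_cst. Qed.

Let er0 : 0 <= e / r. Proof. by rewrite divr_ge0 ?(ltW r0). Qed.
Let nr0 : 0 <= N / r. Proof. by rewrite divr_ge0 ?(ltW r0). Qed.

Lemma avg_grad_term : (avgR (fun x => V x * Y x `^ (p - 1))%R <=
  (N / r * (e / r) `^ (p - 1))%:E)%E.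
Proof.
have m1 : meas_fun B (fun x => V x `^ p) by meas.
have m2 : meas_fun B (fun x => Y x `^ p) by meas.
have HY' : (avgR (fun x => Y x `^ p)%R <= ((e / r) `^ p)%:E)%E by rewrite HY.
have := avg_holder4 mB B_gt0 B_lty m1 m2 (@meas_cst R n B 1) (@meas_cst R n B 1).
move=> /(_ _ _ 1 1 p^-1 ((p - 1) / p) 0 0 _ (powR_ge0 _ _) (powR_ge0 _ _) ler01 ler01 _ _ _ _ _ HV HY' avg1 avg1).
rewrite powRK1// powRK// !powRr0 !mulr1 => H.
have q1 : 0 <= p^-1 by rewrite invr_ge0 ltW.
have q2 : 0 <= (p - 1) / p by apply: divr_ge0; exact: ltW.
have qs : p^-1 + (p - 1) / p + 0 + 0 <= 1.
  by rewrite !addr0 le_eqVlt; apply/orP; left; apply/eqP; field.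
rewrite (eq_avg (g := fun x => (V x `^ p) `^ p^-1 * (Y x `^ p) `^ ((p - 1) / p) * 1 * 1)).
  apply: (H _ q1 q2 (lexx 0) (lexx 0) qs).
  by move=> x Bx; rewrite !powR_ge0.
by move=> x Bx; rewrite powRK1 ?V0// powRK ?Y0// !mulr1.
Qed.

(** Hoelder exponents 1/p for V, 1/Bx for b and (p - 1)/(p sigma) for the power of w. The lower
    bound p' sigma' for Bx says precisely that their sum is at most 1. *)
Lemma avg_b_term (b : E -> R) (Bx beta : R) : meas_fun B b -> (forall x, B x -> 0 <= b x) ->
  0 <= beta -> dual_exp p * sg' <= Bx -> (avgR (fun x => b x `^ Bx)%R <= (beta `^ Bx)%:E)%E ->
  (avgR (fun x => V x * b x * w x `^ (p - 1))%R <= (N / r * beta * S `^ (p - 1))%:E)%E.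
Proof.
move=> mb b0 be0 HB Hb.
have ps' : 0 < dual_exp p * sg' by rewrite mulr_gt0// divr_gt0.
have Bx0 : 0 < Bx by exact: lt_le_trans HB.
have Bn0 : Bx != 0 by rewrite gt_eqF.
have m1 : meas_fun B (fun x => V x `^ p) by meas.
have m2 : meas_fun B (fun x => b x `^ Bx) by meas.
have m3 : meas_fun B (fun x => w x `^ (p * sigma)) by meas.
have := avg_holder4 mB B_gt0 B_lty m1 m2 m3 (@meas_cst R n B 1).
move=> /(_ _ _ _ 1 p^-1 Bx^-1 ((p - 1) / (p * sigma)) 0 _ (powR_ge0 _ _) (powR_ge0 _ _) (powR_ge0 _ _)
  ler01 _ _ _ _ _ HV Hb HS avg1).
rewrite !powRK1// powRK// !powRr0 !mulr1 => H.
have q1 : 0 <= p^-1 by rewrite invr_ge0 ltW.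
have q2 : 0 <= Bx^-1 by rewrite invr_ge0 ltW.
have q3 : 0 <= (p - 1) / (p * sigma) by apply: divr_ge0; [|apply: mulr_ge0]; exact: ltW.
have qs : p^-1 + Bx^-1 + (p - 1) / (p * sigma) + 0 <= 1.
  rewrite addr0; apply: (@le_trans _ _ (p^-1 + (dual_exp p * sg')^-1 + (p - 1) / (p * sigma))).
    by rewrite lerD2r lerD2l lef_pV2.
  by rewrite /sg' /dual_exp le_eqVlt; apply/orP; left; apply/eqP; field; rewrite !gt_eqF.
rewrite (eq_avg (g := fun x => (V x `^ p) `^ p^-1 * (b x `^ Bx) `^ Bx^-1 *
   (w x `^ (p * sigma)) `^ ((p - 1) / (p * sigma)) * 1)).
  apply: (H _ q1 q2 q3 (lexx 0) qs).
  by move=> x Bx'; rewrite !powR_ge0.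
by move=> x Bx'; rewrite !powRK1 ?V0 ?b0// powRK ?w0// !mulr1.
Qed.

(** w is interpolated between L^p and L^(p sigma) with weight [th] = p sigma' / Cx, which makes the
    four Hoelder exponents add up to 1. The strict inequality for Cx leaves a positive power of
    N. *)
Lemma avg_c_term (c : E -> R) (Cx beta : R) : meas_fun B c -> (forall x, B x -> 0 <= c x) ->
  0 <= beta -> p * sg' < Cx -> (avgR (fun x => c x `^ Cx)%R <= (beta `^ Cx)%:E)%E ->
  (avgR (fun x => w x * (c x * Y x `^ (p - 1)))%R <=
    (beta * (e / r) `^ (p - 1) * N `^ (1 - p * sg' / Cx) * S `^ (p * sg' / Cx))%:E)%E.
Proof.
move=> mc c0 be0 HC Hc; set th := p * sg' / Cx.
have ps' : 0 < p * sg' by rewrite mulr_gt0.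
have Cx0 : 0 < Cx by exact: lt_trans HC.
have Cn0 : Cx != 0 by rewrite gt_eqF.
have th0 : 0 < th by rewrite divr_gt0.
have th1 : th < 1 by rewrite ltr_pdivrMr// mul1r.
have HY' : (avgR (fun x => Y x `^ p)%R <= ((e / r) `^ p)%:E)%E by rewrite HY.
have m1 : meas_fun B (fun x => c x `^ Cx) by meas.
have m2 : meas_fun B (fun x => Y x `^ p) by meas.
have m3 : meas_fun B (fun x => w x `^ p) by meas.
have m4 : meas_fun B (fun x => w x `^ (p * sigma)) by meas.
have := avg_holder4 mB B_gt0 B_lty m1 m2 m3 m4.
move=> /(_ _ _ _ _ Cx^-1 ((p - 1) / p) ((1 - th) / p) (th / (p * sigma)) _ (powR_ge0 _ _) (powR_ge0 _ _)
  (powR_ge0 _ _) (powR_ge0 _ _) _ _ _ _ _ Hc HY' Hw HS).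
rewrite powRK1// !powRK// => H.
have q1 : 0 <= Cx^-1 by rewrite invr_ge0 ltW.
have q2 : 0 <= (p - 1) / p by apply: divr_ge0; exact: ltW.
have q3 : 0 <= (1 - th) / p by apply: divr_ge0; rewrite ?subr_ge0; exact: ltW.
have q4 : 0 <= th / (p * sigma) by apply: divr_ge0; [|apply: mulr_ge0]; exact: ltW.
have qs : Cx^-1 + (p - 1) / p + (1 - th) / p + th / (p * sigma) <= 1.
  rewrite /th /sg' /dual_exp le_eqVlt; apply/orP; left; apply/eqP.
  by field; rewrite !gt_eqF.
rewrite (eq_avg (g := fun x => (c x `^ Cx) `^ Cx^-1 * (Y x `^ p) `^ ((p - 1) / p) *
  (w x `^ p) `^ ((1 - th) / p) * (w x `^ (p * sigma)) `^ (th / (p * sigma)))).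
  apply: (H _ q1 q2 q3 q4 qs).
  by move=> x Bx'; rewrite !powR_ge0.
move=> x Bx'; rewrite powRK1 ?c0// !powRK ?w0 ?Y0// -mulrA -powRD; last first.
  by rewrite subrK oner_eq0.
by rewrite subrK powRr1 ?w0// mulrC.
Qed.

(** As for c, but with all of w^p interpolated, so the weight is sigma' / Dx. It serves for d and
    for h. *)
Lemma avg_d_term (d : E -> R) (Dx beta : R) : meas_fun B d -> (forall x, B x -> 0 <= d x) ->
  0 <= beta -> sg' < Dx -> (avgR (fun x => d x `^ Dx)%R <= (beta `^ Dx)%:E)%E ->
  (avgR (fun x => d x * w x `^ p)%R <=
    (beta * N `^ (p * (1 - sg' / Dx)) * S `^ (p * (sg' / Dx)))%:E)%E.
Proof.
move=> md d0 be0 HD Hd; set th := sg' / Dx.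
have Dx0 : 0 < Dx by exact: lt_trans HD.
have Dn0 : Dx != 0 by rewrite gt_eqF.
have th0 : 0 < th by rewrite divr_gt0.
have th1 : th < 1 by rewrite ltr_pdivrMr// mul1r.
have m1 : meas_fun B (fun x => d x `^ Dx) by meas.
have m3 : meas_fun B (fun x => w x `^ p) by meas.
have m4 : meas_fun B (fun x => w x `^ (p * sigma)) by meas.
have := avg_holder4 mB B_gt0 B_lty m1 m3 m4 (@meas_cst R n B 1).
move=> /(_ _ _ _ 1 Dx^-1 ((p * (1 - th)) / p) ((p * th) / (p * sigma)) 0 _ (powR_ge0 _ _)
  (powR_ge0 _ _) (powR_ge0 _ _) ler01 _ _ _ _ _ Hd Hw HS avg1).
rewrite powRK1// !powRK// !powRr0 !mulr1 => H.
have q1 : 0 <= Dx^-1 by rewrite invr_ge0 ltW.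
have q2 : 0 <= p * (1 - th) / p by apply: divr_ge0; [apply: mulr_ge0; rewrite ?subr_ge0|]; exact: ltW.
have q3 : 0 <= p * th / (p * sigma) by apply: divr_ge0; apply: mulr_ge0; exact: ltW.
have qs : Dx^-1 + p * (1 - th) / p + p * th / (p * sigma) + 0 <= 1.
  rewrite /th /sg' /dual_exp le_eqVlt; apply/orP; left; apply/eqP.
  by field; rewrite !gt_eqF.
rewrite (eq_avg (g := fun x => (d x `^ Dx) `^ Dx^-1 * (w x `^ p) `^ ((p * (1 - th)) / p) *
  (w x `^ (p * sigma)) `^ ((p * th) / (p * sigma)) * 1)).
  apply: (H _ q1 q2 q3 (lexx 0) qs).
  by move=> x Bx'; rewrite !powR_ge0.
move=> x Bx'; rewrite powRK1 ?d0// !powRK ?w0// mulr1 -mulrA -powRD; last first.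
  by rewrite -mulrDr subrK mulr1 (gt_eqF p0).
by rewrite -mulrDr subrK mulr1.
Qed.

Variables (a lam1 lam2 D M Bx Cx Dx Hx : R) (b c d h : E -> R).
Hypotheses (a1 : 1 <= a) (lam10 : 0 < lam1) (lam11 : lam1 <= 1) (lam21 : 1 <= lam2).
Hypotheses (D1 : 1 <= D) (M1 : 1 <= M) (Np : 0 < N) (SE : S = D * Num.max e N).
Hypotheses (HBx : dual_exp p * sg' <= Bx) (HCx : p * sg' < Cx) (HDx : sg' < Dx) (HHx : sg' < Hx).
Let th1 := p * sg' / Cx.
Let th2 := sg' / Hx.
Let th3 := sg' / Dx.
Let e1 := Num.min 1 (p * (1 - th1)).
Let e2 := Num.min 1 (p * (1 - th2)).
Let e3 := Num.min 1 (p * (1 - th3)).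
Hypotheses (mb : meas_fun B b) (mc : meas_fun B c) (md : meas_fun B d) (mh : meas_fun B h).
Hypotheses (b0 : forall x, B x -> 0 <= b x) (c0 : forall x, B x -> 0 <= c x)
  (d0 : forall x, B x -> 0 <= d x) (h0 : forall x, B x -> 0 <= h x).
Hypotheses (Hb : (avgR (fun x => b x `^ Bx)%R <= ((M / r `^ (p - 1)) `^ Bx)%:E)%E)
  (Hc : (avgR (fun x => c x `^ Cx)%R <= ((M `^ (e1 / p) / r) `^ Cx)%:E)%E)
  (Hd : (avgR (fun x => d x `^ Dx)%R <= ((M `^ e3 / r `^ p) `^ Dx)%:E)%E)
  (Hh : (avgR (fun x => h x `^ Hx)%R <= ((M `^ e2 / r `^ p) `^ Hx)%:E)%E).
Hypothesis Hen : (intU B (fun x => lam1 / a * Y x `^ p)%R <= intU B (fun x =>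
  p * V x * (a * Y x `^ (p - 1) + b x * w x `^ (p - 1)) +
  w x * (c x * Y x `^ (p - 1) + d x * w x `^ (p - 1)) + lam2 * (h x * w x `^ p))%R)%E.

Let T := Num.max e N.

(** After the four Hoelder estimates every term carries the factor r^(-p), so the radius drops out
    and [absorption] applies to plain numbers. *)
Lemma avg_absorption : T <= absorption_cst p a lam1 lam2 D th1 th2 th3 * M * N.
Proof.
have a0 : 0 < a by exact: lt_le_trans a1.
have lam20 : 0 <= lam2 by exact: le_trans lam21.
have pa0 : 0 <= p * a by rewrite mulr_ge0// ltW.
have Cx0 : 0 < Cx by apply: lt_trans HCx; rewrite mulr_gt0.
have Hx0 : 0 < Hx by exact: lt_trans HHx.
have Dx0 : 0 < Dx by exact: lt_trans HDx.
have th10 : 0 <= th1 by apply: divr_ge0; [apply: mulr_ge0|]; exact: ltW.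
have th11 : th1 < 1 by rewrite ltr_pdivrMr ?mul1r.
have th20 : 0 <= th2 by apply: divr_ge0; exact: ltW.
have th21 : th2 < 1 by rewrite ltr_pdivrMr ?mul1r.
have th30 : 0 <= th3 by apply: divr_ge0; exact: ltW.
have th31 : th3 < 1 by rewrite ltr_pdivrMr ?mul1r.
have M0 : 0 < M by exact: lt_le_trans M1.
have be1 : 0 <= M / r `^ (p - 1) by rewrite divr_ge0 ?powR_ge0// ltW.
have be2 : 0 <= M `^ (e1 / p) / r by rewrite divr_ge0 ?powR_ge0// ltW.
have be3 : 0 <= M `^ e3 / r `^ p by rewrite divr_ge0 ?powR_ge0.
have be4 : 0 <= M `^ e2 / r `^ p by rewrite divr_ge0 ?powR_ge0.
have H1 := avg_grad_term.
have H2 := avg_b_term mb b0 be1 HBx Hb.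
have H3 := avg_c_term mc c0 be2 HCx Hc.
have H4 := avg_d_term md d0 be3 HDx Hd.
have H5 := avg_d_term mh h0 be4 HHx Hh.
pose t1 x := V x * Y x `^ (p - 1).
pose t2 x := V x * b x * w x `^ (p - 1).
pose t3 x := w x * (c x * Y x `^ (p - 1)).
pose t4 x := d x * w x `^ p.
pose t5 x := h x * w x `^ p.
have [m1 m2 m3] : [/\ meas_fun B t1, meas_fun B t2 & meas_fun B t3].
  by split; rewrite /t1 /t2 /t3; meas.
have [m4 m5] : meas_fun B t4 /\ meas_fun B t5 by split; rewrite /t4 /t5; meas.
have [z1 z2 z3] : [/\ forall x, B x -> 0 <= t1 x, forall x, B x -> 0 <= t2 x &
    forall x, B x -> 0 <= t3 x].
  by split=> x Bx'; rewrite !mulr_ge0 ?powR_ge0 ?V0 ?w0 ?b0 ?c0.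
have [z4 z5] : (forall x, B x -> 0 <= t4 x) /\ (forall x, B x -> 0 <= t5 x).
  by split=> x Bx'; rewrite !mulr_ge0 ?powR_ge0 ?d0 ?h0.
have key : (avgR (fun x => lam1 / a * Y x `^ p)%R <=
    avgR (fun x => p * a * t1 x + (p * t2 x + (t3 x + (t4 x + lam2 * t5 x))))%R)%E.
  rewrite [X in (_ <= X)%E](eq_avg (g := fun x =>
    p * V x * (a * Y x `^ (p - 1) + b x * w x `^ (p - 1)) +
    w x * (c x * Y x `^ (p - 1) + d x * w x `^ (p - 1)) + lam2 * (h x * w x `^ p))).
    apply: lee_wpmul2l; last exact: Hen.
    by rewrite lee_fin invr_ge0 ltW// vol_gt0.
  by move=> x Bx'; rewrite /t1 /t2 /t3 /t4 /t5 -(mulr_powRB1 (w0 Bx') p0); ring.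
move: key.
have mq5 : meas_fun B (fun x => lam2 * t5 x) by meas.
have zq5 x : B x -> 0 <= lam2 * t5 x by move=> Bx'; rewrite mulr_ge0 ?z5.
have mq4 : meas_fun B (fun x => t4 x + lam2 * t5 x) by meas.
have zq4 x : B x -> 0 <= t4 x + lam2 * t5 x by move=> Bx'; rewrite addr_ge0 ?z4 ?zq5.
have mq3 : meas_fun B (fun x => t3 x + (t4 x + lam2 * t5 x)) by meas.
have zq3 x : B x -> 0 <= t3 x + (t4 x + lam2 * t5 x) by move=> Bx'; rewrite addr_ge0 ?z3 ?zq4.
have mq2 : meas_fun B (fun x => p * t2 x) by meas.
have zq2 x : B x -> 0 <= p * t2 x by move=> Bx'; rewrite mulr_ge0 ?z2// ltW.
have mq1 : meas_fun B (fun x => p * a * t1 x) by meas.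
have zq1 x : B x -> 0 <= p * a * t1 x by move=> Bx'; rewrite mulr_ge0 ?z1.
have mq23 : meas_fun B (fun x => p * t2 x + (t3 x + (t4 x + lam2 * t5 x))) by meas.
have zq23 x : B x -> 0 <= p * t2 x + (t3 x + (t4 x + lam2 * t5 x)).
  by move=> Bx'; rewrite addr_ge0 ?zq2 ?zq3.
have mYp : meas_fun B (fun x => Y x `^ p) by meas.
have Yp0 x : B x -> 0 <= Y x `^ p by move=> _; exact: powR_ge0.
have la0 : 0 <= lam1 / a by apply: divr_ge0; exact: ltW.
rewrite (avgZ mB la0 mYp Yp0) HY.
rewrite (avgD mB mq1 mq23 zq1 zq23) (avgD mB mq2 mq3 zq2 zq3).
rewrite (avgD mB m3 mq4 z3 zq4) (avgD mB m4 mq5 z4 zq5).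
rewrite (avgZ mB pa0 m1 z1) (avgZ mB (ltW p0) m2 z2) (avgZ mB lam20 m5 z5).
move=> key.
have {}key := le_trans key (leeD (lee_wpmul2l (_ : 0 <= (p * a)%:E)%E H1)
  (leeD (lee_wpmul2l (_ : 0 <= p%:E)%E H2) (leeD H3 (leeD H4
  (lee_wpmul2l (_ : 0 <= lam2%:E)%E H5))))).
have {}key := key pa0 (ltW p0) lam20.
rewrite -!EFinM -!EFinD lee_fin in key.
apply: (@absorption R p a lam1 lam2 D M N e th1 th2 th3) => //.
rewrite -/T -SE -(ler_pM2l (_ : 0 < (r `^ p)^-1)); last by rewrite invr_gt0 powR_gt0.
have rV q : r^-1 `^ q = (r `^ q)^-1 by rewrite powR_invM// ltW.
rewrite !powRM ?invr_ge0 ?(ltW r0)// !rV in key.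
have rE : r `^ p = r * r `^ (p - 1) by exact: powR_pos1.
have rp1 : r `^ (p - 1) != 0 by rewrite gt_eqF// powR_gt0.
rewrite rE in key *.
rewrite -/e1 -/e2 -/e3.
have E1 : (r * r `^ (p - 1))^-1 * (lam1 / a * e `^ p) = lam1 / a * (e `^ p * (r * r `^ (p - 1))^-1).
  by ring.
rewrite E1; apply: (le_trans key); rewrite le_eqVlt; apply/orP; left; apply/eqP.
by field; rewrite rp1 gt_eqF.
Qed.

End averaged_absorption.

(** * Energy estimates for the weak solution *)

Section energy.
Context {R : realType} {n : nat}.
Local Notation E := 'rV[R]_n.+1.
Local Opaque enorm sqrtmx mulmx grad meas_fun.
Variables (Omega : set E) (p : R) (Q : E -> 'M[R]_n.+1).
Hypotheses (oO : open Omega) (p1 : 1 < p) (Qpsd : forall x, Omega x -> psdmx (Q x)).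
Hypothesis mQ : forall i j, meas_fun Omega (fun x => Q x i j).
Local Notation qn x v := (enorm (v *m sqrtmx (Q x))).
Let p0 : 0 < p. Proof. exact: lt_trans p1. Qed.
Let p0' : 0 <= p. Proof. exact: ltW. Qed.
Let mO : measurable (Omega : set (Rn R n)). Proof. exact: open_measurable_Rn. Qed.
Variable B : set E.
Hypotheses (oB : open B) (BO : B `<=` Omega).
Hypotheses (B_gt0 : (0 < @leb R n B)%E) (B_lty : (@leb R n B < +oo)%E).
Let mB : measurable (B : set (Rn R n)). Proof. exact: open_measurable_Rn. Qed.

Lemma W1pQ0_lty w W : W1pQ0 p Q B (w, W) ->
  (Lpi B p w < +oo)%E /\ (Lpi B p (Qnorm Q W) < +oo)%E.
Proof.
move=> /(W_closureP Q p1 _ _ _ mB)[mw mW [v [Lv fv cu cW]]].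
have [K HK] := cu 1 ltr01; have [L HL] := cW 1 ltr01.
have lv k : lipschitz (v k) by have [] := Lv k.
have mv k : meas_fun B (v k) by exact: meas_Lip_loc oB (lipschitz_Lip_loc (lv k)).
have mg k : measV B (grad (v k)) by exact: meas_grad oB (lipschitz_Lip_loc (lv k)).
have mq (V : E -> E) : measV B V -> meas_fun B (fun x => qn x (V x)).
  exact: (meas_qn oO Qpsd mQ mB BO).
split.
  have m1 : meas_fun B (fun x => v K x - w x) by exact: measB.
  apply: (Lpi_ltyD p0' mB (mv K) m1 mw).
  - apply: aeW => x _; rewrite -[X in `|X| <= _](subrK (v K x)) addrC distrC.
    by rewrite (le_trans (ler_normD _ _))// distrC.
  - by have [] := fv K.
  - by apply: le_lt_trans (HK K _) _ => //; rewrite ltry.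
apply: (Lpi_ltyD p0' mB (mq _ (mg L)) (mq _ (measVB (mg L) mW)) (mq _ mW)).
- apply: aeW => x _; rewrite !norm_enorm -(qnN Q x (_ - W x)).
  by apply: le_trans (qnD _ _ _ _); rewrite opprB addrC subrK.
- by have [] := fv L.
- by apply: le_lt_trans (HL L _) _ => //; rewrite ltry.
Qed.

Lemma Lpi_prod (q q1 q2 al : R) (f g : E -> R) : 0 < q -> 0 < q1 -> 0 < q2 -> 0 < al ->
  q / q1 + al * q / q2 <= 1 -> meas_fun B f -> meas_fun B g ->
  (Lpi B q1 f < +oo)%E -> (Lpi B q2 g < +oo)%E ->
  (Lpi B q (fun x => f x * `|g x| `^ al)%R < +oo)%E.
Proof.
move=> q0 q10 q20 al0 H mf mg fq1 gq2.
have V0 := vol_gt0 B_gt0 B_lty; have Vi0 : 0 <= (vol B)^-1 by rewrite invr_ge0 ltW.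
have fin (r : R) (w : E -> R) : (Lpi B r w < +oo)%E ->
    exists2 A : R, 0 <= A & (avg B (fun x => (`|w x| `^ r)%:E) <= A%:E)%E.
  move=> h; exists (fine (avg B (fun x => (`|w x| `^ r)%:E))).
    by apply: fine_ge0; rewrite avg_Lpi mule_ge0 ?Lpi_ge0// lee_fin.
  rewrite fineK// ge0_fin_numE; last by rewrite avg_Lpi mule_ge0 ?Lpi_ge0// lee_fin.
  by rewrite avg_Lpi lte_mul_pinfty// lee_fin.
have [A A0 fA] := fin _ _ fq1; have [C C0 gC] := fin _ _ gq2.
have m1 : meas_fun B (fun x => `|f x| `^ q) by meas.
have m2 : meas_fun B (fun x => `|g x| `^ (al * q)) by meas.
have r1 : 0 < q1 / q by rewrite divr_gt0.
have r2 : 0 < q2 / (al * q) by rewrite divr_gt0// mulr_gt0.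
have rr : (q1 / q)^-1 + (q2 / (al * q))^-1 <= 1 by rewrite !invf_div.
have E1 : (avg B (fun x => (`| `|f x| `^ q | `^ (q1 / q))%:E) <= A%:E)%E.
  rewrite (eq_avg (g := fun x => `|f x| `^ q1))// => x _.
  by rewrite ger0_norm ?powR_ge0// -powRrM mulrCA mulfV ?mulr1 ?gt_eqF.
have E2 : (avg B (fun x => (`| `|g x| `^ (al * q) | `^ (q2 / (al * q)))%:E) <= C%:E)%E.
  rewrite (eq_avg (g := fun x => `|g x| `^ q2))// => x _.
  by rewrite ger0_norm ?powR_ge0// -powRrM mulrCA mulfV ?mulr1 ?gt_eqF// mulr_gt0.
have := holder_avg mB B_gt0 B_lty r1 r2 rr m1 m2 A0 C0 E1 E2.
rewrite (eq_avg (g := fun x => `|f x * `|g x| `^ al| `^ q)); last first.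
  move=> x _; rewrite (normrM (f x)) powRM// (ger0_norm (powR_ge0 _ al)) -powRrM.
  by rewrite [LHS]ger0_norm// mulr_ge0 ?powR_ge0.
move=> h; rewrite (Lpi_avg B_gt0 B_lty); apply: lte_mul_pinfty.
- by rewrite lee_fin ltW.
- by [].
- by apply: le_lt_trans h _; rewrite ltry.
Qed.

Section cut.
Variable eta0 : E -> R.
Hypothesis geta0 : good_cutoff Omega p Q B eta0.

(** The inner cutoff is supported where the outer one is 1. There u inherits what is known of eta0
    u, and local integrability of the coefficients suffices because the plateau lies in a compact
    set. *)
Definition plateau := [set x : E | B x /\ eta0 x = 1].

Lemma measurable_plateau : measurable (plateau : set (Rn R n)).
Proof.
have [le _ _ _ _] := geta0.
have : meas_fun B eta0 by exact: meas_Lip_loc oB (lipschitz_Lip_loc le).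
move=> /(_ mB [set 1] (measurable_set1 _)); rewrite (_ : _ `&` _ = plateau)//.
Qed.

Lemma plateau_supp : plateau `<=` supp eta0.
Proof. by move=> x [_ e1]; apply: subset_closure; rewrite /= e1 oner_eq0. Qed.

Lemma meas_indic_plateau U : meas_fun U (\1_plateau : E -> R).
Proof. exact: (@measurable_indic _ (Rn R n) R U plateau measurable_plateau). Qed.

Lemma Lpi_indic (q : R) (f : E -> R) : 0 < q -> measurable (plateau : set (Rn R n)) ->
  Lpi B q (fun x => \1_plateau x * f x) = Lpi plateau q f.
Proof.
move=> q0 mP; rewrite /Lpi /intU -{2}(@setIidr _ B plateau) ?integral_mkcondr; last first.
  by move=> x [].
apply: eq_integral => x _; rewrite patchE indicE; case: ifPn => xP.
  by rewrite mul1r.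
by rewrite mul0r normr0 powR0// gt_eqF.
Qed.

Lemma Lloc_Lpi (q : R) (f : E -> R) : 0 < q -> Lloc q%:E Omega f ->
  (Lpi B q (fun x => \1_plateau x * f x)%R < +oo)%E.
Proof.
move=> q0 [mf Hf]; have [le _ [cs sB] _ _] := geta0.
have mP := measurable_plateau.
have mS : measurable (supp eta0 : set (Rn R n)) by apply: closed_measurable_Rn; exact: closed_closure.
rewrite Lpi_indic//; apply: (@le_lt_trans _ _ (Lpi (supp eta0) q f)).
  apply: (le_intU_set mP mS plateau_supp); last by move=> x _; exact: powR_ge0.
  by apply/meas_powR/meas_norm; apply: (meas_sub mO _ mf); exact: subset_trans sB BO.
have := Hf _ cs (subset_trans sB BO); rewrite lnorm_Lpi//.
exact: poweR_inv_lty.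
Qed.

End cut.

Variables (u : E -> R) (Du : E -> E) (v : nat -> E -> R).
Hypotheses (mu : meas_fun Omega u) (mDu : measV Omega Du).
Hypothesis appv : approximates Omega p Q v u Du.
Variables (sigma C1 r : R).
Hypotheses (s1 : 1 < sigma) (C10 : 0 <= C1) (r0 : 0 < r).
Hypothesis Hsob : forall w, W1pQ0 p Q B w -> (avg_lnorm (p * sigma)%:E B w.1 <=
      C1%:E * (r%:E * avg_lnorm p%:E B (Qnorm Q w.2) + avg_lnorm p%:E B w.1))%E.
Variables eta0 eta : E -> R.
Hypotheses (geta0 : good_cutoff Omega p Q B eta0) (geta : good_cutoff Omega p Q B eta).
Hypothesis eta_sub : supp eta `<=` plateau eta0.

Let V0 : 0 < vol B. Proof. exact: vol_gt0. Qed.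
Let Vi0 : 0 <= (vol B)^-1. Proof. by rewrite invr_ge0 ltW. Qed.
Let ps0 : 0 < p * sigma. Proof. by rewrite mulr_gt0// (lt_trans ltr01). Qed.
Local Notation S := (plateau eta0).
Let mS : measurable (S : set (Rn R n)). Proof. exact: measurable_plateau geta0. Qed.

Lemma sobolev_lty w W : W1pQ0 p Q B (w, W) -> (Lpi B (p * sigma) w < +oo)%E.
Proof.
move=> hw; have [f1 f2] := W1pQ0_lty hw; have := Hsob hw.
have fin (q : R) (x : \bar R) : (0 <= x)%E -> (x < +oo)%E ->
    exists2 y : R, 0 <= y & (((vol B)^-1%:E * x) `^ q = y%:E)%E.
  case: x => [x| |]// x0 _; exists (((vol B)^-1 * x) `^ q); first exact: powR_ge0.
  by rewrite -EFinM poweR_EFin.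
have [y1 y10 E1] := fin p^-1 _ (Lpi_ge0 _ _ _) f1.
have [y2 y20 E2] := fin p^-1 _ (Lpi_ge0 _ _ _) f2.
move=> Hw; have : (((vol B)^-1%:E * Lpi B (p * sigma) w) `^ (p * sigma)^-1 <=
    C1%:E * (r%:E * y2%:E + y1%:E))%E by rewrite -E1 -E2; exact: Hw.
have -> : (C1%:E * (r%:E * y2%:E + y1%:E) = (C1 * (r * y2 + y1))%:E)%E by rewrite EFinM EFinD EFinM.
move=> H.
have : ((vol B)^-1%:E * Lpi B (p * sigma) w < +oo)%E.
  by apply: (poweR_inv_lty ps0); apply: le_lt_trans H _; rewrite ltry.
have := Lpi_ge0 B (p * sigma) w; case: (Lpi _ _ _) => [z _ _|_|//]; first by rewrite ltry.
by rewrite gt0_muley ?ltxx// lte_fin invr_gt0.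
Qed.

Let i_ x : R := \1_S x.
Let mi : meas_fun B i_. Proof. exact: meas_indic_plateau geta0 B. Qed.

(** The Sobolev inequality is applied to eta0 u, which equals u on the plateau; by itself u is only
    known to be in L^p. *)
Lemma Lpi_sigma_plateau : (Lpi B (p * sigma) (fun x => i_ x * u x)%R < +oo)%E.
Proof.
have di z : is_derive z (1 : R) (@id R) ((fun=> 1) z) by exact: is_derive_id.
have c1 : continuous (fun _ : R => 1 : R) by move=> z; exact: cvg_cst.
have b1 z : `|(fun _ : R => 1 : R) z| <= 1 by rewrite normr1.
have hw := W1pQ0_cutoff_comp oO p1 Qpsd mQ oB BO geta0 mu mDu appv di c1 b1 B_lty.
have mw : meas_fun B (fun x => eta0 x * id (u x)).
  by move: hw => /(W_closureP Q p1 _ _ _ mB)[].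
have mBu : meas_fun B u by exact: meas_sub mO BO mu.
have m1 : meas_fun B (fun x => i_ x * u x) by exact: measM mi mBu.
apply: le_lt_trans (sobolev_lty hw); apply: (le_Lpi (ltW ps0) mB m1 mw).
apply: aeW => x _; rewrite /i_ indicE; case: (boolP (x \in S)) => [|_].
  by rewrite inE => -[_ ->].
by rewrite mul0r normr0.
Qed.

Variables (gamma psi delta a : R) (b c d e f g h : E -> R).
Variables (A : E -> R -> E -> E) (Bf : E -> R -> E -> R).
Hypotheses (gamma1 : 1 < gamma) (gammap : gamma < p) (delta1 : 1 < delta) (deltap : delta < p).
Hypotheses (psi1 : 1 < psi) (psip : psi < p) (a1 : 1 < a).
Hypothesis Hstr : structural Omega p Q gamma psi delta a b c d e f g h A Bf.
Hypothesis Lc : Lloc (sigma * p / (sigma * p - 1 - sigma * (psi - 1)))%:E Omega c.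
Hypothesis Le : Lloc (dual_exp p)%:E Omega e.
Hypothesis Lf : Lloc (dual_exp (sigma * p))%:E Omega f.
Hypothesis Lb : Lloc (sigma * p / (sigma * (p - 1) - gamma + 1))%:E Omega b.
Hypothesis Ld : Lloc (p * sigma / (p * sigma - delta))%:E Omega d.
Hypothesis Hsol : forall phi, Lip0 Omega phi -> (forall x, 0 <= phi x) ->
  let F x := (dotv (grad phi x) (A x (u x) (Du x)) + phi x * Bf x (u x) (Du x))%:E in
  leb.-integrable (Omega : set (Rn R n)) F /\ (\int[leb]_(x in Omega) F x = 0)%E.

Let i1 x : S x -> i_ x = 1. Proof. by move=> Sx; rewrite /i_ indicE mem_set. Qed.
Let i2 x : 0 <= i_ x <= 1.
Proof. by rewrite /i_ indicE; case: (x \in S); rewrite ?ler01 ?lexx. Qed.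

Let coef_meas (w : E -> R) : meas_fun Omega w -> meas_fun B w.
Proof. exact: meas_sub mO BO. Qed.

(** Majorants for the growth of A and of the right-hand side along u, restricted to the plateau
    where the coefficients are integrable. *)
Let Abar x := a * qn x (Du x) `^ (p - 1) + (i_ x * b x) * `|i_ x * u x| `^ (gamma - 1) + i_ x * e x.
Let Bbar x := (i_ x * c x) * `|qn x (Du x)| `^ (psi - 1) +
  (i_ x * d x) * `|i_ x * u x| `^ (delta - 1) + i_ x * f x.

Let mBu : meas_fun B u. Proof. exact: coef_meas. Qed.
Let mqDu : meas_fun B (fun x => qn x (Du x)).
Proof. exact: (meas_qn oO Qpsd mQ mB BO (measV_sub mO BO mDu)). Qed.

Let p10 : 0 < p - 1. Proof. by rewrite subr_gt0. Qed.
Let sp0 : 0 < sigma * p. Proof. by rewrite mulrC. Qed.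
Let sg0 : 0 < sigma. Proof. exact: lt_trans s1. Qed.

Let fqDu : (Lpi B p (fun x => qn x (Du x)) < +oo)%E.
Proof.
have [_ fDu] := approximates_lty oO p1 Qpsd mQ mu mDu appv.
apply: le_lt_trans fDu; apply: (le_intU_set mB mO BO); last by move=> x _; exact: powR_ge0.
have mq := meas_qn oO Qpsd mQ mO (@subset_refl _ Omega) mDu.
exact/meas_powR/meas_norm.
Qed.

(** The standing integrability exponent of b is the one for which its product with |u|^(gamma-1), u
    in L^(p sigma), belongs to the dual of L^p; likewise in [Bbar_lty] for c and d and the dual of
    L^(p sigma). *)
Let Abar_lty : meas_fun B Abar /\ (Lpi B (dual_exp p) Abar < +oo)%E.
Proof.
have [[[mb _] [mc _] [md _] [me _]] [[[mf _] [mg _] [mh _]] _]] := Hstr.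
have mib : meas_fun B (fun x => i_ x * b x) by exact: measM mi (coef_meas mb).
have mie : meas_fun B (fun x => i_ x * e x) by exact: measM mi (coef_meas me).
have miu : meas_fun B (fun x => i_ x * u x) by exact: measM mi mBu.
have m1 : meas_fun B (fun x => a * qn x (Du x) `^ (p - 1)) by meas.
have m2 : meas_fun B (fun x => (i_ x * b x) * `|i_ x * u x| `^ (gamma - 1)).
  exact/measM/meas_powR/meas_norm.
have m12 : meas_fun B (fun x => a * qn x (Du x) `^ (p - 1) + (i_ x * b x) * `|i_ x * u x| `^ (gamma - 1)).
  exact: measD.
have mA : meas_fun B Abar by exact: measD.
have [dp0 _] := dual_expV p1.
have dpE : dual_exp p * (p - 1) = p by rewrite /dual_exp divfK// gt_eqF.
split; first exact: mA.
apply: (Lpi_ltyD (ltW dp0) mB m12 mie mA).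
- by apply: aeW => x _; exact: ler_normD.
- apply: (Lpi_ltyD (ltW dp0) mB m1 m2 m12).
  + by apply: aeW => x _; exact: ler_normD.
  + have m3 : meas_fun B (fun x => qn x (Du x) `^ (p - 1)) by exact: meas_powR.
    have E3 : Lpi B (dual_exp p) (fun x => qn x (Du x) `^ (p - 1)) = Lpi B p (fun x => qn x (Du x)).
      apply: eq_intU => x _; rewrite !ger0_norm ?powR_ge0 ?enorm_ge0//.
      by rewrite -powRrM mulrC dpE.
    rewrite (LpiZ _ _ mB m3) E3; move: fqDu; move: (Lpi B p _) => z zy.
    by rewrite lte_mul_pinfty ?lee_fin ?powR_ge0.
  + have q0 : 0 < sigma * (p - 1) - gamma + 1.
      have : p - 1 < sigma * (p - 1) by rewrite ltr_pMl.
      by move: gammap; move: (sigma * (p - 1)) => x; lra.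
    have fb := Lloc_Lpi geta0 (divr_gt0 sp0 q0) Lb.
    apply: (Lpi_prod dp0 (divr_gt0 sp0 q0) ps0 _ _ mib miu fb Lpi_sigma_plateau).
      by rewrite subr_gt0.
    rewrite le_eqVlt; apply/orP; left; apply/eqP; rewrite /dual_exp.
    by field; rewrite !gt_eqF.
- exact: Lloc_Lpi.
Qed.

Let Bbar_lty : meas_fun B Bbar /\ (Lpi B (dual_exp (p * sigma)) Bbar < +oo)%E.
Proof.
have [[[mb _] [mc _] [md _] [me _]] [[[mf _] [mg _] [mh _]] _]] := Hstr.
have mic : meas_fun B (fun x => i_ x * c x) by exact: measM mi (coef_meas mc).
have mid : meas_fun B (fun x => i_ x * d x) by exact: measM mi (coef_meas md).
have mif : meas_fun B (fun x => i_ x * f x) by exact: measM mi (coef_meas mf).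
have miu : meas_fun B (fun x => i_ x * u x) by exact: measM mi mBu.
have m1 : meas_fun B (fun x => (i_ x * c x) * `|qn x (Du x)| `^ (psi - 1)).
  exact/measM/meas_powR/meas_norm.
have m2 : meas_fun B (fun x => (i_ x * d x) * `|i_ x * u x| `^ (delta - 1)).
  exact/measM/meas_powR/meas_norm.
have m12 : meas_fun B (fun x => (i_ x * c x) * `|qn x (Du x)| `^ (psi - 1) +
   (i_ x * d x) * `|i_ x * u x| `^ (delta - 1)) by exact: measD.
have mBb : meas_fun B Bbar by exact: measD.
have ps1 : 1 < p * sigma by rewrite -[ltLHS]mulr1 ltr_pM// ?(ltW ltr01).
have [dp0 _] := dual_expV ps1.
have psm : 0 < p * sigma - 1 by rewrite subr_gt0.
split; first exact: mBb.
apply: (Lpi_ltyD (ltW dp0) mB m12 mif mBb).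
- by apply: aeW => x _; exact: ler_normD.
- apply: (Lpi_ltyD (ltW dp0) mB m1 m2 m12).
  + by apply: aeW => x _; exact: ler_normD.
  + have q0 : 0 < sigma * p - 1 - sigma * (psi - 1).
      have -> : sigma * p - 1 - sigma * (psi - 1) = (sigma - 1) + sigma * (p - psi) by ring.
      by rewrite addr_gt0 ?mulr_gt0 ?subr_gt0.
    have fc := Lloc_Lpi geta0 (divr_gt0 sp0 q0) Lc.
    apply: (Lpi_prod dp0 (divr_gt0 sp0 q0) p0 _ _ mic mqDu fc fqDu).
      by rewrite subr_gt0.
    rewrite le_eqVlt; apply/orP; left; apply/eqP; rewrite /dual_exp.
    by field; rewrite !gt_eqF.
  + have q0 : 0 < p * sigma - delta.
      rewrite subr_gt0 (lt_trans deltap)// ltr_pMr//.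
    have fd := Lloc_Lpi geta0 (divr_gt0 ps0 q0) Ld.
    apply: (Lpi_prod dp0 (divr_gt0 ps0 q0) ps0 _ _ mid miu fd Lpi_sigma_plateau).
      by rewrite subr_gt0.
    rewrite le_eqVlt; apply/orP; left; apply/eqP; rewrite /dual_exp.
    by field; rewrite !gt_eqF.
- by apply: (Lloc_Lpi geta0 dp0); rewrite [p * sigma]mulrC.
Qed.

Let AB_ae : {ae @leb R n, forall x, B x -> supp (fun x => eta x `^ p) x ->
  (exists2 At : E, A x (u x) (Du x) = At *m sqrtmx (Q x) & enorm At <= Abar x) /\
  `|Bf x (u x) (Du x)| <= Bbar x}.
Proof.
have [_ [_ [At HA]]] := Hstr; apply: ae_imp HA => x + Bx sx => /(_ (BO Bx) (u x) (Du x)).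
have Sx : S x.
  apply: eta_sub; move: sx; apply: closureS => y /=.
  by apply: contraNneq => ->; rewrite powR0// gt_eqF.
move=> [-> _ h1 h2]; rewrite /Abar /Bbar i1// !mul1r norm_enorm.
by split=> //; exists (At x (u x) (Du x)).
Qed.

Variable k : R.
Hypothesis k0 : 0 < k.
Hypothesis u_ge0 : {ae @leb R n, forall x, B x -> 0 <= u x}.

Definition shifted x := pos_shift k (u x).
Local Notation U := shifted.
Definition coef_b x := b x + (b x + e x) * k `^ (1 - p).
Definition coef_d x := d x + (c x + d x + f x) * k `^ (1 - p).
Definition coef_h x := h x + (g x + h x) * k `^ (- p).

Variables (M Bx Cx Dx Hx Lam ss : R).
Let e1 := Num.min 1 (p * (1 - p * dual_exp sigma / Cx)).
Let e2 := Num.min 1 (p * (1 - dual_exp sigma / Hx)).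
Let e3 := Num.min 1 (p * (1 - dual_exp sigma / Dx)).
Hypotheses (M1 : 1 <= M) (HBx : dual_exp p * dual_exp sigma <= Bx) (HCx : p * dual_exp sigma < Cx)
  (HDx : dual_exp sigma < Dx) (HHx : dual_exp sigma < Hx).
Local Notation avgR f := (avg B (fun x => (f x)%:E)).
Hypotheses (Hcb : (avgR (fun x => coef_b x `^ Bx)%R <= ((M / r `^ (p - 1)) `^ Bx)%:E)%E)
  (Hcc : (avgR (fun x => c x `^ Cx)%R <= ((M `^ (e1 / p) / r) `^ Cx)%:E)%E)
  (Hcd : (avgR (fun x => coef_d x `^ Dx)%R <= ((M `^ e3 / r `^ p) `^ Dx)%:E)%E)
  (Hch : (avgR (fun x => coef_h x `^ Hx)%R <= ((M `^ e2 / r `^ p) `^ Hx)%:E)%E).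
Hypotheses (Lam0 : 0 <= Lam) (ss1 : 1 <= ss).
(** Hoelder form of a bound Lam / r for the gradient of the cutoff in L^sstar: the price is an
    increase of the exponent of w from p to p ss. *)
Hypothesis Hqeta : forall (w : E -> R) (X : R), meas_fun B w -> (forall x, B x -> 0 <= w x) -> 0 <= X ->
  (avgR (fun x => w x `^ (p * ss))%R <= (X `^ (p * ss))%:E)%E ->
  (avgR (fun x => (w x * qn x (grad eta x)) `^ p)%R <= ((X * Lam / r) `^ p)%:E)%E.

Section exponent.
Variables m l : R.
Hypotheses (l0 : 0 <= l) (lm : m <= 1 /\ l = 0 \/ 1 < m /\ 0 < l).
Let lam1 := Num.min 1 `|1 + p * (m - 1)|.
Let lam2 := 1 + p * `|m - 1|.
Definition energy_W x := U x * theta m l (U x).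
Definition energy_y x := theta m l (U x) * qn x (Du x).
Local Notation W := energy_W.
Local Notation y := energy_y.

Definition energy_rhs x :=
  p * (W x * qn x (grad eta x)) * (a * (eta x * y x) `^ (p - 1) +
     coef_b x * (eta x * W x) `^ (p - 1)) +
  eta x * W x * (c x * (eta x * y x) `^ (p - 1) + coef_d x * (eta x * W x) `^ (p - 1)) +
  lam2 * (coef_h x * (eta x * W x) `^ p).

Lemma shifted_gt0 x : 0 < U x. Proof. exact: pos_shift_gt0. Qed.

Lemma meas_shifted : meas_fun B U.
Proof.
apply: (meas_comp (g := pos_shift k)) => // z.
by apply/differentiable_continuous/derivable1_diffP; have [] := is_derive_pos_shift k0 z.
Qed.

Lemma meas_theta_shifted : meas_fun B (fun x => theta m l (U x)).
Proof.
have mU := meas_shifted; apply: measM; first exact: meas_powR.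
by apply: meas_powR; meas.
Qed.

Lemma meas_energy_W : meas_fun B W.
Proof. exact: measM meas_shifted meas_theta_shifted. Qed.

Lemma meas_energy_y : meas_fun B y.
Proof. exact: measM meas_theta_shifted mqDu. Qed.

Lemma energy_W_gt0 x : 0 < W x.
Proof. by rewrite mulr_gt0 ?shifted_gt0// theta_gt0// shifted_gt0. Qed.

Lemma energy_y_ge0 x : 0 <= y x.
Proof. by rewrite mulr_ge0 ?enorm_ge0// ltW// theta_gt0// shifted_gt0. Qed.

Let meta : meas_fun B eta.
Proof. by have [le _ _ _ _] := geta; exact: meas_Lip_loc oB (lipschitz_Lip_loc le). Qed.

Let mqeta : meas_fun B (fun x => qn x (grad eta x)).
Proof.
have [le _ _ _ _] := geta.
exact: (meas_qn oO Qpsd mQ mB BO (meas_grad oB (lipschitz_Lip_loc le))).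
Qed.

Let eta_ge0 x : 0 <= eta x. Proof. by have [_ /(_ x)/andP[]] := geta. Qed.

Let coef_ge0 x : B x -> [/\ 0 <= b x, 0 <= c x, 0 <= d x & 0 <= e x] /\
  [/\ 0 <= f x, 0 <= g x & 0 <= h x].
Proof.
have [[[_ b0] [_ c0] [_ d0] [_ e0]] [[[_ f0] [_ g0] [_ h0]] _]] := Hstr.
by move=> /BO Ox; split; split; auto.
Qed.

Lemma meas_coefs : [/\ meas_fun B coef_b, meas_fun B coef_d & meas_fun B coef_h].
Proof.
have [[[mb _] [mc _] [md _] [me _]] [[[mf _] [mg _] [mh _]] _]] := Hstr.
move: (coef_meas mb) (coef_meas mc) (coef_meas md) (coef_meas me) (coef_meas mf)
  (coef_meas mg) (coef_meas mh) => ? ? ? ? ? ? ?.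
by split; rewrite /coef_b /coef_d /coef_h; meas.
Qed.

Lemma coefs_ge0 x : B x -> [/\ 0 <= coef_b x, 0 <= coef_d x & 0 <= coef_h x].
Proof.
move=> /coef_ge0[[? ? ? ?] [? ? ?]].
by split; rewrite addr_ge0// mulr_ge0 ?powR_ge0// !addr_ge0.
Qed.

Lemma meas_energy_rhs : meas_fun B energy_rhs.
Proof.
have [mb md mh] := meas_coefs; have mW := meas_energy_W; have my := meas_energy_y.
have [[_ [mc _] _ _] _] := Hstr; have mc' := coef_meas mc.
by rewrite /energy_rhs; meas.
Qed.

Lemma energy_rhs_ge0 x : B x -> 0 <= energy_rhs x.
Proof.
move=> hBx; have [b0 d0 h0] := coefs_ge0 hBx; have [[_ c0 _ _] _] := coef_ge0 hBx.
have W0 := ltW (energy_W_gt0 x).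
have l20 : 0 <= lam2 by rewrite addr_ge0// mulr_ge0.
have q0 : 0 <= qn x (grad eta x) by exact: enorm_ge0.
have a0 : 0 <= a by rewrite ltW// (lt_trans ltr01).
have e0 := eta_ge0 x.
apply: addr_ge0; last by rewrite !mulr_ge0 ?powR_ge0.
apply: addr_ge0; apply: mulr_ge0.
- by rewrite mulr_ge0// mulr_ge0.
- by rewrite addr_ge0// mulr_ge0 ?powR_ge0.
- exact: mulr_ge0.
- by rewrite addr_ge0// mulr_ge0 ?powR_ge0.
Qed.

(** [test_ineq] with the test function eta^p U theta(U)^p; the pointwise comparison it asks for is
    [pointwise_energy]. *)
Lemma energy_ineq : 0 < lam1 ->
  (intU B (fun x => lam1 / a * (eta x * y x) `^ p)%R <= intU B energy_rhs)%E.
Proof.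
move=> lam10.
have [mA fA] := Abar_lty; have [mBb fBb] := Bbar_lty.
have gz := good_cutoff_pow oO p1 Qpsd mQ oB BO p1 geta.
have dG z : is_derive z (1 : R) (fun z => pos_shift k z * theta m l (pos_shift k z) `^ p)
    (theta m l (pos_shift k z) `^ p * theta_beta m l p (pos_shift k z) * pos_shift' k z).
  exact: (is_derive_comp_pos_shift k0 (fun z z0 => is_derive_theta_powR m p l0 z0)).
have cG : continuous (fun z => theta m l (pos_shift k z) `^ p * theta_beta m l p (pos_shift k z)
    * pos_shift' k z).
  exact: (continuous_comp_pos_shift k0 (fun z z0 => continuous_theta_powR' l0 z0)).
have k20 : 0 < k / 2 by rewrite divr_gt0.
have [T T0 HT] := theta_bounded l0 lm k20.
have bG z : `|theta m l (pos_shift k z) `^ p * theta_beta m l p (pos_shift k z)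
    * pos_shift' k z| <= T `^ p * lam2.
  apply: (@bound_comp_pos_shift R k k0 (fun z => theta m l z `^ p * theta_beta m l p z)) => w kw; have w0 : 0 < w by exact: lt_le_trans kw.
  rewrite normrM ger0_norm ?powR_ge0// ler_pM ?powR_ge0//; last exact: theta_beta_bound.
  by apply: powR_mono; rewrite ?HT// ltW// theta_gt0.
have F0 z : 0 <= pos_shift k z * theta m l (pos_shift k z) `^ p.
  by rewrite mulr_ge0 ?powR_ge0// ltW// pos_shift_gt0.
have s1' : `|Num.sg (1 + p * (m - 1))| <= 1 by rewrite normr_sg lern1 leq_b1.
have mLow : meas_fun B (fun x => lam1 / a * (eta x * y x) `^ p).
  by have my := meas_energy_y; meas.
have a0 : 0 < a by exact: lt_trans a1.
apply: (test_ineq oO p1 Qpsd mQ oB BO B_gt0 B_lty gz mu mDu appv dG cG bG s1 C10 (ltW r0)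
   Hsob F0 Hsol mA mBb fA fBb AB_ae s1' mLow meas_energy_rhs).
- by move=> x _; rewrite mulr_ge0 ?powR_ge0// divr_ge0 ?ltW.
- exact: energy_rhs_ge0.
have [le e01 _ _ _] := geta.
have [_ [_ [At HA]]] := Hstr.
apply: ae_imp2 (grad_cutoff_pow (B := B) oB le e01 p1) (ae_imp2 (fun x h1 h2 => conj h1 h2) HA u_ge0).
move=> x gx [HAx ux] hBx; rewrite gx//; have ux0 := ux hBx.
have [AE hA1 hA2 hB] := HAx (BO hBx) (u x) (Du x).
have [[b0 c0 d0 e0] [f0 g0 h0]] := coef_ge0 hBx.
have UE : pos_shift k (u x) = u x + k by rewrite pos_shiftE.
have Ux0 : 0 < u x + k by rewrite ltr_wpDl.
rewrite pos_shift'E// mulr1 /energy_rhs /W /y /U UE.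
rewrite (ger0_norm ux0) in hA1 hA2 hB.
set th := theta m l (u x + k).
have th0 : 0 <= th by rewrite ltW// theta_gt0.
rewrite dotvDl !dotvZl.
have X1b : `|dotv (grad eta x) (A x (u x) (Du x))| <= qn x (grad eta x) * enorm (At x (u x) (Du x)).
  by rewrite AE; exact: dotv_sqrtmx.
have := @pointwise_energy R p a gamma psi delta lam1 lam2 k p1 a0 k0 gamma1 gammap psi1 psip
  delta1 deltap (b x) (c x) (d x) (e x) (f x) (g x) (h x) b0 c0 d0 e0 f0 g0 h0 (eta x)
  (qn x (grad eta x)) (u x) (qn x (Du x)) th (theta_beta m l p (u x + k)) (Num.sg (1 + p * (m - 1)))
  (enorm (At x (u x) (Du x))) (dotv (grad eta x) (A x (u x) (Du x)))
  (dotv (Du x) (A x (u x) (Du x))) (Bf x (u x) (Du x)) (eta_ge0 x) (enorm_ge0 _) ux0 (enorm_ge0 _)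
  th0 s1' (theta_beta_sg l0 p1 lm Ux0) (theta_beta_bound m l0 p1 Ux0) (ltW lam10)
  hA2 X1b hA1 hB.
move=> /le_trans; apply.
rewrite /coef_b /coef_d /coef_h le_eqVlt; apply/orP; left; apply/eqP.
by move: (qn x (grad eta x)) (qn x (Du x)) => ? ?; ring.
Qed.

Let a0 : 0 < a. Proof. exact: lt_trans a1. Qed.
Let k20 : 0 < k / 2. Proof. by rewrite divr_gt0. Qed.

Let Yf x := eta x * y x.
Let wf x := eta x * W x.
Let Vf x := W x * qn x (grad eta x).

Let mYf : meas_fun B Yf. Proof. exact: measM meta meas_energy_y. Qed.
Let mwf : meas_fun B wf. Proof. exact: measM meta meas_energy_W. Qed.
Let mVf : meas_fun B Vf. Proof. exact: measM meas_energy_W mqeta. Qed.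
Let Yf0 x : B x -> 0 <= Yf x. Proof. by move=> _; rewrite mulr_ge0// energy_y_ge0. Qed.
Let wf0 x : B x -> 0 <= wf x. Proof. by move=> _; rewrite mulr_ge0// ltW// energy_W_gt0. Qed.
Let Vf0 x : B x -> 0 <= Vf x.
Proof. by move=> _; rewrite mulr_ge0 ?enorm_ge0// ltW// energy_W_gt0. Qed.

(** Qualitative finiteness of the energy, from the boundedness of theta on [k / 2, +oo). Absorption
    needs a finite number to work with; the value is improved afterwards. *)
Lemma energy_y_fin : exists2 e0 : R, 0 <= e0 & avgR (fun x => Yf x `^ p)%R = ((e0 / r) `^ p)%:E.
Proof.
have [T T0 HT] := theta_bounded l0 lm k20.
have mTq : meas_fun B (fun x => T * qn x (Du x)).
  exact: (@measM _ _ _ (fun=> T) _ (@meas_cst _ _ _ T) mqDu).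
have e01 x : 0 <= eta x <= 1 by have [_ + _ _ _] := geta; apply.
have H : (Lpi B p Yf < +oo)%E.
  apply: (@le_lt_trans _ _ (Lpi B p (fun x => T * qn x (Du x))%R)).
    apply: (le_Lpi p0' mB mYf mTq); apply: aeW => x _.
    have /andP[h0 h1] := e01 x.
    rewrite /Yf (normrM (eta x)) (ger0_norm h0) (ger0_norm (energy_y_ge0 x)) (normrM T) (ger0_norm T0).
    rewrite norm_enorm -[leRHS]mul1r; apply: ler_pM h0 (energy_y_ge0 x) h1 _.
    by rewrite /energy_y ler_wpM2r ?enorm_ge0// HT// pos_shift_ge.
  rewrite (LpiZ _ _ mB mqDu); move: fqDu; move: (Lpi B p _) => z zy.
  by rewrite lte_mul_pinfty ?lee_fin ?powR_ge0.
have E0 : avgR (fun x => Yf x `^ p)%R = ((vol B)^-1%:E * Lpi B p Yf)%E.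
  rewrite -avg_Lpi; apply: eq_avg => x Bx'; rewrite ger0_norm//; exact: Yf0.
have := Lpi_ge0 B p Yf; move: H; rewrite E0.
case: (Lpi B p Yf) => [z| |] zy z0; last 2 first; [by move: zy|by move: z0|].
have : 0 <= (vol B)^-1 * z by apply: mulr_ge0; [rewrite invr_ge0 ltW//; exact: vol_gt0|move: z0; rewrite lee_fin].
rewrite -EFinM; move: (_ * z) => z1 z1_ge0.
exists (r * z1 `^ p^-1); first by apply: mulr_ge0; [exact: ltW|exact: powR_ge0].
by rewrite [r * _]mulrC (mulfK (lt0r_neq0 r0)) -powRrM (mulVf (lt0r_neq0 p0)) (powRr1 z1_ge0).
Qed.

Lemma energy_absorb (D N e0 : R) : 0 < lam1 -> 1 <= D -> 0 < N -> 0 <= e0 ->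
  avgR (fun x => Yf x `^ p)%R = ((e0 / r) `^ p)%:E ->
  (avgR (fun x => wf x `^ p)%R <= (N `^ p)%:E)%E ->
  (avgR (fun x => wf x `^ (p * sigma))%R <= ((D * Num.max e0 N) `^ (p * sigma))%:E)%E ->
  (avgR (fun x => Vf x `^ p)%R <= ((N / r) `^ p)%:E)%E ->
  Num.max e0 N <= absorption_cst p a lam1 lam2 D (p * dual_exp sigma / Cx) (dual_exp sigma / Hx)
    (dual_exp sigma / Dx) * M * N.
Proof.
move=> lam10 D1 N0 e00 HY Hw HS HV.
have [mb md mh] := meas_coefs.
have [[_ [mc _] _ _] _] := Hstr; have mc' := coef_meas mc.
have c0 x : B x -> 0 <= c x by move=> /coef_ge0[[]].
have b0 x : B x -> 0 <= coef_b x by move=> /coefs_ge0[].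
have d0 x : B x -> 0 <= coef_d x by move=> /coefs_ge0[].
have h0 x : B x -> 0 <= coef_h x by move=> /coefs_ge0[].
have lam11 : lam1 <= 1 by rewrite ge_min lexx.
have lam21 : 1 <= lam2 by rewrite lerDl mulr_ge0.
have S0 : 0 <= D * Num.max e0 N by rewrite mulr_ge0 ?le_max ?e00// (le_trans ler01).
exact: (avg_absorption mB B_gt0 B_lty p1 s1 mwf mYf mVf wf0 Yf0 Vf0 (ltW N0) S0 e00 r0 Hw HS HY HV
  (ltW a1) lam10 lam11 lam21 D1 M1 N0 (erefl _) HBx HCx HDx HHx mb mc' md mh b0 c0 d0 h0
  Hcb Hcc Hcd Hch (energy_ineq lam10)).
Qed.

(** The 5 is 4 for the gradient of eta W, which is a sum of two terms, plus 1 for its L^p norm. The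
    growth is linear in |m| because that of [theta_mu] is. *)
Definition sobolev_growth := 1 + 5 * C1 * (1 + `|m - 1|).
Local Notation D_ := sobolev_growth.

Lemma sobolev_growth_ge1 : 1 <= D_.
Proof. by rewrite lerDl mulr_ge0// ?addr_ge0// mulr_ge0. Qed.

Lemma sobolev_energy (N e0 : R) : 0 < N -> 0 <= e0 ->
  avgR (fun x => Yf x `^ p)%R = ((e0 / r) `^ p)%:E ->
  (avgR (fun x => wf x `^ p)%R <= (N `^ p)%:E)%E ->
  (avgR (fun x => Vf x `^ p)%R <= ((N / r) `^ p)%:E)%E ->
  (avgR (fun x => wf x `^ (p * sigma))%R <= ((D_ * Num.max e0 N) `^ (p * sigma))%:E)%E.
Proof.
move=> N0 e00 HY Hw HV.
pose F z := pos_shift k z * theta m l (pos_shift k z).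
pose F' z := theta m l (pos_shift k z) * theta_mu m l (pos_shift k z) * pos_shift' k z.
have dF z : is_derive z (1 : R) F (F' z).
  exact: (is_derive_comp_pos_shift k0 (fun z z0 => is_derive_theta_mul m l0 z0)).
have cF : continuous F'.
  exact: (continuous_comp_pos_shift k0 (fun z z0 => continuous_theta_mul' l0 z0)).
have [T T0 HT] := theta_bounded l0 lm k20.
have bF z : `|F' z| <= T * (1 + `|m - 1|).
  apply: (@bound_comp_pos_shift R k k0 (fun z => theta m l z * theta_mu m l z)) => w kw.
  have w0 : 0 < w by exact: lt_le_trans kw.
  rewrite normrM; apply: ler_pM => //; last exact: theta_mu_bound.
  by rewrite ger0_norm ?HT// ltW// theta_gt0.
have hw := W1pQ0_cutoff_comp oO p1 Qpsd mQ oB BO geta mu mDu appv dF cF bF B_lty.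
have := Hsob hw; rewrite /=.
pose Tm := Num.max e0 N; pose la := 1 + `|m - 1|.
have Tm0 : 0 < Tm by rewrite lt_max N0 orbT.
have la1 : 1 <= la by rewrite lerDl.
have la0 : 0 < la by exact: lt_le_trans la1.
set WV := (fun x => F (u x) *: grad eta x + (eta x * F' (u x)) *: Du x).
have mWV : measV B WV by move: hw => /(W_closureP Q p1 _ _ _ mB)[].
have mqWV : meas_fun B (fun x => qn x (WV x)) by exact: (meas_qn oO Qpsd mQ mB BO mWV).
have mVY : meas_fun B (fun x => 2 `^ p * (Vf x `^ p + la `^ p * Yf x `^ p)) by meas.
have mVp : meas_fun B (fun x => Vf x `^ p) by meas.
have mYp : meas_fun B (fun x => Yf x `^ p) by meas.
have mYl : meas_fun B (fun x => la `^ p * Yf x `^ p) by meas.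
have mVYl : meas_fun B (fun x => Vf x `^ p + la `^ p * Yf x `^ p) by meas.
have mqp : meas_fun B (fun x => `|qn x (WV x)| `^ p) by meas.
have H1 : (avgR (fun x => `|qn x (WV x)| `^ p)%R <= ((4 * la * Tm / r) `^ p)%:E)%E.
  apply: (@le_trans _ _ (avgR (fun x => 2 `^ p * (Vf x `^ p + la `^ p * Yf x `^ p))%R)).
    apply: (le_avg mB B_gt0 B_lty mqp mVY) => x Bx'; rewrite powR_ge0/=.
    rewrite norm_enorm.
    apply: (@le_trans _ _ ((Vf x + la * Yf x) `^ p)).
      apply: powR_mono => //; first exact: enorm_ge0.
      apply: le_trans (qnD _ _ _ _) _; rewrite !qnZ; apply: lerD.
        by rewrite /Vf ger0_norm// ltW// energy_W_gt0.
      rewrite normrM (ger0_norm (eta_ge0 x)) /Yf /y mulrCA -mulrA ler_wpM2l//.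
      rewrite mulrA ler_wpM2r ?enorm_ge0// /F'.
      have /andP[q0 q1] := pos_shift'_bound k0 (u x).
      have t0 : 0 < theta m l (pos_shift k (u x)) by rewrite theta_gt0// pos_shift_gt0.
      rewrite (normrM (theta m l _ * _)) (normrM (theta m l _)) (ger0_norm (ltW q0)) (ger0_norm (ltW t0)).
      apply: (@le_trans _ _ (theta m l (pos_shift k (u x)) * `|theta_mu m l (pos_shift k (u x))|)).
        by rewrite ler_piMr// mulr_ge0// ltW.
      by rewrite mulrC ler_wpM2r ?(ltW t0)// theta_mu_bound// pos_shift_gt0.
    apply: le_trans (powR_leD p0' (Vf0 Bx') (mulr_ge0 (ltW la0) (Yf0 Bx'))) _.
    by rewrite (powRM _ (ltW la0) (Yf0 Bx')).
  have VY0 x : B x -> 0 <= Vf x `^ p + la `^ p * Yf x `^ p.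
    by move=> _; rewrite addr_ge0 ?mulr_ge0 ?powR_ge0.
  rewrite (avgZ mB (powR_ge0 2 p) mVYl VY0).
  rewrite (avgD mB mVp mYl (fun x _ => powR_ge0 _ _) (fun x _ => mulr_ge0 (powR_ge0 _ _) (powR_ge0 _ _))).
  rewrite (avgZ mB (powR_ge0 la p) mYp (fun x _ => powR_ge0 _ _)) HY.
  apply: (@le_trans _ _ ((2 `^ p)%:E * (((N / r) `^ p)%:E + (la `^ p)%:E * ((e0 / r) `^ p)%:E))%E).
    by rewrite lee_wpmul2l ?lee_fin ?powR_ge0// leeD2r.
  have -> : ((2 `^ p)%:E * (((N / r) `^ p)%:E + (la `^ p)%:E * ((e0 / r) `^ p)%:E) =
    (2 `^ p * ((N / r) `^ p + la `^ p * (e0 / r) `^ p))%:E)%E by rewrite EFinM EFinD EFinM.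
  rewrite lee_fin.
  have rV0 : 0 <= r^-1 by rewrite invr_ge0 ltW.
  have h1 : (N / r) `^ p <= (la * Tm / r) `^ p.
    apply: powR_mono; rewrite ?divr_ge0 ?(ltW N0) ?(ltW r0)// ler_wpM2r//.
    by rewrite -[leLHS]mul1r ler_pM ?(ltW N0)// le_max lexx orbT.
  have h2 : la `^ p * (e0 / r) `^ p <= (la * Tm / r) `^ p.
    rewrite -powRM ?(ltW la0) ?divr_ge0 ?(ltW r0)// mulrA; apply: powR_mono => //.
      by rewrite mulr_ge0 ?mulr_ge0 ?(ltW la0).
    by rewrite ler_wpM2r// ler_wpM2l ?(ltW la0)// le_max lexx.
  have lT0 : 0 <= la * Tm / r by rewrite mulr_ge0// mulr_ge0 ?(ltW la0) ?(ltW Tm0).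
  apply: (@le_trans _ _ (2 `^ p * (2 * (la * Tm / r) `^ p))).
    by rewrite ler_wpM2l ?powR_ge0// mulr2n mulrDl mul1r lerD.
  have -> : 4 * la * Tm / r = 2 * (2 * (la * Tm / r)) by ring.
  move: lT0; set G := la * Tm / r => G0.
  have two0 : 0 <= (2 : R) by [].
  rewrite (powRM p two0 (mulr_ge0 two0 G0)) (powRM p two0 G0).
  rewrite ler_wpM2l ?powR_ge0// ler_wpM2r ?powR_ge0//.
  by rewrite -[leLHS](powRr1 two0) ler_powR ?(ltW p1)// ler1n.
have H2 : (avgR (fun x => `|eta x * F (u x)| `^ p)%R <= (N `^ p)%:E)%E.
  rewrite (eq_avg (g := fun x => wf x `^ p)) => [//|x Bx'].
  by rewrite ger0_norm//; exact: wf0.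
have E3 : avgR (fun x => `|eta x * F (u x)| `^ (p * sigma))%R = avgR (fun x => wf x `^ (p * sigma))%R.
  by apply: eq_avg => x Bx'; rewrite ger0_norm//; exact: wf0.
have cc0 : 0 <= 4 * la * Tm / r by rewrite divr_ge0 ?mulr_ge0 ?(ltW la0) ?(ltW Tm0) ?(ltW r0).
have av0 q (w : E -> R) : (0 <= avgR (fun x => `|w x| `^ q)%R)%E.
  by apply: (avg_ge0 B_gt0 B_lty) => x _; rewrite lee_fin powR_ge0.
have K1 := (poweR_root_le p0 cc0 (av0 p (fun x => qn x (WV x)))).2 H1.
have K2 := (poweR_root_le p0 (ltW N0) (av0 p (fun x => eta x * F (u x)))).2 H2.
move=> Hs; rewrite -E3.
have DT0 : 0 <= D_ * Tm by rewrite mulr_ge0 ?(ltW Tm0)// (le_trans ler01 sobolev_growth_ge1).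
apply/(poweR_root_le ps0 DT0 (av0 _ _)); apply: (le_trans Hs).
apply: (@le_trans _ _ (C1%:E * (r%:E * (4 * la * Tm / r)%:E + N%:E))%E).
  apply: lee_wpmul2l; first by rewrite lee_fin.
  apply: leeD; last exact: K2.
  by apply: lee_wpmul2l; [rewrite lee_fin ltW|exact: K1].
have -> : (C1%:E * (r%:E * (4 * la * Tm / r)%:E + N%:E) = (C1 * (r * (4 * la * Tm / r) + N))%:E)%E.
  by move: (4 * la * Tm / r) => q; rewrite EFinM EFinD EFinM.
rewrite lee_fin [r * _]mulrC divfK ?gt_eqF// /D_ -/la.
have NT : N <= Tm by rewrite le_max lexx orbT.
have hN : C1 * N <= C1 * (la * Tm).
  by rewrite ler_wpM2l// -[leLHS]mul1r ler_pM ?(ltW N0).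
have -> : (1 + 5 * C1 * la) * Tm = Tm + 4 * (C1 * (la * Tm)) + C1 * (la * Tm) by ring.
have -> : C1 * (4 * la * Tm + N) = 4 * (C1 * (la * Tm)) + C1 * N by ring.
by move: hN Tm0; move: (C1 * (la * Tm)) (C1 * N) => ? ? ? ?; lra.
Qed.

Let i01 x : eta x <= i_ x.
Proof.
have e01 := geta; case: e01 => _ /(_ x)/andP[_ e1'] _ _ _.
have [sx|sx] := pselect (supp eta x); first by rewrite i1//; exact: eta_sub.
have -> : eta x = 0.
  by apply/eqP/negPn/negP => ex; apply: sx; exact: subset_closure.
by have /andP[] := i2 x.
Qed.

Let qeta_off x : B x -> i_ x * qn x (grad eta x) = qn x (grad eta x).
Proof.
move=> Bx'; have [sx|sx] := pselect (supp eta x); first by rewrite i1 ?mul1r//; exact: eta_sub.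
have oS : open (~` supp eta) by rewrite openC; exact: closed_closure.
rewrite (@grad_locally0 _ _ eta (~` supp eta) x oS sx).
  by rewrite mul0mx enorm0 mulr0.
by move=> z zs; apply/eqP/negPn/negP => ex; apply: zs; exact: subset_closure.
Qed.

Lemma plateau_bounds (X : R) : 0 <= X ->
  (avgR (fun x => (i_ x * W x) `^ (p * ss))%R <= (X `^ (p * ss))%:E)%E ->
  (avgR (fun x => wf x `^ p)%R <= ((X * (Lam + 1)) `^ p)%:E)%E /\
  (avgR (fun x => Vf x `^ p)%R <= ((X * (Lam + 1) / r) `^ p)%:E)%E.
Proof.
move=> X0 HX.
have miW : meas_fun B (fun x => i_ x * W x) by exact: measM mi meas_energy_W.
have iW0 x : B x -> 0 <= i_ x * W x.
  by move=> _; rewrite mulr_ge0 ?(ltW (energy_W_gt0 x))//; have /andP[] := i2 x.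
have pss0 : 0 < p * ss by rewrite mulr_gt0// (lt_le_trans ltr01).
split.
  have m1 : meas_fun B (fun x => (i_ x * W x) `^ (p * ss)) by exact: meas_powR.
  have := avg_holder4 mB B_gt0 B_lty m1 (@meas_cst R n B 1) (@meas_cst R n B 1) (@meas_cst R n B 1).
  have av1 : (avgR (fun=> 1)%R <= 1%:E)%E by rewrite avg_cst.
  have q1 : 0 <= ss^-1 by rewrite invr_ge0 (le_trans ler01).
  have qs : ss^-1 + 0 + 0 + 0 <= 1 by rewrite !addr0 invf_le1// (lt_le_trans ltr01).
  have hpos x : B x -> [/\ 0 <= (i_ x * W x) `^ (p * ss), 0 <= (1 : R), 0 <= (1 : R) & 0 <= (1 : R)].
    by move=> _; rewrite powR_ge0.
  move=> /(_ _ 1 1 1 ss^-1 0 0 0 hpos (powR_ge0 _ _) ler01 ler01 ler01 q1 (lexx 0) (lexx 0) (lexx 0) qs HX av1 av1 av1).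
  have ssn : ss != 0 by rewrite gt_eqF// (lt_le_trans ltr01).
  have XE : (X `^ (p * ss)) `^ ss^-1 = X `^ p by rewrite -powRrM mulfK.
  rewrite XE !powRr0 !mulr1 => H; apply: (@le_trans _ _ (X `^ p)%:E); last first.
    by rewrite lee_fin; apply: powR_mono => //; rewrite ler_peMr// lerDr.
  apply: le_trans H; have mwp : meas_fun B (fun x => wf x `^ p) by exact: meas_powR.
  apply: (le_avg mB B_gt0 B_lty mwp) => [|x Bx'].
    by do 3 (apply: measM; last exact: meas_cst); apply: (@meas_powR _ _ _ (fun x => (i_ x * W x) `^ (p * ss))); exact: m1.
  rewrite powR_ge0/= !mulr1 -powRrM mulfK//; apply: powR_mono => //; first exact: wf0.
  by rewrite ler_wpM2r ?(ltW (energy_W_gt0 x)).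
have := Hqeta miW iW0 X0 HX.
rewrite (eq_avg (g := fun x => Vf x `^ p)); last first.
  by move=> x Bx'; rewrite /Vf -[in RHS]qeta_off//; congr (_ `^ _); ring.
move=> H; apply: (le_trans H); rewrite lee_fin.
have rV0 : 0 <= r^-1 by rewrite invr_ge0 ltW.
apply: powR_mono => //; first by rewrite mulr_ge0// mulr_ge0.
by rewrite ler_wpM2r// ler_wpM2l// lerDl.
Qed.

Definition step_cst := D_ * absorption_cst p a lam1 lam2 D_ (p * dual_exp sigma / Cx)
  (dual_exp sigma / Hx) (dual_exp sigma / Dx) * (Lam + 1).

Lemma truncated_step (X : R) : 0 < lam1 -> 0 < X ->
  (avgR (fun x => (i_ x * W x) `^ (p * ss))%R <= (X `^ (p * ss))%:E)%E ->
  (avgR (fun x => wf x `^ (p * sigma))%R <= ((step_cst * M * X) `^ (p * sigma))%:E)%E.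
Proof.
move=> lam10 X0 HX; have [Hw HV] := plateau_bounds (ltW X0) HX.
have N0 : 0 < X * (Lam + 1) by rewrite mulr_gt0// ltr_wpDl.
have [e0 e00 HY] := energy_y_fin.
have HS := sobolev_energy N0 e00 HY Hw HV.
have D1 := sobolev_growth_ge1; have D0 : 0 < D_ by exact: lt_le_trans D1.
have HT := energy_absorb lam10 D1 N0 e00 HY Hw HS HV.
apply: (le_trans HS); rewrite lee_fin; apply: powR_mono.
- exact: ltW.
- by rewrite mulr_ge0 ?(ltW D0)// le_max e00.
apply: (le_trans (ler_wpM2l (ltW D0) HT)).
by rewrite /step_cst le_eqVlt; apply/orP; left; apply/eqP; ring.
Qed.

Definition log_cst := absorption_cst p a lam1 lam2 1 (p * dual_exp sigma / Cx)
  (dual_exp sigma / Hx) (dual_exp sigma / Dx) * (Lam + 1).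

(** For m = 0 and l = 0 the function W is 1, so eta W <= 1 and its L^(p sigma) average is bounded
    trivially, with D = 1. Hence C1 does not occur in [log_cst], as it must not, because this
    constant ends up in the exponent C6. *)
Lemma log_energy : m = 0 -> l = 0 ->
  (avgR (fun x => (eta x * (qn x (Du x) / U x)) `^ p)%R <= ((log_cst * M / r) `^ p)%:E)%E.
Proof.
move=> mE lE.
have WE x : W x = 1.
  rewrite /W /theta mE lE mul0r addr0 powR1 mulr1 sub0r powR_inv1 ?(ltW (shifted_gt0 x))//.
  by rewrite mulfV// gt_eqF// shifted_gt0.
have lam10 : 0 < lam1.
  rewrite /lam1 mE sub0r mulrN1 lt_min ltr01 normr_gt0 subr_eq0 eq_sym.
  by rewrite gt_eqF.
have X1 : (avgR (fun x => (i_ x * W x) `^ (p * ss))%R <= (1 `^ (p * ss))%:E)%E.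
  have mm : meas_fun B (fun x => (i_ x * W x) `^ (p * ss)).
    by apply: meas_powR; exact: measM mi meas_energy_W.
  rewrite powR1 -(avg_cst mB B_gt0 B_lty 1); apply: (le_avg mB B_gt0 B_lty mm) => [|x _].
    exact: meas_cst.
  rewrite powR_ge0/= WE mulr1 powR_le1_of//.
  by rewrite mulr_ge0// (le_trans ler01).
have [Hw HV] := plateau_bounds ler01 X1; rewrite !mul1r in Hw HV.
have N0 : 0 < Lam + 1 by rewrite ltr_wpDl.
have [e0 e00 HY] := energy_y_fin.
have HS : (avgR (fun x => wf x `^ (p * sigma))%R <= ((1 * Num.max e0 (Lam + 1)) `^ (p * sigma))%:E)%E.
  have mm : meas_fun B (fun x => wf x `^ (p * sigma)) by exact: meas_powR.
  apply: (@le_trans _ _ 1%:E); last first.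
    rewrite lee_fin mul1r -[leLHS](powRr0 (Num.max e0 (Lam + 1))); apply: ler_powR; last exact: ltW.
    by rewrite le_max lerDr Lam0 orbT.
  rewrite -(avg_cst mB B_gt0 B_lty 1); apply: (le_avg mB B_gt0 B_lty mm) => [|x Bx'].
    exact: meas_cst.
  rewrite powR_ge0/= /wf WE mulr1 powR_le1_of ?(ltW ps0)//.
  by have [_ /(_ x)] := geta.
have := energy_absorb lam10 (lexx 1) N0 e00 HY Hw HS HV.
move=> HT; rewrite (eq_avg (g := fun x => Yf x `^ p)); last first.
  move=> x _; rewrite /Yf /y /theta mE lE mul0r addr0 powR1 mulr1 sub0r.
  by rewrite powR_inv1 ?(ltW (shifted_gt0 x))// [_^-1 * _]mulrC.
rewrite HY lee_fin; apply: powR_mono => //; first by rewrite divr_ge0// ltW.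
rewrite ler_wpM2r ?invr_ge0 ?(ltW r0)//.
apply: (@le_trans _ _ (Num.max e0 (Lam + 1))); first by rewrite le_max lexx.
apply: (le_trans HT); rewrite /log_cst le_eqVlt; apply/orP; left; apply/eqP; ring.
Qed.

End exponent.

Lemma meas_shifted_powR (q : R) : meas_fun B (fun x => U x `^ q).
Proof. by apply: (@meas_powR _ _ _ shifted q); apply: meas_shifted. Qed.

Lemma theta0E (m z : R) : 0 < z -> z * theta m 0 z = z `^ m.
Proof. by move=> z0; rewrite /theta mul0r addr0 powR1 mulr1 -powR_pos1. Qed.

Lemma cvg_truncation (m z : R) : 0 < z ->
  z * theta m (i.+1%:R^-1) z @[i --> \oo] --> z `^ m.
Proof.
move=> z0; rewrite (powR_pos1 m z0); apply: cvgM; first exact: cvg_cst.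
rewrite -[X in _ --> X]mulr1; apply: cvgM; first exact: cvg_cst.
have cv1 : 1 + i.+1%:R^-1 * z @[i --> \oo] --> (1 : R).
  rewrite -[X in _ --> X]addr0; apply: cvgD; first exact: cvg_cst.
  rewrite -(mul0r z); apply: cvgM; last exact: cvg_cst.
  exact: cvg_harmonic.
rewrite -[X in _ --> X](_ : 1 `^ (1 - m) = 1); last by rewrite powR1.
exact: (continuous_cvg _ (@continuous_powR_pos _ (1 - m) 1 ltr01) cv1).
Qed.

(** For m <= 1 no truncation is made. For m > 1 the estimate is uniform in the truncation parameter
    l = 1/(i+1), and Fatou's lemma removes it. *)
Lemma moser_step (m X : R) : 1 + p * (m - 1) != 0 -> 0 < X ->
  (avgR (fun x => (i_ x * U x `^ m) `^ (p * ss))%R <= (X `^ (p * ss))%:E)%E ->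
  (avgR (fun x => (eta x * U x `^ m) `^ (p * sigma))%R <=
    ((step_cst m * M * X) `^ (p * sigma))%:E)%E.
Proof.
move=> mn X0 HX.
have lam10 : 0 < Num.min 1 `|1 + p * (m - 1)| by rewrite lt_min ltr01 normr_gt0.
have mU q : meas_fun B (fun x => U x `^ q) by exact: meas_shifted_powR.
have meta : meas_fun B eta by have [le _ _ _ _] := geta; exact: meas_Lip_loc oB (lipschitz_Lip_loc le).
have step l (l0 : 0 <= l) (lm : m <= 1 /\ l = 0 \/ 1 < m /\ 0 < l) :
    (avgR (fun x => (eta x * energy_W m l x) `^ (p * sigma))%R <=
    ((step_cst m * M * X) `^ (p * sigma))%:E)%E.
  have mW : meas_fun B (energy_W m l) by exact: meas_energy_W.
  have miW : meas_fun B (fun x => i_ x * energy_W m l x).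
    exact: measM mi mW.
  apply: (truncated_step l0 lm lam10 X0); apply: le_trans HX.
  have m1 : meas_fun B (fun x => (i_ x * energy_W m l x) `^ (p * ss)) by exact: meas_powR.
  have m2 : meas_fun B (fun x => (i_ x * U x `^ m) `^ (p * ss)).
    by apply: meas_powR; exact: measM mi (mU m).
  apply: (le_avg mB B_gt0 B_lty m1 m2) => x Bx'.
  have /andP[h0 _] := i2 x; have W0 := energy_W_gt0 m l0 x.
  rewrite powR_ge0/=; apply: powR_mono.
  - by rewrite mulr_ge0 ?(ltW p0)// (le_trans ler01).
  - by rewrite mulr_ge0// ltW.
  - rewrite ler_wpM2l// (powR_pos1 m (shifted_gt0 x)) ler_wpM2l ?(ltW (shifted_gt0 x))//.
    by apply: (theta_le l0 lm); exact: shifted_gt0.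
have [m1|m1] := leP m 1.
  have := step 0 (lexx 0) (or_introl (conj m1 erefl)).
  rewrite (eq_avg (g := fun x => (eta x * U x `^ m) `^ (p * sigma)))// => x _.
  by rewrite /energy_W theta0E// shifted_gt0.
have l0 i : 0 < (i.+1%:R^-1 : R) by rewrite invr_gt0.
have Hi i := step _ (ltW (l0 i)) (or_intror (conj m1 (l0 i))).
set Z := (_ `^ (p * sigma)) in Hi *.
have int_avg (w : E -> R) : (avgR w <= Z%:E)%E <-> (intU B w <= (vol B * Z)%:E)%E.
  rewrite /avg -/(intU B w) EFinM; split=> H.
    rewrite -[X in (X <= _)%E]mul1e -(mulfV (lt0r_neq0 V0)) EFinM -muleA.
    by rewrite lee_wpmul2l// lee_fin ltW.
  rewrite -[X in (_ <= X)%E]mul1e -(mulVf (lt0r_neq0 V0)) EFinM -muleA.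
  by rewrite lee_wpmul2l.
apply/int_avg.
have mWi i : meas_fun B (fun x => (eta x * energy_W m (i.+1%:R^-1) x) `^ (p * sigma)).
  by apply: meas_powR; apply: measM meta _; exact: meas_energy_W.
apply: (@intU_fatou R n B _ _ _ mB mWi).
- by move=> i x _; exact: powR_ge0.
- by move=> x _; exact: powR_ge0.
- apply: aeW => x Bx'; have eta0x : 0 <= eta x by have [_ /(_ x)/andP[]] := geta.
  have cv : `|eta x * energy_W m (i.+1%:R^-1) x| `^ (p * sigma) @[i --> \oo] -->
      `|eta x * U x `^ m| `^ (p * sigma).
    apply: cvg_norm_powR ps0 _; apply: cvgM; first exact: cvg_cst.
    exact: cvg_truncation (shifted_gt0 x).
  have E1 i : `|eta x * energy_W m (i.+1%:R^-1) x| = eta x * energy_W m (i.+1%:R^-1) x.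
    rewrite [LHS]ger0_norm//; apply: mulr_ge0; first exact: eta0x.
    by apply: ltW; apply: energy_W_gt0; exact: ltW.
  have E2 : `|eta x * U x `^ m| = eta x * U x `^ m.
    by rewrite [LHS]ger0_norm//; apply: mulr_ge0; [exact: eta0x|exact: powR_ge0].
  by move: cv; rewrite E2; under eq_fun do rewrite E1.
- by apply: nearW => i; apply/int_avg.
Qed.

End energy.

(** * Moser iteration *)

Section moser_iteration.
Context {R : realType} {n : nat}.
Local Notation E := 'rV[R]_n.+1.
Local Notation avgR B f := (avg B (fun x => (f x)%:E)).
Variables (B T : set E).
Hypotheses (mB : measurable (B : set (Rn R n))) (mT : measurable (T : set (Rn R n))) (TB : T `<=` B).
Hypotheses (B_gt0 : (0 < @leb R n B)%E) (B_lty : (@leb R n B < +oo)%E).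

Lemma intU_indic (c : R) (N : set E) : measurable (N : set (Rn R n)) -> 0 <= c -> N `<=` B ->
  intU B (fun x => c * \1_N x) = (c%:E * leb N)%E.
Proof.
move=> mN c0 NB; rewrite intUZ//; last first.
  exact: measurable_indic.
by rewrite /intU integral_indic// setIidl.
Qed.

Lemma avg_intU (f : E -> R) (Z : R) :
  (avgR B f <= Z%:E)%E <-> (intU B f <= (vol B * Z)%:E)%E.
Proof.
have V0 : 0 < vol B by exact: vol_gt0.
rewrite /avg -/(intU B f) EFinM; split=> H.
  rewrite -[X in (X <= _)%E]mul1e -(mulfV (lt0r_neq0 V0)) EFinM -muleA.
  by rewrite lee_wpmul2l// lee_fin ltW.
rewrite -[X in (_ <= X)%E]mul1e -(mulVf (lt0r_neq0 V0)) EFinM -muleA.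
by rewrite lee_wpmul2l// lee_fin invr_ge0 ltW.
Qed.

(* Chebyshev at exponents tending to infinity. *)
Lemma ae_le_of_powers (V : E -> R) (W : R) (q : nat -> R) : meas_fun B V ->
  (forall x, B x -> 0 <= V x) -> 0 < W -> q j @[j --> \oo] --> +oo ->
  (forall j, (avgR B (fun x => \1_T x * V x `^ q j)%R <= (W `^ q j)%:E)%E) ->
  {ae @leb R n, forall x, T x -> V x <= W}.
Proof.
move=> mV V0 W0 qoo HV.
have vB : 0 < vol B by exact: vol_gt0.
have mTV : meas_fun T V by exact: meas_sub mB TB mV.
pose N i := [set x : Rn R n | T x /\ W * (1 + i.+1%:R^-1) < V x].
have mN i : measurable (N i).
  have -> : N i = T `&` V @^-1` `]W * (1 + i.+1%:R^-1), +oo[%classic.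
    by apply/seteqP; split => x /=; rewrite in_itv/= andbT.
  exact: (mTV mT _ (measurable_itv _)).
have NB i : N i `<=` B by move=> x [/TB].
have N0 i : leb (N i) = 0%E.
  pose c : R := 1 + i.+1%:R^-1; have c1 : 1 < c by rewrite ltrDl invr_gt0.
  have c0 : 0 < c by exact: lt_trans c1.
  have Nlty : (leb (N i) < +oo)%E.
    by apply: le_lt_trans B_lty; apply: le_measure; rewrite ?inE//; exact: mN.
  have NE : leb (N i) = (fine (leb (N i)))%:E by rewrite fineK// ge0_fin_numE.
  have Hj j : 0 <= q j -> fine (leb (N i)) * c `^ q j <= vol B.
    move=> qj; have Wq : 0 < W `^ q j by exact: powR_gt0.
    have := (avg_intU _ _).1 (HV j) => H.
    have H1 : (intU B (fun x => (W * c) `^ q j * \1_(N i) x)%R <= (vol B * W `^ q j)%:E)%E.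
      apply: le_trans H; apply: le_intU => //.
      - apply: measM; [exact: meas_cst|exact: measurable_indic].
      - by apply: measM; [exact: measurable_indic|exact: (@meas_powR _ _ _ V)].
      - move=> x Bx; rewrite mulr_ge0 ?powR_ge0//=.
        rewrite [\1_(N i) x]indicE; have [|] := boolP (x \in N i); rewrite ?mulr0 ?mulr_ge0 ?powR_ge0//.
        rewrite inE => -[Tx Wx]; rewrite indicE mem_set// mulr1 mul1r.
        by apply: powR_mono => //; [rewrite mulr_ge0// ltW|exact: ltW].
    move: H1; rewrite intU_indic ?powR_ge0// NE -EFinM lee_fin.
    by rewrite (powRM _ (ltW W0) (ltW c0)) mulrC mulrCA [leRHS]mulrC ler_pM2l.
  rewrite NE; congr EFin; apply/eqP; apply/negPn/negP => a0.
  have a_gt0 : 0 < fine (leb (N i)) by rewrite lt_neqAle eq_sym a0/= fine_ge0.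
  have lc0 : 0 < ln c by rewrite ln_gt0.
  have /cvgryPge/(_ (vol B / (fine (leb (N i)) * ln c))) := qoo.
  case=> j _ /(_ j (leqnn _))/= qj.
  have qj0 : 0 <= q j by apply: le_trans qj; apply: divr_ge0; [exact: ltW|rewrite mulr_ge0 ?ltW].
  have := Hj j qj0; apply/negP; rewrite -ltNge.
  have : vol B <= fine (leb (N i)) * (q j * ln c).
    by move: qj; rewrite ler_pdivrMr ?mulr_gt0// => qj; rewrite mulrCA.
  move=> /le_lt_trans; apply; rewrite ltr_pM2l// /powR gt_eqF//.
  by apply: lt_le_trans (expR_ge1Dx _); rewrite ltrDr.
have UN : (@leb R n).-negligible (\bigcup_i N i).
  by apply: negligible_bigcup => i; apply/negligibleP; [exact: mN|exact: N0].
apply: negligibleS UN.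
move=> x /= /not_implyP[Tx /negP]; rewrite -ltNge => WV.
have d0 : 0 < V x / W - 1 by rewrite subr_gt0 ltr_pdivlMr// mul1r.
have [i Hi] := ltr_add_invr d0.
exists i => //; split => //; rewrite -ltr_pdivlMl// mulrC.
by move: Hi; rewrite add0r ltrBrDl.
Qed.

Variables (U : E -> R) (m0 q0 chi X G H : R) (Z : nat -> R) (i_ eta : nat -> E -> R) (A : nat -> R).
Hypotheses (mU : meas_fun B U) (U0 : forall x, B x -> 0 < U x).
Hypotheses (chi1 : 1 < chi) (q00 : 0 < q0) (X0 : 0 < X) (G1 : 1 <= G) (H1 : 1 <= H).
Hypotheses (mi : forall j, meas_fun B (i_ j)) (me : forall j, meas_fun B (eta j)).
Hypotheses (i01 : forall j x, B x -> i_ j x = 0 \/ i_ j x = 1).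
Hypotheses (ieta : forall j x, B x -> i_ j.+1 x <= eta j x).
Hypotheses (iT : forall j x, T x -> i_ j x = 1).
Hypotheses (AG : forall j, 0 < A j <= G * H ^+ j.+1).
Let m j := m0 * chi ^+ j.
Hypothesis start : (avgR B (fun x => (i_ 0%N x * U x `^ m0) `^ q0)%R <= (X `^ q0)%:E)%E.
Hypothesis step : forall j Y, 0 < Y ->
  (avgR B (fun x => (i_ j x * U x `^ m j) `^ q0)%R <= (Y `^ q0)%:E)%E ->
  (avgR B (fun x => (eta j x * U x `^ m j) `^ (q0 * chi))%R <= ((A j * Y) `^ (q0 * chi))%:E)%E.

Let al := chi / (chi - 1).
Let be := al / (chi - 1).

(** X times the product over j of (G H^(j+1))^(chi^(-j)): [al] is the sum of chi^(-j) and [al + be]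
    that of (j + 1) chi^(-j). *)
Definition moser_bound := X * G `^ al * H `^ (al + be).

(* With [A j = G H^(j+1)] the recursion [Y' = (A j Y)^chi] is solved exactly by [moser_level]. *)
Let moser_level j := moser_bound `^ (chi ^+ j) * G `^ (- al) * H `^ (- (al * j.+1%:R + be)).

Let chi0 : 0 < chi. Proof. exact: lt_trans chi1. Qed.
Let G0 : 0 < G. Proof. exact: lt_le_trans G1. Qed.
Let H0 : 0 < H. Proof. exact: lt_le_trans H1. Qed.
Let W0 : 0 < moser_bound. Proof. by rewrite !mulr_gt0 ?powR_gt0. Qed.
Let L0 j : 0 < moser_level j. Proof. by rewrite !mulr_gt0 ?powR_gt0. Qed.
Let chi10 : 0 < chi - 1. Proof. by rewrite subr_gt0. Qed.

Let level_step j : (A j * moser_level j) `^ chi <= moser_level j.+1.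
Proof.
have /andP[A0 AGj] := AG j.
apply: (@le_trans _ _ ((G * H ^+ j.+1 * moser_level j) `^ chi)).
  apply: powR_mono; [exact: ltW|rewrite mulr_ge0// ltW//; exact: L0|].
  by rewrite ler_pM2r.
rewrite le_eqVlt; apply/orP; left; apply/eqP.
have GE : G = expR (ln G) by rewrite lnK.
have HE : H = expR (ln H) by rewrite lnK.
have WE : moser_bound = expR (ln moser_bound) by rewrite lnK.
have E1 q : G `^ q = expR (q * ln G) by rewrite /powR gt_eqF.
have E2 q : H `^ q = expR (q * ln H) by rewrite /powR gt_eqF.
have E3 q : moser_bound `^ q = expR (q * ln moser_bound) by rewrite /powR gt_eqF.
rewrite /moser_level E1 !E2 !E3 -[H ^+ _](powR_mulrn _ (ltW H0)) E2 {1}GE -!expRD.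
rewrite [LHS]/powR gt_eqF ?expR_gt0// expRK; congr expR.
rewrite exprS /be /al -[in RHS](natr1 j.+1).
by field; rewrite gt_eqF.
Qed.

Let level_bound j : (avgR B (fun x => (i_ j x * U x `^ m j) `^ q0)%R <= (moser_level j `^ q0)%:E)%E.
Proof.
elim: j => [|j IH].
  have -> : moser_level 0 = X; last by rewrite /m expr0 mulr1.
  rewrite /moser_level expr0 (powRr1 (ltW W0)) /moser_bound mulr1 !powRN.
  by field; rewrite !gt_eqF ?powR_gt0.
have := step (L0 j) IH => Hs.
have mUj j' : meas_fun B (fun x => U x `^ m j') by exact: (@meas_powR _ _ _ U).
apply: (@le_trans _ _ (avgR B (fun x => (eta j x * U x `^ m j) `^ (q0 * chi))%R)).
  apply: le_avg => //.
  - by apply: (@meas_powR _ _ _ (fun x => i_ j.+1 x * U x `^ m j.+1)); exact: (measM (mi _) (mUj _)).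
  - by apply: (@meas_powR _ _ _ (fun x => eta j x * U x `^ m j)); exact: (measM (me _) (mUj _)).
  move=> x Bx; rewrite powR_ge0/=.
  have -> : U x `^ m j.+1 = (U x `^ m j) `^ chi by rewrite -powRrM /m exprSr mulrA.
  have := ieta j Bx; have [->|->] := i01 j.+1 Bx => ie.
    by rewrite mul0r powR0 ?powR_ge0// gt_eqF.
  rewrite mul1r -powRrM mulrC [q0 * chi]mulrC; apply: powR_mono.
  - by rewrite mulr_ge0// ltW.
  - exact: powR_ge0.
  - by rewrite ler_peMl ?powR_ge0.
apply: (le_trans Hs); rewrite lee_fin [q0 * chi]mulrC powRrM.
have /andP[A0 _] := AG j.
by apply: powR_mono; [exact: ltW|exact: powR_ge0|exact: level_step].
Qed.

(** On T all the plateau indicators are 1, and (U^(m j))^q0 is the power chi^j q0 of U^m0, so the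
    level bounds are moments of U^m0 with exponents tending to infinity. The sign of m0 is
    irrelevant to the argument, which serves for the essential supremum and infimum alike. *)
Lemma moser_iteration : {ae @leb R n, forall x, T x -> U x `^ m0 <= moser_bound}.
Proof.
have mUj q : meas_fun B (fun x => U x `^ q) by exact: (@meas_powR _ _ _ U).
apply: (@ae_le_of_powers (fun x => U x `^ m0) moser_bound (fun j => chi ^+ j * q0)); [exact: mUj|by move=> x _; exact: powR_ge0|exact: W0| |].
(* Bernoulli's inequality, from which chi^j tends to infinity. *)
- have HB j : 1 + (chi - 1) * j%:R <= chi ^+ j.
    elim: j => [|j IH]; first by rewrite mulr0 addr0 expr0.
    rewrite exprS -natr1; apply: (@le_trans _ _ (chi * (1 + (chi - 1) * j%:R))).
      have h1 := ler0n R j; have h2 := mulr_ge0 (ltW chi10) (ltW chi10).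
      have := mulr_ge0 h2 h1; nra.
    by rewrite ler_pM2l.
  apply/cvgryPge => K; near=> j.
  apply: (@le_trans _ _ ((chi - 1) * j%:R * q0)).
    rewrite mulrAC -ler_pdivrMl ?mulr_gt0//; near: j; exact: nbhs_infty_ger.
  by rewrite ler_pM2r// (le_trans _ (HB j))// lerDr.
- move=> j; apply: (le_trans _ (_ : ((moser_level j `^ q0)%:E <= _)%E)).
  apply: (le_trans _ (level_bound j)); apply: le_avg => //.
  + apply: measM; first exact: measurable_indic.
    exact: (@meas_powR _ _ _ (fun x => U x `^ m0)).
  + by apply: (@meas_powR _ _ _ (fun x => i_ j x * U x `^ m j)); exact: (measM (mi _) (mUj _)).
  + move=> x Bx; rewrite mulr_ge0 ?powR_ge0//=.
    rewrite indicE; have [|] := boolP (x \in T); rewrite ?mul0r ?powR_ge0// inE => Tx.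
    by rewrite mul1r (iT j Tx) mul1r -!powRrM mulrA.
  rewrite lee_fin powRrM; apply: powR_mono; [exact: ltW|exact: ltW|].
  rewrite /moser_level -mulrA ler_piMr ?powR_ge0// mulr_ile1 ?powR_ge0//.
    rewrite powRN invf_le1 ?powR_gt0// -[leLHS](powRr0 G); apply: ler_powR => //.
    by rewrite divr_ge0// ltW.
  rewrite powRN invf_le1 ?powR_gt0// -[leLHS](powRr0 H); apply: ler_powR => //.
  have al0 : 0 <= al by apply: divr_ge0; exact: ltW.
  by apply: addr_ge0; [exact: mulr_ge0|apply: divr_ge0 => //; exact: ltW].
Unshelve. all: by end_near. Qed.

End moser_iteration.

(** * The John-Nirenberg inequality *)

Section covering.
Context {R : realType} {n : nat}.
Local Notation E := 'rV[R]_n.+1.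

Lemma leb_box ab : (@leb R n (box ab) <= box_vol ab)%E.
Proof.
pose F (k : nat) : E * E := if k is 0 then ab else (0, 0).
apply: (@le_trans _ _ (\sum_(k <oo) box_vol (F k))%E).
  by apply: ereal_inf_lbound; exists F => // x Ax; exists 0.
rewrite (nneseries_split 0 1)//; last by move=> *; exact: box_vol_ge0.
rewrite eseries0 ?adde0; first by rewrite big_nat1.
move=> [|k]// _ _; rewrite /box_vol /= big_ord_recl /= mxE subrr maxxx mul0r//.
Qed.

Lemma open_box (a b : E) : open [set x : E | forall i, a ord0 i < x ord0 i < b ord0 i].
Proof.
rewrite openE => x /= xab.
pose e := \big[Num.min/1]_i Num.min (x ord0 i - a ord0 i) (b ord0 i - x ord0 i).
have e0 : 0 < e.
  rewrite /e; elim/big_ind: _ => // [y z y0 z0|i _]; first by rewrite lt_min y0.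
  by rewrite lt_min !subr_gt0.
apply/nbhs_ballP; exists e => //= y xy i.
have := (ball_rV _ _ e0).1 xy i; have : e <= Num.min (x ord0 i - a ord0 i) (b ord0 i - x ord0 i).
  exact: bigmin_le_cond.
rewrite le_min => /andP[h1 h2]; rewrite /ball/= ltr_distl => /andP[h3 h4].
by apply/andP; split; lra.
Qed.

(** Only the upper faces of a half-open box have to be moved outwards, and the volume depends
    continuously on the displacement 1/(k+1). *)
Lemma box_enlarge (ab : E * E) (e : R) : 0 < e ->
  exists O : set E, [/\ open O, box ab `<=` O & (leb O <= box_vol ab + e%:E)%E].
Proof.
move=> e0; pose v (d : R) := \prod_i Num.max 0 (ab.2 ord0 i + d - ab.1 ord0 i).
have cv : v k.+1%:R^-1 @[k --> \oo] --> v 0.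
  rewrite /v; apply: cvg_big => [|i _]; first exact: mul_continuous.
  have cz : ab.2 ord0 i + k.+1%:R^-1 - ab.1 ord0 i @[k --> \oo] --> ab.2 ord0 i + 0 - ab.1 ord0 i.
    apply: cvgB; last exact: cvg_cst.
    by apply: cvgD; [exact: cvg_cst|exact: cvg_harmonic].
  rewrite maxr_absE; under eq_fun do rewrite maxr_absE.
  apply: cvgM; last exact: cvg_cst.
  apply: cvgD; first by apply: cvgD; [exact: cvg_cst|exact: cz].
  by apply: cvg_norm; apply: cvgB; [exact: cvg_cst|exact: cz].
have : \forall k \near \oo, v k.+1%:R^-1 < v 0 + e.
  by apply: (cvgr_lt _ cv); rewrite ltrDl.
case=> k _ /(_ k (leqnn k))/= vk.
pose d : R := k.+1%:R^-1; have d0 : 0 < d by rewrite invr_gt0.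
pose b' : E := \row_i (ab.2 ord0 i + d).
exists [set x : E | forall i, ab.1 ord0 i < x ord0 i < b' ord0 i]; split.
- exact: open_box.
- by move=> x abx i; have /andP[-> h] := abx i; rewrite mxE (le_lt_trans h)// ltrDl.
- apply: (@le_trans _ _ (leb (box (ab.1, b')))).
    by apply: le_leb_outer => x /= H i; have /andP[-> /ltW ->] := H i.
  apply: (le_trans (leb_box _)); rewrite -EFinD lee_fin /=.
  have -> : \prod_i Num.max 0 (b' ord0 i - ab.1 ord0 i) = v d.
    by apply: eq_bigr => i _; rewrite mxE.
  apply: (le_trans (ltW vk)); rewrite lerD2r le_eqVlt; apply/orP; left; apply/eqP.
  by apply: eq_bigr => i _; rewrite addr0.
Qed.

Lemma leb_outer_regular (A : set E) (e : R) : 0 < e -> (leb A < +oo)%E ->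
  exists O : set E, [/\ open O, A `<=` O & (leb O <= leb A + e%:E)%E].
Proof.
move=> e0 Alty; have e20 : 0 < e / 2 by rewrite divr_gt0.
have fA : ereal_inf [set (\sum_(k <oo) box_vol (F k))%E |
             F in [set F : nat -> E * E | A `<=` \bigcup_k box (F k)]] \is a fin_num.
  by rewrite ge0_fin_numE// leb_outer_ge0.
have [_ [F AF <-] HF] := lb_ereal_inf_adherent e20 fA.
have ek k : 0 < e / 2 / (2 ^ k.+1)%:R by rewrite divr_gt0// ltr0n expn_gt0.
have /choice[G HG] k := box_enlarge (F k) (ek k).
exists (\bigcup_k G k); split.
- by apply: bigcup_open => k _; have [] := HG k.
- by move=> x /AF[k _ xk]; exists k => //; have [_ h _] := HG k; exact: h.
apply: (le_trans (outer_measure_sigma_subadditive _ _)).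
apply: (@le_trans _ _ (\sum_(k <oo) (box_vol (F k) + (e / 2 / (2 ^ k.+1)%:R)%:E))%E).
  by apply: lee_nneseries => [k _ _|k _]; [exact: leb_outer_ge0|have [] := HG k].
apply: (le_trans (epsilon_trick _ _ (ltW e20))); first by move=> k; exact: box_vol_ge0.
rewrite [in leRHS](splitr e) EFinD addeA; apply: leeD => //.
exact: ltW.
Qed.

(** Vitali's selection with integer levels in place of radii, a small level meaning a large ball.
    Zorn's lemma is applied to disjoint families such that any set meeting the family meets a member
    of no larger level. If a maximal family missed some set, one of minimal level among the missed
    sets could be added. *)
Lemma vitali_family (X T : Type) (S : set T) (b : T -> set X) (lev : T -> nat) :
  (forall x, S x -> b x !=set0) -> exists D, [/\ D `<=` S, trivIset D b &
    forall x, S x -> exists d, [/\ D d, (lev d <= lev x)%N & b d `&` b x !=set0]].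
Proof.
move=> b0; pose meets D x := exists2 d, D d & b d `&` b x !=set0.
pose P D := [/\ D `<=` S, trivIset D b & forall x, S x -> meets D x ->
  exists d, [/\ D d, (lev d <= lev x)%N & b d `&` b x !=set0]].
have [|D [[DS tD HD] maxD]] := @Zorn_bigcup T P.
  move=> F FP Ft; split.
  - by move=> x [D FD Dx]; have [h _ _] := FP D FD; exact: h.
  - move=> i j [x Fx xi] [y Fy yj] ij; have [xy|yx] := Ft _ _ Fx Fy.
      by have [_ h _] := FP _ Fy; exact: (h _ _ (xy _ xi) yj).
    by have [_ h _] := FP _ Fx; exact: (h _ _ xi (yx _ yj)).
  - move=> x Sx [d [D FD Dd] bd]; have [_ _ h] := FP _ FD.
    have [|d' [Dd' l1 l2]] := h x Sx; first by exists d.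
    by exists d'; split => //; exists D.
exists D; split => // x Sx; apply: contrapT => nx.
have free0 : exists k, `[< exists2 z, S z & lev z = k /\ ~ meets D z >].
  exists (lev x); apply/asboolP; exists x => //; split => // mx.
  by apply: nx; exact: HD.
case: (ex_minnP free0) => k /asboolP[z Sz [lz nz]] kmin.
have Dz : ~ D z.
  by move=> Dz; apply: nz; exists z => //; rewrite setIid; exact: b0.
apply: (maxD (D `|` [set z])).
  by split=> [w Dw|H]; [left|apply: Dz; apply: H; right].
have disj w : D w -> b w `&` b z = set0.
  move=> Dw; apply/eqP/negPn/negP => /set0P h; apply: nz; exists w => //.
split.
- by move=> w [/DS|->].
- move=> i j [Di|->] [Dj|->] // ij; first exact: tD.
    by case: ij => w; rewrite disj.
  by case: ij => w; rewrite setIC disj.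
- move=> w Sw mw; have [mD|nD] := pselect (meets D w).
    have [d [Dd l1 l2]] := HD w Sw mD; exists d; split => //; by left.
  case: mw => d [Dd|->] dw; first by case: nD; exists d.
  exists z; split => //; first by right.
  by rewrite lz; apply: kmin; apply/asboolP; exists w.
Qed.

(** b' d is a dilation of b d that contains every point x whose b x meets b d and is of no larger
    size. The selected balls are disjoint, so the local estimates add up to one over V. *)
Lemma covering_bound (S V : set E) (b b' : E -> set E) (lev : E -> nat) (C : R) (w : E -> R) :
  0 <= C -> measurable (V : set (Rn R n)) -> meas_fun V w -> (forall x, V x -> 0 <= w x) ->
  (forall x, S x -> [/\ open (b x), b x x & b x `<=` V]) ->
  (forall x, S x -> (leb (S `&` b' x) <= C%:E * intU (b x) w)%E) ->
  (forall x d, S x -> S d -> (lev d <= lev x)%N -> b d `&` b x !=set0 -> b' d x) ->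
  (leb S <= C%:E * intU V w)%E.
Proof.
move=> C0 mV mw w0 HbV Hb Hb'.
have [D [DS tD HD]] := @vitali_family E E S b lev (fun x Sx => ex_intro _ x (let: And3 _ h _ := HbV x Sx in h)).
(* Disjoint open sets contain distinct rational points, so the selected family can be indexed by
   natural numbers. *)
have : forall d, exists q : 'rV[rat]_n.+1, D d -> b d (ratv q).
  move=> d; have [Dd|Dd] := pselect (D d); last by exists 0.
  have [od dd _] := HbV _ (DS _ Dd).
  have /nbhs_ballP[e/= e0 eb] := open_nbhs_nbhs (conj od dd).
  by have [q xq] := dense_ratv d e0; exists q => _; exact: eb.
move=> /choice[q Hq]; pose kk d := pickle (q d).
have kk_inj d d' : D d -> D d' -> kk d = kk d' -> d = d'.
  move=> Dd Dd' /(pcan_inj pickleK) qq; apply: (tD d d' Dd Dd').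
  by exists (ratv (q d)); split; [exact: Hq|rewrite qq; exact: Hq].
pose Dk k := [set d | D d /\ kk d = k].
pose B k := \bigcup_(d in Dk k) b d.
pose B' k := \bigcup_(d in Dk k) (S `&` b' d).
have SB : S `<=` \bigcup_k B' k.
  move=> x Sx; have [d [Dd ld bd]] := HD x Sx.
  by exists (kk d) => //; exists d => //; split => //; exact: Hb' (DS _ Dd) ld bd.
have oB k : open (B k).
  by apply: bigcup_open => d [/DS Sd _]; have [] := HbV _ Sd.
have mB k : measurable (B k : set (Rn R n)) by exact: open_measurable_Rn.
have BV k : B k `<=` V by move=> x [d [/DS Sd _] bx]; have [_ _ h] := HbV _ Sd; exact: h.
have Dk1 k d : Dk k d -> Dk k = [set d].
  move=> [Dd kd]; apply/seteqP; split=> [d' [Dd' kd']|_ ->] /=; last by [].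
  by apply: kk_inj => //; rewrite kd.
have HB k : (leb (B' k) <= C%:E * intU (B k) w)%E.
  have [[d Dkd]|nk] := pselect (exists d, Dk k d).
    rewrite /B' /B (Dk1 k d Dkd) !bigcup_set1; exact: Hb (DS _ Dkd.1).
  have -> : B' k = set0 by apply/seteqP; split=> // x [d Dkd]; case: nk; exists d.
  rewrite measure0 mule_ge0// ?lee_fin//; apply: intU_ge0 => x Bx; exact: w0 (BV k x Bx).
have tB : trivIset setT B.
  move=> i j _ _ [x [[d [Dd kd] bd] [d' [Dd' kd'] bd']]].
  by rewrite -kd -kd'; congr kk; apply: tD => //; exists x.
apply: (@le_trans _ _ (\sum_(k <oo) leb (B' k))%E).
  by apply: le_trans (outer_measure_sigma_subadditive (@leb_outer R n) _); exact: le_leb_outer.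
apply: (@le_trans _ _ (\sum_(k <oo) (C%:E * intU (B k) w))%E).
  by apply: lee_nneseries => k _ //; rewrite measure_ge0.
rewrite nneseriesZl; last first.
  by move=> k _; apply: intU_ge0 => x Bx; exact: w0 (BV k x Bx).
apply: lee_wpmul2l; first by rewrite lee_fin.
have UV : \bigcup_k B k `<=` V by move=> x [k _]; exact: BV.
rewrite -(@ge0_integral_bigcup _ _ _ leb B (EFin \o w)) => //.
- by apply: le_intU_set => //; exact: bigcupT_measurable.
- by apply: meas_EFin; exact: meas_sub mV UV mw.
- by move=> x /UV Vx; rewrite lee_fin; exact: w0.
Qed.

End covering.

(** * Decay of level sets for functions of bounded mean oscillation *)

Section john_nirenberg.
Context {R : realType} {n : nat}.
Local Notation E := 'rV[R]_n.+1.

Lemma qball_sub (Omega : set E) rho (kappa : R) (z x : E) (s t r : R) : quasimetric Omega rho kappa ->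
  Omega z -> qball Omega rho z s x -> kappa * (s + t) <= r ->
  qball Omega rho x t `<=` qball Omega rho z r.
Proof.
move=> [k1 rs rt] Oz [Ox zx] h y [Oy xy]; split => //.
apply: (le_lt_trans (rt z y x Oz Oy Ox)); apply: lt_le_trans h.
have [_ -> _] := rs y x Oy Ox; rewrite ltr_pM2l ?ltrD//.
exact: lt_le_trans k1.
Qed.

Lemma qballxx (Omega : set E) rho (kappa : R) (z : E) (r : R) : quasimetric Omega rho kappa ->
  Omega z -> 0 < r -> qball Omega rho z r z.
Proof. by move=> [_ rs _] Oz r0; split=> //; have [_ _ [_ ->]] := rs z z Oz Oz. Qed.

Lemma intU_const (b : set E) (K : R) : measurable (b : set (Rn R n)) -> (@leb R n b < +oo)%E ->
  intU b (fun=> K) = (K * vol b)%:E.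
Proof.
by move=> mb bf; rewrite /intU integral_cst// EFinM /vol fineK// ge0_fin_numE.
Qed.

Lemma const_le_intUD (b : set E) (K : R) (g h : E -> R) : measurable (b : set (Rn R n)) ->
  (@leb R n b < +oo)%E -> 0 <= K -> meas_fun b g -> meas_fun b h ->
  (forall x, b x -> 0 <= g x) -> (forall x, b x -> 0 <= h x) ->
  (forall x, b x -> K <= g x + h x) -> ((K * vol b)%:E <= intU b g + intU b h)%E.
Proof.
move=> mb bf K0 mg mh g0 h0 H; rewrite -intU_const// -intUD//.
apply: (@le_intU _ _ _ (fun=> K) (fun x => g x + h x) mb (@meas_cst _ _ b K) (measD mg mh)) => x bx.
by rewrite K0 H.
Qed.

Variables (Omega : set E) (rho : E -> E -> R) (kappa : R).
Hypothesis qm : quasimetric Omega rho kappa.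
Local Notation ball := (qball Omega rho).
Hypothesis oball : forall x r, Omega x -> open (ball x r).
Hypothesis fine_balls : forall x, Omega x -> forall eps : R, 0 < eps -> exists2 del : R, 0 < del &
  forall y, Omega y -> rho x y < del -> `|x - y| < eps.
Variables (ok : E -> R -> Prop) (f : E -> R) (c : E -> R -> R) (Lam D : R).
Hypotheses (Lam0 : 0 < Lam) (D0 : 0 <= D).
Hypothesis okP : forall z r, ok z r -> [/\ Omega z, 0 < r, (0 < @leb R n (ball z r))%E,
  (@leb R n (ball z r) < +oo)%E & meas_fun (ball z r) f].
Hypothesis ok_sub : forall z x r t, ok z (2 * kappa * r) -> ball z r x -> 0 < t -> t <= r -> ok x t.
Hypothesis doubling : forall x t z r, ok x t -> ok z r -> t <= r -> r <= 8 * kappa ^+ 3 * t ->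
  ball x t `<=` ball z r -> vol (ball z r) <= D * vol (ball x t).
Hypothesis oscillation : forall z r, ok z r ->
  (intU (ball z r) (fun x => `|f x - c z r|)%R <= (Lam * vol (ball z r))%:E)%E.

Let k1 : 1 <= kappa. Proof. by have [] := qm. Qed.
Let k0 : 0 < kappa. Proof. exact: lt_le_trans k1. Qed.

(** [delta] bounds the difference of the constants c of comparable nested balls. [thr] is taken so
    large that D (Lam + delta) |V| / (thr - Lam) is at most half of |B| when |V| <= D |B|; this is
    the factor 1/2 gained at each level. *)
Let delta := (1 + D) * Lam.
Let thr := Lam + 4 * delta * (D ^+ 2 + 1).
Definition jn_step := thr + 2 * delta.
Let d0 : 0 < delta. Proof. by rewrite mulr_gt0// ltr_wpDr. Qed.
Let Ld : Lam <= delta. Proof. by rewrite /delta mulrDl mul1r lerDl; apply: mulr_ge0 => //; exact: ltW. Qed.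
Let thr_d : 2 * delta <= thr - Lam.
Proof. by rewrite /thr addrC addKr mulrDr mulr1; have := mulr_ge0 (ltW d0) (sqr_ge0 D); have := d0; nra. Qed.

Let mball x r : Omega x -> measurable (ball x r : set (Rn R n)).
Proof. by move=> Ox; apply: open_measurable_Rn; exact: oball. Qed.

Let mosc z r b K : ok z r -> measurable (b : set (Rn R n)) -> b `<=` ball z r ->
  meas_fun b (fun x => `|f x - K|).
Proof.
move=> okz mb bz; have [Oz _ _ _ mf] := okP okz.
apply: meas_norm; apply: measB; last exact: meas_cst.
exact: meas_sub (mball _ Oz) bz mf.
Qed.

Let ok_vol z r : ok z r -> 0 < vol (ball z r).
Proof. by move=> /okP[_ _ h1 h2 _]; exact: vol_gt0. Qed.

Let ok_leb z r : ok z r -> leb (ball z r) = (vol (ball z r))%:E.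
Proof. by move=> /okP[_ _ h1 h2 _]; rewrite volE. Qed.

(** The triangle inequality through f is averaged over the smaller ball; doubling compares the two
    volumes. *)
Lemma oscillation_compare x t z r : ok x t -> ok z r -> t <= r -> r <= 8 * kappa ^+ 3 * t ->
  ball x t `<=` ball z r -> `|c x t - c z r| <= delta.
Proof.
move=> okx okz tr rt sub; have vx := ok_vol okx.
have [Ox _ _ fx _] := okP okx; have [Oz _ _ _ _] := okP okz.
have mx := mosc (c x t) okx (mball t Ox) (@subset_refl _ _).
have mz := mosc (c z r) okz (mball t Ox) sub.
have H1 := const_le_intUD (K := `|c x t - c z r|) (mball t Ox) fx (normr_ge0 _) mx mz
   (fun _ _ => normr_ge0 _) (fun _ _ => normr_ge0 _).
have {}H1 : ((`|c x t - c z r| * vol (ball x t))%:E <= intU (ball x t) (fun y => `|f y - c x t|)%R +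
    intU (ball x t) (fun y => `|f y - c z r|)%R)%E.
  apply: H1 => y _; have -> : c x t - c z r = (f y - c z r) - (f y - c x t) by ring.
  by rewrite [X in _ <= X]addrC; exact: ler_normB.
have H2 : (intU (ball x t) (fun y => `|f y - c z r|)%R <= (Lam * vol (ball z r))%:E)%E.
  apply: le_trans (oscillation okz); apply: le_intU_set => //; try exact: mball.
  exact: mosc okz (mball r Oz) (@subset_refl _ _).
have := le_trans H1 (leeD (oscillation okx) H2); rewrite -EFinD lee_fin => H.
rewrite -(ler_pM2r vx); apply: (le_trans H).
have := doubling okx okz tr rt sub; have := Lam0; rewrite /delta; nra.
Qed.

Let lvl (m : nat) z r := [set x | ball z r x /\ m%:R * jn_step < `|f x - c z r|].

Section step.
Variable m : nat.
Hypothesis IH : forall z r, ok z (2 * kappa * r) -> 0 < r ->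
  (leb (lvl m z r) <= (2^-1 ^+ m * vol (ball z r))%:E)%E.
Variables (z : E) (r : R).
Hypotheses (okz : ok z (2 * kappa * r)) (r0 : 0 < r).
Let B := ball z r.
Let V := ball z (2 * kappa * r).
Let S := lvl m.+1 z r.
Let K := c z r.
Let t j := r / (4 * kappa ^+ 2) * 2^-1 ^+ j.

Let Oz : Omega z. Proof. by have [] := okP okz. Qed.
Let okB : ok z r. Proof. exact: ok_sub okz (qballxx qm Oz r0) r0 (lexx r). Qed.
Let t_gt0 j : 0 < t j. Proof. by rewrite !mulr_gt0// ?invr_gt0 ?exprn_gt0// mulr_gt0// exprn_gt0. Qed.
Let t_le j : 4 * kappa ^+ 2 * t j <= r.
Proof.
have k4 : 0 < 4 * kappa ^+ 2 by rewrite mulr_gt0// exprn_gt0.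
rewrite /t mulrA [_ * (r / _)]mulrC divfK ?gt_eqF// ler_piMr//; first exact: ltW.
by apply: exprn_ile1; [rewrite invr_ge0|rewrite invf_le1// ler1n].
Qed.
Let t_S j : t j = 2 * t j.+1.
Proof. by rewrite /t (exprS _ j); move: (r / _) (_ ^+ j) => ? ?; field. Qed.
Let t0E : r = 4 * kappa ^+ 2 * t 0%N.
Proof. by rewrite /t expr0 mulr1 mulrC divfK// gt_eqF// mulr_gt0// exprn_gt0. Qed.
Let ok_small x s : B x -> 0 < s -> s <= r -> ok x s. Proof. by move=> Bx; exact: ok_sub okz Bx. Qed.
Let k2 : 1 <= kappa ^+ 2. Proof. exact: exprn_ege1. Qed.
Let k3 : kappa <= kappa ^+ 3. Proof. by rewrite exprS ler_peMr// ltW. Qed.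
Let tr j : t j <= r. Proof. by apply: le_trans (t_le j); have := t_gt0 j; have := k2; nra. Qed.
Let t2_gt0 j : 0 < 2 * kappa * t j. Proof. by apply: mulr_gt0 (t_gt0 j); exact: mulr_gt0. Qed.
Let t2r j : 2 * kappa * t j <= r.
Proof.
apply: le_trans (t_le j); rewrite ler_pM2r//.
by have := k1; have := mulr_ge0 (ltW k0) (ltW k0); nra.
Qed.
Let subV x s : B x -> s <= r -> ball x s `<=` V.
Proof. by move=> Bx sr; apply: (qball_sub qm Oz Bx); have := k0; nra. Qed.

Let center : `|K - c z (2 * kappa * r)| <= delta.
Proof.
apply: oscillation_compare okB okz _ _ (subV (qballxx qm Oz r0) (lexx r)).
  by have := k1; have := r0; nra.
by have := k3; have := r0; have := k0; nra.
Qed.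

Let start x : B x -> `|c x (t 0%N) - K| <= 2 * delta.
Proof.
move=> Bx; have okx := ok_small Bx (t_gt0 0) (tr 0).
have h1 : `|c x (t 0%N) - c z (2 * kappa * r)| <= delta.
  apply: oscillation_compare okx okz _ _ (subV Bx (tr 0)).
    by apply: (le_trans (tr 0)); have := k1; have := r0; nra.
  (* The radii are exactly in the ratio 2 kappa r / t 0 = 8 kappa^3, the largest that [doubling]
     allows. *)
  by rewrite {1}t0E le_eqVlt; apply/orP; left; apply/eqP; ring.
have h2 := center.
have -> : c x (t 0%N) - K = c x (t 0%N) - c z (2 * kappa * r) - (K - c z (2 * kappa * r)) by ring.
by apply: (le_trans (ler_normB _ _)); rewrite (_ : 2 * delta = delta + delta); [exact: lerD|ring].
Qed.

Let ballS x s s' : s <= s' -> ball x s `<=` ball x s'.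
Proof. by move=> ss y [Oy xy]; split=> //; exact: lt_le_trans ss. Qed.

Let next x j : B x -> `|c x (t j.+1) - c x (t j)| <= delta.
Proof.
move=> Bx; apply: oscillation_compare; first exact: (ok_small Bx (t_gt0 _) (tr _)).
- exact: (ok_small Bx (t_gt0 _) (tr _)).
- by rewrite (t_S j); have := t_gt0 j.+1; lra.
- by rewrite (t_S j); have := t_gt0 j.+1; have := k3; have := k1; nra.
- by apply: ballS; rewrite (t_S j); have := t_gt0 j.+1; lra.
Qed.

Let enlarge x j : B x -> `|c x (t j) - c x (2 * kappa * t j)| <= delta.
Proof.
move=> Bx; apply: oscillation_compare; first exact: (ok_small Bx (t_gt0 _) (tr _)).
- exact: (ok_small Bx (t2_gt0 j) (t2r j)).
- by have := t_gt0 j; have := k1; nra.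
- by have := t_gt0 j; have := k3; have := k0; nra.
- by apply: ballS; have := t_gt0 j; have := k1; nra.
Qed.

(** Along the dyadic radii the constants change by at most delta. Either one of them leaves the
    threshold, and then the first to do so is within delta of it, the radius t 0 being excluded by
    [start]; or none does, and a sufficiently small ball lies in G. *)
Let stop (G : set E) x : open G -> G x -> B x -> exists j, `|c x (t j) - K| <= thr + delta /\
  (thr < `|c x (t j) - K| \/ `|c x (t j) - K| <= thr /\ ball x (t j) `<=` G).
Proof.
move=> oG Gx Bx; have [ex|nex] := pselect (exists j, thr < `|c x (t j) - K|).
  case: (ex_minnP ex) => -[|j] hj jmin.
    exfalso; have := start Bx; have := thr_d; have := Lam0; lra.
  exists j.+1; split; last by left.
  have hj' : `|c x (t j) - K| <= thr.
    by rewrite leNgt; apply/negP => /jmin; rewrite ltnn.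
  have -> : c x (t j.+1) - K = (c x (t j.+1) - c x (t j)) + (c x (t j) - K) by ring.
  by apply: (le_trans (ler_normD _ _)); rewrite addrC lerD// next.
have all_le j : `|c x (t j) - K| <= thr by rewrite leNgt; apply/negP => h; apply: nex; exists j.
have [Ox _] := Bx.
have /nbhs_ballP[e/= e0 eG] := open_nbhs_nbhs (conj oG Gx).
have [del del0 Hdel] := fine_balls Ox e0.
have tcv : t j @[j --> \oo] --> (0 : R).
  rewrite -(mulr0 (r / (4 * kappa ^+ 2))); apply: cvgM; first exact: cvg_cst.
  by apply: cvg_expr; rewrite ger0_norm// invf_lt1// ltr1n.
have := cvgr_lt _ tcv _ del0; case=> j _ /(_ j (leqnn j))/= tj.
exists j; split; first by rewrite (le_trans (all_le j))// lerDl ltW.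
right; split => // y [Oy xy]; apply: eG; rewrite -ball_normE/=.
exact: Hdel Oy (lt_trans xy tj).
Qed.

(* Every point of [S] has a first dyadic ball whose mean has moved far from [K],  *)
(* or small balls inside an open set [O] containing [S] of almost the same        *)
(* measure. A Vitali subfamily is charged to the oscillation or to [O] minus [S], *)
(* which replaces Lebesgue's differentiation theorem.                            *)
Lemma jn_induction : (leb S <= (2^-1 ^+ m.+1 * vol B)%:E)%E.
Proof.
have mB : measurable (B : set (Rn R n)) by exact: mball.
have mV : measurable (V : set (Rn R n)) by exact: mball.
have BV : B `<=` V by exact: (subV (qballxx qm Oz r0) (lexx r)).
have [_ _ B_gt0 B_lty mfB] := okP okB; have [_ _ V_gt0 V_lty mfV] := okP okz.
have mS : measurable (S : set (Rn R n)).
  have mg := mosc K okB mB (@subset_refl _ _).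
  have -> : S = B `&` (fun x => `|f x - K|) @^-1` `]m.+1%:R * jn_step, +oo[%classic.
    by apply/seteqP; split => x /=; rewrite in_itv/= andbT.
  exact: (mg mB _ (measurable_itv _)).
have SB : S `<=` B by move=> x [].
have S_lty : (leb S < +oo)%E by apply: le_lt_trans B_lty; exact: le_leb_outer.
have tD0 : 0 < thr - Lam by apply: lt_le_trans thr_d; rewrite mulr_gt0.
have thrL : Lam <= thr by rewrite -subr_ge0 ltW.
pose C := 2^-1 ^+ m * D.
have C0 : 0 <= C by rewrite mulr_ge0// exprn_ge0.
have key e : 0 < e -> (leb S <= (2^-1 ^+ m.+1 * vol B + 2 * C * e)%:E)%E.
  move=> e0; have [G [oG SG Ge]] := leb_outer_regular e0 S_lty.
  have mG : measurable (G : set (Rn R n)) by exact: open_measurable_Rn.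
  have HG : (leb (G `\` S) <= e%:E)%E.
    have : (leb G = leb S + leb (G `\` S))%E.
      by rewrite -measureU ?setDUK//; [exact: measurableD|rewrite setIDA setIidl ?setDv].
    move=> GE; move: Ge; rewrite GE leeD2lE//.
    by rewrite ge0_fin_numE.
  have : forall x, exists j, S x -> `|c x (t j) - K| <= thr + delta /\
    (thr < `|c x (t j) - K| \/ `|c x (t j) - K| <= thr /\ ball x (t j) `<=` G).
    move=> x; have [Sx|nSx] := pselect (S x); last by exists 0%N.
    by have [j hj] := stop oG (SG x Sx) (SB x Sx); exists j.
  move=> /choice[lev Hlev].
  (* w1 pays for balls whose constant is far from K, on which |f - K| has mean at least thr - Lam.
     w2 pays for the others: they lie in G, and on S the function is farther than 2 Lam from their
     constant, so at least half of such a ball is outside S. *)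
  pose w1 x := (thr - Lam)^-1 * `|f x - K|; pose w2 x := 2 * \1_(G `\` S) x : R.
  have w10 x : 0 <= w1 x by rewrite mulr_ge0// invr_ge0 ltW.
  have w20 x : 0 <= w2 x by rewrite mulr_ge0// indicE.
  have mabs b : measurable (b : set (Rn R n)) -> b `<=` V -> meas_fun b (fun x => `|f x - K|).
    exact: mosc okz.
  have mw1 b : measurable (b : set (Rn R n)) -> b `<=` V -> meas_fun b w1.
    by move=> mb bV; exact: (@measM _ _ b (fun=> (thr - Lam)^-1) _ (@meas_cst _ _ b _) (mabs b mb bV)).
  have mGS : measurable (G `\` S : set (Rn R n)) by exact: measurableD.
  have mw2 b : meas_fun b w2 by apply: measM; [exact: meas_cst|exact: measurable_indic].
  have HV : (leb S <= C%:E * intU V (fun x => w1 x + w2 x)%R)%E.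
    apply: (@covering_bound R n S V (fun x => ball x (t (lev x)))
       (fun x => ball x (2 * kappa * t (lev x))) lev C) => //.
    - exact: (measD (mw1 V mV (@subset_refl _ _)) (mw2 V)).
    - by move=> x _; rewrite addr_ge0.
    - move=> x Sx; have [Ox _] := SB x Sx; split; first exact: oball.
        exact: (qballxx qm Ox (t_gt0 _)).
      exact: (subV (SB x Sx) (tr _)).
    - move=> x Sx; have Bx := SB x Sx; have [Ox _] := Bx; set j := lev x.
      have okb := ok_small Bx (t_gt0 j) (tr j).
      have t2 := t2_gt0 j.
      have okb' := ok_small Bx t2 (t2r j).
      have okb2 : ok x (2 * kappa * (2 * kappa * t j)).
        apply: (ok_small Bx); first by apply: mulr_gt0 t2; exact: mulr_gt0.
        by have -> : 2 * kappa * (2 * kappa * t j) = 4 * kappa ^+ 2 * t j by ring.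
      have [h1 h2] := Hlev x Sx.
      have bV := subV Bx (tr j); have mb : measurable (ball x (t j) : set (Rn R n)) by exact: mball.
      have [_ _ b_gt0 b_lty mfb] := okP okb.
      have Hvol : (leb (S `&` ball x (2 * kappa * t j)) <= (C * vol (ball x (t j)))%:E)%E.
        apply: (@le_trans _ _ (2^-1 ^+ m * vol (ball x (2 * kappa * t j)))%:E).
          (* On S the distance to K exceeds m + 1 steps, while the constant of the dilated ball is
             within thr + 2 delta, one step, of K; m steps remain for the induction hypothesis. *)
          apply: le_trans (IH okb2 t2); apply: le_leb_outer => y [[By Hy] by'].
          split => //; have := enlarge j Bx; move: h1 Hy; rewrite -/j -/K -natr1 mulrDl mul1r.
          rewrite /jn_step => h1 Hy h3.
          have -> : f y - c x (2 * kappa * t j) =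
            (f y - K) - ((c x (t j) - K) - (c x (t j) - c x (2 * kappa * t j))) by ring.
          apply: lt_le_trans (lerB_dist _ _); have := ler_normB (c x (t j) - K) (c x (t j) - c x (2 * kappa * t j)).
          move: Hy h1 h3; move: (m%:R * _) (`|f y - K|) (`|c x (t j) - K|) (`|c x (t j) - c x (2 * kappa * t j)|) (`|_ - _|).
          by move=> *; lra.
        rewrite lee_fin /C -[X in _ <= X]mulrA; apply: ler_wpM2l; first exact: exprn_ge0.
        apply: (doubling okb okb').
        + by have := t_gt0 j; have := k1; nra.
        + by have := t_gt0 j; have := k3; have := k0; nra.
        + by apply: ballS; have := t_gt0 j; have := k1; nra.
      apply: (le_trans Hvol); rewrite EFinM; apply: lee_wpmul2l; first by rewrite lee_fin.
      have mab := mabs _ mb bV.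
      have mcb := mosc (c x (t j)) okb mb (@subset_refl _ _).
      rewrite (intUD mb (mw1 _ mb bV) (mw2 _) (fun x _ => w10 x) (fun x _ => w20 x)).
      have i2 : intU (ball x (t j)) w2 = (2%:E * intU (ball x (t j)) (\1_(G `\` S) : E -> R))%E.
        by apply: intUZ => //; exact: measurable_indic.
      case: h2 => [h2|[h2 bG]].
        have H1 := const_le_intUD (K := thr) mb b_lty (le_trans (ltW Lam0) thrL) mcb mab
          (fun _ _ => normr_ge0 _) (fun _ _ => normr_ge0 _).
        have {}H1 : ((thr * vol (ball x (t j)))%:E <= intU (ball x (t j)) (fun y => `|f y - c x (t j)|)%R +
            intU (ball x (t j)) (fun y => `|f y - K|)%R)%E.
          apply: H1 => y _; apply: (le_trans (ltW h2)).
          have -> : c x (t j) - K = (f y - K) - (f y - c x (t j)) by ring.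
          by rewrite [X in _ <= X]addrC; exact: ler_normB.
        have {H1} := le_trans H1 (leeD (oscillation okb) (lexx _)).
        rewrite -leeBlDl// -EFinB -mulrBl => H1.
        apply: (@le_trans _ _ (intU (ball x (t j)) w1)); last first.
          by rewrite leeDl// intU_ge0.
        have tDi : 0 <= (thr - Lam)^-1 by rewrite invr_ge0 ltW.
        rewrite /w1 (intUZ mb tDi mab (fun _ _ => normr_ge0 _)).
        apply: (@le_trans _ _ ((thr - Lam)^-1%:E * ((thr - Lam) * vol (ball x (t j)))%:E)%E).
          by rewrite -EFinM lee_fin mulrA mulVf ?mul1r// gt_eqF.
        by apply: lee_wpmul2l => //; rewrite lee_fin.
      have mi : meas_fun (ball x (t j)) (\1_(G `\` S) : E -> R) by exact: measurable_indic.
      have mc2 : meas_fun (ball x (t j)) (fun y => (2 * Lam)^-1 * `|f y - c x (t j)|).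
        exact: (@measM _ _ _ (fun=> (2 * Lam)^-1) _ (@meas_cst _ _ _ _) mcb).
      have L20 : 0 <= (2 * Lam)^-1 by rewrite invr_ge0 mulr_ge0// ltW.
      have H1 : ((1 * vol (ball x (t j)))%:E <= intU (ball x (t j)) (fun y => (2 * Lam)^-1 * `|f y - c x (t j)|)%R +
          intU (ball x (t j)) (\1_(G `\` S) : E -> R))%E.
        apply: (const_le_intUD mb b_lty ler01 mc2 mi).
        - by move=> y _; rewrite mulr_ge0.
        - by move=> y _; rewrite indicE.
        - move=> y by'; rewrite indicE; have [yGS|] := boolP (y \in G `\` S).
            by rewrite lerDr mulr_ge0.
          rewrite notin_setE => nyGS; rewrite addr0.
          have [_ Hy] : S y by apply: contrapT => nSy; apply: nyGS; split => //; exact: bG.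
          rewrite ler_pdivlMl ?mulr_gt0// mulr1.
          have -> : f y - c x (t j) = (f y - K) - (c x (t j) - K) by ring.
          apply: le_trans (lerB_dist _ _); move: Hy h2.
          have : jn_step <= m.+1%:R * jn_step.
            by rewrite ler_peMl ?ler1n//; have := thr_d; have := Lam0; have := d0; rewrite /jn_step; lra.
          have := Ld; rewrite -/K /jn_step; move: (`|f y - K|) (`|c x (t j) - K|) (_ * (_ + _)) => *; lra.
      move: H1; rewrite mul1r (intUZ mb L20 mcb (fun _ _ => normr_ge0 _)) => H1.
      have H2 : ((2 * Lam)^-1%:E * intU (ball x (t j)) (fun y => `|f y - c x (t j)|)%R <=
          (2^-1 * vol (ball x (t j)))%:E)%E.
        have -> : 2^-1 * vol (ball x (t j)) = (2 * Lam)^-1 * (Lam * vol (ball x (t j))).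
          by field; rewrite gt_eqF.
        by rewrite [in leRHS]EFinM; apply: lee_wpmul2l; [rewrite lee_fin|exact: oscillation].
      have {H1 H2} := le_trans H1 (leeD H2 (lexx _)).
      rewrite -leeBlDl// -EFinB => H1.
      apply: (@le_trans _ _ (intU (ball x (t j)) w2)); last first.
        by rewrite leeDr// intU_ge0.
      rewrite i2; apply: (@le_trans _ _ (2%:E * (vol (ball x (t j)) - 2^-1 * vol (ball x (t j)))%:E)%E).
        by rewrite -EFinM lee_fin; lra.
      by apply: lee_wpmul2l.
    - move=> x d Sx Sd ld [y [[Oy dy] [_ xy]]].
      have [Ox _] := SB x Sx; have [Od _] := SB d Sd; split => //.
      have [_ rs rt] := qm; apply: (le_lt_trans (rt d x y Od Ox Oy)).
      have txd : t (lev x) <= t (lev d).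
        rewrite /t ler_pM2l; last by rewrite divr_gt0// mulr_gt0// exprn_gt0.
        by apply: ler_wiXn2l => //; rewrite invf_le1// ler1n.
      have -> : 2 * kappa * t (lev d) = kappa * (t (lev d) + t (lev d)) by ring.
      by rewrite ltr_pM2l//; apply: ltr_leD => //; exact: le_trans (ltW xy) txd.
  have v2 : (intU V (fun x => w1 x + w2 x)%R <= ((2 * (D ^+ 2 + 1))^-1 * (D * vol B) + 2 * e)%:E)%E.
    rewrite (intUD mV (mw1 V mV (@subset_refl _ _)) (mw2 V) (fun x _ => w10 x) (fun x _ => w20 x)) EFinD.
    have vV := ok_vol okz.
    apply: leeD.
      have mcV := mosc (c z (2 * kappa * r)) okz mV (@subset_refl _ _).
      have mabV := mabs V mV (@subset_refl _ _).
      have H1 : (intU V (fun x => `|f x - K|)%R <= ((Lam + delta) * vol V)%:E)%E.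
        apply: (@le_trans _ _ (intU V (fun x => `|f x - c z (2 * kappa * r)| + delta)%R)).
          apply: (le_intU mV mabV (measD mcV (@meas_cst _ _ V delta))) => x _; rewrite normr_ge0/=.
          have -> : f x - K = (f x - c z (2 * kappa * r)) - (K - c z (2 * kappa * r)) by ring.
          by apply: (le_trans (ler_normB _ _)); rewrite lerD2l//; exact: center.
        rewrite (intUD mV mcV (@meas_cst _ _ V delta) (fun _ _ => normr_ge0 _) (fun _ _ => ltW d0)).
        by rewrite (intU_const delta mV V_lty) (mulrDl Lam delta) EFinD; apply: leeD; [exact: oscillation|].
      rewrite /w1 intUZ ?invr_ge0 ?(ltW tD0)//.
      apply: (@le_trans _ _ ((thr - Lam)^-1%:E * ((Lam + delta) * vol V)%:E)%E).
        by apply: lee_wpmul2l => //; rewrite lee_fin invr_ge0 ltW.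
      rewrite -EFinM lee_fin.
      have -> : (2 * (D ^+ 2 + 1))^-1 * (D * vol B) = (thr - Lam)^-1 * (2 * delta * (D * vol B)).
        have -> : thr - Lam = 4 * delta * (D ^+ 2 + 1) by rewrite /thr addrC addKr.
        have D2 : 0 < D ^+ 2 + 1 by rewrite ltr_wpDl// sqr_ge0.
        have := d0; move: delta => d1 d10; field.
        by do ?[apply/andP; split]; rewrite gt_eqF.
      rewrite ler_wpM2l ?invr_ge0 ?(ltW tD0)//; apply: ler_pM.
      - by rewrite addr_ge0 ?ltW.
      - exact: ltW.
      - by have := Ld; lra.
      - apply: (doubling okB okz) => //.
          by have := k1; have := r0; nra.
        by have := k3; have := r0; have := k0; nra.
    rewrite /w2 intUZ//; last exact: measurable_indic.
    rewrite EFinM; apply: lee_wpmul2l => //; rewrite /intU integral_indic//.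
    by apply: le_trans HG; apply: le_measure; rewrite ?inE//; exact: measurableI.
  apply: (le_trans HV); apply: (@le_trans _ _ (C%:E * ((2 * (D ^+ 2 + 1))^-1 * (D * vol B) + 2 * e)%:E)%E).
    by apply: lee_wpmul2l; first by rewrite lee_fin.
  rewrite -EFinM lee_fin mulrDr.
  have D2 : 0 < D ^+ 2 + 1 by rewrite ltr_wpDl// sqr_ge0.
  have h : (D ^+ 2 + 1)^-1 * D ^+ 2 <= 1 by rewrite ler_pdivrMl// mulr1 lerDl.
  apply: lerD; last by rewrite le_eqVlt; apply/orP; left; apply/eqP; ring.
  have -> : C * ((2 * (D ^+ 2 + 1))^-1 * (D * vol B)) =
      2^-1 ^+ m.+1 * vol B * ((D ^+ 2 + 1)^-1 * D ^+ 2).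
    by rewrite /C (exprS _ m); move: (_ ^+ m) => q; field; rewrite gt_eqF.
  rewrite ler_piMr//; apply: mulr_ge0; first exact: exprn_ge0.
  exact: ltW (ok_vol okB).
apply/lee_addgt0Pr => e e0.
have C20 : 0 < 2 * C + 1 by rewrite ltr_wpDl// mulr_ge0.
apply: (le_trans (key (e / (2 * C + 1)) _)); first exact: divr_gt0.
rewrite -EFinD lee_fin lerD2l mulrA ler_pdivrMr// mulrC ler_pM2l//.
by rewrite lerDl.
Qed.
End step.

Lemma john_nirenberg m z r : ok z (2 * kappa * r) -> 0 < r ->
  (leb (lvl m z r) <= (2^-1 ^+ m * vol (ball z r))%:E)%E.
Proof.
elim: m z r => [|m IH] z r okz r0; last exact: jn_induction.
have [Oz _ _ _ _] := okP okz.
have okB : ok z r by exact: ok_sub okz (qballxx qm Oz r0) r0 (lexx r).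
by rewrite expr0 mul1r -(ok_leb okB); apply: le_leb_outer => x [].
Qed.

End john_nirenberg.

(** * Exponential integrability of the logarithm *)

Section exponential_integrability.
Context {R : realType} {n : nat}.
Local Notation E := 'rV[R]_n.+1.
Variables (B : set E) (U : E -> R) (c st : R).
Hypotheses (mB : measurable (B : set (Rn R n))) (B_gt0 : (0 < @leb R n B)%E) (B_lty : (@leb R n B < +oo)%E).
Hypotheses (U0 : forall x, 0 < U x) (mU : meas_fun B U) (st0 : 0 < st).
Let g (x : E) : R := `|ln (U x) - c|.
Hypothesis decay : forall m, (leb [set x | B x /\ (m%:R * st < g x)%R] <= (2^-1 ^+ m * vol B)%:E)%E.

(** With this exponent a further level of height st multiplies the exponential by 3/2 while the
    measure of the level set halves, so the contributions form a geometric series of ratio 3/4. *)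
Definition jn_exponent := ln (3 / 2) / st.
Let al := jn_exponent.
Let al0 : 0 < al. Proof. by rewrite divr_gt0// ln_gt0// ltr_pdivlMr//; lra. Qed.
Let alE : al * st = ln (3 / 2). Proof. by rewrite /al /jn_exponent divfK// gt_eqF. Qed.
Let mg : meas_fun B g.
Proof.
apply: meas_norm; apply: measB; last exact: meas_cst.
exact: (meas_compM (@measurable_ln R) mU).
Qed.
Let vB : 0 < vol B. Proof. exact: vol_gt0. Qed.

Let h M x := expR (al * Num.min (g x) (M%:R * st)).
Let mh M : meas_fun B (h M).
Proof.
apply: (meas_comp (g := fun y => expR (al * Num.min y (M%:R * st)))) mg => y.
apply: continuous_comp; last exact: continuous_expR.
apply: cvgM; first exact: cvg_cst.
exact: (@continuous_min R R id (fun=> M%:R * st) y (@cvg_id _ _) (@cvg_cst _ _ _ _ _)).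
Qed.

Let exp_st M : expR (al * (M%:R * st)) = (3 / 2) ^+ M.
Proof.
have -> : al * (M%:R * st) = M%:R * ln (3 / 2) by rewrite mulrCA alE.
by rewrite expRM_natl lnK// posrE divr_gt0.
Qed.

(** The bound equals 1 at M = 0 and increases by (3/2)(3/4)^M, the contribution of the set where g
    exceeds M st. *)
Let int_h M : (intU B (h M) <= ((7 - 6 * (3 / 4) ^+ M) * vol B)%:E)%E.
Proof.
elim: M => [|M IH].
  have -> : 7 - 6 * (3 / 4) ^+ 0 = 1 :> R by rewrite expr0; ring.
  rewrite -(intU_const 1 mB B_lty) (_ : intU B (h 0) = intU B (fun=> 1))//.
  by apply: eq_intU => x _; rewrite /h mul0r min_r ?normr_ge0// mulr0 expR0.
set N := [set x | B x /\ M%:R * st < g x].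
have mN : measurable (N : set (Rn R n)).
  have -> : N = B `&` g @^-1` `]M%:R * st, +oo[%classic.
    by apply/seteqP; split => x /=; rewrite in_itv/= andbT.
  exact: (mg mB (measurable_itv _)).
have q0 : 0 <= (3 / 2) ^+ M.+1 :> R by rewrite exprn_ge0.
have mi : meas_fun B (fun x => (3 / 2) ^+ M.+1 * \1_N x : R).
  by apply: (@measM _ _ _ (fun=> (3 / 2) ^+ M.+1) _ (@meas_cst _ _ _ _)); exact: measurable_indic.
have i0 x : 0 <= (3 / 2) ^+ M.+1 * \1_N x :> R by rewrite mulr_ge0// indicE.
apply: (@le_trans _ _ (intU B (fun x => h M x + (3 / 2) ^+ M.+1 * \1_N x)%R)).
  apply: (le_intU mB (mh _) (measD (mh _) mi)) => x Bx; rewrite expR_ge0/=.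
  have MS : M%:R * st <= M.+1%:R * st by rewrite ler_pM2r// ler_nat.
  have [gM|gM] := leP (g x) (M%:R * st).
    by rewrite {1}/h min_l ?(le_trans gM)// /h min_l// lerDl.
  rewrite indicE mem_set// mulr1; apply: (@le_trans _ _ ((3 / 2) ^+ M.+1)); last by rewrite lerDr expR_ge0.
  by rewrite -exp_st ler_expR ler_pM2l// ge_min lexx orbT.
rewrite (intUD mB (mh _) mi (fun _ _ => expR_ge0 _) (fun _ _ => i0 _)) intU_indic//; last by move=> x [].
apply: (le_trans (leeD IH (lee_wpmul2l _ (decay M)))); first by rewrite lee_fin.
rewrite -EFinM -EFinD lee_fin mulrA -mulrDl ler_pM2r//.
have -> : (3 / 2) ^+ M.+1 * 2^-1 ^+ M = 3 / 2 * (3 / 4) ^+ M :> R.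
  by rewrite exprS -mulrA -exprMn; congr (_ * _ ^+ _); field.
by rewrite [(3 / 4) ^+ M.+1]exprS; move: (_ ^+ M) => q; lra.
Qed.

Lemma exp_integrable : (intU B (fun x => expR (al * g x)) <= (7 * vol B)%:E)%E.
Proof.
have mex : meas_fun B (fun x => expR (al * g x)).
  apply: (meas_comp (g := fun y => expR (al * y))) mg => y.
  apply: continuous_comp; last exact: continuous_expR.
  by apply: cvgM; [exact: cvg_cst|exact: cvg_id].
apply: (@intU_fatou R n B h) => //.
- by move=> M x _; exact: expR_ge0.
- apply: aeW => x Bx; apply: cvg_near_cst.
  have [k _ Hk] := nbhs_infty_ger (g x / st); exists k => // j /= kj.
  by rewrite /h min_l// -ler_pdivrMr//; exact: Hk.
- apply: nearW => M; apply: (le_trans (int_h M)); rewrite lee_fin ler_pM2r//.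
  by rewrite lerBlDr lerDl mulr_ge0// exprn_ge0// divr_ge0.
Qed.

(** Both signs of q are covered with the same c, so the product of the means of U^q and U^(-q) is at
    most 49. *)
Lemma avg_powR_exp (q : R) : `|q| <= jn_exponent ->
  (avg B (fun x => (U x `^ q)%:E) <= (7 * expR (q * c))%:E)%E.
Proof.
move=> qal; apply/(avg_intU B_gt0 B_lty).
have mex : meas_fun B (fun x => expR (q * c) * expR (al * g x)).
  apply: (@measM _ _ _ (fun=> expR (q * c)) _ (@meas_cst _ _ _ _)).
  apply: (meas_comp (g := fun y => expR (al * y))) mg => y.
  apply: continuous_comp; last exact: continuous_expR.
  by apply: cvgM; [exact: cvg_cst|exact: cvg_id].
apply: (@le_trans _ _ (intU B (fun x => expR (q * c) * expR (al * g x))%R)).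
  apply: (@le_intU _ _ _ (fun x => U x `^ q) _ mB (@meas_powR _ _ _ U q mU) mex) => x Bx.
  rewrite powR_ge0/= /powR gt_eqF// -expRD ler_expR.
  have -> : q * ln (U x) = q * c + q * (ln (U x) - c) by ring.
  rewrite lerD2l; apply: (le_trans (ler_norm _)); rewrite normrM.
  by apply: ler_wpM2r.
have me2 : meas_fun B (fun x => expR (al * g x)).
  apply: (meas_comp (g := fun y => expR (al * y))) mg => y.
  apply: continuous_comp; last exact: continuous_expR.
  by apply: cvgM; [exact: cvg_cst|exact: cvg_id].
rewrite (intUZ mB (expR_ge0 _) me2 (fun _ _ => expR_ge0 _)).
have -> : vol B * (7 * expR (q * c)) = expR (q * c) * (7 * vol B) by ring.
rewrite EFinM; apply: lee_wpmul2l; first by rewrite lee_fin expR_ge0.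
exact: exp_integrable.
Qed.

End exponential_integrability.

(** * The Harnack inequality *)

Section cutoff_sequence.
Context {R : realType} {n : nat}.
Local Notation E := 'rV[R]_n.+1.
Local Opaque enorm sqrtmx mulmx grad meas_fun.
Local Notation avgR B f := (avg B (fun x => (f x)%:E)).
Variables (Omega : set E) (p : R) (Q : E -> 'M[R]_n.+1).
Hypotheses (oO : open Omega) (p1 : 1 < p) (Qpsd : forall x, Omega x -> psdmx (Q x)).
Hypothesis mQ : forall i j, meas_fun Omega (fun x => Q x i j).
Hypothesis bO : bounded_set Omega.
Variable B : set E.
Hypotheses (oB : open B) (BO : B `<=` Omega) (B_gt0 : (0 < @leb R n B)%E).
Let p0 : 0 < p. Proof. exact: lt_trans p1. Qed.
Let mB : measurable (B : set (Rn R n)). Proof. exact: open_measurable_Rn. Qed.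
Let B_lty : (@leb R n B < +oo)%E.
Proof. by apply: le_lt_trans (leb_lty bO); exact: le_leb_outer. Qed.

(** The exponent s, dual to sstar / p, with value 1 when sstar is infinite. *)
Definition cutoff_exp (sstar : \bar R) : R := if sstar is s'%:E then s' / (s' - p) else 1.

Lemma cutoff_exp_ge1 (sstar : \bar R) : (p%:E < sstar)%E -> 1 <= cutoff_exp sstar.
Proof.
case: sstar => [s'| |]//=; rewrite lte_fin => ps.
by rewrite ler_pdivlMr ?subr_gt0// mul1r gerDl oppr_le0 ltW.
Qed.

Lemma cutoff_exp_lt (sstar : \bar R) (sigma : R) : 1 < sigma ->
  ((p * dual_exp sigma)%:E < sstar)%E -> cutoff_exp sstar < sigma.
Proof.
move=> s1; have s10 : 0 < sigma - 1 by rewrite subr_gt0.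
have s0 : 0 < sigma by exact: lt_trans s1.
have ps : p < p * dual_exp sigma.
  by rewrite ltr_pMr// /dual_exp ltr_pdivlMr// mul1r gtrDl oppr_lt0.
case: sstar => [s'| |]//; rewrite !lte_fin => sst; have ps' := lt_trans ps sst.
rewrite /= ltr_pdivrMr ?subr_gt0//; move: sst; rewrite /dual_exp mulrA ltr_pdivrMr//.
by nra.
Qed.

(** Hoelder's inequality with sstar / p for the gradient and its dual for w; for infinite sstar the
    gradient is essentially bounded. *)
Lemma avg_grad_cutoff (sstar : \bar R) (eta : E -> R) (L : R) : (p%:E < sstar)%E ->
  lipschitz eta -> 0 <= L -> (avg_lnorm sstar B (Qnorm Q (grad eta)) <= L%:E)%E ->
  forall (w : E -> R) (X : R), meas_fun B w -> (forall x, B x -> 0 <= w x) -> 0 <= X ->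
  (avgR B (fun x => w x `^ (p * cutoff_exp sstar))%R <= (X `^ (p * cutoff_exp sstar))%:E)%E ->
  (avgR B (fun x => (w x * Qnorm Q (grad eta) x) `^ p)%R <= ((X * L) `^ p)%:E)%E.
Proof.
move=> ps le L0 HL w X mw w0 X0 HX; have ss1 := cutoff_exp_ge1 ps.
have mge : measV B (grad eta) by apply: meas_grad oB (lipschitz_Lip_loc le).
have mq : meas_fun B (Qnorm Q (grad eta)) by exact: (meas_qn oO Qpsd mQ mB BO mge).
have q0 x : 0 <= Qnorm Q (grad eta) x by exact: enorm_ge0.
have mwp : meas_fun B (fun x => (w x * Qnorm Q (grad eta) x) `^ p).
  by apply: (@meas_powR _ _ _ (fun x => w x * Qnorm Q (grad eta) x)); exact: (measM mw mq).
have mwq r : meas_fun B (fun x => w x `^ r) by exact: (@meas_powR _ _ _ w).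
case: sstar ps ss1 HL HX => [s'| |]//=.
  rewrite lte_fin => ps ss1 HL HX; have s'0 : 0 < s' by exact: lt_trans ps.
  have sp0 : 0 < s' - p by rewrite subr_gt0.
  have Hq : (avgR B (fun x => Qnorm Q (grad eta) x `^ s')%R <= (L `^ s')%:E)%E.
    have A0 : (0 <= avgR B (fun x => `|Qnorm Q (grad eta) x| `^ s')%R)%E.
      by apply: (avg_ge0 B_gt0 B_lty) => x _; rewrite lee_fin powR_ge0.
    move: HL => /(poweR_root_le s'0 L0 A0) H.
    rewrite (eq_avg (g := fun x => `|Qnorm Q (grad eta) x| `^ s'))// => x _.
    by rewrite ger0_norm// q0.
  have mqs : meas_fun B (fun x => Qnorm Q (grad eta) x `^ s') by exact: (@meas_powR _ _ _ (Qnorm Q (grad eta))).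
  have hpos x : B x -> [/\ 0 <= w x `^ (p * (s' / (s' - p))), 0 <= Qnorm Q (grad eta) x `^ s', 0 <= (1 : R) & 0 <= (1 : R)].
    by move=> _; rewrite !powR_ge0.
  have av1 : (avgR B (fun=> 1)%R <= 1%:E)%E by rewrite avg_cst.
  have := avg_holder4 mB B_gt0 B_lty (mwq (p * (s' / (s' - p)))) mqs (@meas_cst R n B 1) (@meas_cst R n B 1).
  have qa : 0 <= (s' - p) / s' by apply: divr_ge0; exact: ltW.
  have qb : 0 <= p / s' by apply: divr_ge0; exact: ltW.
  have qs : (s' - p) / s' + p / s' + 0 + 0 <= 1.
    by rewrite !addr0 -mulrDl subrK divff// gt_eqF.
  move=> /(_ _ _ 1 1 _ _ 0 0 hpos (powR_ge0 _ _) (powR_ge0 _ _) ler01 ler01 qa qb (lexx 0) (lexx 0) qs HX Hq av1 av1).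
  have e1 : p * (s' / (s' - p)) * ((s' - p) / s') = p by field; rewrite !gt_eqF.
  have e2 : s' * (p / s') = p by rewrite mulrC divfK// gt_eqF.
  rewrite -!powRrM e1 e2 !powRr0 !mulr1 -powRM//; apply: le_trans.
  rewrite [X in (_ <= X)%E](eq_avg (g := fun x => (w x * Qnorm Q (grad eta) x) `^ p))// => x Bx.
  by rewrite -!powRrM e1 e2 !mulr1 -powRM// ?w0.
move=> _ ss1 HL; rewrite mulr1 => HX.
have T0 : (0 < @leb R n setT)%E by apply: lt_le_trans B_gt0 _; apply: le_leb_outer.
have Hae : {ae @leb R n, forall x, B x -> Qnorm Q (grad eta) x <= L}.
  move: HL; rewrite /lnorm unlock T0; set s := ess_sup _ _ => H.
  have := @ess_sup_ge _ (Rn R n) R (@leb R n) (abse \o ((EFin \o (Qnorm Q (grad eta))) \_ B)).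
  apply: ae_imp => x /= + Bx; rewrite patchE mem_set// => /le_trans/(_ H).
  by rewrite lee_fin ger0_norm// q0.
have Lp : 0 <= L `^ p by exact: powR_ge0.
apply: (@le_trans _ _ (avgR B (fun x => L `^ p * w x `^ p)%R)).
  have mLw : meas_fun B (fun x => L `^ p * w x `^ p).
    exact: (@measM _ _ _ (fun=> L `^ p) _ (@meas_cst _ _ _ _) (mwq p)).
  apply: (le_avg_ae mB B_gt0 B_lty mwp mLw) => [x _|x _|]; [exact: powR_ge0|by rewrite mulr_ge0// powR_ge0|].
  apply: ae_imp Hae => x h Bx; rewrite mulrC -powRM ?q0//; last exact: w0.
  apply: powR_mono; [exact: ltW|by rewrite mulr_ge0// w0|].
  by rewrite ler_wpM2r ?w0// h.
rewrite (avgZ mB Lp (mwq p)); last by move=> x _; exact: powR_ge0.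
by rewrite powRM// mulrC EFinM; apply: lee_wpmul2l.
Qed.

Variables (sstar t : \bar R) (eta : nat -> E -> R) (r Cs tau N C3 : R) (T : set E).
Hypotheses (ps : (p%:E < sstar)%E) (t1 : (1 <= t)%E) (r0 : 0 < r) (Cs0 : 0 < Cs) (N0 : 0 < N).
Hypothesis supp1 : supp (eta 1%N) `<=` B.
Hypothesis Heta : forall j, (1 <= j)%N ->
  [/\ lipschitz (eta j), forall x, 0 <= eta j x <= 1, forall x, T x -> eta j x = 1,
    supp (eta j.+1) `<=` [set x | B x /\ eta j x = 1] &
    (avg_lnorm sstar B (Qnorm Q (grad (eta j))) <= (Cs * N ^+ j / r)%:E)%E].
Hypothesis Hint : forall j, (1 <= j)%N -> (lnorm (p%:E * t) B (Qnorm Q (grad (eta j))) < +oo)%E.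
Hypothesis C30 : 0 < C3.
Hypothesis Hemb : forall f, Lip_loc Omega f ->
  (lnorm (p%:E * hoelder_conjugate t) B f <= C3%:E * Wnorm p Q Omega f (grad f))%E.

Lemma cutoff_grad j : (1 <= j)%N -> forall (w : E -> R) (X : R),
  meas_fun B w -> (forall x, B x -> 0 <= w x) -> 0 <= X ->
  (avgR B (fun x => w x `^ (p * cutoff_exp sstar))%R <= (X `^ (p * cutoff_exp sstar))%:E)%E ->
  (avgR B (fun x => (w x * Qnorm Q (grad (eta j)) x) `^ p)%R <= ((X * (Cs * N ^+ j) / r) `^ p)%:E)%E.
Proof.
move=> j1 w X mw w0 X0 HX; have [le _ _ _ HL] := Heta j1.
have L0 : 0 <= Cs * N ^+ j / r.
  by apply: divr_ge0; [apply: mulr_ge0; [exact: ltW|apply: exprn_ge0; exact: ltW]|exact: ltW].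
by rewrite -mulrA; exact: (avg_grad_cutoff ps le L0 HL mw w0 X0 HX).
Qed.

(** Supports are compact because Omega is bounded, the L^p bound of the gradient is [cutoff_grad]
    with w = 1, and the multiplication clause is [cutoff_mul_bound]. *)
Lemma cutoff_good j : (1 <= j)%N -> good_cutoff Omega p Q B (eta j).
Proof.
move=> j1; have [le e01 _ _ _] := Heta j1.
have sB : supp (eta j) `<=` B.
  case: j j1 {le e01} => [//|[_|j _]]; first exact: supp1.
  by have [_ _ _ + _] := Heta (ltn0Sn j) => h x /h[].
split => //.
- split => //; apply: bounded_closed_compact; last exact: closed_closure.
  by move: bO => [M [Mr HM]]; exists M; split => // y /HM h x /sB/BO; exact: h.
- have := cutoff_grad j1 (@meas_cst R n B 1) (fun _ _ => ler01) ler01.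
  have H1 : (avgR B (fun=> 1 `^ (p * cutoff_exp sstar))%R <= (1 `^ (p * cutoff_exp sstar))%:E)%E.
    by rewrite avg_cst.
  move=> /(_ H1); set Y := (_ `^ p) => HY.
  have : (avg B (fun x => (`|Qnorm Q (grad (eta j)) x| `^ p)%:E) < +oo)%E.
    apply: le_lt_trans (ltry Y); apply: le_trans HY.
    rewrite (eq_avg (g := fun x => (1 * Qnorm Q (grad (eta j)) x) `^ p))// => x _.
    by rewrite mul1r ger0_norm// enorm_ge0.
  rewrite (Lpi_avg B_gt0 B_lty) => h; apply: lte_mul_pinfty => //.
  by rewrite lee_fin ltW// vol_gt0.
- exact: (cutoff_mul_bound oO p1 Qpsd mQ oB BO B_gt0 B_lty le t1 (Hint j1) C30 Hemb).
Qed.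

End cutoff_sequence.

(** * Scaling of coefficient norms under doubling *)

Section coefficient_scaling.
Context {R : realType} {n : nat}.
Local Notation E := 'rV[R]_n.+1.
Local Notation avgR B f := (avg B (fun x => (f x)%:E)).

Lemma powR_superadd (q x y : R) : 1 <= q -> 0 <= x -> 0 <= y -> x `^ q + y `^ q <= (x + y) `^ q.
Proof.
move=> q1 x0 y0; have q0 : 0 < q by exact: lt_le_trans q1.
have key z s : 0 <= z -> z <= s -> z `^ q <= z * s `^ (q - 1).
  rewrite le_eqVlt => /predU1P[<-|z0] zs; first by rewrite powR0 ?gt_eqF// mul0r.
  rewrite (powR_pos1 q z0) ler_pM2l//; apply: powR_mono => //; last exact: ltW.
  by rewrite subr_ge0.
have := addr_ge0 x0 y0; rewrite le_eqVlt => /predU1P[s0|s0].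
  have -> : x = 0 by lra. have -> : y = 0 by lra.
  by rewrite addr0 powR0 ?gt_eqF// addr0.
rewrite (powR_pos1 q s0) mulrDl; apply: lerD; apply: key => //; first by rewrite lerDl.
by rewrite lerDr.
Qed.

(** Passing from V to the smaller set B costs (S / r)^d0 in the q-th power, at most (S / r)^(m q) as
    soon as d0 <= m q. This is the use of the lower bounds by d0 on the integrability exponents:
    norms scaled by S^m on V control norms scaled by r^m on every smaller ball. *)
Lemma avg_rescale (B V : set E) (w : E -> R) (q m r S C0 d0 Y : R) :
  measurable (B : set (Rn R n)) -> measurable (V : set (Rn R n)) -> B `<=` V ->
  (0 < @leb R n B)%E -> (@leb R n V < +oo)%E -> meas_fun V w -> (forall x, V x -> 0 <= w x) ->
  0 < q -> d0 <= m * q -> 0 < r -> r <= S -> 0 < C0 -> 0 <= Y ->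
  (leb V <= (C0 * (S / r) `^ d0)%:E * leb B)%E ->
  ((S `^ m)%:E * avg_lnorm q%:E V w <= Y%:E)%E ->
  (avgR B (fun x => w x `^ q)%R <= ((C0 `^ q^-1 * Y / r `^ m) `^ q)%:E)%E.
Proof.
move=> mB mV BV B_gt0 V_lty mw w0 q0 dq r0 rS C00 Y0 dbl HV.
have V_gt0 : (0 < @leb R n V)%E by apply: lt_le_trans B_gt0 _; exact: le_leb_outer.
have B_lty : (@leb R n B < +oo)%E by apply: le_lt_trans V_lty; exact: le_leb_outer.
have S0 : 0 < S by exact: lt_le_trans rS.
have Sm : 0 < S `^ m by exact: powR_gt0.
have vB : 0 < vol B by exact: vol_gt0.
have mwq : meas_fun V (fun x => w x `^ q) by exact: (@meas_powR _ _ _ w).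
have H1 : (avg_lnorm q%:E V w <= (Y / S `^ m)%:E)%E.
  rewrite -[X in (X <= _)%E]mul1e -(mulVf (lt0r_neq0 Sm)) EFinM -muleA [Y / _]mulrC EFinM.
  by apply: lee_wpmul2l => //; rewrite lee_fin invr_ge0 ltW.
have YS0 : 0 <= Y / S `^ m by apply: divr_ge0; [exact: Y0|exact: ltW].
have A0 : (0 <= avgR V (fun x => `|w x| `^ q)%R)%E.
  by apply: (avg_ge0 V_gt0 V_lty) => x _; rewrite lee_fin powR_ge0.
move: H1 => /(poweR_root_le q0 YS0 A0).
rewrite (eq_avg (g := fun x => w x `^ q)) => [|x Vx]; last by rewrite ger0_norm// w0.
move=> /(avg_intU V_gt0 V_lty) H1; apply/(avg_intU B_gt0 B_lty).
apply: (@le_trans _ _ (intU V (fun x => w x `^ q))).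
  by apply: le_intU_set => // x _; exact: powR_ge0.
apply: (le_trans H1); rewrite lee_fin.
have vV : vol V <= C0 * (S / r) `^ d0 * vol B.
  by rewrite -lee_fin (volE V_lty) EFinM (volE B_lty).
apply: (le_trans (ler_wpM2r (powR_ge0 _ _) vV)).
rewrite mulrAC mulrC ler_pM2l//.
have Sr : 1 <= S / r by rewrite ler_pdivlMr// mul1r.
have Srd : (S / r) `^ d0 <= (S / r) `^ (m * q) by exact: ler_powR.
have Yq := powR_ge0 (Y / S `^ m) q.
apply: (@le_trans _ _ (C0 * (S / r) `^ (m * q) * (Y / S `^ m) `^ q)).
  by apply: ler_wpM2r => //; apply: ler_wpM2l => //; exact: ltW.
have rm : 0 < r `^ m by exact: powR_gt0.
have Cq : C0 = (C0 `^ q^-1) `^ q by rewrite -powRrM mulVf ?gt_eqF// powRr1// ltW.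
have SRm : (S / r) `^ (m * q) = (S `^ m / r `^ m) `^ q.
  by rewrite powRrM powRM ?invr_ge0 ?ltW// powR_invM// ltW.
have G0 := powR_ge0 C0 q^-1.
rewrite {1}Cq SRm; move: (C0 `^ q^-1) (S `^ m) (r `^ m) G0 Sm rm YS0 => G s1 r2 G0 s10 r20 YS0.
have sr0 : 0 <= s1 / r2 by apply: divr_ge0; exact: ltW.
rewrite -(powRM q G0 sr0) -(powRM q (mulr_ge0 G0 sr0) YS0).
rewrite le_eqVlt; apply/orP; left; apply/eqP; congr (_ `^ q).
by field; rewrite !gt_eqF.
Qed.

Lemma avg_coef_sum (B : set E) (w1 w2 : E -> R) (q c Y1 Y2 : R) :
  measurable (B : set (Rn R n)) -> (0 < @leb R n B)%E -> (@leb R n B < +oo)%E ->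
  meas_fun B w1 -> meas_fun B w2 -> (forall x, B x -> 0 <= w1 x) -> (forall x, B x -> 0 <= w2 x) ->
  1 <= q -> 0 <= c -> 0 <= Y1 -> 0 <= Y2 ->
  (avgR B (fun x => w1 x `^ q)%R <= (Y1 `^ q)%:E)%E ->
  (avgR B (fun x => w2 x `^ q)%R <= (Y2 `^ q)%:E)%E ->
  (avgR B (fun x => (w1 x + w2 x * c) `^ q)%R <= ((2 * (Y1 + Y2 * c)) `^ q)%:E)%E.
Proof.
move=> mB B_gt0 B_lty m1 m2 w10 w20 q1 c0 Y10 Y20 H1 H2.
have q0 : 0 <= q by exact: le_trans q1.
have m1q : meas_fun B (fun x => w1 x `^ q) by exact: (@meas_powR _ _ _ w1).
have m2q : meas_fun B (fun x => w2 x `^ q) by exact: (@meas_powR _ _ _ w2).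
have m2c : meas_fun B (fun x => c `^ q * w2 x `^ q).
  exact: (@measM _ _ _ (fun=> c `^ q) _ (@meas_cst _ _ _ _) m2q).
have mS : meas_fun B (fun x => w1 x `^ q + c `^ q * w2 x `^ q) by exact: measD.
have mL : meas_fun B (fun x => (w1 x + w2 x * c) `^ q).
  apply: (@meas_powR _ _ _ (fun x => w1 x + w2 x * c)); apply: measD => //.
  exact: (@measM _ _ _ _ (fun=> c) m2 (@meas_cst _ _ _ _)).
have m2S : meas_fun B (fun x => 2 `^ q * (w1 x `^ q + c `^ q * w2 x `^ q)).
  exact: (@measM _ _ _ (fun=> 2 `^ q) _ (@meas_cst _ _ _ _) mS).
apply: (@le_trans _ _ (avgR B (fun x => 2 `^ q * (w1 x `^ q + c `^ q * w2 x `^ q))%R)).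
  apply: (le_avg mB B_gt0 B_lty mL m2S) => x Bx; rewrite powR_ge0/=.
  apply: (le_trans (powR_leD q0 (w10 x Bx) _)); first by rewrite mulr_ge0// w20.
  by rewrite ler_wpM2l ?powR_ge0// lerD2l mulrC powRM// w20.
rewrite (avgZ mB (powR_ge0 _ _) mS); last by move=> x _; rewrite addr_ge0 ?mulr_ge0 ?powR_ge0.
rewrite (avgD mB m1q m2c); [|by move=> x _; exact: powR_ge0|by move=> x _; rewrite mulr_ge0 ?powR_ge0].
rewrite (avgZ mB (powR_ge0 _ _) m2q); last by move=> x _; exact: powR_ge0.
apply: (@le_trans _ _ ((2 `^ q)%:E * ((Y1 `^ q)%:E + (c `^ q)%:E * (Y2 `^ q)%:E))%E).
  apply: lee_wpmul2l; first by rewrite lee_fin powR_ge0.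
  by apply: leeD => //; apply: lee_wpmul2l => //; rewrite lee_fin powR_ge0.
rewrite (_ : (_ * (_ + _ * _))%E = (2 `^ q * (Y1 `^ q + c `^ q * Y2 `^ q))%:E); last by rewrite EFinM EFinD EFinM.
rewrite lee_fin powRM ?addr_ge0 ?mulr_ge0// ler_wpM2l ?powR_ge0// mulrC -powRM//.
by apply: powR_superadd => //; rewrite mulr_ge0.
Qed.

End coefficient_scaling.

(** * The Harnack inequality on one ball, for fixed k > k1 *)

Section harnack_setting.
Context {R : realType} {n : nat}.
Local Notation E := 'rV[R]_n.+1.
Local Opaque enorm sqrtmx mulmx grad meas_fun.
Local Notation avgR B f := (avg B (fun x => (f x)%:E)).
Variables (Omega : set E) (p : R) (Q : E -> 'M[R]_n.+1).
Hypotheses (oO : open Omega) (bO : bounded_set Omega) (p1 : 1 < p).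
Hypothesis Qpsd : forall x, Omega x -> psdmx (Q x).
Hypothesis mQ : forall i j, meas_fun Omega (fun x => Q x i j).
Variables (rho : E -> E -> R) (kappa : R).
Hypothesis qm : quasimetric Omega rho kappa.
Local Notation ball := (qball Omega rho).
Hypothesis oball : forall x r, Omega x -> open (ball x r).
Hypothesis fine_balls : forall x, Omega x -> forall eps : R, 0 < eps -> exists2 del : R, 0 < del &
  forall y, Omega y -> rho x y < del -> `|x - y| < eps.
Variables (R1 R2 : E -> R) (C0 d0 C1 sigma C2 bb : R).
Hypotheses (C00 : 0 < C0) (d00 : 0 < d0) (homog : local_homogeneous Omega rho C0 d0 R1).
Hypotheses (C10 : 0 < C1) (s1 : 1 < sigma) (sob : sobolev_ineq Omega rho p Q R2 C1 sigma).
Hypotheses (C20 : 0 < C2) (bb1 : 1 <= bb) (poin : poincare_ineq Omega rho p Q R2 C2 bb).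
Variables (sstar : \bar R) (Cs tau N : R) (t : \bar R).
Hypothesis sst : ((p * dual_exp sigma)%:E < sstar)%E.
Hypotheses (Cs0 : 0 < Cs) (tau0 : 0 < tau) (tau1 : tau < 1) (N0 : 0 < N) (t1 : (1 <= t)%E).
Hypothesis cut : cutoffs Omega rho p Q R2 sstar Cs tau N t.
Variables (gamma psi delta a : R) (b c d e f g h : E -> R).
Variables (A : E -> R -> E -> E) (Bf : E -> R -> E -> R).
Hypotheses (gamma1 : 1 < gamma) (gammap : gamma < p) (delta1 : 1 < delta) (deltap : delta < p).
Hypotheses (psi1 : 1 < psi) (psip : psi < p) (a1 : 1 < a).
Hypothesis Hstr : structural Omega p Q gamma psi delta a b c d e f g h A Bf.
Hypothesis Lc : Lloc (sigma * p / (sigma * p - 1 - sigma * (psi - 1)))%:E Omega c.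
Hypothesis Le : Lloc (dual_exp p)%:E Omega e.
Hypothesis Lf : Lloc (dual_exp (sigma * p))%:E Omega f.
Hypothesis Lb : Lloc (sigma * p / (sigma * (p - 1) - gamma + 1))%:E Omega b.
Hypothesis Ld : Lloc (p * sigma / (p * sigma - delta))%:E Omega d.

Variables (x0 : E) (rB : R).
Hypotheses (Ox0 : Omega x0) (rB0 : 0 < rB).
Let Br := ball x0 rB.
Variables (yt : E) (rT : R).
Hypotheses (Oyt : Omega yt) (rT0 : 0 < rT) (rBT : rB < rT) (rTR1 : rT <= R1 yt).
Let Bt := ball yt rT.
Hypothesis BrBt : Br `<=` Bt.
Hypothesis radii : forall z, Br z -> rB < R1 z /\ rB < R2 z.
Hypothesis Br_gt0 : (0 < @leb R n Br)%E.

Let k1 : 1 <= kappa. Proof. by have [] := qm. Qed.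
Let k0 : 0 < kappa. Proof. exact: lt_le_trans k1. Qed.
Let p0 : 0 < p. Proof. exact: lt_trans p1. Qed.
Let mO : measurable (Omega : set (Rn R n)). Proof. exact: open_measurable_Rn. Qed.
Let O_lty : (@leb R n Omega < +oo)%E. Proof. exact: leb_lty. Qed.
Let mball z s : Omega z -> measurable (ball z s : set (Rn R n)).
Proof. by move=> Oz; apply: open_measurable_Rn; exact: oball. Qed.
Let ballO z s : ball z s `<=` Omega. Proof. by move=> x []. Qed.
Let ball_lty z s : (@leb R n (ball z s) < +oo)%E.
Proof. by apply: le_lt_trans O_lty; exact: le_leb_outer. Qed.
Let ballS z s s' : s <= s' -> ball z s `<=` ball z s'.
Proof. by move=> ss x [Ox xs]; split=> //; exact: lt_le_trans ss. Qed.

Definition subball z s := [/\ Omega z, 0 < s, s <= rB & ball z s `<=` Br].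

Let subball_center z s : subball z s -> Br z.
Proof. by move=> [Oz s0 _]; apply; exact: (qballxx qm Oz s0). Qed.

Let doubling_Br z s : subball z s -> (leb Br <= (C0 * (rB / s) `^ d0)%:E * leb (ball z s))%E.
Proof.
move=> sub; have [Oz s0 sr zB] := sub; have Bx0 : Br x0 by exact: (qballxx qm Ox0 rB0).
apply: (homog Ox0 Oz s0 sr); first by have [] := radii Bx0.
by exists z; split; [exact: (qballxx qm Oz s0)|exact: subball_center sub].
Qed.

Let subball_gt0 z s : subball z s -> (0 < @leb R n (ball z s))%E.
Proof.
move=> sub; rewrite lt_neqAle measure_ge0 andbT; apply/eqP => H.
by have := doubling_Br sub; rewrite -H mule0 leNgt Br_gt0.
Qed.

(** The radius rT may equal R1, while doubling is assumed for smaller radii; the ball is exhausted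
    by concentric ones of radii rT (1 - 1/(i+1)). *)
Lemma doubling_Bt z s : subball z s -> (leb Bt <= (C0 * (rT / s) `^ d0)%:E * leb (ball z s))%E.
Proof.
move=> sub; have [Oz s0 sr zB] := sub; have Bz := subball_center sub; have [_ zy] := BrBt Bz.
pose T (i : nat) := rT * (1 - i.+1%:R^-1).
have TE i : T i < rT by rewrite /T gtr_pMr// gtrDl oppr_lt0 invr_gt0.
have Tcv : T i @[i --> \oo] --> rT.
  rewrite -[X in _ --> X]mulr1; apply: cvgM; first exact: cvg_cst.
  rewrite -[X in _ --> X]subr0; apply: cvgB; [exact: cvg_cst|exact: cvg_harmonic].
have BtE : Bt = \bigcup_i ball yt (T i).
  apply/seteqP; split=> [x [Ox yx]|x [i _]]; last by apply: ballS; exact: ltW.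
  have := cvgr_gt _ Tcv _ yx; case=> i _ /(_ i (leqnn i)) /= yxi.
  by exists i.
have mT i : measurable (ball yt (T i) : set (Rn R n)) by exact: mball.
have mTT : measurable (\bigcup_i ball yt (T i) : set (Rn R n)) by rewrite -BtE; exact: mball.
have ndT : {homo (fun i => ball yt (T i) : set (Rn R n)) : i j / (i <= j)%N >-> (i <= j)%O}.
  move=> i j ij; apply/subsetPset; apply: ballS; rewrite ler_pM2l// lerD2l lerN2.
  by rewrite lef_pV2 ?posrE// ler_nat.
have cv := nondecreasing_cvg_mu (mu := @leb R n) mT mTT ndT.
rewrite -BtE in cv; apply: (cvge_to_le cv).
have C0s : 0 <= C0 * (rT / s) `^ d0 by rewrite mulr_ge0 ?powR_ge0// ltW.
have srT : s < rT by exact: le_lt_trans rBT.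
near=> i.
have sT : s <= T i by near: i; apply: (cvgr_ge _ Tcv).
have yT : rho yt z < T i by near: i; apply: (cvgr_gt _ Tcv).
have T0 : 0 < T i by exact: lt_le_trans sT.
apply: (@le_trans _ _ ((C0 * (T i / s) `^ d0)%:E * leb (ball z s))%E).
  apply: (homog Oyt Oz s0 sT); first exact: lt_le_trans (TE i) _.
  by exists z; split; [exact: (qballxx qm Oz s0)|split].
apply: lee_wpmul2r; first exact: measure_ge0.
rewrite lee_fin ler_wpM2l ?(ltW C00)//; apply: powR_mono.
- exact: ltW.
- by apply: divr_ge0; exact: ltW.
- by rewrite ler_wpM2r ?invr_ge0 ?(ltW s0)// ltW.
Unshelve. all: by end_near. Qed.

Variables (Bx Cx Dx Hx k M1 yb yc yd yh : R).
Let e1 := Num.min 1 (p * (1 - p * dual_exp sigma / Cx)).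
Let e2 := Num.min 1 (p * (1 - dual_exp sigma / Hx)).
Let e3 := Num.min 1 (p * (1 - dual_exp sigma / Dx)).
Hypotheses (HBx : dual_exp p * dual_exp sigma <= Bx) (HBd : d0 <= (p - 1) * Bx).
Hypotheses (HCx : p * dual_exp sigma < Cx) (HCd : d0 <= Cx).
Hypotheses (HDx : dual_exp sigma < Dx) (HDd : d0 <= p * Dx).
Hypotheses (HHx : dual_exp sigma < Hx) (HHd : d0 <= p * Hx).
Hypotheses (k_gt0 : 0 < k) (M11 : 1 <= M1) (yb0 : 0 <= yb) (yc0 : 0 <= yc) (yd0 : 0 <= yd) (yh0 : 0 <= yh).
Hypothesis kb : ((rB `^ (p - 1))%:E * avg_lnorm Bx%:E Br (fun x => b x + e x)%R <= (k `^ (p - 1))%:E)%E.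
Hypothesis kd : ((rB `^ p)%:E * avg_lnorm Dx%:E Br (fun x => c x + d x + f x)%R <= (k `^ (p - 1))%:E)%E.
Hypothesis kh : ((rB `^ p)%:E * avg_lnorm Hx%:E Br (fun x => g x + h x)%R <= (k `^ p)%:E)%E.
Hypothesis Hyb : ((rT `^ (p - 1))%:E * avg_lnorm Bx%:E Bt b <= yb%:E)%E.
Hypothesis Hyc : ((rT `^ 1)%:E * avg_lnorm Cx%:E Bt c <= yc%:E)%E.
Hypothesis Hyd : ((rT `^ p)%:E * avg_lnorm Dx%:E Bt d <= yd%:E)%E.
Hypothesis Hyh : ((rT `^ p)%:E * avg_lnorm Hx%:E Bt h <= yh%:E)%E.
Hypothesis Mb : C0 `^ Bx^-1 * (1 + yb) <= M1.
Hypothesis Mc : C0 `^ Cx^-1 * yc <= M1 `^ (e1 / p).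
Hypothesis Md : C0 `^ Dx^-1 * (1 + yd) <= M1 `^ e3.
Hypothesis Mh : C0 `^ Hx^-1 * (1 + yh) <= M1 `^ e2.

(** The factor and its powers e2 and e3 are all at least 2; it absorbs into M the 2 lost in
    [avg_coef_sum]. *)
Definition coef_factor := 2 `^ (1 + e2^-1 + e3^-1).
Let M := coef_factor * M1.

Let dsigma : 1 < dual_exp sigma.
Proof. by rewrite /dual_exp ltr_pdivlMr ?subr_gt0// mul1r gtrDl oppr_lt0. Qed.

Let dp : 1 < dual_exp p.
Proof. by rewrite /dual_exp ltr_pdivlMr ?subr_gt0// mul1r gtrDl oppr_lt0. Qed.

Let ds0 : 0 < dual_exp sigma. Proof. exact: lt_trans dsigma. Qed.

Let e2_gt0 : 0 < e2.
Proof.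
rewrite lt_min ltr01 mulr_gt0// subr_gt0 ltr_pdivrMr ?mul1r//.
exact: lt_trans ds0 HHx.
Qed.

Let e3_gt0 : 0 < e3.
Proof.
rewrite lt_min ltr01 mulr_gt0// subr_gt0 ltr_pdivrMr ?mul1r//.
exact: lt_trans ds0 HDx.
Qed.

Let e1_gt0 : 0 < e1.
Proof.
rewrite lt_min ltr01 mulr_gt0// subr_gt0 ltr_pdivrMr ?mul1r//.
by apply: lt_trans HCx; rewrite mulr_gt0.
Qed.

Let factor_ge2 : 2 <= coef_factor.
Proof.
rewrite -[leLHS](powRr1 (ler0n R 2)); apply: ler_powR; first by rewrite ler1n.
by rewrite -addrA lerDl; apply: addr_ge0; rewrite invr_ge0; exact: ltW.
Qed.

Let factor_pow (q : R) : 0 < q -> q^-1 <= 1 + e2^-1 + e3^-1 -> 2 <= coef_factor `^ q.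
Proof.
move=> q0 qe; rewrite -powRrM -[leLHS](powRr1 (ler0n R 2)); apply: ler_powR; first by rewrite ler1n.
by rewrite -ler_pdivrMr// mul1r.
Qed.

Let M_ge1 : 1 <= M.
Proof. by rewrite /M -[1]mulr1 ler_pM// (le_trans _ factor_ge2)// ler1n. Qed.

Let subball_coef z s (w1 w2 : E -> R) (q m kk Y P : R) : subball z s ->
  meas_fun Omega w1 -> meas_fun Omega w2 ->
  (forall x, Omega x -> 0 <= w1 x) -> (forall x, Omega x -> 0 <= w2 x) ->
  1 <= q -> d0 <= m * q -> 0 < kk -> 0 <= Y ->
  ((rT `^ m)%:E * avg_lnorm q%:E Bt w1 <= Y%:E)%E ->
  ((rB `^ m)%:E * avg_lnorm q%:E Br w2 <= kk%:E)%E ->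
  2 * (C0 `^ q^-1 * (1 + Y)) <= P ->
  (avgR (ball z s) (fun x => (w1 x + w2 x * kk^-1) `^ q)%R <= ((P / s `^ m) `^ q)%:E)%E.
Proof.
move=> sub mw1 mw2 w10 w20 q1 dq kk0 Y0 H1 H2 HP.
have [Oz s0 sr zB] := sub; have q0 : 0 < q by exact: lt_le_trans q1.
have zT : ball z s `<=` Bt by move=> x /zB/BrBt.
have mz := mball s Oz; have z_gt0 := subball_gt0 sub.
have mT : measurable (Bt : set (Rn R n)) by exact: mball.
have mB : measurable (Br : set (Rn R n)) by exact: mball.
have w1T : meas_fun Bt w1 by exact: meas_sub mO (@ballO _ _) mw1.
have w2B : meas_fun Br w2 by exact: meas_sub mO (@ballO _ _) mw2.
have rT_s : s <= rT by rewrite (le_trans sr)// ltW.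
have := avg_rescale mz mT zT z_gt0 (ball_lty _ _) w1T (fun x xT => w10 x xT.1) q0 dq s0 rT_s C00 Y0 (doubling_Bt sub) H1.
have := avg_rescale mz mB zB z_gt0 (ball_lty _ _) w2B (fun x xT => w20 x xT.1) q0 dq s0 sr C00 (ltW kk0) (doubling_Br sub) H2.
move=> G2 G1; have sm : 0 < s `^ m by exact: powR_gt0.
have Cq := powR_ge0 C0 q^-1.
have Y1' : 0 <= C0 `^ q^-1 * Y / s `^ m by apply: divr_ge0; [exact: mulr_ge0|exact: ltW].
have Y2' : 0 <= C0 `^ q^-1 * kk / s `^ m by apply: divr_ge0; [apply: mulr_ge0 => //; exact: ltW|exact: ltW].
have ki : 0 <= kk^-1 by rewrite invr_ge0 ltW.
have mz1 : meas_fun (ball z s) w1 by exact: meas_sub mO (@ballO _ _) mw1.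
have mz2 : meas_fun (ball z s) w2 by exact: meas_sub mO (@ballO _ _) mw2.
have := avg_coef_sum mz z_gt0 (ball_lty _ _) mz1 mz2 (fun x xT => w10 x xT.1) (fun x xT => w20 x xT.1) q1 ki Y1' Y2' G1 G2.
move=> G; apply: (le_trans G); rewrite lee_fin; apply: powR_mono; first exact: ltW.
  by apply: mulr_ge0 => //; apply: addr_ge0 => //; exact: mulr_ge0.
have -> : 2 * (C0 `^ q^-1 * Y / s `^ m + C0 `^ q^-1 * kk / s `^ m * kk^-1) =
    2 * (C0 `^ q^-1 * (1 + Y)) / s `^ m.
  by move: (C0 `^ q^-1) (s `^ m) Cq sm => G0 sm0 _ sm1; field; rewrite !gt_eqF.
by rewrite ler_pM2r// invr_gt0.
Qed.

Let nonneg : [/\ meas_fun Omega b, meas_fun Omega c, meas_fun Omega d & meas_fun Omega e] /\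
  [/\ meas_fun Omega f, meas_fun Omega g & meas_fun Omega h].
Proof. by have [[[? _] [? _] [? _] [? _]] [[[? _] [? _] [? _]] _]] := Hstr. Qed.

Let nonneg0 x : Omega x -> [/\ 0 <= b x, 0 <= c x, 0 <= d x & 0 <= e x] /\
  [/\ 0 <= f x, 0 <= g x & 0 <= h x].
Proof.
move=> Ox; have [[[_ hb] [_ hc] [_ hd] [_ he]] [[[_ hf] [_ hg] [_ hh]] _]] := Hstr.
by split; split; auto.
Qed.

(** One M serves on all admissible balls. The parts divided by powers of k are bounded through the
    choice k > k1, from norms on Br; the remaining parts are bounded by M1, from norms on Bt. *)
Let coefs z s : subball z s ->
  [/\ (avgR (ball z s) (fun x => coef_b p b e k x `^ Bx)%R <= ((M / s `^ (p - 1)) `^ Bx)%:E)%E,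
   (avgR (ball z s) (fun x => c x `^ Cx)%R <= ((M `^ (e1 / p) / s) `^ Cx)%:E)%E,
   (avgR (ball z s) (fun x => coef_d p c d f k x `^ Dx)%R <= ((M `^ e3 / s `^ p) `^ Dx)%:E)%E &
   (avgR (ball z s) (fun x => coef_h p g h k x `^ Hx)%R <= ((M `^ e2 / s `^ p) `^ Hx)%:E)%E].
Proof.
move=> sub; have [[mb mc md me] [mf mg mh]] := nonneg.
have M10 : 0 <= M1 by exact: le_trans M11.
have fac0 : 0 <= coef_factor by exact: powR_ge0.
have Mq (q : R) : 0 < q -> q^-1 <= 1 + e2^-1 + e3^-1 -> 2 * M1 `^ q <= M `^ q.
  by move=> q0 qe; rewrite /M powRM// ler_wpM2r ?powR_ge0// factor_pow.
have k1p : k `^ (1 - p) = (k `^ (p - 1))^-1 by rewrite -powRN opprB.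
have kp : k `^ (- p) = (k `^ p)^-1 by rewrite powRN.
have kp1 : 0 < k `^ (p - 1) by exact: powR_gt0.
have kp2 : 0 < k `^ p by exact: powR_gt0.
have Dx1 : 1 <= Dx by exact: ltW (lt_trans dsigma HDx).
have Hx1 : 1 <= Hx by exact: ltW (lt_trans dsigma HHx).
have Bx1 : 1 <= Bx.
  by apply: le_trans HBx; rewrite -[leLHS]mulr1; apply: ler_pM => //; exact: ltW.
have dm : meas_fun Omega (fun x => c x + d x + f x) by exact: (measD (measD mc md) mf).
split.
- rewrite (eq_avg (g := fun x => (b x + (b x + e x) * (k `^ (p - 1))^-1) `^ Bx)) => [|x _]; last by rewrite /coef_b k1p.
  apply: (subball_coef sub mb (measD mb me) _ _ Bx1 HBd kp1 yb0 Hyb kb).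
  + by move=> x /nonneg0[[]].
  + by move=> x /nonneg0[[? _ _ ?] _]; exact: addr_ge0.
  + by rewrite /M; apply: ler_pM => //; rewrite mulr_ge0 ?powR_ge0// addr_ge0.
- have [Oz s0 sr zB] := sub; have C1' : 1 < Cx.
    by apply: lt_trans HCx; apply: lt_trans dsigma _; rewrite ltr_pMl// (lt_trans ltr01).
  have zT : ball z s `<=` Bt by move=> x /zB/BrBt.
  have rT_s : s <= rT by rewrite (le_trans sr)// ltW.
  have cT : meas_fun Bt c by exact: meas_sub mO (@ballO _ _) mc.
  have dC : d0 <= 1 * Cx by rewrite mul1r.
  have c0 x : Bt x -> 0 <= c x by move=> [Ox _]; have [[]] := nonneg0 Ox.
  have := avg_rescale (mball s Oz) (mball rT Oyt) zT (subball_gt0 sub) (ball_lty _ _) cT c0 (lt_trans ltr01 C1') dC s0 rT_s C00 yc0 (doubling_Bt sub) Hyc.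
  move=> H; apply: (le_trans H); rewrite lee_fin; rewrite (powRr1 (ltW s0)); apply: powR_mono.
  + by apply: ltW; exact: lt_trans C1'.
  + by apply: divr_ge0; [rewrite mulr_ge0 ?powR_ge0|exact: ltW].
  + rewrite ler_pM2r ?invr_gt0//; apply: (le_trans Mc); apply: powR_mono => //.
      by apply: divr_ge0; exact: ltW.
    by rewrite /M ler_peMl// (le_trans _ factor_ge2)// ler1n.
- rewrite (eq_avg (g := fun x => (d x + (c x + d x + f x) * (k `^ (p - 1))^-1) `^ Dx)) => [|x _]; last by rewrite /coef_d k1p.
  apply: (subball_coef sub md dm _ _ Dx1 HDd kp1 yd0 Hyd kd).
  + by move=> x /nonneg0[[]].
  + by move=> x /nonneg0[[? ? ? ?] [? _ _]]; rewrite !addr_ge0.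
  + apply: le_trans (Mq e3 e3_gt0 _); first by rewrite ler_wpM2l.
    by rewrite lerDr; apply: addr_ge0 => //; rewrite invr_ge0; exact: ltW.
- rewrite (eq_avg (g := fun x => (h x + (g x + h x) * (k `^ p)^-1) `^ Hx)) => [|x _]; last by rewrite /coef_h kp.
  apply: (subball_coef sub mh (measD mg mh) _ _ Hx1 HHd kp2 yh0 Hyh kh).
  + by move=> x /nonneg0[_ []].
  + by move=> x /nonneg0[_ [_ ? ?]]; exact: addr_ge0.
  + apply: le_trans (Mq e2 e2_gt0 _); first by rewrite ler_wpM2l.
    by rewrite addrAC lerDr; apply: addr_ge0 => //; rewrite invr_ge0; exact: ltW.
Qed.

Variables (u : E -> R) (Du : E -> E) (v : nat -> E -> R).
Hypotheses (mu : meas_fun Omega u) (mDu : measV Omega Du).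
Hypothesis appv : approximates Omega p Q v u Du.
Hypothesis Hsol : forall phi, Lip0 Omega phi -> (forall x, 0 <= phi x) ->
  let F x := (dotv (grad phi x) (A x (u x) (Du x)) + phi x * Bf x (u x) (Du x))%:E in
  leb.-integrable (Omega : set (Rn R n)) F /\ (\int[leb]_(x in Omega) F x = 0)%E.
Hypothesis u0 : {ae @leb R n, forall z, Br z -> 0 <= u z}.
Let U := shifted u k.
Let ss := cutoff_exp p sstar.
Let qn x V := enorm (V *m sqrtmx (Q x)).

Let ps : (p%:E < sstar)%E.
Proof. by apply: lt_trans sst; rewrite lte_fin ltr_pMr. Qed.

Let ss1 : 1 <= ss. Proof. exact: cutoff_exp_ge1 ps. Qed.

Let u0_sub z s : subball z s -> {ae @leb R n, forall x, ball z s x -> 0 <= u x}.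
Proof. by move=> [_ _ _ zB]; apply: ae_imp u0 => x + /zB; apply. Qed.

Definition osc_log_cst := log_cst p sigma a Cx Dx Hx (Cs * N ^+ 2) 0.

Let log_on_ball z s : subball z s -> exists eta : E -> R,
  [/\ forall x, ball z (tau * s) x -> eta x = 1, forall x, 0 <= eta x, meas_fun (ball z s) eta &
   (avgR (ball z s) (fun x => (eta x * (qn x (Du x) / U x)) `^ p)%R <= ((osc_log_cst * M / s) `^ p)%:E)%E].
Proof.
move=> sub; have [Oz s0 sr zB] := sub; have [sR1 sR2] := radii (subball_center sub).
have sR2' : s < R2 z by exact: le_lt_trans sr _.
have [eta [supp1 Heta Hint [C3 [C30 Hemb]]]] := cut Oz s0 sR2'.
have ob : open (ball z s) by exact: oball.
have z_gt0 := subball_gt0 sub.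
have good := cutoff_good oO p1 Qpsd mQ bO ob (@ballO z s) z_gt0 ps t1 s0 Cs0 N0 supp1 Heta Hint C30 Hemb.
have gr := cutoff_grad oO p1 Qpsd mQ bO ob (@ballO z s) z_gt0 ps s0 Cs0 N0 Heta.
have [le2 e01 one2 _ _] := Heta 2 isT.
have [_ _ _ sup2 _] := Heta 1 isT.
exists (eta 2); split => //; first by move=> x; have /andP[] := e01 x.
  exact: meas_Lip_loc ob (lipschitz_Lip_loc le2).
have [hb hc hd hh] := coefs sub.
have Lam0 : 0 <= Cs * N ^+ 2 by apply: mulr_ge0; [exact: ltW|apply: exprn_ge0; exact: ltW].
have lm : (0 : R) <= 1 /\ (0 : R) = 0 \/ (1 : R) < 0 /\ (0 : R) < 0 by left.
exact: (log_energy oO p1 Qpsd mQ ob (@ballO z s) z_gt0 (ball_lty z s) mu mDu appv s1 (ltW C10) s0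
  (sob Oz s0 sR2') (good 1 isT) (good 2 isT) sup2 gamma1 gammap delta1 deltap psi1 psip a1 Hstr Lc Le Lf Lb Ld
  Hsol k_gt0 (u0_sub sub) M_ge1 HBx HCx HDx HHx hb hc hd hh Lam0 ss1 (gr 2 isT) (lexx 0) lm erefl erefl).
Qed.

(** C2 comes from the Poincare inequality, (C0 tau^(-d0))^(1/p) from doubling between the radii tau
    S and S, and tau / bb is the ratio s / S of the radius to that of the cutoff. *)
Definition osc_cst := C2 * (C0 * tau `^ (- d0)) `^ p^-1 * osc_log_cst * (tau / bb).
Let ok z s := subball z (bb / tau * s).
Let lnU x := ln (U x).
Let cav z s := fine (avg (ball z s) (fun x => (lnU x)%:E)).
Let F' y := (pos_shift k y)^-1 * pos_shift' k y.

Let bb0 : 0 < bb. Proof. exact: lt_le_trans bb1. Qed.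
Let ratio_ge1 : 1 <= bb / tau.
Proof. by rewrite ler_pdivlMr// mul1r (le_trans (ltW tau1)). Qed.
Let ratio0 : 0 < bb / tau. Proof. exact: divr_gt0. Qed.

Let lnU_W1pQ : W1pQ p Q Omega (lnU, fun x => F' (u x) *: Du x).
Proof.
have k20 : 0 < k / 2 by apply: divr_gt0.
have dln (y : R) : 0 < y -> is_derive y (1 : R) (@ln R) y^-1 by exact: is_derive1_ln.
have cV (y : R) : 0 < y -> {for y, continuous (fun z : R => z^-1)} by move=> y0; apply: inv_continuous; rewrite gt_eqF.
apply: (@W1pQ_comp R n Omega p Q oO p1 Qpsd mQ O_lty u Du v mu mDu appv (fun y => ln (pos_shift k y)) F' (k / 2)^-1).
- exact: (is_derive_comp_pos_shift k_gt0 dln).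
- exact: (continuous_comp_pos_shift k_gt0 cV).
- apply: (bound_comp_pos_shift k_gt0) => y ky.
  have y0 : 0 < y by exact: lt_le_trans ky.
  by rewrite ger0_norm ?invr_ge0 ?(ltW y0)// lef_pV2.
Qed.

(** The Poincare inequality on B(z, s) involves the gradient of log U on B(z, bb s). With S = bb s /
    tau this is B(z, tau S), where the cutoff of B(z, S) equals 1, so [log_on_ball] applies after
    one use of doubling. *)
Let log_osc z s : ok z s ->
  (intU (ball z s) (fun x => `|lnU x - cav z s|)%R <= (osc_cst * M * vol (ball z s))%:E)%E.
Proof.
move=> oks; have [Oz S0 Sr zB] := oks; set S := bb / tau * s in oks S0 Sr zB *.
have s0 : 0 < s by rewrite -(pmulr_rgt0 _ ratio0).
have sS : s <= S by rewrite /S ler_peMl// ltW.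
have tS : tau * S = bb * s by rewrite /S mulrA [tau * _]mulrC divfK// gt_eqF.
have tS0 : 0 < tau * S by apply: mulr_gt0.
have tSS : tau * S <= S by rewrite ler_piMl// ltW.
have [SR1 SR2] := radii (subball_center oks).
have sub_s s' : 0 < s' -> s' <= S -> subball z s'.
  by move=> s'0 s'S; split => //; [exact: le_trans Sr|exact: subset_trans (ballS s'S) zB].
have s_gt0 := subball_gt0 (sub_s s s0 sS).
have tS_gt0 := subball_gt0 (sub_s _ tS0 tSS).
have S_gt0 := subball_gt0 oks.
have mS := mball S Oz; have mtS := mball (tau * S) Oz; have ms := mball s Oz.
have sR2 : s < R2 z by apply: le_lt_trans SR2; exact: le_trans Sr.
have := poin Oz s0 sR2 lnU_W1pQ; rewrite -tS /= => HP.
have [eta [eta1 eta0 meta Heta]] := log_on_ball oks.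
have mqD : meas_fun Omega (fun x => qn x (Du x)) by exact: (meas_qn oO Qpsd mQ mO (@subset_refl _ _) mDu).
have mU : meas_fun Omega U.
  apply: (meas_comp (g := pos_shift k)) mu => y.
  by apply/differentiable_continuous/derivable1_diffP; have [] := is_derive_pos_shift k_gt0 y.
have U0 x : 0 < U x by exact: pos_shift_gt0.
have mUi : meas_fun Omega (fun x => (U x)^-1).
  have -> : (fun x => (U x)^-1) = (fun x => U x `^ (-1)) by apply/funext => x; rewrite powR_inv1// ltW.
  exact: (@meas_powR _ _ _ U).
have mw : meas_fun (ball z S) (fun x => (eta x * (qn x (Du x) / U x)) `^ p).
  apply: (@meas_powR _ _ _ (fun x => eta x * (qn x (Du x) / U x))); apply: (measM meta).
  by apply: (meas_sub mO (@ballO z S)); exact: (measM mqD mUi).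
have L0 : 0 <= osc_log_cst * M / S.
  apply: divr_ge0; last exact: ltW.
  apply: mulr_ge0; last exact: le_trans M_ge1.
  rewrite /osc_log_cst /log_cst; apply: mulr_ge0; first exact: powR_ge0.
  by apply: addr_ge0 => //; apply: mulr_ge0; [exact: ltW|apply: exprn_ge0; exact: ltW].
have K0 : 0 <= C0 * tau `^ (- d0) by rewrite mulr_ge0 ?powR_ge0// ltW.
have H1 : (avg_lnorm p%:E (ball z (tau * S)) (Qnorm Q (fun x => F' (u x) *: Du x)) <=
    ((C0 * tau `^ (- d0)) `^ p^-1 * (osc_log_cst * M / S))%:E)%E.
  have A0 : (0 <= avgR (ball z (tau * S)) (fun x => `|Qnorm Q (fun x => F' (u x) *: Du x) x| `^ p)%R)%E.
    by apply: (avg_ge0 tS_gt0 (ball_lty _ _)) => x _; rewrite lee_fin powR_ge0.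
  apply/(poweR_root_le p0 (mulr_ge0 (powR_ge0 _ _) L0) A0).
  rewrite (powRM p (powR_ge0 _ _) L0) -(powRrM _ p^-1 p) mulVf ?gt_eqF// (powRr1 K0).
  apply/(avg_intU tS_gt0 (ball_lty _ _)).
  apply: (@le_trans _ _ (intU (ball z S) (fun x => (eta x * (qn x (Du x) / U x)) `^ p))).
    apply: (@le_trans _ _ (intU (ball z (tau * S)) (fun x => (eta x * (qn x (Du x) / U x)) `^ p))); last first.
      by apply: (le_intU_set mtS mS (ballS tSS) mw) => x _; exact: powR_ge0.
    have mF : meas_fun (ball z (tau * S)) (fun x => `|Qnorm Q (fun x => F' (u x) *: Du x) x| `^ p).
      have mV : measV Omega (fun x => F' (u x) *: Du x) by case: lnU_W1pQ => _ mV _.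
      have mqV := meas_qn oO Qpsd mQ mtS (@ballO z _) (fun i => meas_sub mO (@ballO z (tau * S)) (mV i)).
      exact: (@meas_powR _ _ _ (fun x => `|Qnorm Q (fun x => F' (u x) *: Du x) x|) _ (meas_norm mqV)).
    apply: (le_intU mtS mF (meas_sub mS (ballS tSS) mw)) => x xt.
    rewrite powR_ge0/= eta1// mul1r; apply: powR_mono; [exact: ltW|exact: normr_ge0|].
    rewrite ger0_norm ?enorm_ge0// /Qnorm qnZ.
    have /andP[d1 d2] := pos_shift'_bound k_gt0 (u x).
    rewrite ger0_norm; last by rewrite /F'; apply: mulr_ge0; [rewrite invr_ge0; exact: ltW (U0 x)|exact: ltW].
    rewrite mulrC ler_wpM2l ?enorm_ge0// /F' ler_piMr// invr_ge0; exact: ltW (U0 x).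
  move: Heta => /(avg_intU S_gt0 (ball_lty _ _)) H; apply: (le_trans H); rewrite lee_fin.
  have SR1' : S < R1 z by exact: le_lt_trans Sr _.
  have zz : ball z (tau * S) `&` ball z S !=set0.
    by exists z; split; [exact: (qballxx qm Oz tS0)|exact: (qballxx qm Oz S0)].
  have := homog Oz Oz tS0 tSS SR1' zz.
  rewrite -(volE (ball_lty z S)) -(volE (ball_lty z (tau * S))) -EFinM lee_fin.
  have -> : S / (tau * S) = tau^-1 by field; rewrite !gt_eqF.
  rewrite powR_invM ?(ltW tau0)// -powRN => hv.
  rewrite -/S; move: (_ `^ p) (powR_ge0 (osc_log_cst * M / S) p) => Y Y0.
  have -> : vol (ball z (tau * S)) * (C0 * tau `^ (- d0) * Y) = C0 * tau `^ (- d0) * vol (ball z (tau * S)) * Y by ring.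
  exact: ler_wpM2r.
rewrite [_ * vol _]mulrC; apply/(avg_intU s_gt0 (ball_lty _ _)); apply: (le_trans HP).
apply: (@le_trans _ _ ((C2 * s)%:E * ((C0 * tau `^ (- d0)) `^ p^-1 * (osc_log_cst * M / S))%:E)%E).
  by apply: lee_wpmul2l => //; rewrite lee_fin mulr_ge0 ?ltW.
rewrite -EFinM lee_fin le_eqVlt; apply/orP; left; apply/eqP.
rewrite /osc_cst /S; move: (_ `^ p^-1) => G; field.
by rewrite !gt_eqF.
Qed.

Definition harnack_doubling := C0 * (8 * kappa ^+ 3) `^ d0.
Definition harnack_step := jn_step (osc_cst * M) harnack_doubling.

Hypothesis osc_cst_gt0 : 0 < osc_cst.
Variable r : R.
Hypotheses (r0 : 0 < r) (rrB : bb / tau * (2 * kappa * r) <= rB).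

Let mU : meas_fun Omega U.
Proof.
apply: (meas_comp (g := pos_shift k)) mu => y.
by apply/differentiable_continuous/derivable1_diffP; have [] := is_derive_pos_shift k_gt0 y.
Qed.

Let U0 x : 0 < U x. Proof. exact: pos_shift_gt0. Qed.

Let ok_center : ok x0 (2 * kappa * r).
Proof.
split=> //; first by apply: mulr_gt0 => //; apply: mulr_gt0 => //; exact: mulr_gt0.
exact: ballS.
Qed.

Let okP z s : ok z s -> [/\ Omega z, 0 < s, (0 < @leb R n (ball z s))%E,
  (@leb R n (ball z s) < +oo)%E & meas_fun (ball z s) lnU].
Proof.
move=> oks; have [Oz S0 Sr zB] := oks.
have s0 : 0 < s by rewrite -(pmulr_rgt0 _ ratio0).
have sS : s <= bb / tau * s by rewrite ler_peMl// ltW.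
split => //.
  by apply: subball_gt0; split => //; [exact: le_trans Sr|exact: subset_trans (ballS sS) zB].
exact: (meas_compM (@measurable_ln R) (meas_sub mO (@ballO z s) mU)).
Qed.

Let ok_sub z x s w : ok z (2 * kappa * s) -> ball z s x -> 0 < w -> w <= s -> ok x w.
Proof.
move=> [Oz S0 Sr zB] zx w0 ws; have [Ox _] := zx; split => //.
- exact: mulr_gt0.
- apply: le_trans Sr; rewrite ler_pM2l//; apply: (le_trans ws).
  have s0 : 0 <= s by exact: le_trans (ltW w0) ws.
  by have := k1; nra.
- apply: subset_trans zB; apply: (qball_sub qm Oz zx).
  have -> : bb / tau * (2 * kappa * s) = kappa * (bb / tau * s + bb / tau * s) by ring.
  rewrite ler_pM2l//; apply: lerD; last by rewrite ler_pM2l.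
  by rewrite ler_peMl//; exact: le_trans (ltW w0) ws.
Qed.

Let vol_doubling x w z s : ok x w -> ok z s -> w <= s -> s <= 8 * kappa ^+ 3 * w ->
  ball x w `<=` ball z s -> vol (ball z s) <= harnack_doubling * vol (ball x w).
Proof.
move=> okx okz ws sw sub; have [Ox w0 _ _ _] := okP okx; have [Oz s0 _ _ _] := okP okz.
have [_ _ Sr _] := okz; have [sR _] := radii (subball_center okz).
have sR1 : s < R1 z.
  by apply: le_lt_trans sR; apply: le_trans Sr; rewrite ler_peMl// ltW.
have xx : ball x w `&` ball z s !=set0.
  by exists x; split; [exact: (qballxx qm Ox w0)|apply: sub; exact: (qballxx qm Ox w0)].
have := homog Oz Ox w0 ws sR1 xx.
rewrite -(volE (ball_lty z s)) -(volE (ball_lty x w)) -EFinM lee_fin => H; apply: (le_trans H).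
apply: ler_wpM2r; first by rewrite /vol fine_ge0.
rewrite ler_pM2l//; apply: powR_mono; first exact: ltW.
  by apply: divr_ge0; exact: ltW.
by rewrite ler_pdivrMr.
Qed.

Lemma avg_power_bound (q : R) : `|q| <= jn_exponent harnack_step ->
  (avgR (ball x0 r) (fun x => U x `^ q)%R <= (7 * expR (q * cav x0 r))%:E)%E.
Proof.
move=> qal; have x0x0 := qballxx qm Ox0 r0.
have okr : ok x0 r by exact: (ok_sub ok_center x0x0 r0 (lexx r)).
have [_ _ B_gt0 B_lty _] := okP okr.
have L0 : 0 < osc_cst * M by apply: mulr_gt0 => //; exact: lt_le_trans M_ge1.
have D0 : 0 <= harnack_doubling by apply: mulr_ge0; [exact: ltW|exact: powR_ge0].
have st0 : 0 < harnack_step.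
  rewrite /harnack_step /jn_step; have := D0; have := L0; move: (osc_cst * M) harnack_doubling => l D l0 D0'.
  by have := mulr_ge0 D0' (ltW l0); have := sqr_ge0 D; nra.
apply: (avg_powR_exp (mball r Ox0) B_gt0 B_lty U0 (meas_sub mO (@ballO _ _) mU) st0 _ qal) => m.
exact: (@john_nirenberg R n Omega rho kappa qm oball fine_balls ok lnU cav (osc_cst * M) harnack_doubling
  L0 D0 okP ok_sub vol_doubling log_osc m x0 r ok_center r0).
Qed.

Let chi := sigma / ss.
Let B0 := ball x0 r.
Let T := ball x0 (tau * r).

Let chi1 : 1 < chi.
Proof.
by rewrite /chi ltr_pdivlMr ?(lt_le_trans ltr01)// mul1r; exact: cutoff_exp_lt.
Qed.

Let ok_r : ok x0 r.
Proof. exact: (ok_sub ok_center (qballxx qm Ox0 r0) r0 (lexx r)). Qed.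

Let sub_r : subball x0 r.
Proof.
have [_ _ Sr zB] := ok_r; have rS : r <= bb / tau * r by rewrite ler_peMl// ltW.
by split => //; [exact: le_trans Sr|exact: subset_trans (ballS rS) zB].
Qed.

Let step_cst_gt0 Lam m : 0 <= Lam -> 1 + p * (m - 1) != 0 ->
  0 < step_cst p sigma C1 a Cx Dx Hx Lam m.
Proof.
move=> Lam0 m0; have lam1 : 0 < Num.min 1 `|1 + p * (m - 1)| by rewrite lt_min ltr01 normr_gt0.
have D1 : 1 <= sobolev_growth C1 m.
  by rewrite /sobolev_growth lerDl mulr_ge0 ?addr_ge0// mulr_ge0// ltW.
rewrite /step_cst; apply: mulr_gt0; last by rewrite ltr_wpDl.
apply: mulr_gt0; first exact: lt_le_trans D1.
apply: powR_gt0; apply: divr_gt0 => //; apply: mulr_gt0; last first.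
  by apply: powR_gt0; exact: lt_le_trans D1.
have a0 : 0 < a by exact: lt_trans a1.
apply: mulr_gt0 => //; apply: addr_gt0; first by rewrite addr_gt0// !mulr_gt0.
by rewrite ltr_pwDl// mulr_ge0// ltW.
Qed.

Lemma moser_on_ball (m0 G H : R) : `|m0 * (p * ss)| <= jn_exponent harnack_step ->
  1 <= G -> 1 <= H -> (forall j, 1 + p * (m0 * chi ^+ j - 1) != 0) ->
  (forall j, step_cst p sigma C1 a Cx Dx Hx (Cs * N ^+ j.+2) (m0 * chi ^+ j) * M <= G * H ^+ j.+1) ->
  {ae @leb R n, forall x, T x -> U x `^ m0 <= moser_bound chi (7 * expR (m0 * cav x0 r)) G H}.
Proof.
move=> mal G1 H1 mn HG.
have [rR1 rR2] := radii (subball_center sub_r); have [_ _ rrB' _] := sub_r.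
have rR2' : r < R2 x0 by exact: le_lt_trans rR2.
have [eta [supp1 Heta Hint [C3 [C30 Hemb]]]] := cut Ox0 r0 rR2'.
have ob : open B0 by exact: oball.
have B_gt0 := subball_gt0 sub_r; have B_lty := ball_lty x0 r.
have mB := mball r Ox0; have mT := mball (tau * r) Ox0.
have TB : T `<=` B0 by apply: ballS; rewrite ler_piMl// ltW.
have good := cutoff_good oO p1 Qpsd mQ bO ob (@ballO x0 r) B_gt0 ps t1 r0 Cs0 N0 supp1 Heta Hint C30 Hemb.
have gr := cutoff_grad oO p1 Qpsd mQ bO ob (@ballO x0 r) B_gt0 ps r0 Cs0 N0 Heta.
have [hb hc hd hh] := coefs sub_r.
have Lam0 j : 0 <= Cs * N ^+ j by apply: mulr_ge0; [exact: ltW|apply: exprn_ge0; exact: ltW].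
pose i_ j : E -> R := \1_(plateau B0 (eta j.+1)).
have q0 : 0 < p * ss by rewrite mulr_gt0// (lt_le_trans ltr01).
have mUB : meas_fun B0 U by exact: meas_sub mO (@ballO _ _) mU.
have mi j : meas_fun B0 (i_ j) by exact: meas_indic_plateau (good j.+1 isT) _.
have meta j : meas_fun B0 (eta j.+2).
  by have [le _ _ _ _] := Heta j.+2 isT; exact: meas_Lip_loc ob (lipschitz_Lip_loc le).
have i01 j x : B0 x -> i_ j x = 0 \/ i_ j x = 1.
  by move=> _; rewrite /i_ indicE; case: (_ \in _); [right|left].
have e01 j x : 0 <= eta j.+1 x <= 1 by have [_ he _ _ _] := Heta j.+1 isT.
have ieta j x : B0 x -> i_ j.+1 x <= eta j.+2 x.
  move=> Bx0'; rewrite /i_ indicE; have [|_] := boolP (x \in _); last by have /andP[] := e01 j.+1 x.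
  by rewrite inE => -[_ ->].
have iT j x : T x -> i_ j x = 1.
  move=> Tx; rewrite /i_ indicE mem_set//; split; first exact: TB.
  by have [_ _ he _ _] := Heta j.+1 isT; exact: he.
have AG j : 0 < step_cst p sigma C1 a Cx Dx Hx (Cs * N ^+ j.+2) (m0 * chi ^+ j) * M <= G * H ^+ j.+1.
  by rewrite HG andbT mulr_gt0 ?step_cst_gt0// (lt_le_trans ltr01).
have X0 : 0 < 7 * expR (m0 * cav x0 r) by rewrite mulr_gt0// expR_gt0.
have mUq q : meas_fun B0 (fun x => U x `^ q) by exact: (@meas_powR _ _ _ U).
apply: (@moser_iteration R n B0 T mB mT TB B_gt0 B_lty U m0 (p * ss) chi _ G H i_ (fun j => eta j.+2) _
  mUB chi1 q0 X0 G1 H1 mi meta i01 ieta iT AG).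
- have := avg_power_bound mal => HA.
  apply: (@le_trans _ _ (avgR B0 (fun x => U x `^ (m0 * (p * ss)))%R)).
    apply: (le_avg mB B_gt0 B_lty _ (mUq _)) => [|x Bx'].
      by apply: (@meas_powR _ _ _ (fun x => i_ 0%N x * U x `^ m0)); exact: (measM (mi _) (mUq _)).
    rewrite powR_ge0/=; have [->|->] := i01 0%N x Bx'.
      by rewrite mul0r powR0 ?powR_ge0// gt_eqF.
    by rewrite mul1r -powRrM.
  apply: (le_trans HA); rewrite lee_fin powRM ?expR_ge0//.
  have -> : m0 * (p * ss) * cav x0 r = m0 * cav x0 r * (p * ss) by ring.
  rewrite (expRM (m0 * cav x0 r)); apply: ler_wpM2r; first exact: powR_ge0.
  rewrite -[leLHS](powRr1 (ler0n R 7)); apply: ler_powR; first by rewrite ler1n.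
  by rewrite -[leLHS]mulr1 ler_pM// ltW.
- move=> j Y Y0 HY; have [_ _ _ sup _] := Heta j.+1 isT.
  have E1 : p * ss * chi = p * sigma.
    by rewrite /chi -mulrA [ss * _]mulrC divfK// gt_eqF// (lt_le_trans ltr01).
  rewrite E1.
  exact: (moser_step oO p1 Qpsd mQ ob (@ballO x0 r) B_gt0 B_lty mu mDu appv s1 (ltW C10) r0
    (sob Ox0 r0 rR2') (good j.+1 isT) (good j.+2 isT) sup gamma1 gammap delta1 deltap psi1 psip a1 Hstr Lc Le Lf Lb Ld
    Hsol k_gt0 (u0_sub sub_r) M_ge1 HBx HCx HDx HHx hb hc hd hh (Lam0 j.+2) ss1 (gr j.+2 isT) (mn j) Y0 HY).
Qed.

(** The iteration at m0 and at -m0 gives U^m0 <= e^(m0 l) W and U^(-m0) <= e^(-m0 l) W with the same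
    mean l of log U. Hence U lies between e^l W^(-1/m0) and e^l W^(1/m0), and l disappears from the
    quotient. *)
Lemma harnack_ball (m0 G H : R) : 0 < m0 -> m0 * (p * ss) <= jn_exponent harnack_step ->
  1 <= G -> 1 <= H -> (forall j, 1 + p * (m0 * chi ^+ j - 1) != 0) ->
  (forall j (s : R), `|s| = 1 -> step_cst p sigma C1 a Cx Dx Hx (Cs * N ^+ j.+2) (s * m0 * chi ^+ j) * M <= G * H ^+ j.+1) ->
  exists2 lo : R, 0 < lo & {ae @leb R n, forall x, T x ->
    lo <= u x + k <= moser_bound chi 7 G H `^ (2 / m0) * lo}.
Proof.
move=> m00 mal G1 H1 mn HG.
have ps0 : 0 < p * ss by rewrite mulr_gt0// (lt_le_trans ltr01).
have W0 : 0 < moser_bound chi 7 G H.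
  have G0 : 0 < G by exact: lt_le_trans G1.
  have H0 : 0 < H by exact: lt_le_trans H1.
  by rewrite /moser_bound; apply: mulr_gt0; [apply: mulr_gt0 => //|]; exact: powR_gt0.
have WE l : moser_bound chi (7 * expR l) G H = expR l * moser_bound chi 7 G H.
  by rewrite /moser_bound; ring.
set l := cav x0 r.
have Hp : {ae @leb R n, forall x, T x -> U x `^ m0 <= expR (m0 * l) * moser_bound chi 7 G H}.
  rewrite -WE; apply: moser_on_ball => //; first by rewrite ger0_norm// mulr_ge0// ltW.
  by move=> j; have := HG j 1 (normr1 _); rewrite mul1r.
have Hn : {ae @leb R n, forall x, T x -> U x `^ (- m0) <= expR (- m0 * l) * moser_bound chi 7 G H}.
  rewrite -WE; apply: moser_on_ball => //.
  - by rewrite mulNr normrN ger0_norm// mulr_ge0// ltW.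
  (* At negative exponents 1 + p(m - 1) is below 1 - p, so there is no resonance. *)
  - move=> j; rewrite lt_eqF//; have : 0 < m0 * chi ^+ j by rewrite mulr_gt0// exprn_gt0// (lt_trans ltr01).
    by have := p1; have := p0; rewrite mulNr; move: (m0 * _) => y *; nra.
  - by move=> j; have := HG j (-1) (normrN1 _); rewrite mulN1r.
exists (expR l * moser_bound chi 7 G H `^ (- m0^-1)); first by rewrite mulr_gt0 ?expR_gt0// powR_gt0.
have [_ _ _ rB'] := sub_r.
have TBr x : T x -> Br x.
  move=> Tx; apply: rB'; move: x Tx; apply: ballS; by rewrite ler_piMl// ltW.
have := ae_imp2 (fun x (h1 : T x -> _) (h2 : T x -> _) (Tx : T x) => conj (h1 Tx) (h2 Tx)) Hp Hn.
move=> Hpn; apply: ae_imp2 Hpn u0 => x hUx ux Tx; have [h1 h2] := hUx Tx.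
have UE : U x = u x + k by rewrite /U /shifted pos_shiftE// ux//; exact: TBr.
rewrite -UE; have Ux := U0 x.
have lnW := lnK W0; set w := ln (moser_bound chi 7 G H) in lnW.
have P1 q : moser_bound chi 7 G H `^ q = expR (q * w) by rewrite /powR gt_eqF.
have P2 q : U x `^ q = expR (q * ln (U x)) by rewrite /powR gt_eqF.
have UxE : U x = expR (ln (U x)) by rewrite lnK.
move: h1 h2; rewrite -lnW !P2 -!expRD !ler_expR => h1 h2.
rewrite lnW !P1 UxE -!expRD !ler_expR.
have mi : m0^-1 * m0 = 1 by rewrite mulVf// gt_eqF.
have mi0 : 0 < m0^-1 by rewrite invr_gt0.
clear Hp Hn hUx; move: (ln (U x)) l h1 h2 => y l' h1 h2.
have h3 : y <= l' + m0^-1 * w.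
  have := ler_wpM2l (ltW mi0) h1.
  by rewrite mulrDr !mulrA mi !mul1r.
have h4 : l' - m0^-1 * w <= y.
  have := ler_wpM2l (ltW mi0) h2.
  by rewrite mulrDr !mulrA mulrN mi !mulN1r; lra.
apply/andP; split; first by rewrite mulNr.
have -> : 2 / m0 * w + (l' + - m0^-1 * w) = l' + m0^-1 * w by ring.
exact: h3.
Qed.

End harnack_setting.

(** * The constants and their dependence on M1 and C1 *)

Section harnack_constants.
Context {R : realType}.
Variables (p a sigma s e1 e2 e3 kappa C2 bb tau N Cs C0 d0 : R).

(** The constants are rewritten as functions of e1, e2, e3, since the integrability exponents may
    enter C4, C5 and C6 only through these. *)
Definition absorption_min := Num.min (Num.min (e1 / p) e2) e3.
Local Notation E := absorption_min.
Definition moser_ratio := sigma / s.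
Local Notation chi := moser_ratio.
(** The positive exponents nearest to the resonance are (p - 1)/p times chi^(1/2) and chi^(-1/2);
    this bounds |1 + p(m - 1)| below along the iteration. *)
Definition resonance_gap := Num.min 1 ((p - 1) * (1 - (chi `^ 2^-1)^-1)).
Local Notation lam0 := resonance_gap.
Definition coef_factor_eps := 2 `^ (1 + e2^-1 + e3^-1).
Definition moser_base := 15 * (a * (2 * p * a + 3 + 2 * p) * 15 `^ p / lam0) `^ E^-1 *
  (Cs + 1) * Num.max 1 N * coef_factor_eps.
Definition moser_growth := chi `^ (1 + (1 + p) / E) * Num.max 1 N.
Definition osc_cst_eps := C2 * (C0 * tau `^ (- d0)) `^ p^-1 *
  ((a * (2 * p * a + 2 + (1 + p * `|0 - 1|)) * 1 `^ p / Num.min 1 `|1 + p * (0 - 1)|) `^ E^-1 *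
   (Cs * N ^+ 2 + 1)) * (tau / bb).
Definition step_factor := jn_step (osc_cst_eps * coef_factor_eps) (harnack_doubling kappa C0 d0).
(** [exponent_bound] times M1 bounds 1/m0, and [log_bound] bounds the logarithm of the Moser
    constant in units of ln((2 + C1) M1). The 2 in [harnack_exponent] is that of W^(2/m0). *)
Definition exponent_bound := chi `^ 2^-1 * (p / (p - 1)) + p * s * chi * step_factor / ln (3 / 2).
Definition log_bound := (ln 7 + chi / (chi - 1) * ln moser_base +
    (chi / (chi - 1) + chi / (chi - 1) / (chi - 1)) * ln moser_growth) / ln 2 +
  chi / (chi - 1) * (1 + p / E) + chi / (chi - 1).
Definition harnack_exponent := 2 * log_bound * exponent_bound.

Hypotheses (p1 : 1 < p) (a1 : 1 < a) (s1 : 1 <= s) (ss : s < sigma).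
Hypotheses (e10 : 0 < e1) (e20 : 0 < e2) (e30 : 0 < e3).
Hypotheses (C20 : 0 < C2) (bb1 : 1 <= bb) (tau0 : 0 < tau) (N0 : 0 < N) (Cs0 : 0 < Cs).
Hypotheses (C00 : 0 < C0) (k1 : 1 <= kappa).

Let p0 : 0 < p. Proof. exact: lt_trans p1. Qed.
Let a0 : 0 < a. Proof. exact: lt_trans a1. Qed.
Let s0 : 0 < s. Proof. exact: lt_le_trans s1. Qed.
Let p10 : 0 < p - 1. Proof. by rewrite subr_gt0. Qed.
Let bb0 : 0 < bb. Proof. exact: lt_le_trans bb1. Qed.
Let E0 : 0 < E. Proof. by rewrite /E !lt_min e20 e30 divr_gt0. Qed.
Let chi1 : 1 < chi. Proof. by rewrite /moser_ratio ltr_pdivlMr// mul1r. Qed.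
Let chi0 : 0 < chi. Proof. exact: lt_trans chi1. Qed.
Let chi10 : 0 < chi - 1. Proof. by rewrite subr_gt0. Qed.
Let w := chi `^ 2^-1.
Let w2 : w * w = chi.
Proof. by rewrite /w -powRDp// (_ : 2^-1 + 2^-1 = 1) ?powRr1//; [exact: ltW|field]. Qed.
Let w1 : 1 < w.
Proof.
have w0 : 0 < w by exact: powR_gt0.
by rewrite ltNge; apply/negP => h; have := ler_pM (ltW w0) (ltW w0) h h; rewrite w2 mulr1 leNgt chi1.
Qed.
Let w0 : 0 < w. Proof. exact: lt_trans w1. Qed.
Let wi : w^-1 < 1. Proof. by rewrite invf_lt1. Qed.

Let lam00 : 0 < lam0. Proof. by rewrite lt_min ltr01 mulr_gt0// subr_gt0. Qed.

Lemma resonance_gap_gt0 : 0 < lam0. Proof. exact: lam00. Qed.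

Let Nm1 : 1 <= Num.max 1 N. Proof. by rewrite le_max lexx. Qed.
Let Nm0 : 0 < Num.max 1 N. Proof. exact: lt_le_trans Nm1. Qed.

Let factor1 : 1 <= coef_factor_eps.
Proof.
rewrite -[leLHS](powRr0 2); apply: ler_powR; first by rewrite ler1n.
by apply: addr_ge0; rewrite ?addr_ge0// invr_ge0 ltW.
Qed.

Let base0 : 1 <= a * (2 * p * a + 3 + 2 * p) * 15 `^ p / lam0.
Proof.
rewrite ler_pdivlMr// mul1r; apply: (@le_trans _ _ 1); first by rewrite ge_min lexx.
have h15 : 1 <= 15 `^ p by rewrite -[leLHS](powRr0 15); apply: ler_powR; [rewrite ler1n|exact: ltW].
have h1 : 1 <= 2 * p * a + 3 + 2 * p.
  by have := mulr_gt0 p0 a0; have := p0; nra.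
rewrite -[leLHS]mulr1; apply: ler_pM => //.
by rewrite -[leLHS]mulr1; apply: ler_pM => //; exact: ltW.
Qed.

Lemma moser_base_ge1 : 1 <= moser_base.
Proof.
have h : 1 <= (a * (2 * p * a + 3 + 2 * p) * 15 `^ p / lam0) `^ E^-1.
  by rewrite -[leLHS](powRr0 (a * (2 * p * a + 3 + 2 * p) * 15 `^ p / lam0)); apply: ler_powR => //; rewrite invr_ge0 ltW.
rewrite /moser_base; move: (_ `^ E^-1) h => X h.
have m1 (x y : R) : 1 <= x -> 1 <= y -> 1 <= x * y by move=> x1 y1; rewrite -[leLHS]mulr1; apply: ler_pM.
have cs : 1 <= Cs + 1 by rewrite lerDr ltW.
by apply: (m1) => //; apply: (m1) => //; apply: (m1) => //; apply: (m1) => //; rewrite ler1n.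
Qed.

Lemma moser_growth_ge1 : 1 <= moser_growth.
Proof.
rewrite /moser_growth -[leLHS]mulr1; apply: ler_pM => //.
rewrite -[leLHS](powRr0 chi); apply: ler_powR; first exact: ltW.
by rewrite addr_ge0// divr_ge0 ?addr_ge0// ltW.
Qed.

(* The exponents [m0 chi^j] stay away from the resonance [(p - 1) / p], where    *)
(* [1 + p (m - 1)] vanishes, because they straddle it symmetrically.             *)
Lemma nonresonant_exponent (al : R) : 0 < al ->
  exists m0, [/\ 0 < m0 <= 1, m0 * (p * s) <= al,
    m0^-1 <= w * (p / (p - 1)) + p * s * chi / al &
    forall j t, `|t| = 1 -> lam0 <= `|1 + p * (t * m0 * chi ^+ j - 1)|].
Proof.
move=> al0; pose ms := (p - 1) / p; have ms0 : 0 < ms by exact: divr_gt0.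
have ms1 : ms <= 1 by rewrite ler_pdivrMr// mul1r gerDl oppr_le0.
have pm : p * ms = p - 1 by rewrite /ms mulrC divfK// gt_eqF.
pose m J := ms / w / chi ^+ J.
have m_gt0 J : 0 < m J by rewrite !divr_gt0// exprn_gt0.
have cJ J : 1 <= chi ^+ J by apply: exprn_ege1; exact: ltW.
have exJ : exists J, m J * (p * s) <= al.
  have ch : `|chi^-1| < 1 by rewrite ger0_norm ?invr_ge0 ?(ltW chi0)// invf_lt1.
  have cv : ms / w * (p * s) * chi^-1 ^+ J @[J --> \oo] --> (0 : R).
    by rewrite -(mulr0 (ms / w * (p * s))); apply: cvgM; [exact: cvg_cst|exact: cvg_expr].
  have := cvgr_le _ cv _ al0; case=> J _ /(_ J (leqnn J))/= hJ; exists J.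
  by rewrite /m mulrAC -exprVn.
case: (ex_minnP exJ) => J HJ Jmin; exists (m J); split => //.
- rewrite m_gt0/= ler_pdivrMr ?exprn_gt0// mul1r; apply: le_trans (cJ J).
  by rewrite ler_pdivrMr// mul1r; apply: le_trans ms1 (ltW w1).
- have q0 : 0 <= w * (p / (p - 1)) by apply: mulr_ge0; [exact: ltW|apply: divr_ge0; exact: ltW].
  have q1 : 0 <= p * s * chi / al by apply: divr_ge0; [apply: mulr_ge0; [apply: mulr_ge0|]; exact: ltW|exact: ltW].
  (* Minimality of J keeps m0 from being too small: either J = 0 and 1/m0 is explicit, or the
     exponent for the previous J exceeded al. *)
  case: J HJ Jmin => [|J] HJ Jmin.
    have -> : (m 0%N)^-1 = w * (p / (p - 1)).
      by rewrite /m expr0 /ms; field; rewrite !gt_eqF.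
    by rewrite lerDl.
  have hJ : al < m J * (p * s) by rewrite ltNge; apply/negP => /Jmin; rewrite ltnn.
  have -> : (m J.+1)^-1 = chi / m J.
    by rewrite /m exprS; move: (chi ^+ J) (exprn_gt0 J chi0) => X X0; field; rewrite !gt_eqF.
  rewrite -[leLHS]add0r; apply: lerD => //.
  rewrite ler_pdivrMr// mulrAC ler_pdivlMr// mulrC.
  by have := ltW chi0; have := ltW hJ; nra.
move=> j t t1; have mj : 0 < m J * chi ^+ j by rewrite mulr_gt0// exprn_gt0.
have gap : lam0 <= (p - 1) * (1 - w^-1) by rewrite ge_min lexx orbT.
have : t = 1 \/ t = -1.
  by have [t0|t0] := ger0P t; [left; rewrite -t1 ger0_norm|right; rewrite -[t]opprK -t1 ler0_norm// ltW].
case=> ->.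
  rewrite mul1r; have -> : 1 + p * (m J * chi ^+ j - 1) = p * (m J * chi ^+ j - ms) by rewrite !mulrBr pm; ring.
  rewrite normrM (gtr0_norm p0); apply: (le_trans gap); rewrite -pm -mulrA ler_pM2l//.
  have [jJ|Jj] := leqP j J.
    rewrite distrC; apply: le_trans (ler_norm _); rewrite mulrBr mulr1 lerD2l lerN2.
    rewrite /m mulrAC -[leRHS]mulr1 -mulrA.
    apply: ler_wpM2l; first by apply: divr_ge0; exact: ltW.
    by rewrite ler_pdivrMr ?exprn_gt0// mul1r; apply: ler_weXn2l => //; exact: ltW.
  apply: le_trans (ler_norm _).
  have h : ms * w <= m J * chi ^+ j.
    have -> : ms * w = m J * (chi ^+ J * chi).
      have cw : w^-1 * chi = w by rewrite -w2 mulrA mulVf ?mul1r// gt_eqF.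
      by rewrite /m mulrA divfK ?gt_eqF ?exprn_gt0// -mulrA cw.
    rewrite ler_pM2l// -exprSr; apply: ler_weXn2l => //; exact: ltW.
  apply: (@le_trans _ _ (ms * w - ms)); last by rewrite lerD2r.
  have -> : ms * w - ms = ms * (w - 1) by ring.
  rewrite ler_pM2l// -subr_ge0.
  have -> : w - 1 - (1 - w^-1) = (w - 1) ^+ 2 * w^-1 by field; rewrite gt_eqF.
  by rewrite mulr_ge0 ?sqr_ge0// invr_ge0 ltW.
rewrite mulN1r mulNr; apply: (le_trans gap); rewrite ler0_norm; last first.
  by have := p10; have := mulr_gt0 p0 mj; nra.
have wv0 : 0 < w^-1 by rewrite invr_gt0.
have := mulr_gt0 p0 mj; have := mulr_gt0 p10 wv0; nra.
Qed.

(** The constant of the j-th step grows geometrically: [sobolev_growth] and the bound for theta_beta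
    are linear in |m| <= chi^j, the cutoffs contribute a power of N, and the gap bounds the
    coercivity constant below. C1 is isolated in the factor (1 + C1)^(1 + p/E), so that it reaches
    only the base of the final constant. *)
Lemma step_cst_bound (C1 Cx Dx Hx M1 m : R) (j : nat) : 0 <= C1 -> 0 <= M1 ->
  e1 = Num.min 1 (p * (1 - p * dual_exp sigma / Cx)) ->
  e2 = Num.min 1 (p * (1 - dual_exp sigma / Hx)) ->
  e3 = Num.min 1 (p * (1 - dual_exp sigma / Dx)) ->
  `|m| <= chi ^+ j -> lam0 <= `|1 + p * (m - 1)| ->
  step_cst p sigma C1 a Cx Dx Hx (Cs * N ^+ j.+2) m * (coef_factor p sigma Dx Hx * M1) <=
    moser_base * (1 + C1) `^ (1 + p / E) * M1 * moser_growth ^+ j.+1.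
Proof.
move=> C10 M10 E1 E2 E3 mX mlam.
rewrite /step_cst /absorption_cst /absorption_exp /coef_factor -E1 -E2 -E3 -/E -/coef_factor_eps.
set X := chi ^+ j in mX *; set D := sobolev_growth C1 m; set lam1 := Num.min 1 _.
have X1 : 1 <= X by apply: exprn_ege1; exact: ltW.
have X0 : 0 < X by exact: lt_le_trans X1.
have lam01 : lam0 <= lam1 by rewrite le_min mlam andbT ge_min lexx.
have lam10 : 0 < lam1 by exact: lt_le_trans lam01.
have m1 : `|m - 1| <= 2 * X.
  by apply: (le_trans (ler_normB _ _)); rewrite normr1; lra.
have C11 : 0 < 1 + C1 by rewrite ltr_wpDr.
have D1 : 1 <= D by rewrite /D /sobolev_growth lerDl mulr_ge0 ?addr_ge0// mulr_ge0.
have DX : D <= 15 * (1 + C1) * X.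
  rewrite /D /sobolev_growth; have := mulr_ge0 C10 (ltW X0).
  have : C1 * (1 + `|m - 1|) <= C1 * (3 * X) by rewrite ler_wpM2l//; lra.
  by move: (`|m - 1|) => y; lra.
have CX0 : 0 <= 15 * (1 + C1) * X by rewrite !mulr_ge0// ltW.
set base := a * (2 * p * a + 3 + 2 * p) * 15 `^ p / lam0.
have B1 : a * (2 * p * a + 2 + (1 + p * `|m - 1|)) * D `^ p / lam1 <=
    base * ((1 + C1) `^ p * X `^ (1 + p)).
  have -> : base * ((1 + C1) `^ p * X `^ (1 + p)) =
      (a * (2 * p * a + 3 + 2 * p) * X) * (15 * (1 + C1) * X) `^ p * lam0^-1.
    have C1p := ltW C11; have Xp := ltW X0; have h15 : 0 <= 15 * (1 + C1) by exact: mulr_ge0.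
    rewrite (powRM p h15 Xp) (powRM p (ler0n R 15) C1p) (powRDp 1 p X0) (powRr1 Xp) /base.
    by move: (15 `^ p) ((1 + C1) `^ p) (X `^ p) => *; ring.
  have q1 : 0 <= 2 * p * a + 2 + (1 + p * `|m - 1|).
    by rewrite !addr_ge0 ?mulr_ge0// ltW.
  apply: ler_pM.
  - by rewrite !mulr_ge0 ?powR_ge0// ltW.
  - by rewrite invr_ge0 ltW.
  - apply: ler_pM.
    + by rewrite mulr_ge0// ltW.
    + exact: powR_ge0.
    + rewrite -[leRHS]mulrA ler_pM2l//.
      have h2 : p * `|m - 1| <= p * (2 * X) by rewrite ler_pM2l.
      have h3 : 2 * p * a + 3 <= (2 * p * a + 3) * X.
        by rewrite ler_peMr// !addr_ge0 ?mulr_ge0// ltW.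
      by move: h2 h3; move: (p * `|m - 1|) (2 * p * a) => y z; lra.
    + by apply: powR_mono => //; [exact: ltW|exact: le_trans D1].
  - by rewrite lef_pV2.
have base_ge0 : 0 <= base by exact: le_trans base0.
have Ei : 0 <= E^-1 by rewrite invr_ge0 ltW.
have B2 : (a * (2 * p * a + 2 + (1 + p * `|m - 1|)) * D `^ p / lam1) `^ E^-1 <=
    base `^ E^-1 * ((1 + C1) `^ (p / E) * X `^ ((1 + p) / E)).
  apply: (@le_trans _ _ ((base * ((1 + C1) `^ p * X `^ (1 + p))) `^ E^-1)).
    apply: powR_mono => //; apply: divr_ge0; last exact: ltW.
    by rewrite !mulr_ge0 ?powR_ge0 ?addr_ge0 ?mulr_ge0// ltW.
  by rewrite (powRM _ base_ge0 (mulr_ge0 (powR_ge0 _ _) (powR_ge0 _ _))) (powRM _ (powR_ge0 _ _) (powR_ge0 _ _)) -!powRrM.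
have L1 : Cs * N ^+ j.+2 + 1 <= (Cs + 1) * Num.max 1 N ^+ j.+2.
  rewrite mulrDl mul1r; apply: lerD; last exact: exprn_ege1.
  rewrite ler_pM2l//; apply: lerXn2r; rewrite ?nnegrE ?(ltW N0) ?(ltW Nm0)//.
  by rewrite le_max lexx orbT.
have XH : X * X `^ ((1 + p) / E) <= (chi `^ (1 + (1 + p) / E)) ^+ j.+1.
  rewrite -{1}(powRr1 (ltW X0)) -powRDp// /X -(powR_mulrn j (ltW chi0)) -(powR_mulrn j.+1 (powR_ge0 _ _)).
  rewrite -!powRrM; apply: ler_powR; first exact: ltW.
  rewrite mulrC ler_wpM2l ?ler_nat//.
  by rewrite addr_ge0// divr_ge0 ?addr_ge0// ltW.
have cf0 : 0 <= coef_factor_eps by exact: powR_ge0.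
apply: (@le_trans _ _ (15 * (1 + C1) * X * (base `^ E^-1 * ((1 + C1) `^ (p / E) * X `^ ((1 + p) / E))) *
   ((Cs + 1) * Num.max 1 N ^+ j.+2) * (coef_factor_eps * M1))).
  apply: ler_wpM2r; first exact: mulr_ge0.
  apply: ler_pM => //.
  - by rewrite mulr_ge0 ?powR_ge0// (le_trans ler01).
  - by rewrite addr_ge0// mulr_ge0 ?exprn_ge0// ltW.
  - by apply: ler_pM => //; [exact: le_trans D1|exact: powR_ge0].
rewrite (powRDp 1 (p / E) C11) (powRr1 (ltW C11)) /moser_growth exprMn [Num.max 1 N ^+ j.+2]exprS.
rewrite /moser_base -/base.
have -> : 15 * (1 + C1) * X * (base `^ E^-1 * ((1 + C1) `^ (p / E) * X `^ ((1 + p) / E))) *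
   ((Cs + 1) * (Num.max 1 N * Num.max 1 N ^+ j.+1)) * (coef_factor_eps * M1) =
   (15 * base `^ E^-1 * (Cs + 1) * Num.max 1 N * coef_factor_eps * ((1 + C1) * (1 + C1) `^ (p / E)) * M1 *
   Num.max 1 N ^+ j.+1) * (X * X `^ ((1 + p) / E)) by ring.
have -> Z : 15 * base `^ E^-1 * (Cs + 1) * Num.max 1 N * coef_factor_eps * ((1 + C1) * (1 + C1) `^ (p / E)) * M1 *
   (Z * Num.max 1 N ^+ j.+1) = (15 * base `^ E^-1 * (Cs + 1) * Num.max 1 N * coef_factor_eps * ((1 + C1) * (1 + C1) `^ (p / E)) * M1 *
   Num.max 1 N ^+ j.+1) * Z by ring.
apply: ler_wpM2l => //; rewrite !mulr_ge0 ?powR_ge0 ?exprn_ge0// ?addr_ge0//; exact: ltW.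
Qed.

Let oc_gt0 : 0 < osc_cst_eps.
Proof.
have N2 : 0 <= Cs * N ^+ 2 by rewrite mulr_ge0 ?exprn_ge0// ltW.
apply: mulr_gt0; last exact: divr_gt0.
apply: mulr_gt0; first by apply: mulr_gt0 => //; rewrite powR_gt0// mulr_gt0// powR_gt0.
apply: mulr_gt0; last by rewrite ltr_wpDl.
have lam : 0 < Num.min 1 `|1 + p * (0 - 1)|.
  by rewrite lt_min ltr01 normr_gt0 sub0r mulrN1 subr_eq0 eq_sym gt_eqF.
apply: powR_gt0; apply: divr_gt0 => //; apply: mulr_gt0; last exact: powR_gt0.
apply: mulr_gt0 => //; apply: addr_gt0; first by rewrite addr_gt0// !mulr_gt0.
by rewrite ltr_pwDl// mulr_ge0// ltW.
Qed.

Lemma osc_cst_epsE (Cx Dx Hx : R) :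
  e1 = Num.min 1 (p * (1 - p * dual_exp sigma / Cx)) ->
  e2 = Num.min 1 (p * (1 - dual_exp sigma / Hx)) ->
  e3 = Num.min 1 (p * (1 - dual_exp sigma / Dx)) ->
  osc_cst p C0 d0 sigma C2 bb Cs tau N a Cx Dx Hx = osc_cst_eps.
Proof.
move=> E1 E2 E3; rewrite /osc_cst /osc_log_cst /log_cst /absorption_cst /absorption_exp.
by rewrite -E1 -E2 -E3.
Qed.

Lemma osc_cst_eps_gt0 : 0 < osc_cst_eps. Proof. exact: oc_gt0. Qed.

Let D0 : 0 <= harnack_doubling kappa C0 d0.
Proof. by apply: mulr_ge0; [exact: ltW|exact: powR_ge0]. Qed.

Lemma step_factor_gt0 : 0 < step_factor.
Proof.
rewrite /step_factor /jn_step; have cf : 0 < coef_factor_eps by exact: powR_gt0.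
have := D0; have := mulr_gt0 oc_gt0 cf.
move: (osc_cst_eps * _) (harnack_doubling _ _ _) => l D l0 D0'.
by have := mulr_ge0 D0' (ltW l0); have := sqr_ge0 D; nra.
Qed.

(** The step of the John-Nirenberg decay is linear in M1, which makes the admissible exponents of
    order 1 / M1. *)
Lemma harnack_stepE (Cx Dx Hx M1 : R) :
  e1 = Num.min 1 (p * (1 - p * dual_exp sigma / Cx)) ->
  e2 = Num.min 1 (p * (1 - dual_exp sigma / Hx)) ->
  e3 = Num.min 1 (p * (1 - dual_exp sigma / Dx)) ->
  harnack_step p kappa C0 d0 sigma C2 bb Cs tau N a Cx Dx Hx M1 = step_factor * M1.
Proof.
move=> E1 E2 E3; rewrite /harnack_step (osc_cst_epsE E1 E2 E3) /coef_factor -E2 -E3 -/coef_factor_eps.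
by rewrite /step_factor /jn_step; ring.
Qed.

Lemma exponent_bound_gt0 : 0 < exponent_bound.
Proof.
have l32 : 0 < ln (3 / 2 : R) by rewrite ln_gt0// ltr_pdivlMr//; lra.
apply: addr_gt0; first by apply: mulr_gt0 => //; exact: divr_gt0.
apply: divr_gt0 => //; apply: mulr_gt0; last exact: step_factor_gt0.
by apply: mulr_gt0 => //; exact: mulr_gt0.
Qed.

Let al0 : 0 < chi / (chi - 1). Proof. exact: divr_gt0. Qed.
Let be0 : 0 < chi / (chi - 1) / (chi - 1). Proof. exact: divr_gt0. Qed.
Let ln2 : 0 < ln (2 : R). Proof. by rewrite ln_gt0// ltr1n. Qed.

Lemma log_bound_gt0 : 0 < log_bound.
Proof.
have l1 : 0 <= ln moser_base by rewrite ln_ge0// moser_base_ge1.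
have l2 : 0 <= ln moser_growth by rewrite ln_ge0// moser_growth_ge1.
have l7 : 0 <= ln (7 : R) by rewrite ln_ge0// ler1n.
apply: ltr_wpDl => //; apply: addr_ge0; last first.
  by apply: mulr_ge0; [exact: ltW|rewrite addr_ge0// divr_ge0// ltW].
apply: divr_ge0; last exact: ltW.
by rewrite !addr_ge0// mulr_ge0 ?addr_ge0// ltW.
Qed.

Lemma harnack_exponent_gt0 : 0 < harnack_exponent.
Proof. by rewrite !mulr_gt0 ?log_bound_gt0 ?exponent_bound_gt0. Qed.

(** All logarithms are compared with L = ln((2 + C1) M1). Since L >= ln 2, numerical constants are
    multiples of L as well; multiplication by 2/m0, at most 2 [exponent_bound] M1, puts M1 into the
    exponent. *)
Lemma moser_bound_le (C1 M1 m0 : R) : 0 <= C1 -> 1 <= M1 -> 0 < m0 ->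
  m0^-1 <= exponent_bound * M1 ->
  moser_bound chi 7 (moser_base * (1 + C1) `^ (1 + p / E) * M1) moser_growth `^ (2 / m0) <=
    ((2 + C1) * M1) `^ (harnack_exponent * M1).
Proof.
move=> C10 M11 m00 hm; have M10 : 0 < M1 by exact: lt_le_trans M11.
have C11 : 0 < 1 + C1 by rewrite ltr_wpDr.
have b0 : 0 < moser_base by apply: lt_le_trans moser_base_ge1.
have g0 : 0 < moser_growth by apply: lt_le_trans moser_growth_ge1.
have C2M : 2 <= (2 + C1) * M1 by rewrite -[leLHS]mulr1; apply: ler_pM => //; rewrite lerDl.
have X0 : 0 < (2 + C1) * M1 by apply: lt_le_trans C2M.
set L := ln ((2 + C1) * M1).
have L2 : ln (2 : R) <= L by rewrite ler_ln ?posrE.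
have LC : ln (1 + C1) <= L.
  rewrite ler_ln ?posrE// -[leLHS]mulr1; apply: ler_pM => //; first exact: ltW.
  by rewrite lerD2r ler1n.
have LM : ln M1 <= L.
  by rewrite ler_ln ?posrE// -[leLHS]mul1r; apply: ler_pM => //; [exact: ltW|rewrite -[leLHS]addr0 lerD// ler1n].
have L0 : 0 < L by exact: lt_le_trans L2.
have C1p : 0 < (1 + C1) `^ (1 + p / E) by exact: powR_gt0.
have G0 : 0 < moser_base * (1 + C1) `^ (1 + p / E) * M1 by apply: mulr_gt0 => //; exact: mulr_gt0.
have W0 : 0 < moser_bound chi 7 (moser_base * (1 + C1) `^ (1 + p / E) * M1) moser_growth.
  by rewrite /moser_bound; apply: mulr_gt0; [apply: mulr_gt0 => //|]; exact: powR_gt0.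
have lnW : ln (moser_bound chi 7 (moser_base * (1 + C1) `^ (1 + p / E) * M1) moser_growth) <= log_bound * L.
  have GA : 0 < 7 * (moser_base * (1 + C1) `^ (1 + p / E) * M1) `^ (chi / (chi - 1)) by apply: mulr_gt0 => //; exact: powR_gt0.
  rewrite /moser_bound lnM ?posrE ?powR_gt0//.
  rewrite lnM ?posrE ?powR_gt0// !ln_powR lnM ?posrE//; last exact: mulr_gt0.
  rewrite lnM ?posrE// ln_powR.
  have l1 : 0 <= ln moser_base by rewrite ln_ge0// moser_base_ge1.
  have l2 : 0 <= ln moser_growth by rewrite ln_ge0// moser_growth_ge1.
  have l7 : 0 <= ln (7 : R) by rewrite ln_ge0// ler1n.
  rewrite /log_bound.
  set x := chi / (chi - 1); set y := x / (chi - 1); set P := p / E.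
  have P0 : 0 <= P by apply: divr_ge0; exact: ltW.
  set K := ln 7 + x * ln moser_base + (x + y) * ln moser_growth.
  have K0 : 0 <= K by rewrite !addr_ge0// mulr_ge0 ?addr_ge0// ltW.
  have hK : K <= K / ln 2 * L.
    rewrite -[leLHS]mulr1 -mulrA ler_wpM2l// -ler_pdivrMl ?invr_gt0// invrK mulr1//.
  have h1 : x * ((1 + P) * ln (1 + C1)) <= x * (1 + P) * L.
    by rewrite mulrA ler_wpM2l// mulr_ge0 ?addr_ge0// ltW.
  have h2 : x * ln M1 <= x * L by rewrite ler_wpM2l// ltW.
  have -> : ln 7 + x * (ln moser_base + (1 + P) * ln (1 + C1) + ln M1) + (x + y) * ln moser_growth =
      K + x * ((1 + P) * ln (1 + C1)) + x * ln M1 by rewrite /K; ring.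
  by rewrite (mulrDl (K / ln 2 + x * (1 + P))) (mulrDl (K / ln 2)); apply: lerD => //; apply: lerD.
have PE (z q : R) : 0 < z -> z `^ q = expR (q * ln z) by move=> z0; rewrite /powR gt_eqF.
rewrite (PE _ _ W0) (PE _ _ X0) ler_expR -/L.
have m2 : 0 <= 2 / m0 by apply: divr_ge0 => //; exact: ltW.
apply: (le_trans (ler_wpM2l m2 lnW)).
have -> : harnack_exponent * M1 * L = 2 * (exponent_bound * M1) * (log_bound * L).
  by rewrite /harnack_exponent; ring.
by apply: ler_wpM2r; [rewrite mulr_ge0// ltW// log_bound_gt0|rewrite ler_pM2l].
Qed.

End harnack_constants.

(** * Rescaled norms and essential bounds *)

Section conclusion.
Context {R : realType} {n : nat}.
Local Notation E := 'rV[R]_n.+1.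

(* [avg_lnorm] of a null set is 0, since the inverse of its volume is 0. *)
Lemma avg_lnorm_null (B : set E) (w : E -> R) (q : R) : q != 0 -> leb B = 0%E ->
  avg_lnorm q%:E B w = 0%E.
Proof.
move=> q0 B0; by rewrite /avg_lnorm /avg /vol B0 /= invr0 mul0e poweR0r// invr_eq0.
Qed.

Lemma avg_lnorm_ge0 (B : set E) (w : E -> R) (q : R) : (0 <= avg_lnorm q%:E B w)%E.
Proof. exact: poweR_ge0. Qed.

(** In logarithmic form the claim is linear and reduces to (m - q - lam)(ln rT - ln r) >= 0. *)
Lemma scale_radii (Cst r rT q m lam : R) : 0 < Cst -> 0 < r -> r <= rT -> lam <= m - q ->
  (Cst * r) `^ m * (rT / (Cst * r)) `^ q <= Cst `^ (m - q) * rT `^ (m - lam) * r `^ lam.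
Proof.
move=> Cst0 r0 rrT lamq; have rT0 : 0 < rT by exact: lt_le_trans rrT.
have CE (x y : R) : 0 < x -> x `^ y = expR (y * ln x) by move=> x0; rewrite /powR gt_eqF.
have Cr0 : 0 < Cst * r by exact: mulr_gt0.
rewrite (CE _ _ Cr0) (CE _ _ (divr_gt0 rT0 Cr0)) !(CE _ _ Cst0) !(CE _ _ rT0) !(CE _ _ r0) -!expRD ler_expR.
have Cri : 0 < (Cst * r)^-1 by rewrite invr_gt0.
rewrite (lnM (x := rT)) ?posrE// lnV ?posrE// lnM ?posrE//.
have h : ln r <= ln rT by rewrite ler_ln ?posrE.
move: (ln r) (ln rT) (ln Cst) h => x y z h.
have : 0 <= (m - q - lam) * (y - x) by rewrite mulr_ge0// subr_ge0.
nra.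
Qed.

(** On a null ball the left side vanishes, and for an infinite norm on V the right side is infinite.
    Otherwise [avg_rescale] is used with the scaling exponent d0 / q, which reproduces the doubling
    factor exactly. *)
Lemma rescaled_norm_le (B V : set E) (w : E -> R) (Cst r rT C0 d0 q m rt lam : R) :
  measurable (B : set (Rn R n)) -> measurable (V : set (Rn R n)) -> B `<=` V ->
  (@leb R n V < +oo)%E -> meas_fun V w -> (forall x, V x -> 0 <= w x) ->
  0 < q -> 0 < rt -> 0 < C0 -> 0 < Cst -> 0 < r -> r <= rT -> Cst * r <= rT ->
  ((0 < leb B)%E -> (leb V <= (C0 * (rT / (Cst * r)) `^ d0)%:E * leb B)%E) ->
  lam <= m / rt - d0 / (rt * q) ->
  ((((Cst * r) `^ m)%:E * avg_lnorm q%:E B w) `^ rt^-1 <=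
   ((C0 `^ (rt * q)^-1 * Cst `^ (m / rt - d0 / (rt * q)) * rT `^ (m / rt - lam))%:E *
     avg_lnorm q%:E V w `^ rt^-1) * (r `^ lam)%:E)%E.
Proof.
move=> mB mV BV V_lty mw w0 q0 rt0 C00 Cst0 r0 rrT CrT dbl lamq.
have rT0 : 0 < rT by exact: lt_le_trans rrT.
have Cr0 : 0 < Cst * r by exact: mulr_gt0.
have rti : rt^-1 != 0 by rewrite invr_eq0 gt_eqF.
set co := C0 `^ _ * _ * _; have co0 : 0 < co by rewrite !mulr_gt0 ?powR_gt0.
have rl0 : 0 < r `^ lam by exact: powR_gt0.
have V0 := avg_lnorm_ge0 V w q.
have R0 : (0 <= co%:E * avg_lnorm q%:E V w `^ rt^-1 * (r `^ lam)%:E)%E.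
  by rewrite mule_ge0 ?lee_fin ?(ltW rl0)// mule_ge0 ?lee_fin ?(ltW co0)// poweR_ge0.
have [B0|B0] := eqVneq (leb B) 0%E.
  by rewrite (avg_lnorm_null w _ B0) ?gt_eqF// mule0 poweR0r.
have B_gt0 : (0 < leb B)%E by rewrite lt_neqAle eq_sym B0 measure_ge0.
have B_lty : (leb B < +oo)%E by apply: le_lt_trans V_lty; exact: le_leb_outer.
move: V0 R0; case VE : (avg_lnorm q%:E V w) => [y| |] //; last first.
  move=> _ _; rewrite poweRyr// gt0_muley ?lte_fin// gt0_mulye ?lte_fin//.
  exact: leey.
rewrite lee_fin => y0 _.
have dq : d0 <= d0 / q * q by rewrite divfK// gt_eqF.
have Y0 : 0 <= rT `^ (d0 / q) * y by rewrite mulr_ge0 ?powR_ge0.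
have HV : ((rT `^ (d0 / q))%:E * avg_lnorm q%:E V w <= (rT `^ (d0 / q) * y)%:E)%E by rewrite VE EFinM.
have H := avg_rescale mB mV BV B_gt0 V_lty mw w0 q0 dq Cr0 CrT C00 Y0 (dbl B_gt0) HV.
set Z := C0 `^ q^-1 * (rT `^ (d0 / q) * y) / (Cst * r) `^ (d0 / q) in H.
have Z0 : 0 <= Z by apply: divr_ge0; [rewrite mulr_ge0 ?powR_ge0|exact: powR_ge0].
have A0 : (0 <= avg B (fun x => (`|w x| `^ q)%:E))%E.
  by apply: (avg_ge0 B_gt0 B_lty) => x _; rewrite lee_fin powR_ge0.
have HB : (avg_lnorm q%:E B w <= Z%:E)%E.
  apply/(poweR_root_le q0 Z0 A0); rewrite (eq_avg (g := fun x => w x `^ q))// => x Bx.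
  by rewrite ger0_norm// w0//; exact: BV.
apply: (@le_trans _ _ ((((Cst * r) `^ m)%:E * Z%:E) `^ rt^-1)%E).
  apply: gt0_ler_poweR; rewrite ?invr_ge0 ?(ltW rt0)//.
  - by rewrite in_itv/= leey andbT mule_ge0 ?avg_lnorm_ge0// lee_fin powR_ge0.
  - by rewrite in_itv/= leey andbT -EFinM lee_fin mulr_ge0// powR_ge0.
  - by apply: lee_wpmul2l => //; rewrite lee_fin powR_ge0.
rewrite -EFinM !poweR_EFin -!EFinM lee_fin.
have CE (x z : R) : 0 < x -> x `^ z = expR (z * ln x) by move=> x0; rewrite /powR gt_eqF.
have -> : ((Cst * r) `^ m * Z) `^ rt^-1 =
    C0 `^ (rt * q)^-1 * y `^ rt^-1 * ((Cst * r) `^ (m / rt) * (rT / (Cst * r)) `^ (d0 / (rt * q))).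
  have -> : Z = C0 `^ q^-1 * y * (rT / (Cst * r)) `^ (d0 / q).
    rewrite /Z (powRM _ (ltW rT0)) ?invr_ge0 ?(ltW Cr0)// (powR_invM _ (ltW Cr0)); ring.
  have h1 : 0 <= C0 `^ q^-1 * y by rewrite mulr_ge0 ?powR_ge0.
  rewrite (powRM _ (powR_ge0 _ _) (mulr_ge0 h1 (powR_ge0 _ _))) (powRM _ h1 (powR_ge0 _ _)) (powRM _ (powR_ge0 _ _) y0).
  rewrite -!powRrM.
  have -> : q^-1 / rt = (rt * q)^-1 by rewrite invfM mulrC.
  have -> : d0 / q / rt = d0 / (rt * q) by field; rewrite !gt_eqF.
  ring.
have -> : co * y `^ rt^-1 * r `^ lam = C0 `^ (rt * q)^-1 * y `^ rt^-1 *
    (Cst `^ (m / rt - d0 / (rt * q)) * rT `^ (m / rt - lam) * r `^ lam) by rewrite /co; ring.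
by apply: ler_wpM2l; [rewrite mulr_ge0 ?powR_ge0|exact: scale_radii].
Qed.

Lemma root_term_bound (c q M : R) (X : \bar R) : 0 < c -> 0 < q -> (0 <= X)%E ->
  (c%:E * X `^ q^-1 <= M%:E)%E -> exists y : R, [/\ X = y%:E, 0 <= y & c `^ q * y <= M `^ q].
Proof.
move=> c0 q0; case: X => [y| |]//.
  rewrite lee_fin => y0; rewrite poweR_EFin -EFinM lee_fin => H; exists y; split => //.
  have yq := powR_ge0 y q^-1.
  have -> : c `^ q * y = (c * y `^ q^-1) `^ q.
    by rewrite (powRM _ (ltW c0) yq) -powRrM mulVf ?gt_eqF// powRr1.
  by apply: powR_mono => //; [exact: ltW|rewrite mulr_ge0// ltW].
by move=> _; rewrite poweRyr ?invr_eq0 ?gt_eqF// gt0_muley ?lte_fin.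
Qed.

(** The two-sided estimate is available for k > K only, as K may be 0. With k = K + e it yields the
    claim up to an error C e; an infinite essential infimum, as on a null set, is treated apart. *)
Lemma ess_sup_le_ess_inf (T : set E) (u : E -> R) (K C : R) : 0 < C ->
  (forall k, K < k -> exists2 lo : R, 0 < lo &
    {ae @leb R n, forall x, T x -> lo <= u x + k <= C * lo}) ->
  (ess_sup_on T (fun z => (u z)%:E + K%:E) <= C%:E * ess_inf_on T (fun z => (u z)%:E + K%:E))%E.
Proof.
move=> C0 H.
set I := ess_inf_on _ _.
have key e : 0 < e -> (ess_sup_on T (fun z => (u z)%:E + K%:E) <= C%:E * (I + e%:E))%E.
  move=> e0; have [|lo lo0 Hlo] := H (K + e); first by rewrite ltrDl.
  have H1 : (ess_sup_on T (fun z => (u z)%:E + K%:E) <= (C * lo)%:E)%E.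
    apply/ess_supP; apply: ae_imp Hlo => x hx; rewrite /patch.
    have [|_] := boolP (x \in T); last exact: leNye.
    rewrite inE => /hx/andP[_ h]; rewrite -EFinD lee_fin; apply: le_trans h.
    by rewrite addrA lerDl ltW.
  have H2 : ((lo - e)%:E <= I)%E.
    apply/ess_infP; apply: ae_imp Hlo => x hx; rewrite /patch.
    have [|_] := boolP (x \in T); last exact: leey.
    by rewrite inE => /hx/andP[h _]; rewrite -EFinD lee_fin lerBlDr -addrA.
  apply: (le_trans H1); rewrite EFinM; apply: lee_wpmul2l; first by rewrite lee_fin ltW.
  by rewrite -leeBlDr// -EFinB.
have [Iy|Iy] := eqVneq I +oo%E; first by rewrite Iy gt0_muley ?lte_fin// leey.
apply/lee_addgt0Pr => e e0.
have eC : 0 < e / C by exact: divr_gt0.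
apply: (le_trans (key _ eC)); rewrite muleDr ?fin_num_adde_defl// -EFinM.
by rewrite [C * _]mulrC divfK ?gt_eqF.
Qed.

End conclusion.

(** * Geometry of the balls and the final inequality *)

Section harnack_inequality.
Context {R : realType} {n : nat}.
Local Notation E := 'rV[R]_n.+1.
Local Opaque enorm sqrtmx mulmx grad meas_fun.
Variables (Omega : set E) (p : R) (Q : E -> 'M[R]_n.+1) (rho : E -> E -> R) (kappa : R).
Variables (R1 R2 : E -> R) (C0 d0 C1 sigma C2 bb : R) (sstar : \bar R) (Cs tau N : R) (t : \bar R).
Variables (gamma psi delta a : R) (b c d e f g h : E -> R).
Variables (A : E -> R -> E -> E) (Bf : E -> R -> E -> R).
Hypotheses (oO : open Omega) (bO : bounded_set Omega) (p1 : 1 < p).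
Hypothesis Qpsd : forall x, Omega x -> psdmx (Q x).
Hypothesis mQ : forall i j, meas_fun Omega (fun x => Q x i j).
Hypothesis qm : quasimetric Omega rho kappa.
Local Notation ball := (qball Omega rho).
Hypothesis oball : forall x r, Omega x -> open (ball x r).
Hypothesis fine_balls : forall x, Omega x -> forall eps : R, 0 < eps -> exists2 del : R, 0 < del &
  forall y, Omega y -> rho x y < del -> `|x - y| < eps.
Hypotheses (C00 : 0 < C0) (d00 : 0 < d0) (homog : local_homogeneous Omega rho C0 d0 R1).
Hypotheses (C10 : 0 < C1) (s1 : 1 < sigma) (sob : sobolev_ineq Omega rho p Q R2 C1 sigma).
Hypotheses (C20 : 0 < C2) (bb1 : 1 <= bb) (poin : poincare_ineq Omega rho p Q R2 C2 bb).
Hypothesis sst : ((p * dual_exp sigma)%:E < sstar)%E.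
Hypotheses (Cs0 : 0 < Cs) (tau0 : 0 < tau) (tau1 : tau < 1) (N0 : 0 < N) (t1 : (1 <= t)%E).
Hypothesis cut : cutoffs Omega rho p Q R2 sstar Cs tau N t.
Hypotheses (gamma1 : 1 < gamma) (gammap : gamma < p) (delta1 : 1 < delta) (deltap : delta < p).
Hypotheses (psi1 : 1 < psi) (psip : psi < p) (a1 : 1 < a).
Hypothesis Hstr : structural Omega p Q gamma psi delta a b c d e f g h A Bf.
Hypothesis Lc : Lloc (sigma * p / (sigma * p - 1 - sigma * (psi - 1)))%:E Omega c.
Hypothesis Le : Lloc (dual_exp p)%:E Omega e.
Hypothesis Lf : Lloc (dual_exp (sigma * p))%:E Omega f.
Hypothesis Lb : Lloc (sigma * p / (sigma * (p - 1) - gamma + 1))%:E Omega b.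
Hypothesis Ld : Lloc (p * sigma / (p * sigma - delta))%:E Omega d.
Variables (y : E) (r1 : E -> R) (Astar : R) (x0 : E) (r Bx Hx Dx Cx : R).
Let Btilde := ball y (r1 y).
Let Cstar := 128 * bb * kappa ^+ 10 * (kappa + 2 * kappa ^+ 2) ^+ 8 /
    (tau * Astar ^+ 3 * Num.min (Astar ^+ 2) (8 * kappa ^+ 5)^-1).
Hypothesis Oy : Omega y.
Hypothesis r1_radii : forall x, Omega x -> [/\ 0 < r1 x, r1 x <= R1 x & r1 x <= R2 x].
Hypotheses (A0 : 0 < Astar) (A1 : Astar < 1) (r1_unif : locally_uniform Omega rho r1 Btilde Astar).
Hypothesis x0y : ball y (tau / (5 * kappa) * r1 y) x0.
Hypotheses (r0 : 0 < r) (r_lt : r < tau * Astar / (5 * kappa * Cstar) * r1 y).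
Hypotheses (HBx : dual_exp p * dual_exp sigma <= Bx) (HBd : d0 / (p - 1) <= Bx).
Hypotheses (HHd : d0 / p <= Hx) (HHx : dual_exp sigma < Hx).
Hypotheses (HDd : d0 / p <= Dx) (HDx : dual_exp sigma < Dx).
Hypotheses (HCd : d0 <= Cx) (HCx : p * dual_exp sigma < Cx).
Let Br := ball x0 (Cstar * r).
Let Btau := ball x0 (tau * r).

Let k1 : 1 <= kappa. Proof. by have [] := qm. Qed.
Let k0 : 0 < kappa. Proof. exact: lt_le_trans k1. Qed.
Let p0 : 0 < p. Proof. exact: lt_trans p1. Qed.
Let p10 : 0 < p - 1. Proof. by rewrite subr_gt0. Qed.
Let bb0 : 0 < bb. Proof. exact: lt_le_trans bb1. Qed.
Let rT0 : 0 < r1 y. Proof. by have [] := r1_radii Oy. Qed.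
Let ds0 : 0 < dual_exp sigma.
Proof. by rewrite /dual_exp divr_gt0 ?subr_gt0// (lt_trans _ s1). Qed.
Let H0 : 0 < Hx. Proof. exact: lt_trans HHx. Qed.
Let D0 : 0 < Dx. Proof. exact: lt_trans HDx. Qed.
Let Cx0 : 0 < Cx. Proof. exact: lt_le_trans HCd. Qed.
Let B0 : 0 < Bx. Proof. by apply: lt_le_trans HBd; exact: divr_gt0. Qed.

(** The lower bound that gives the ball of radius Cstar r room for the dilations by 2 kappa
    (John-Nirenberg) and bb / tau (Poincare and cutoffs). *)
Let Cstar_ge : 128 * bb * kappa / tau <= Cstar.
Proof.
have m1 (x z : R) : 1 <= x -> 1 <= z -> 1 <= x * z by move=> hx hz; rewrite -[leLHS]mulr1; apply: ler_pM.
have kap5 : 1 <= 8 * kappa ^+ 5 by apply: (m1) => //; [rewrite ler1n|exact: exprn_ege1].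
have mn0 : 0 < Num.min (Astar ^+ 2) (8 * kappa ^+ 5)^-1.
  by rewrite lt_min exprn_gt0//= invr_gt0 (lt_le_trans ltr01).
have den0 : 0 < tau * Astar ^+ 3 * Num.min (Astar ^+ 2) (8 * kappa ^+ 5)^-1.
  by rewrite mulr_gt0// mulr_gt0// exprn_gt0.
have A3 : Astar ^+ 3 <= 1 by apply: exprn_ile1; exact: ltW.
have A2 : Num.min (Astar ^+ 2) (8 * kappa ^+ 5)^-1 <= 1.
  by rewrite ge_min exprn_ile1// ltW.
have den : tau * Astar ^+ 3 * Num.min (Astar ^+ 2) (8 * kappa ^+ 5)^-1 <= tau.
  rewrite -mulrA -[leRHS]mulr1 ler_pM2l// -[leRHS]mulr1; apply: ler_pM => //; last exact: ltW.
  by rewrite exprn_ge0// ltW.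
have gs : 1 <= kappa + 2 * kappa ^+ 2 by rewrite -[leLHS]addr0 lerD// mulr_ge0// exprn_ge0// ltW.
rewrite /Cstar; apply: ler_pM.
- by rewrite !mulr_ge0// ltW.
- by rewrite invr_ge0 ltW.
- rewrite -[leLHS]mulr1; apply: ler_pM => //; first by rewrite !mulr_ge0// ltW.
    by apply: ler_wpM2l; [rewrite mulr_ge0// ltW|rewrite -[leLHS]expr1; apply: ler_weXn2l].
  exact: exprn_ege1.
- by rewrite lef_pV2.
Qed.

Let Cstar_ge128 : 128 <= Cstar.
Proof.
apply: le_trans Cstar_ge; rewrite ler_pdivlMr//.
have : 1 <= bb * kappa by rewrite -[leLHS]mulr1; apply: ler_pM.
by have := tau1; rewrite -mulrA; move: (bb * kappa) => z; lra.
Qed.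
Let Cstar_gt0 : 0 < Cstar. Proof. by apply: lt_le_trans Cstar_ge128. Qed.
Let rB := Cstar * r.
Let rB0 : 0 < rB. Proof. exact: mulr_gt0. Qed.

Let rB_lt : 5 * kappa * rB < tau * Astar * r1 y.
Proof.
move: r_lt; have k5 : 0 < 5 * kappa by exact: mulr_gt0.
rewrite mulrAC (ltr_pdivlMr _ _ (mulr_gt0 k5 Cstar_gt0)) /rB => H.
by rewrite (_ : 5 * kappa * (Cstar * r) = r * (5 * kappa * Cstar))//; ring.
Qed.

Let rB_ltA : rB < Astar * r1 y.
Proof.
have h1 : rB <= 5 * kappa * rB by rewrite ler_peMl ?(ltW rB0)//; have := k1; lra.
apply: (le_lt_trans h1); apply: (lt_le_trans rB_lt).
by rewrite -mulrA ger_pMl ?mulr_gt0// ltW.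
Qed.

Let rBT : rB < r1 y.
Proof. by apply: (lt_trans rB_ltA); rewrite gtr_pMl. Qed.

Let Ox0 : Omega x0. Proof. by have [] := x0y. Qed.

(** kappa times the distance from y to x0 and kappa times the radius Cstar r are each at most r1(y)
    / 5. *)
Let BrBt : Br `<=` Btilde.
Proof.
apply: (qball_sub qm Oy x0y); rewrite -/rB mulrDr.
have h1 : kappa * rB <= 5^-1 * r1 y.
  have : tau * Astar * r1 y <= r1 y.
    by rewrite ger_pMl//; have := mulr_ile1 (ltW tau0) (ltW A0) (ltW tau1) (ltW A1).
  by have := rB_lt; rewrite -mulrA; move: (kappa * rB) => z; lra.
have h2 : kappa * (tau / (5 * kappa) * r1 y) <= 5^-1 * r1 y.
  have -> : kappa * (tau / (5 * kappa) * r1 y) = tau * (5^-1 * r1 y) by field; rewrite gt_eqF.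
  by rewrite ger_pMl ?mulr_gt0// ltW.
by have := rT0; lra.
Qed.

(** Local uniformity gives r1(z) > Astar r1(y), which exceeds Cstar r. *)
Let radii z : Br z -> rB < R1 z /\ rB < R2 z.
Proof.
move=> /BrBt Bz; have Oz : Omega z by have [] := Bz.
have Byy : Btilde y by split => //; have [_ rs _] := qm; have [_ _ [_ ->]] := rs y y Oy Oy.
have [z0 zR1 zR2] := r1_radii Oz.
have /andP[] := r1_unif Byy Bz; rewrite ltr_pdivlMr// => hA _.
by split; [apply: lt_le_trans zR1|apply: lt_le_trans zR2]; exact: lt_trans rB_ltA hA.
Qed.

Let rrB : bb / tau * (2 * kappa * r) <= rB.
Proof.
rewrite /rB; have -> : bb / tau * (2 * kappa * r) = (2 * bb * kappa / tau) * r by field; rewrite gt_eqF.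
rewrite ler_pM2r//; apply: le_trans Cstar_ge.
apply: ler_wpM2r; first by rewrite invr_ge0 ltW.
have : 0 < bb * kappa by exact: mulr_gt0.
by rewrite -!mulrA; move: (bb * kappa) => z; lra.
Qed.

Let r_le : r <= r1 y.
Proof.
apply: le_trans (ltW rBT); rewrite /rB ler_peMl ?(ltW r0)//.
by apply: le_trans Cstar_ge128; rewrite ler1n.
Qed.

Let mball z s : Omega z -> measurable (ball z s : set (Rn R n)).
Proof. by move=> Oz; apply: open_measurable_Rn; exact: oball. Qed.
Let ball_lty z s : (@leb R n (ball z s) < +oo)%E.
Proof. by apply: le_lt_trans (leb_lty bO); apply: le_leb_outer => x []. Qed.

Let HBd' : d0 <= (p - 1) * Bx. Proof. by move: HBd; rewrite ler_pdivrMr// mulrC. Qed.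
Let HHd' : d0 <= p * Hx. Proof. by move: HHd; rewrite ler_pdivrMr// mulrC. Qed.
Let HDd' : d0 <= p * Dx. Proof. by move: HDd; rewrite ler_pdivrMr// mulrC. Qed.

Let lambda : R := Num.min (Num.min (1 - d0 / ((p - 1) * Bx))
  ((p - 1)^-1 * (p - d0 / Dx))) (1 - d0 / (p * Hx)).
Let kb_term : \bar R :=
  ((((Cstar * r) `^ (p - 1))%:E * avg_lnorm Bx%:E Br (b \+ e)%R) `^ (p - 1)^-1)%E.
Let kd_term : \bar R :=
  ((((Cstar * r) `^ p)%:E * avg_lnorm Dx%:E Br (c \+ d \+ f)%R) `^ (p - 1)^-1)%E.
Let kh_term : \bar R :=
  ((((Cstar * r) `^ p)%:E * avg_lnorm Hx%:E Br (g \+ h)%R) `^ p^-1)%E.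

Let nonneg : [/\ meas_fun Omega b, meas_fun Omega c, meas_fun Omega d & meas_fun Omega e] /\
  [/\ meas_fun Omega f, meas_fun Omega g & meas_fun Omega h].
Proof. by have [[[? _] [? _] [? _] [? _]] [[[? _] [? _] [? _]] _]] := Hstr. Qed.

Let nonneg0 x : Omega x -> [/\ 0 <= b x, 0 <= c x, 0 <= d x & 0 <= e x] /\
  [/\ 0 <= f x, 0 <= g x & 0 <= h x].
Proof.
have [[[_ b0] [_ c0] [_ dd0] [_ e0]] [[[_ f0] [_ g0] [_ h0]] _]] := Hstr.
by move=> Ox; split; split; [exact: b0|exact: c0|exact: dd0|exact: e0|exact: f0|exact: g0|exact: h0].
Qed.

Let mBr : measurable (Br : set (Rn R n)). Proof. exact: mball. Qed.
Let mBt : measurable (Btilde : set (Rn R n)). Proof. exact: mball. Qed.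
Let meas_Bt w : meas_fun Omega w -> meas_fun Btilde w.
Proof. by apply: meas_sub; [exact: open_measurable_Rn|move=> x []]. Qed.

Let dbl : (0 < leb Br)%E -> (leb Btilde <= (C0 * (r1 y / (Cstar * r)) `^ d0)%:E * leb Br)%E.
Proof.
move=> _; have [_ yR _] := r1_radii Oy.
by apply: (doubling_Bt qm oball C00 d00 homog Oy rT0 rBT yR BrBt); split.
Qed.

(** [rescaled_norm_le] for each of the three terms; lambda is the smallest of the three resulting
    powers of r. *)
Lemma coefficient_term_le :
  (kb_term + kd_term + kh_term <=
   ((C0 `^ ((p - 1) * Bx)^-1 * Cstar `^ (1 - d0 / ((p - 1) * Bx)) * r1 y `^ (1 - lambda))%:E
       * avg_lnorm Bx%:E Btilde (b \+ e)%R `^ (p - 1)^-1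
     + (C0 `^ ((p - 1) * Dx)^-1 * Cstar `^ ((p * Dx - d0) / ((p - 1) * Dx))
        * r1 y `^ (p / (p - 1) - lambda))%:E
       * avg_lnorm Dx%:E Btilde (c \+ d \+ f)%R `^ (p - 1)^-1
     + (C0 `^ (p * Hx)^-1 * Cstar `^ (1 - d0 / (p * Hx)) * r1 y `^ (1 - lambda))%:E
       * avg_lnorm Hx%:E Btilde (g \+ h)%R `^ p^-1) * (r `^ lambda)%:E)%E.
Proof.
have [[mb mc md me] [mf mg mh]] := nonneg.
have e1 : (p - 1) / (p - 1) = 1 by rewrite divff// gt_eqF.
have e2 : p / p = 1 by rewrite divff// gt_eqF.
have e3 : (p * Dx - d0) / ((p - 1) * Dx) = p / (p - 1) - d0 / ((p - 1) * Dx).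
  by field; rewrite !gt_eqF.
have lB : lambda <= (p - 1) / (p - 1) - d0 / ((p - 1) * Bx) by rewrite e1 !ge_min lexx.
have lD : lambda <= p / (p - 1) - d0 / ((p - 1) * Dx).
  rewrite !ge_min; apply/orP; left; apply/orP; right.
  by rewrite le_eqVlt; apply/orP; left; apply/eqP; field; rewrite !gt_eqF.
have lH : lambda <= p / p - d0 / (p * Hx) by rewrite e2 !ge_min lexx orbT.
have term (w : E -> R) q m rt := @rescaled_norm_le R n Br Btilde w Cstar r (r1 y) C0 d0 q m rt lambda
  mBr mBt BrBt (ball_lty _ _).
have mBt1 : meas_fun Btilde (fun x => b x + e x) by exact: measD (meas_Bt mb) (meas_Bt me).
have mBt2 : meas_fun Btilde (fun x => c x + d x + f x).
  exact: measD (measD (meas_Bt mc) (meas_Bt md)) (meas_Bt mf).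
have mBt3 : meas_fun Btilde (fun x => g x + h x) by exact: measD (meas_Bt mg) (meas_Bt mh).
have nb x : Btilde x -> 0 <= b x + e x.
  by move=> [/nonneg0[[? _ _ ?] _] _]; exact: addr_ge0.
have nd x : Btilde x -> 0 <= c x + d x + f x.
  by move=> [/nonneg0[[_ ? ? _] [? _ _]] _]; rewrite addr_ge0// addr_ge0.
have nh x : Btilde x -> 0 <= g x + h x.
  by move=> [/nonneg0[_ [_ ? ?]] _]; exact: addr_ge0.
have Tb := term _ Bx (p - 1) (p - 1) mBt1 nb B0 p10 C00 Cstar_gt0 r0 r_le (ltW rBT) dbl lB.
have Td := term _ Dx p (p - 1) mBt2 nd D0 p10 C00 Cstar_gt0 r0 r_le (ltW rBT) dbl lD.
have Th := term _ Hx p p mBt3 nh H0 p0 C00 Cstar_gt0 r0 r_le (ltW rBT) dbl lH.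
rewrite e1 in Tb; rewrite e2 in Th; rewrite -e3 in Td.
have P1 (x : R) (z : \bar R) q : 0 <= x -> (0 <= x%:E * z `^ q)%E.
  by move=> hx; apply: mule_ge0; [rewrite lee_fin|exact: poweR_ge0].
have P2 (x1 x2 x3 : R) : 0 <= x1 `^ x2 * Cstar `^ x3 by rewrite mulr_ge0 ?powR_ge0.
rewrite ge0_muleDl; last 2 first.
- by apply: adde_ge0; apply: P1; exact: mulr_ge0 (P2 _ _ _) (powR_ge0 _ _).
- by apply: P1; exact: mulr_ge0 (P2 _ _ _) (powR_ge0 _ _).
rewrite ge0_muleDl; last 2 first.
- by apply: P1; exact: mulr_ge0 (P2 _ _ _) (powR_ge0 _ _).
- by apply: P1; exact: mulr_ge0 (P2 _ _ _) (powR_ge0 _ _).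
exact: leeD (leeD Tb Td) Th.
Qed.

Let ss := cutoff_exp p sstar.
Let ps : (p%:E < sstar)%E.
Proof.
apply: lt_trans sst; rewrite lte_fin ltr_pMr// /dual_exp ltr_pdivlMr ?subr_gt0// mul1r.
by rewrite ltrBlDr ltrDl.
Qed.
Let ss1 : 1 <= ss. Proof. exact: cutoff_exp_ge1 ps. Qed.
Let sss : ss < sigma. Proof. exact: cutoff_exp_lt s1 sst. Qed.

Let e1 := Num.min 1 (p - p ^+ 2 * dual_exp sigma / Cx).
Let e2 := Num.min 1 (p - p * dual_exp sigma / Hx).
Let e3 := Num.min 1 (p - p * dual_exp sigma / Dx).
Let e1E : e1 = Num.min 1 (p * (1 - p * dual_exp sigma / Cx)).
Proof. by rewrite /e1; congr Num.min; field; rewrite gt_eqF. Qed.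
Let e2E : e2 = Num.min 1 (p * (1 - dual_exp sigma / Hx)).
Proof. by rewrite /e2; congr Num.min; field; rewrite gt_eqF. Qed.
Let e3E : e3 = Num.min 1 (p * (1 - dual_exp sigma / Dx)).
Proof. by rewrite /e3; congr Num.min; field; rewrite gt_eqF. Qed.
Let e10 : 0 < e1.
Proof. by rewrite e1E lt_min ltr01 (mulr_gt0 p0)// subr_gt0 ltr_pdivrMr// mul1r. Qed.
Let e20 : 0 < e2.
Proof. by rewrite e2E lt_min ltr01 (mulr_gt0 p0)// subr_gt0 ltr_pdivrMr// mul1r. Qed.
Let e30 : 0 < e3.
Proof. by rewrite e3E lt_min ltr01 (mulr_gt0 p0)// subr_gt0 ltr_pdivrMr// mul1r. Qed.

Let expo := harnack_exponent p a sigma ss e1 e2 e3 kappa C2 bb tau N Cs C0 d0.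

Lemma exponent_gt0 : 0 < expo.
Proof. exact: harnack_exponent_gt0. Qed.

Let M1 : \bar R :=
  (1 + (C0 `^ Bx^-1)%:E * (1 + (r1 y `^ (p - 1))%:E * avg_lnorm Bx%:E Btilde b)
     + (C0 `^ (e2 * Hx)^-1)%:E * (1 + (r1 y `^ p)%:E * avg_lnorm Hx%:E Btilde h) `^ e2^-1
     + (C0 `^ (e3 * Dx)^-1)%:E * (1 + (r1 y `^ p)%:E * avg_lnorm Dx%:E Btilde d) `^ e3^-1
     + (C0 `^ (p / (e1 * Cx)))%:E * ((r1 y `^ p)%:E * avg_lnorm Cx%:E Btilde c `^ p) `^ e1^-1)%E.

Let shifted_term (c' q m : R) (X : \bar R) : 0 < c' -> 0 < q -> (0 <= X)%E ->
  (c'%:E * (1 + X) `^ q^-1 <= m%:E)%E ->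
  exists z : R, [/\ 0 <= z, (X <= z%:E)%E & c' `^ q * (1 + z) <= m `^ q].
Proof.
move=> c0 q0 X0 /(root_term_bound c0 q0); case=> [|z [XE _ hz]]; first exact: adde_ge0.
case: X X0 XE => [X| |]// X0; rewrite -EFinD => -[XE]; exists X; split => //.
by rewrite XE.
Qed.

Let M1_terms : (M1 < +oo)%E -> [/\ 1 <= fine M1,
  exists z : R, [/\ 0 <= z, ((r1 y `^ (p - 1))%:E * avg_lnorm Bx%:E Btilde b <= z%:E)%E &
    C0 `^ Bx^-1 * (1 + z) <= fine M1],
  exists z : R, [/\ 0 <= z, ((r1 y `^ p)%:E * avg_lnorm Hx%:E Btilde h <= z%:E)%E &
    C0 `^ Hx^-1 * (1 + z) <= fine M1 `^ e2],
  exists z : R, [/\ 0 <= z, ((r1 y `^ p)%:E * avg_lnorm Dx%:E Btilde d <= z%:E)%E &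
    C0 `^ Dx^-1 * (1 + z) <= fine M1 `^ e3] &
  exists z : R, [/\ 0 <= z, ((r1 y `^ 1)%:E * avg_lnorm Cx%:E Btilde c <= z%:E)%E &
    C0 `^ Cx^-1 * z <= fine M1 `^ (e1 / p)]].
Proof.
rewrite /M1.
have P1 (x q : R) (z : \bar R) : (0 <= z)%E -> (0 <= (x `^ q)%:E * z)%E.
  by move=> hz; apply: mule_ge0 => //; rewrite lee_fin powR_ge0.
have ZB := P1 (r1 y) (p - 1) _ (avg_lnorm_ge0 Btilde b Bx).
have ZH := P1 (r1 y) p _ (avg_lnorm_ge0 Btilde h Hx).
have ZD := P1 (r1 y) p _ (avg_lnorm_ge0 Btilde d Dx).
have ZC := P1 (r1 y) 1 _ (avg_lnorm_ge0 Btilde c Cx).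
have -> : ((r1 y `^ p)%:E * avg_lnorm Cx%:E Btilde c `^ p = ((r1 y `^ 1)%:E * avg_lnorm Cx%:E Btilde c) `^ p)%E.
  by rewrite poweRM ?avg_lnorm_ge0 ?lee_fin ?powR_ge0// poweR_EFin -powRrM mul1r.
rewrite -poweRrM.
move: (_ * avg_lnorm Bx%:E _ _)%E ZB => XB XB0; move: (_ * avg_lnorm Hx%:E _ _)%E ZH => XH XH0.
move: (_ * avg_lnorm Dx%:E _ _)%E ZD => XD XD0; move: (_ * avg_lnorm Cx%:E _ _)%E ZC => XC XC0.
have XB1 : (0 <= 1 + XB)%E by exact: adde_ge0.
have T1 := P1 C0 Bx^-1 _ XB1.
have T2 := P1 C0 (e2 * Hx)^-1 _ (poweR_ge0 (1 + XH) e2^-1).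
have T3 := P1 C0 (e3 * Dx)^-1 _ (poweR_ge0 (1 + XD) e3^-1).
have T4 := P1 C0 (p / (e1 * Cx)) _ (poweR_ge0 XC (p * e1^-1)).
have eB : ((C0 `^ Bx^-1)%:E * (1 + XB))%E = ((C0 `^ Bx^-1)%:E * (1 + XB) `^ 1^-1)%E.
  by rewrite invr1 poweRe1.
rewrite eB in T1 *; have eC : p * e1^-1 = (e1 / p)^-1 by rewrite invf_div.
rewrite eC in T4 *.
set t1' := ((C0 `^ Bx^-1)%:E * _)%E in T1 *; set t2 := ((C0 `^ (e2 * Hx)^-1)%:E * _)%E in T2 *.
set t3 := ((C0 `^ (e3 * Dx)^-1)%:E * _)%E in T3 *; set t4 := ((C0 `^ (p / (e1 * Cx)))%:E * _)%E in T4 *.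
have S0 : (0 <= 1 + t1' + t2 + t3 + t4)%E by rewrite !adde_ge0.
move=> Slty; have SE : ((fine (1 + t1' + t2 + t3 + t4))%:E = 1 + t1' + t2 + t3 + t4)%E.
  by rewrite fineK// ge0_fin_numE.
move: SE; move: (fine _) => m SE.
have L1 : (1 <= m%:E)%E by rewrite SE -!addeA leeDl// !adde_ge0.
have LB : (t1' <= m%:E)%E by rewrite SE [(1 + t1')%E]addeC -!addeA leeDl// !adde_ge0.
have LH : (t2 <= m%:E)%E by rewrite SE [(1 + t1' + t2)%E]addeC -!addeA leeDl// !adde_ge0.
have LD : (t3 <= m%:E)%E by rewrite SE [(_ + t3)%E]addeC -!addeA leeDl// !adde_ge0.
have LC : (t4 <= m%:E)%E by rewrite SE leeDr// !adde_ge0.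
have CP q : 0 < C0 `^ q by exact: powR_gt0.
have cp (q w w' : R) : q * w = w' -> (C0 `^ q) `^ w = C0 `^ w' by move=> <-; rewrite powRrM.
split; first by rewrite -lee_fin.
- have [z [z0 hz]] := shifted_term (CP _) ltr01 XB0 LB; exists z; split => //.
  have m0 : 0 <= m by rewrite -lee_fin; exact: le_trans L1.
  by move: p2; rewrite !powRr1// ltW.
- have [z [z0 hz Hz]] := shifted_term (CP _) e20 XH0 LH; exists z; split => //.
  by rewrite -(@cp (e2 * Hx)^-1 e2)//; field; rewrite !gt_eqF.
- have [z [z0 hz Hz]] := shifted_term (CP _) e30 XD0 LD; exists z; split => //.
  by rewrite -(@cp (e3 * Dx)^-1 e3)//; field; rewrite !gt_eqF.
- have [z [XE z0 Hz]] := root_term_bound (CP _) (divr_gt0 e10 p0) XC0 LC; exists z.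
  rewrite XE; split => //; rewrite -(@cp (p / (e1 * Cx)) (e1 / p))//; field; rewrite !gt_eqF//.
Qed.

Lemma weak_solution_harnack (u : E -> R) (Du : E -> E) :
  weak_solution Omega p Q A Bf u Du -> {ae @leb R n, forall z, Br z -> 0 <= u z} ->
  (M1 < +oo)%E ->
  (ess_sup_on Btau (fun z => (u z)%:E + (kb_term + kd_term + kh_term)) <=
   (((2 + C1) * fine M1) `^ (expo * fine M1))%:E *
   ess_inf_on Btau (fun z => (u z)%:E + (kb_term + kd_term + kh_term)))%E.
Proof.
move=> [Wu Hsol] u0 /M1_terms[].
move: (fine M1) => m m1 [yb [yb0 Hyb Mb]] [yh [yh0 Hyh Mh]] [yd [yd0 Hyd Md]] [yc [yc0 Hyc Mc]].
have m0 : 0 < m by exact: lt_le_trans m1.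
have cst0 : 0 < ((2 + C1) * m) `^ (expo * m) by rewrite powR_gt0 ?mulr_gt0 ?addr_gt0.
have kb0 : (0 <= kb_term)%E by exact: poweR_ge0.
have kd0 : (0 <= kd_term)%E by exact: poweR_ge0.
have kh0 : (0 <= kh_term)%E by exact: poweR_ge0.
have k10 : (0 <= kb_term + kd_term + kh_term)%E by rewrite !adde_ge0.
(* For infinite k1 the essential infimum on the right is infinite, and its factor is positive. *)
case k1E : (kb_term + kd_term + kh_term)%E k10 => [K| |]// K0; last first.
  have -> : ess_inf_on Btau (fun z => (u z)%:E + +oo)%E = +oo%E.
    apply/eqP; rewrite -leye_eq; apply/ess_infP; apply: nearW => x; rewrite /patch.
    by case: ifP => // _; rewrite addey.
  by rewrite gt0_muley ?lte_fin// leey.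
(* If the large ball is null, so is the small one, and any two-sided bound holds almost everywhere
   on it. *)
have [B0'|Br_gt0] := leP (leb Br) 0%E.
  have N0' : leb.-negligible (Btau : set (Rn R n)).
    exists (Br : set (Rn R n)); split; [exact: mBr|apply/eqP; rewrite eq_le B0'; exact: leb_outer_ge0|].
    move=> x [Ox hx]; split=> //; apply: (lt_le_trans hx); rewrite ler_pM2r//.
    by apply: le_trans (ltW tau1) (le_trans _ Cstar_ge128); rewrite ler1n.
  apply: ess_sup_le_ess_inf => // k _; exists 1 => //.
  by apply: negligibleS N0' => x /= nx; apply: contrapT => nB; apply: nx.
have [mu mDu [v appv]] := W1pQ_approx oO p1 Wu.
have [_ yR _] := r1_radii Oy.
have sf0 : 0 < step_factor p a e1 e2 e3 kappa C2 bb tau N Cs C0 d0 by exact: step_factor_gt0.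
have ln32 : 0 < ln (3 / 2 : R) by rewrite ln_gt0// ltr_pdivlMr//; lra.
(* The John-Nirenberg exponent for the step [step_factor] m; m0 p s has to stay below it. *)
pose al := ln (3 / 2) / (step_factor p a e1 e2 e3 kappa C2 bb tau N Cs C0 d0 * m).
have al0 : 0 < al by rewrite divr_gt0// mulr_gt0.
have [mu0 [/andP[mu0_gt0 mu0_le1] mu0_al mu0_inv gap]] := nonresonant_exponent p1 ss1 sss al0.
have chi1 : 1 < moser_ratio sigma ss by rewrite /moser_ratio ltr_pdivlMr ?mul1r// (lt_le_trans ltr01).
have C11 : 1 <= 1 + C1 by rewrite lerDl ltW.
pose G := moser_base p a sigma ss e1 e2 e3 N Cs * (1 + C1) `^ (1 + p / absorption_min p e1 e2 e3) * m.
have base1 : 1 <= moser_base p a sigma ss e1 e2 e3 N Cs by exact: moser_base_ge1.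
have E0 : 0 < absorption_min p e1 e2 e3.
  rewrite /absorption_min lt_min; apply/andP; split=> //; rewrite lt_min; apply/andP; split=> //.
  exact: divr_gt0.
have G1 : 1 <= G.
  have h1 : 1 <= (1 + C1) `^ (1 + p / absorption_min p e1 e2 e3).
    by rewrite -[leLHS](powRr0 (1 + C1)); apply: ler_powR => //; rewrite addr_ge0// divr_ge0// ltW.
  rewrite /G -[leLHS]mulr1; apply: ler_pM => //; rewrite -[leLHS]mulr1; exact: ler_pM.
have gr1 : 1 <= moser_growth p sigma ss e1 e2 e3 N by exact: moser_growth_ge1.
have lam0 : 0 < resonance_gap p sigma ss by exact: resonance_gap_gt0.
have inv_bound : mu0^-1 <= exponent_bound p a sigma ss e1 e2 e3 kappa C2 bb tau N Cs C0 d0 * m.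
  apply: (le_trans mu0_inv); rewrite /exponent_bound mulrDl; apply: lerD.
    rewrite ler_peMr// mulr_ge0 ?powR_ge0//; apply: divr_ge0; exact: ltW.
  rewrite le_eqVlt; apply/orP; left; apply/eqP; rewrite /al; field.
  by rewrite !gt_eqF.
apply: ess_sup_le_ess_inf => // k Kk.
have k_gt0 : 0 < k by exact: le_lt_trans Kk.
have le_k (x : \bar R) : (x <= kb_term + kd_term + kh_term)%E -> (x <= k%:E)%E.
  by rewrite k1E => h1; apply: (le_trans h1); rewrite lee_fin ltW.
have Cr_ge0 (q1 q2 : R) w B : (0 <= ((Cstar * r) `^ q1)%:E * avg_lnorm q2%:E B w)%E.
  by apply: mule_ge0; [rewrite lee_fin powR_ge0|exact: avg_lnorm_ge0].
have kb : (((Cstar * r) `^ (p - 1))%:E * avg_lnorm Bx%:E Br (fun x => b x + e x)%R <= (k `^ (p - 1))%:E)%E.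
  apply/(poweR_root_le p10 (ltW k_gt0)) => //; apply: le_k.
  by rewrite -addeA leeDl// adde_ge0.
have kd : (((Cstar * r) `^ p)%:E * avg_lnorm Dx%:E Br (fun x => c x + d x + f x)%R <= (k `^ (p - 1))%:E)%E.
  apply/(poweR_root_le p10 (ltW k_gt0)) => //; apply: le_k.
  by rewrite addeAC leeDr// adde_ge0.
have kh : (((Cstar * r) `^ p)%:E * avg_lnorm Hx%:E Br (fun x => g x + h x)%R <= (k `^ p)%:E)%E.
  apply/(poweR_root_le p0 (ltW k_gt0)) => //; apply: le_k.
  by rewrite leeDr// adde_ge0.
rewrite e1E in Mc; rewrite e2E in Mh; rewrite e3E in Md.
have oc0 : 0 < osc_cst p C0 d0 sigma C2 bb Cs tau N a Cx Dx Hx.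
  by rewrite (osc_cst_epsE _ _ _ _ _ _ _ _ e1E e2E e3E); exact: osc_cst_eps_gt0.
have [|j|j z hz|lo lo0 Hlo] := harnack_ball oO bO p1 Qpsd mQ qm oball fine_balls C00 d00 homog C10 s1 sob
  C20 bb1 poin sst Cs0 tau0 tau1 N0 t1 cut gamma1 gammap delta1 deltap psi1 psip a1 Hstr Lc Le Lf Lb Ld
  Ox0 rB0 Oy rT0 rBT yR BrBt radii Br_gt0 HBx HBd' HCx HCd HDx HDd' HHx HHd' k_gt0 m1 yb0 yc0 yd0 yh0
  kb kd kh Hyb Hyc Hyd Hyh Mb Mc Md Mh mu mDu appv Hsol u0 oc0 r0 rrB (m0 := mu0) mu0_gt0 _ G1 gr1.
- by rewrite (harnack_stepE _ _ _ _ _ _ _ _ _ _ e1E e2E e3E) /jn_exponent.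
- by have := gap j 1 (normr1 _); rewrite mul1r -normr_gt0; exact: lt_le_trans.
- apply: step_cst_bound => //; [exact: ltW|exact: ltW| |exact: gap].
  rewrite !normrM hz mul1r gtr0_norm// ger0_norm ?exprn_ge0 ?(ltW (lt_trans ltr01 chi1))//.
  by rewrite ler_piMl// exprn_ge0// (ltW (lt_trans ltr01 chi1)).
exists lo => //; apply: ae_imp Hlo => x hx Tx; have /andP[-> h1] := hx Tx.
apply: (le_trans h1); rewrite ler_wpM2r ?(ltW lo0)//.
exact: moser_bound_le (ltW C10) m1 mu0_gt0 inv_bound.
Qed.

End harnack_inequality.

Theorem theorem3p10 (R : realType) :
  (* arguments: p sigma s eps1 eps2 eps3 *)
  exists C4 : R -> R -> R -> R -> R -> R -> R,
  (* arguments: n Omega rho kappa a p sigma s eps1 eps2 eps3 C1 N Cs *)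
  exists C5 : forall n : nat,
      set 'rV[R]_n.+1 -> ('rV[R]_n.+1 -> 'rV[R]_n.+1 -> R) -> R ->
      R -> R -> R -> R -> R -> R -> R -> R -> R -> R -> R,
  (* arguments: n Omega rho kappa a p sigma s eps1 eps2 eps3 C2 bb tau N Cs C0 d0 *)
  exists C6 : forall n : nat,
      set 'rV[R]_n.+1 -> ('rV[R]_n.+1 -> 'rV[R]_n.+1 -> R) -> R ->
      R -> R -> R -> R -> R -> R -> R -> R -> R -> R -> R -> R -> R -> R -> R,
  forall (n : nat) (Omega : set 'rV[R]_n.+1) (p : R)
    (Q : 'rV[R]_n.+1 -> 'M[R]_n.+1)
    (rho : 'rV[R]_n.+1 -> 'rV[R]_n.+1 -> R) (kappa : R)
    (R0 R1 R2 : 'rV[R]_n.+1 -> R) (C0 d0 C1 sigma C2 bb : R)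
    (sstar : \bar R) (Cs tau N : R) (t : \bar R)
    (gamma psi delta a : R) (b c d e f g h : 'rV[R]_n.+1 -> R)
    (A : 'rV[R]_n.+1 -> R -> 'rV[R]_n.+1 -> 'rV[R]_n.+1)
    (B : 'rV[R]_n.+1 -> R -> 'rV[R]_n.+1 -> R),
  open Omega -> connected Omega -> Omega !=set0 -> bounded_set Omega ->
  1 < p ->
  (forall x, Omega x -> psdmx (Q x)) ->
  (forall i j, meas_fun Omega (fun x => Q x i j)) ->
  Lloc (p / 2)%:E Omega (fun x => opnorm (Q x)) ->
  quasimetric Omega rho kappa ->
  (forall x r, Omega x -> open (qball Omega rho x r)) ->
  (forall x, Omega x -> forall eps : R, 0 < eps -> exists2 del : R, 0 < del &
     forall y, Omega y -> rho x y < del -> `|x - y| < eps) ->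
  (forall x, Omega x -> [/\ 0 < R0 x, 0 < R1 x & 0 < R2 x]) ->
  (forall x r, Omega x -> 0 < r -> r < R0 x ->
     closure (qball Omega rho x r) `<=` Omega) ->
  0 < C0 -> 0 < d0 -> local_homogeneous Omega rho C0 d0 R1 ->
  0 < C1 -> 1 < sigma -> sobolev_ineq Omega rho p Q R2 C1 sigma ->
  0 < C2 -> 1 <= bb -> poincare_ineq Omega rho p Q R2 C2 bb ->
  ((p * dual_exp sigma)%:E < sstar)%E ->
  0 < Cs -> 0 < tau -> tau < 1 -> 0 < N -> (1 <= t)%E ->
  cutoffs Omega rho p Q R2 sstar Cs tau N t ->
  1 < gamma -> gamma < p -> 1 < delta -> delta < p -> 1 < psi -> psi < p ->
  1 < a ->
  structural Omega p Q gamma psi delta a b c d e f g h A B ->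
  Lloc (sigma * p / (sigma * p - 1 - sigma * (psi - 1)))%:E Omega c ->
  Lloc (dual_exp p)%:E Omega e ->
  Lloc (dual_exp (sigma * p))%:E Omega f ->
  Lloc (sigma * p / (sigma * (p - 1) - gamma + 1))%:E Omega b ->
  Lloc (p * sigma / (p * sigma - delta))%:E Omega d ->
  forall (y : 'rV[R]_n.+1) (r1 : 'rV[R]_n.+1 -> R) (Astar : R)
    (x0 : 'rV[R]_n.+1) (r : R) (Bx Hx Dx Cx : R),
  let ball := qball Omega rho in
  let gammastar := kappa + 2 * kappa ^+ 2 in
  let Btilde := ball y (r1 y) in
  let Cstar := 128 * bb * kappa ^+ 10 * gammastar ^+ 8 /
    (tau * Astar ^+ 3 * Num.min (Astar ^+ 2) (8 * kappa ^+ 5)^-1) in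
  let s := if sstar is s'%:E then s' / (s' - p) else 1 in
  Omega y ->
  (forall x, Omega x -> 0 < r1 x /\
     r1 x <= Num.min (Num.min (Num.min (R0 x) (R1 x)) (R2 x)) 1) ->
  0 < Astar -> Astar < 1 -> locally_uniform Omega rho r1 Btilde Astar ->
  ball y (tau / (5 * kappa) * r1 y) x0 ->
  0 < r -> r < tau * Astar / (5 * kappa * Cstar) * r1 y ->
  Num.max (dual_exp p * dual_exp sigma) (d0 / (p - 1)) <= Bx ->
  Lloc Bx%:E Omega b -> Lloc Bx%:E Omega e ->
  d0 / p <= Hx -> dual_exp sigma < Hx ->
  Lloc Hx%:E Omega h -> Lloc Hx%:E Omega g ->
  d0 / p <= Dx -> dual_exp sigma < Dx ->
  Lloc Dx%:E Omega d -> Lloc Dx%:E Omega f ->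
  d0 <= Cx -> p * dual_exp sigma < Cx ->
  Lloc Cx%:E Omega c ->
  let eps1 := Num.min 1 (p - p ^+ 2 * dual_exp sigma / Cx) in
  let eps2 := Num.min 1 (p - p * dual_exp sigma / Hx) in
  let eps3 := Num.min 1 (p - p * dual_exp sigma / Dx) in
  let lambda : R := Num.min (Num.min (1 - d0 / ((p - 1) * Bx))
    ((p - 1)^-1 * (p - d0 / Dx))) (1 - d0 / (p * Hx)) in
  let Br := ball x0 (Cstar * r) in
  let Btau := ball x0 (tau * r) in
  let k1 : \bar R :=
    ((((Cstar * r) `^ (p - 1))%:E * avg_lnorm Bx%:E Br (b \+ e)%R) `^ (p - 1)^-1
     + (((Cstar * r) `^ p)%:E * avg_lnorm Dx%:E Br (c \+ d \+ f)%R) `^ (p - 1)^-1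
     + (((Cstar * r) `^ p)%:E * avg_lnorm Hx%:E Br (g \+ h)%R) `^ p^-1)%E in
  let Lambda1 : \bar R :=
    ((C0 `^ ((p - 1) * Bx)^-1 * Cstar `^ (1 - d0 / ((p - 1) * Bx))
        * r1 y `^ (1 - lambda))%:E
       * avg_lnorm Bx%:E Btilde (b \+ e)%R `^ (p - 1)^-1
     + (C0 `^ ((p - 1) * Dx)^-1 * Cstar `^ ((p * Dx - d0) / ((p - 1) * Dx))
        * r1 y `^ (p / (p - 1) - lambda))%:E
       * avg_lnorm Dx%:E Btilde (c \+ d \+ f)%R `^ (p - 1)^-1
     + (C0 `^ (p * Hx)^-1 * Cstar `^ (1 - d0 / (p * Hx))
        * r1 y `^ (1 - lambda))%:E
       * avg_lnorm Hx%:E Btilde (g \+ h)%R `^ p^-1)%E in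
  let M1 : \bar R :=
    (1 + (C0 `^ Bx^-1)%:E
         * (1 + (r1 y `^ (p - 1))%:E * avg_lnorm Bx%:E Btilde b)
     + (C0 `^ (eps2 * Hx)^-1)%:E
         * (1 + (r1 y `^ p)%:E * avg_lnorm Hx%:E Btilde h) `^ eps2^-1
     + (C0 `^ (eps3 * Dx)^-1)%:E
         * (1 + (r1 y `^ p)%:E * avg_lnorm Dx%:E Btilde d) `^ eps3^-1
     + (C0 `^ (p / (eps1 * Cx)))%:E
         * ((r1 y `^ p)%:E * avg_lnorm Cx%:E Btilde c `^ p) `^ eps1^-1)%E in
  let c4 := C4 p sigma s eps1 eps2 eps3 in
  let c5 := C5 n Omega rho kappa a p sigma s eps1 eps2 eps3 C1 N Cs in
  let c6 :=
    C6 n Omega rho kappa a p sigma s eps1 eps2 eps3 C2 bb tau N Cs C0 d0 in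
  (k1 <= Lambda1 * (r `^ lambda)%:E)%E /\
  [/\ 0 < c4, 0 < c5, 0 < c6 &
    forall (u : 'rV[R]_n.+1 -> R) (Du : 'rV[R]_n.+1 -> 'rV[R]_n.+1),
      weak_solution Omega p Q A B u Du ->
      {ae @leb R n, forall z, Br z -> 0 <= u z} ->
      (* for M1 = +oo the constant C is infinite and nothing is claimed *)
      (M1 < +oo)%E ->
      let C := c4 * (c5 * fine M1) `^ (c6 * fine M1) in
      (ess_sup_on Btau (fun z => (u z)%:E + k1) <=
       C%:E * ess_inf_on Btau (fun z => (u z)%:E + k1))%E].
Proof.
(* C4 = 1 is possible because numerical factors were absorbed in powers of the base (2 + C1) M1,
   which is at least 2. *)
exists (fun _ _ _ _ _ _ => 1).
exists (fun _ _ _ _ _ _ _ _ _ _ _ C1 _ _ => 2 + C1).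
exists (fun _ _ _ kappa a p sigma s e1 e2 e3 C2 bb tau N Cs C0 d0 =>
  harnack_exponent p a sigma s e1 e2 e3 kappa C2 bb tau N Cs C0 d0).
move=> n Omega p Q rho kappa R0 R1 R2 C0 d0 C1 sigma C2 bb sstar Cs tau N t gamma psi delta a
  b c d e f g h A B oO _ _ bO p1 Qpsd mQ _ qm oball fine_balls _ _ C00 d00 homog C10 s1 sob C20 bb1 poin
  sst Cs0 tau0 tau1 N0 t1 cut gamma1 gammap delta1 deltap psi1 psip a1 Hstr Lc Le Lf Lb Ld
  y r1 Astar x0 r Bx Hx Dx Cx ball gammastar Btilde Cstar s Oy Hr1 A0 A1 unif x0y r0 r_lt.
rewrite ge_max => /andP[HBx HBd] _ _ HHd HHx _ _ HDd HDx _ _ HCd HCx _.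
move=> eps1 eps2 eps3 lambda Br Btau k1 Lambda1 M1 c4 c5 c6.
have radii x : Omega x -> [/\ 0 < r1 x, r1 x <= R1 x & r1 x <= R2 x].
  by move=> /Hr1[r1_gt0]; rewrite !le_min => /andP[/andP[/andP[_ ->] ->] _].
split.
  exact: (coefficient_term_le oO bO p1 qm oball C00 d00 homog s1 bb1 tau0 tau1 Hstr Oy radii A0 A1
    x0y r0 r_lt HBd HHx HDx).
split=> //; first exact: addr_gt0.
  exact: (exponent_gt0 _ p1 C00 d00 s1 C20 bb1 sst Cs0 tau0 N0 a1 HHx HDx HCd HCx).
move=> u Du sol u0 M1_lty; cbv zeta; rewrite /c4 mul1r.
exact: (weak_solution_harnack oO bO p1 Qpsd mQ qm oball fine_balls C00 d00 homog C10 s1 sob C20 bb1 poin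
  sst Cs0 tau0 tau1 N0 t1 cut gamma1 gammap delta1 deltap psi1 psip a1 Hstr Lc Le Lf Lb Ld Oy radii A0 A1
  unif x0y r0 r_lt HBx HBd HHd HHx HDd HDx HCd HCx sol u0 M1_lty).
Qed.
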